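(* Let $(X^{n+1},g_+)$ be a conformally compact manifold, let $r$ be a defining function for $\partial X$, put $\bar g=r^2g_+$, and let $1<p<\infty$. Then $$\lambda_{1,p}(X^{n+1},g_+)\;\le\;\Big(\min_{\partial X}|dr|_{\bar g}\Big)^p\Big(\frac{n}{p}\Big)^{p}\;=\;\lambda_{1,p}\Big(\mathbb{H}^{n+1}\big(-\min_{\partial X}|dr|^2_{\bar g}\big)\Big),$$ where $\mathbb{H}^{n+1}(-\kappa)$ denotes the complete simply connected $(n+1)$-dimensional Riemannian manifold of constant sectional curvature $-\kappa$.
   Context: Let $X^{n+1}$ be the interior of a smooth compact manifold $\overline X$ with smooth nonempty boundary $\partial X$, and let $g_+$ be a complete metric on $X$. A defining function is a smooth function $r:\overline X\to[0,\infty)$ with $r^{-1}(0)=\partial X$ and $dr\neq0$ on $\partial X$. $(X^{n+1},g_+)$ is conformally compact (CC) if for a defining function $r$ the metric $\bar g=r^2g_+$ extends to a $C^{3,\alpha}$ metric on $\overline X$ for some $\alpha\in(0,1)$. (The restriction $|dr|_{\bar g}|_{\partial X}$ does not depend on the choice of $r$.) For a noncompact Riemannian manifold $(X,g)$ and $1<p<\infty$, the first $p$-Dirichlet eigenvalue is $$\lambda_{1,p}(X,g)=\inf_{\Omega}\lambda_{1,p}(\Omega),\qquad \lambda_{1,p}(\Omega)=\inf_{f\in W^{1,p}_0(\Omega)\setminus\{0\}}\frac{\int_\Omega|\nabla_g f|^p\,dv_g}{\int_\Omega|f|^p\,dv_g},$$ where $\Omega$ ranges over all bounded domains in $X$ with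 smooth boundary and $W^{1,p}_0(\Omega)$ is the completion of $C_0^\infty(\Omega)$ in the $W^{1,p}$ Sobolev norm. *)

(* Defs.v *)
From HB Require Import structures.
From mathcomp Require Import all_boot all_order all_algebra.
From mathcomp Require Import all_classical all_reals all_analysis.

Set Implicit Arguments.
Unset Strict Implicit.
Unset Printing Implicit Defensive.

Import Order.TTheory GRing.Theory Num.Theory.
Import numFieldNormedType.Exports.

Local Open Scope classical_set_scope.
Local Open Scope ring_scope.

(** * Calculus on open subsets of the half-space {x | 0 <= x_n} of R^(n+1) *)

Definition basis_vec (R : realType) (n : nat) (i : 'I_n.+1) : 'rV[R]_n.+1 :=
  delta_mx 0 i.

Definition half_space (R : realType) (n : nat) : set 'rV[R]_n.+1 :=
  [set x | 0 <= x 0 ord_max].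

(* The i-th partial derivative, as a one-sided difference quotient: every
   basis vector points into the half-space, so for a function that is C^1 up
   to the boundary this is the usual partial derivative, boundary included. *)
Definition rpartial (R : realType) (n : nat) (i : 'I_n.+1)
    (f : 'rV[R]_n.+1 -> R) (x : 'rV[R]_n.+1) : R :=
  lim ((fun h : R => h^-1 * (f (x + h *: basis_vec R i) - f x)) @ 0^'+).

Fixpoint iter_partial (R : realType) (n : nat) (s : seq 'I_n.+1)
    (f : 'rV[R]_n.+1 -> R) : 'rV[R]_n.+1 -> R :=
  if s is i :: s' then (fun x => 'D_(basis_vec R i) (iter_partial s' f) x)
  else f.

Definition Ck_on (R : realType) (n k : nat) (U : set 'rV[R]_n.+1)
    (f : 'rV[R]_n.+1 -> R) : Prop :=
  forall s : seq 'I_n.+1, (size s <= k)%N -> forall x, U x ->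
    {for x, continuous (iter_partial s f)} /\
    ((size s < k)%N ->
      forall i, derivable (iter_partial s f) x (basis_vec R i)).

(* Regularity on a relatively open subset W of the half-space: f extends, near
   each point of W, to a function of that regularity on an open set of
   R^(n+1). *)
Definition smooth_within (R : realType) (n : nat) (W : set 'rV[R]_n.+1)
    (f : 'rV[R]_n.+1 -> R) : Prop :=
  forall x, W x -> exists (U : set 'rV[R]_n.+1) (F : 'rV[R]_n.+1 -> R),
    [/\ open U, U x, (forall k, Ck_on k U F) &
        forall y, U y -> W y -> f y = F y].

Definition holder_within (R : realType) (n k : nat) (alpha : R)
    (W : set 'rV[R]_n.+1) (f : 'rV[R]_n.+1 -> R) : Prop :=
  forall x, W x -> exists (U : set 'rV[R]_n.+1) (F : 'rV[R]_n.+1 -> R),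
    [/\ open U, U x, Ck_on k U F,
        (exists C : R, forall s : seq 'I_n.+1, size s = k ->
           forall y z, U y -> U z ->
           `|iter_partial s F y - iter_partial s F z| <= C * `|y - z| `^ alpha) &
        forall y, U y -> W y -> f y = F y].

(* Lebesgue integral over R^d of a nonnegative Borel function, as an iterated
   integral (Tonelli). *)
Fixpoint integral_rV (R : realType) (d : nat) :
    ('rV[R]_d -> \bar R) -> \bar R :=
  match d return ('rV[R]_d -> \bar R) -> \bar R with
  | 0%N => fun f => f 0
  | d'.+1 => fun f =>
      (\int[@lebesgue_measure R]_x
         integral_rV (fun v : 'rV[R]_d' =>
           f (row_mx (x%:M : 'rV[R]_1) v : 'rV[R]_(1 + d'))))%E
  end.

(** * Smooth manifolds with boundary *)

(* A space with a sequence of charts: [dom k] is the domain of the k-th chart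
   [phi k], and [psi k] is its inverse, meaningful only on [cod k].  Atlases are
   sequences because manifolds are second countable; repetitions and empty
   domains are allowed, so finite atlases are covered. *)
Record charted_space (R : realType) (n : nat) := ChartedSpace {
  carrier :> topologicalType;
  dom : nat -> set carrier;
  phi : nat -> carrier -> 'rV[R]_n.+1;
  psi : nat -> 'rV[R]_n.+1 -> carrier }.

Arguments dom {R n} X k : rename.
Arguments phi {R n} X k : rename.
Arguments psi {R n} X k : rename.

Definition cod (R : realType) (n : nat) (X : charted_space R n) (k : nat) :
  set 'rV[R]_n.+1 := phi X k @` dom X k.

Record smooth_manifold (R : realType) (n : nat) (X : charted_space R n) :
    Prop := SmoothManifold {
  mf_hausdorff : hausdorff_space X;
  mf_cover : forall x : X, exists k, dom X k x;
  mf_dom_open : forall k, open (dom X k);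
  mf_cod_open : forall k, exists2 U : set 'rV[R]_n.+1,
    open U & cod X k = U `&` @half_space R n;
  mf_phiK : forall k x, dom X k x -> psi X k (phi X k x) = x;
  mf_phi_cont : forall k, {within dom X k, continuous (phi X k)};
  mf_psi_cont : forall k, {within cod X k, continuous (psi X k)};
  mf_transition : forall k l (j : 'I_n.+1),
    smooth_within (cod X k `&` psi X k @^-1` dom X l)
      (fun y => phi X l (psi X k y) 0 j) }.

Definition mboundary (R : realType) (n : nat) (X : charted_space R n) : set X :=
  [set x | exists2 k, dom X k x & phi X k x 0 ord_max = 0].

Definition minterior (R : realType) (n : nat) (X : charted_space R n) : set X :=
  ~` @mboundary R n X.

(* The Borel partition of X subordinate to the atlas. *)
Definition piece (R : realType) (n : nat) (X : charted_space R n) (k : nat) :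
  set X := dom X k `\` \bigcup_(j in `I_k) dom X j.

(* The first chart around x, used to evaluate chart-independent quantities. *)
Definition chart_at (R : realType) (n : nat) (X : charted_space R n) (x : X) :
  nat := xget 0%N [set k | @piece R n X k x].

Definition smooth_fun (R : realType) (n : nat) (X : charted_space R n)
    (f : X -> R) : Prop :=
  forall k, smooth_within (cod X k) (f \o psi X k).

(* Components of df at x in the k-th chart. *)
Definition diff_fun (R : realType) (n : nat) (X : charted_space R n) (k : nat)
    (f : X -> R) (x : X) : 'rV[R]_n.+1 :=
  \row_i rpartial i (f \o psi X k) (phi X k x).

Definition jac (R : realType) (n : nat) (X : charted_space R n) (k l : nat)
    (x : X) : 'M[R]_n.+1 :=
  \matrix_(i, j) rpartial i (fun y => phi X l (psi X k y) 0 j) (phi X k x).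

(** * Riemannian metrics *)

(* [g k x] is the Gram matrix at x, in the coordinates of the k-th chart. *)
Definition metric_field (R : realType) (n : nat) (X : charted_space R n) :=
  nat -> X -> 'M[R]_n.+1.

Definition riemannian_metric (R : realType) (n : nat) (X : charted_space R n)
    (S : set X) (g : metric_field X) : Prop :=
  forall k x, S x -> dom X k x ->
    [/\ (g k x)^T = g k x,
        (forall v : 'rV[R]_n.+1, v != 0 -> 0 < (v *m g k x *m v^T) 0 0) &
        forall l, dom X l x -> g k x = jac k l x *m g l x *m (jac k l x)^T].

Definition vec_norm (R : realType) (n : nat) (G : 'M[R]_n.+1)
  (v : 'rV[R]_n.+1) : R := Num.sqrt ((v *m G *m v^T) 0 0).

Definition covec_norm (R : realType) (n : nat) (G : 'M[R]_n.+1)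
  (w : 'rV[R]_n.+1) : R := Num.sqrt ((w *m invmx G *m w^T) 0 0).

(* |df|_g *)
Definition diff_norm (R : realType) (n : nat) (X : charted_space R n)
    (g : metric_field X) (f : X -> R) (x : X) : R :=
  covec_norm (g (chart_at x) x) (diff_fun (chart_at x) f x).

Definition grad (R : realType) (n : nat) (X : charted_space R n)
    (g : metric_field X) (k : nat) (f : X -> R) (x : X) : 'rV[R]_n.+1 :=
  diff_fun k f x *m invmx (g k x).

(* |nabla_g f|_g *)
Definition grad_norm (R : realType) (n : nat) (X : charted_space R n)
    (g : metric_field X) (f : X -> R) (x : X) : R :=
  vec_norm (g (chart_at x) x) (grad g (chart_at x) f x).

(* The integral over A of f >= 0 against the Riemannian volume, which is
   sqrt(det g) dy in each chart; X is cut into Borel pieces lying in one chart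
   each. *)
Definition vol_integral (R : realType) (n : nat) (X : charted_space R n)
    (g : metric_field X) (A : set X) (f : X -> R) : \bar R :=
  (\sum_(0 <= k <oo) integral_rV (fun y : 'rV[R]_n.+1 =>
     (\1_(phi X k @` (A `&` @piece R n X k)) y *
        (f (psi X k y) * Num.sqrt (\det (g k (psi X k y)))))%:E))%E.

(** ** Riemannian distance *)

Definition C1_curve (R : realType) (n : nat) (X : charted_space R n)
    (c : R -> X) : Prop :=
  continuous c /\
  forall k t, dom X k (c t) ->
    derivable (phi X k \o c) t 1 /\ {for t, continuous (derive1 (phi X k \o c))}.

Definition curve_length (R : realType) (n : nat) (X : charted_space R n)
    (g : metric_field X) (c : R -> X) : \bar R :=
  (\int[@lebesgue_measure R]_(t in `[0%R, 1%R]%classic)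
     (vec_norm (g (chart_at (c t)) (c t))
        (derive1 (phi X (chart_at (c t)) \o c) t))%:E)%E.

(* C^1 curves may stop, hence turn corners, so these are as good as piecewise
   C^1 curves; for the same reason they may be taken defined on all of R. *)
Definition rdist (R : realType) (n : nat) (X : charted_space R n)
    (g : metric_field X) (x y : X) : \bar R :=
  ereal_inf [set curve_length g c | c in
    [set c : R -> X | [/\ C1_curve c, (forall t, @minterior R n X (c t)),
                          c 0 = x & c 1 = y]]].

Definition complete_metric (R : realType) (n : nat) (X : charted_space R n)
    (g : metric_field X) : Prop :=
  forall u : nat -> X, (forall i, @minterior R n X (u i)) ->
    (forall e : R, 0 < e -> exists N, forall i j, (N <= i)%N -> (N <= j)%N ->
       (rdist g (u i) (u j) < e%:E)%E) ->
    exists2 x, @minterior R n X x &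
      (fun i => rdist g (u i) x) @ \oo --> (0 : \bar R)%E.

(** ** Conformally compact metrics *)

Definition defining_function (R : realType) (n : nat) (X : charted_space R n)
    (r : X -> R) : Prop :=
  [/\ smooth_fun r, (forall x, 0 <= r x),
      (forall x, r x = 0 <-> @mboundary R n X x) &
      forall k x, @mboundary R n X x -> dom X k x -> diff_fun k r x != 0].

(* r^2 g, extended by continuity to the boundary. *)
Definition compactified (R : realType) (n : nat) (X : charted_space R n)
    (r : X -> R) (g : metric_field X) : metric_field X :=
  fun k x => \matrix_(i, j)
    lim ((fun y : X => r y ^+ 2 * g k y i j) @
           within (@minterior R n X) (nbhs x)).

Definition conformally_compact (R : realType) (n : nat)
    (X : charted_space R n) (g : metric_field X) : Prop :=
  exists (r : X -> R) (alpha : R) (gbar : metric_field X),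
    [/\ defining_function r, 0 < alpha < 1,
        riemannian_metric [set: X] gbar,
        (forall k i j, holder_within 3 alpha (cod X k)
           (fun y => gbar k (psi X k y) i j)) &
        forall k x, @minterior R n X x -> dom X k x ->
          gbar k x = r x ^+ 2 *: g k x].

(** * The first p-Dirichlet eigenvalue of the interior of X *)

Definition smooth_boundary (R : realType) (n : nat) (X : charted_space R n)
    (Om : set X) : Prop :=
  forall q, @minterior R n X q -> closure Om q -> ~ Om q ->
    exists (k : nat) (U : set 'rV[R]_n.+1) (rho : 'rV[R]_n.+1 -> R),
      [/\ dom X k q, open U /\ U (phi X k q), (forall m, Ck_on m U rho),
          (exists i, 'D_(basis_vec R i) rho (phi X k q) != 0) &
          forall x, dom X k x -> U (phi X k x) ->
            (Om x <-> rho (phi X k x) < 0)].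

Definition bounded_smooth_domain (R : realType) (n : nat)
    (X : charted_space R n) (g : metric_field X) (Om : set X) : Prop :=
  [/\ Om `<=` @minterior R n X, Om !=set0, open Om, connected Om &
      (exists K : R, forall x y, Om x -> Om y -> (rdist g x y <= K%:E)%E) /\
      smooth_boundary Om].

Definition test_function (R : realType) (n : nat) (X : charted_space R n)
    (Om : set X) (f : X -> R) : Prop :=
  smooth_fun f /\
  exists K : set X, [/\ compact K, K `<=` Om & forall x, ~ K x -> f x = 0].

Definition Lp_energy (R : realType) (n : nat) (X : charted_space R n)
    (g : metric_field X) (p : R) (Om : set X) (f : X -> R) : \bar R :=
  vol_integral g Om (fun x => `|f x| `^ p).

Definition grad_energy (R : realType) (n : nat) (X : charted_space R n)
    (g : metric_field X) (p : R) (Om : set X) (f : X -> R) : \bar R :=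
  vol_integral g Om (fun x => grad_norm g f x `^ p).

Definition sobolev_norm (R : realType) (n : nat) (X : charted_space R n)
    (g : metric_field X) (p : R) (Om : set X) (f : X -> R) : \bar R :=
  ((Lp_energy g p Om f + grad_energy g p Om f) `^ p^-1)%E.

(* An element of W^{1,p}_0(Om), the completion of C_0^oo(Om) in the W^{1,p}
   norm, is represented by a Cauchy sequence of test functions. *)
Definition W1p0 (R : realType) (n : nat) (X : charted_space R n)
    (g : metric_field X) (p : R) (Om : set X) (u : nat -> X -> R) : Prop :=
  (forall i, test_function Om (u i)) /\
  forall e : R, 0 < e -> exists N, forall i j, (N <= i)%N -> (N <= j)%N ->
    (sobolev_norm g p Om (fun x => u i x - u j x)%R < e%:E)%E.

Definition W1p0_zero (R : realType) (n : nat) (X : charted_space R n)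
    (g : metric_field X) (p : R) (Om : set X) (u : nat -> X -> R) : Prop :=
  (fun i => sobolev_norm g p Om (u i)) @ \oo --> (0 : \bar R)%E.

(* Both energies are continuous in the W^{1,p} norm, so on the completion they
   are limits. *)
Definition rayleigh (R : realType) (n : nat) (X : charted_space R n)
    (g : metric_field X) (p : R) (Om : set X) (u : nat -> X -> R) : \bar R :=
  (limn (fun i => grad_energy g p Om (u i)) /
   limn (fun i => Lp_energy g p Om (u i)))%E.

Definition lambda1p_dom (R : realType) (n : nat) (X : charted_space R n)
    (g : metric_field X) (p : R) (Om : set X) : \bar R :=
  ereal_inf [set rayleigh g p Om u | u in
    [set u | W1p0 g p Om u /\ ~ W1p0_zero g p Om u]].

Definition lambda1p (R : realType) (n : nat) (X : charted_space R n)
    (g : metric_field X) (p : R) : \bar R :=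
  ereal_inf [set lambda1p_dom g p Om | Om in @bounded_smooth_domain R n X g].

(** * Hyperbolic space, in the upper half-space model *)

Definition upper_half_space (R : realType) (n : nat) : set 'rV[R]_n.+1 :=
  [set x | 0 < x 0 ord_max].

Lemma upper_half_space_pt (R : realType) (n : nat) :
  @upper_half_space R n (const_mx 1).
Proof. by rewrite /upper_half_space /= mxE ltr01. Qed.

(* One global chart, the inclusion.  [psi] takes a junk value outside the upper
   half-space. *)
Definition hyperbolic_space (R : realType) (n : nat) : charted_space R n :=
  @ChartedSpace R n (set_type (@upper_half_space R n))
    (fun=> setT) (fun=> set_val)
    (fun=> insubd (exist _ (const_mx 1) (mem_set (upper_half_space_pt R n))
                   : set_type (@upper_half_space R n))).

(* |dx|^2 / (kappa * x_n^2), of constant sectional curvature - kappa. *)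
Definition hyperbolic_metric (R : realType) (n : nat) (kappa : R) :
    metric_field (hyperbolic_space R n) :=
  fun k x => ((kappa * (phi (hyperbolic_space R n) k x 0 ord_max) ^+ 2)^-1)%:M.

(* Main.v *)
(* Upper bound.  In a chart around a boundary point the metric is y_n^-2 H(y)
   with H continuous and positive up to y_n = 0, say H = G at the point.  The
   functions y_n^(n/p) beta(ln y_n / L) prod_i beta((y_i - c_i) / w), supported
   in e^(-3L) <= y_n <= e^(-2L), have Rayleigh quotient at most
   (1 + eps) (|dy_n|_G n / p)^p + O(L^-p), and they are test functions of a
   Euclidean ball tangent to the boundary up to a small distance.  The volume
   integral cuts the support into pieces lying in different charts; only the
   O(L^-p) term needs the comparison between charts, so the change of variables
   is needed only up to a constant factor.  It is obtained by writing a C^1 map,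
   locally, as a linear map followed by a perturbation of the identity, and the
   latter as a composite of maps changing one coordinate at a time.

   Since r and the defining function r0 of the conformal compactification gbar
   have a positive ratio at the boundary, |dr| for r^2 g equals |dr0| for gbar
   there; the latter is continuous, hence has a minimiser on the compact
   boundary, to which the bound applies.

   Lower bound on hyperbolic space.  Hardy's inequality on each vertical line,
   |f'|^p t^(p-1-n) >= (n/p)^p |f|^p t^(-1-n) in integrated form, gives the
   Rayleigh bound for test functions; the energies of a Cauchy sequence converge
   because E(u) <= (1 + th)^p E(v) + (1 + 1/th)^p E(u - v). *)
Require Import Defs.
From HB Require Import structures.
From mathcomp Require Import all_boot all_order all_algebra fingroup perm.
From mathcomp Require Import all_classical all_reals all_analysis.
From mathcomp Require Import measurable_realfun ring lra.

Set Implicit Arguments.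
Unset Strict Implicit.
Unset Printing Implicit Defensive.

Import Order.TTheory GRing.Theory Num.Theory.
Import numFieldNormedType.Exports.

Local Open Scope classical_set_scope.
Local Open Scope ring_scope.

(** * Lebesgue measure on row vectors *)

Section RowVectors.
Variable R : realType.

(** The exponent [n / p] is the borderline one: the p-th power of [y_n ^ (n / p)] times the volume
    density, which is of order [y_n ^ (- n - 1)], is of order [1 / y_n]. Its integral between the
    heights [e^(-3L)] and [e^(-2L)] grows like [L], while a cut-off depending on [ln y_n / L] has
    derivatives whose p-th powers are of order [L^-p]; relative to the horizontal volume their total
    stays bounded and loses against the main term.

    The main term of the gradient energy is a multiple of the p-th power energy of the same
    function. The two are compared pointwise, before any change of chart, so the factor lost in the
    change of variables never meets the sharp constant.

    A slab has corners, so it only carries the support, and the domain is a ball around it. Near the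
    face this ball has width about the square root of the height, and the slab must be as narrow;
    tangential derivatives remain small because [e^(-2L)] over the square root of [e^(-3L)] is
    [e^(-L/2)].

    That a boundary point lies on the face of every chart around it is an invariance statement; it
    is deduced from [dr <> 0]. *)

Lemma rV_norm_le d (v : 'rV[R]_d) e :
  0 <= e -> (forall i, `|v 0 i| <= e) -> `|v| <= e.
Proof.
move=> e0 ve; rewrite [`|v|]mx_normrE; apply: bigmax_le => // -[i j] _ /=.
by rewrite (ord1 i); exact: ve.
Qed.

Lemma rV_norm_lt d (v : 'rV[R]_d) e :
  0 < e -> (forall i, `|v 0 i| < e) -> `|v| < e.
Proof.
move=> e0 ve; rewrite [`|v|]mx_normrE; apply: bigmax_lt => // -[i j] _ /=.
by rewrite (ord1 i); exact: ve.
Qed.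

Lemma rV_coord_le d (v : 'rV[R]_d) i : `|v 0 i| <= `|v|.
Proof.
rewrite [`|v|]mx_normrE.
exact: (@le_bigmax _ _ _ 0 (fun ij : 'I_1 * 'I_d => `|v ij.1 ij.2|) (0, i)).
Qed.

Definition box d (c : 'rV[R]_d) (e : R) : set 'rV[R]_d := [set y | `|y - c| <= e].

Lemma box_closed d (c : 'rV[R]_d) e : closed (box c e).
Proof.
rewrite (_ : box c e = (fun y => `|y - c|) @^-1` [set x | x <= e])//.
apply: preimage_closed; last exact: closed_le.
move=> x _; apply: continuous_comp; last exact: norm_continuous.
by apply: continuousB; [exact: cvg_id|exact: cst_continuous].
Qed.

Lemma box_compact d (c : 'rV[R]_d) e : compact (box c e).
Proof.
apply: bounded_closed_compact; last exact: box_closed.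
exists (`|c| + e); split; first exact: num_real.
move=> M ltM y yc; apply: le_trans (ltW ltM).
by rewrite -[y](subrK c) (le_trans (ler_normD _ _))// addrC lerD2l.
Qed.

Lemma rV_rat_dense d (x : 'rV[R]_d) e :
  0 < e -> exists q : 'rV[rat]_d, `|x - map_mx ratr q| < e.
Proof.
move=> e0; have Hq i : exists q : rat, `|x 0 i - ratr q| < e.
  have [|q] := @rat_in_itvoo R (x 0 i - e) (x 0 i + e).
    by rewrite ltrBlDr -addrA ltrDl addr_gt0.
  rewrite in_itv/= => /andP[q1 q2]; exists q.
  by rewrite distrC ltr_distl q1 q2.
have [f Hf] := boolp.choice Hq; exists (\row_i f i).
by apply: rV_norm_lt => // i; rewrite !mxE.
Qed.

(** A Lindelof argument with control: boxes with rational centre and radius [1 / m.+1] are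
    enumerated by [unpickle], and only those inside some [del]-ball centred in [W] are kept. Local
    bounds can then be summed over countably many boxes. *)
Lemma rV_countable_cover d (W : set 'rV[R]_d) (del : 'rV[R]_d -> R) :
  (forall x, W x -> 0 < del x) ->
  exists B : nat -> set 'rV[R]_d,
  [/\ forall i, compact (B i),
      forall i, B i !=set0 -> exists c e, 0 < e /\ B i = box c e,
      forall i, B i !=set0 ->
        exists2 x, W x & forall y, B i y -> `|y - x| < del x &
      W `<=` \bigcup_i B i].
Proof.
move=> del0.
pose good (cm : 'rV[rat]_d * nat) := exists2 x, W x &
  forall y, box (map_mx ratr cm.1 : 'rV[R]_d) cm.2.+1%:R^-1 y -> `|y - x| < del x.
pose B i := if unpickle i is Some cm then
  if `[< good cm >] then box (map_mx ratr cm.1 : 'rV[R]_d) cm.2.+1%:R^-1 else set0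
  else set0.
exists B; split.
- move=> i; rewrite /B; case: unpickle => [cm|]; last exact: compact0.
  by case: ifPn => _; [exact: box_compact|exact: compact0].
- move=> i [z]; rewrite /B; case: unpickle => [cm|//].
  by case: ifPn => // _ _; exists (map_mx ratr cm.1), cm.2.+1%:R^-1.
- move=> i [z]; rewrite /B; case: unpickle => [cm|//].
  by case: ifPn => // /asboolP[x Wx xP] _; exists x.
move=> x Wx; have dx := del0 _ Wx.
have [m Hm] : exists m : nat, m.+1%:R^-1 < del x / 2.
  have d2 : 0 < del x / 2 by rewrite divr_gt0.
  exists (Num.truncn (del x / 2)^-1).
  rewrite -[ltRHS]invrK ltf_pV2 ?posrE ?invr_gt0//.
  exact: truncnS_gt.
(* The rational centre is closer to [x] than the radius of the box, and the radius is below
   [del x / 2]: the box contains [x] and stays in the [del x]-ball. *)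
have [q Hq] := @rV_rat_dense d x m.+1%:R^-1 ltac:(by rewrite invr_gt0).
exists (pickle (q, m)) => //; rewrite /B pickleK.
case: ifPn => [_|/asboolPn[]]; first by rewrite /box/= ltW.
exists x => // y /= yq.
rewrite -(subrK (map_mx ratr q) y) -addrA (le_lt_trans (ler_normD _ _))//.
rewrite (splitr (del x)) ltr_leD//; first exact: le_lt_trans yq Hm.
by rewrite distrC ltW// (lt_trans Hq).
Qed.

Lemma open_norm_ball d (O : set 'rV[R]_d) x : open O -> O x ->
  exists2 e, 0 < e & forall y, `|y - x| < e -> O y.
Proof.
move=> oO Ox; have /nbhs_ballP[e /= e0 eO] := open_nbhs_nbhs (conj oO Ox).
by exists e => // y yx; apply: eO; rewrite -ball_normE/= distrC.
Qed.

Lemma open_countable_boxes d (O : set 'rV[R]_d) : open O ->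
  exists B : nat -> set 'rV[R]_d,
  [/\ forall i, compact (B i),
      forall i, B i !=set0 -> exists c e, 0 < e /\ B i = box c e &
      O = \bigcup_i B i].
Proof.
move=> oO.
have [del Hdel] : exists del : 'rV[R]_d -> R, forall x, O x ->
    0 < del x /\ forall y, `|y - x| < del x -> O y.
  have H x : exists e, O x -> 0 < e /\ forall y, `|y - x| < e -> O y.
    have [Ox|nOx] := pselect (O x); last by exists 0.
    by have [e e0 eO] := open_norm_ball oO Ox; exists e.
  have [f Hf] := boolp.choice H; by exists f.
have [|B [B1 B2 B3 B4]] := @rV_countable_cover d O del.
  by move=> x /Hdel[].
exists B; split => //; apply/seteqP; split => // x [i _ Bix].
have [|y Oy yB] := B3 i; first by exists x.
exact: (Hdel y Oy).2 (yB _ Bix).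
Qed.

Lemma row_mx_norm_le d (x : 'rV[R]_1) (v : 'rV[R]_d) e : 0 <= e ->
  (`|row_mx x v| <= e) = (`|x 0 0| <= e) && (`|v| <= e).
Proof.
move=> e0; apply/idP/andP => [H|[xe ve]].
  split.
    apply: le_trans H; apply: le_trans (rV_coord_le _ (lshift d 0)).
    by rewrite row_mxEl.
  apply: rV_norm_le => // i; apply: le_trans H.
  by apply: le_trans (rV_coord_le _ (rshift 1 i)); rewrite row_mxEr.
apply: rV_norm_le => // i; rewrite mxE; case: splitP => j _.
  by rewrite (ord1 j).
by apply: le_trans ve; exact: rV_coord_le.
Qed.

End RowVectors.

Notation borel_rV R d := (g_sigma_algebraType (@open 'rV[R]_d)).

Section LebesgueRV.
Variable R : realType.

Lemma open_borel d (A : set 'rV[R]_d) : open A -> measurable (A : set (borel_rV R d)).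
Proof. by move=> oA; exact: sub_sigma_algebra. Qed.

Lemma closed_borel d (A : set 'rV[R]_d) :
  closed A -> measurable (A : set (borel_rV R d)).
Proof.
move=> cA; rewrite -(setCK A); apply: (@measurableC _ (borel_rV R d)).
by apply: open_borel; exact: closed_openC.
Qed.

Lemma continuous_borel d d' (f : 'rV[R]_d -> 'rV[R]_d') :
  continuous f -> measurable_fun setT (f : borel_rV R d -> borel_rV R d').
Proof.
move=> cf; apply: (@measurability _ _ _ (borel_rV R d') _ _ (@open 'rV[R]_d')) => //.
move=> _ [V oV <-]; rewrite setTI; apply: open_borel.
by move/continuousP : cf; exact.
Qed.

Lemma continuous_borel_fun d (f : 'rV[R]_d -> R) :
  continuous f -> measurable_fun setT (f : borel_rV R d -> R).
Proof.
move=> cf; apply: (measurability _ (measurable_realfun.RGenOpens.measurableE R)).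
move=> _ [_ [a [b ->]] <-]; rewrite setTI; apply: open_borel.
by move/continuousP : cf; apply; exact: interval_open.
Qed.

Definition row_cons d (z : measurableTypeR R * borel_rV R d) : borel_rV R d.+1 :=
  row_mx (z.1%:M : 'rV_1) z.2 : 'rV_(1 + d).

(** Open sets are countable unions of sup-norm boxes, and such a box is an interval times a
    lower-dimensional box; this matches the Borel sets of [R^(1+d)] with the product
    sigma-algebra. *)
Lemma row_cons_measurable d : measurable_fun setT (@row_cons d).
Proof.
apply: (@measurability _ _ _ (borel_rV R d.+1) _ _ (@open 'rV[R]_d.+1)) => //.
move=> _ [V oV <-]; rewrite setTI.
have [B [_ B2 ->]] := open_countable_boxes oV.
rewrite preimage_bigcup; apply: bigcupT_measurable => i.
have [[z Biz]|] := pselect (B i !=set0); last first.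
  by move/set0P/negP; rewrite negbK => /eqP ->; rewrite preimage_set0.
have [|c [e [e0 ->]]] := B2 i; first by exists z.
pose c' : 'rV[R]_(1 + d) := c.
have E (x : R) (v : 'rV[R]_d) : row_mx (x%:M : 'rV_1) v - c' =
    row_mx (x%:M - lsubmx c') (v - rsubmx c').
  by rewrite -{1}(hsubmxK c') opp_row_mx add_row_mx.
have H (x : R) (v : 'rV[R]_d) : (`|(row_mx (x%:M : 'rV_1) v : 'rV_(1 + d)) - c'| <= e) =
    (`|x - c' 0 (lshift d 0)| <= e) && (`|v - rsubmx c'| <= e).
  by rewrite E row_mx_norm_le; [rewrite !mxE eqxx mulr1n|exact: ltW].
rewrite (_ : _ @^-1` _ = [set x | `|x - c' 0 (lshift d 0)| <= e] `*`
    ([set v | `|v - rsubmx c'| <= e] : set (borel_rV R d))); last first.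
  apply/seteqP; split => -[x v] /=.
    by move=> xve; apply/andP; rewrite -H.
  by move/andP; rewrite -H.
apply: measurableX; last by apply: closed_borel; exact: box_closed.
rewrite (_ : [set _ | _] = `[c' 0 (lshift d 0) - e, c' 0 (lshift d 0) + e]%classic).
  exact: measurable_itv.
by apply/seteqP; split => x /=; rewrite in_itv/= ler_distl.
Qed.

Definition row_uncons d (v : borel_rV R d.+1) : measurableTypeR R * borel_rV R d :=
  ((v : 'rV_(1 + d)) 0 (lshift d 0), rsubmx (v : 'rV_(1 + d))).

Lemma row_consK d : cancel (@row_cons d) (@row_uncons d).
Proof.
move=> [x v]; rewrite /row_cons /row_uncons /= row_mxEl row_mxKr.
by rewrite mxE eqxx.
Qed.

Lemma row_unconsK d : cancel (@row_uncons d) (@row_cons d).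
Proof.
move=> v; rewrite /row_cons /row_uncons /= -[RHS](hsubmxK (v : 'rV_(1 + d))).
set x := _%:M; suff -> : x = lsubmx (v : 'rV_(1 + d)) by [].
by apply/rowP => i; rewrite !mxE (ord1 i) eqxx.
Qed.

Lemma row_uncons_measurable d : measurable_fun setT (@row_uncons d).
Proof.
apply: measurable_fun_pair.
  by apply: continuous_borel_fun => v; exact: (@coord_continuous R 1 (1 + d) 0).
apply: (@continuous_borel (1 + d) d) => v; exact: continuous_rsubmx.
Qed.

Section step.
Variables (d : nat) (m : {sigma_finite_measure set (borel_rV R d) -> \bar R}).

(** The new coordinate is the outer factor, in the order in which [integral_rV] iterates its
    integrals. *)
Definition leb_step : set (borel_rV R d.+1) -> \bar R :=
  pushforward ((@lebesgue_measure R \x m)%E) (@row_cons d).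

HB.instance Definition _ := Measure.copy leb_step
  (@measure_function_pushforward__canonical__measure_function_Measure
    _ _ _ (borel_rV R d.+1) R
    ((@lebesgue_measure R \x m)%E : {measure set (measurableTypeR R * borel_rV R d) -> \bar R})
    (@row_cons d) (@row_cons_measurable d)).

Lemma leb_step_sigma_finite : sigma_finite setT leb_step.
Proof.
have /sigma_finiteP[F [TF ndF Foo]] := sigma_finiteT (@lebesgue_measure R).
have /sigma_finiteP[G [TG ndG Goo]] := sigma_finiteT m.
exists (fun n => @row_uncons d @^-1` (F n `*` G n)).
  rewrite -preimage_bigcup (_ : \bigcup_n _ = setT) ?preimage_setT//.
  rewrite -setXTT TF TG predeqE => -[x y]; split.
    by move=> [n _ []/= ? ?]; split; exists n.
  move=> [/= [n _ Fnx] [k _ Gky]]; exists (maxn n k) => //; split.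
  - by move: x Fnx; exact/subsetPset/ndF/leq_maxl.
  - by move: y Gky; exact/subsetPset/ndG/leq_maxr.
move=> k; have [mF Fk] := Foo k; have [mG Gk] := Goo k.
have mFG : measurable (F k `*` G k) by exact: measurableX.
split.
  by rewrite -[X in measurable X]setTI; exact: row_uncons_measurable.
rewrite /leb_step /pushforward -comp_preimage (_ : _ \o _ = id); last first.
  by apply/funext => z /=; rewrite row_consK.
by rewrite preimage_id product_measure1E//= lte_mul_pinfty// ge0_fin_numE.
Qed.

HB.instance Definition _ := Measure_isSigmaFinite.Build _ _ _ leb_step
  leb_step_sigma_finite.

End step.

Fixpoint leb_rV (d : nat) : {sigma_finite_measure set (borel_rV R d) -> \bar R} :=
  if d is d'.+1 then leb_step (leb_rV d') else dirac (0 : borel_rV R 0).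

(** Tonelli, one coordinate at a time. For Borel functions the iterated integral becomes an integral
    against a measure, where additivity and countable decompositions are available. *)
Lemma integral_leb_rV d (f : borel_rV R d -> \bar R) :
  measurable_fun setT f -> (forall x, 0 <= f x)%E ->
  (\int[leb_rV d]_x f x = integral_rV (f : 'rV[R]_d -> \bar R))%E.
Proof.
elim: d f => [|d IH] f mf f0 /=.
  by rewrite integral_dirac// diracT mul1e.
rewrite ge0_integral_pushforward//; last exact: row_cons_measurable.
have mfr : measurable_fun setT (f \o @row_cons d).
  by apply: measurableT_comp => //; exact: row_cons_measurable.
rewrite preimage_setT.
apply: etrans (fubini_tonelli1 (f \o @row_cons d) mfr (fun x => f0 _)) _.
apply: eq_integral => x _; rewrite /fubini_F IH//=.
exact: measurable_fun_pair2 mfr.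
Qed.

End LebesgueRV.

(** * Monotonicity of iterated integrals *)

Section NonmeasurableMonotonicity.
Local Open Scope ereal_scope.

(* The library proves monotonicity for measurable functions only; the integral
   of a nonnegative function is a supremum over simple functions below it, so
   none is needed. *)
Lemma ge0_le_integralT d (T : measurableType d) (R : realType)
    (mu : {measure set T -> \bar R}) (f g : T -> \bar R) :
  (forall x, 0 <= f x) -> (forall x, f x <= g x) ->
  \int[mu]_x f x <= \int[mu]_x g x.
Proof.
move=> f0 fg; have g0 x : 0 <= g x := le_trans (f0 x) (fg x).
rewrite !ge0_integralTE//; apply: le_ereal_sup => _ [h hf <-].
by exists h => // x; exact: le_trans (hf x) (fg x).
Qed.

Lemma integral_rV_ge0 (R : realType) d (f : 'rV[R]_d -> \bar R) :
  (forall x, 0 <= f x) -> 0 <= integral_rV f.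
Proof.
elim: d f => [|d IH] f f0 /=; first exact: f0.
by apply: integral_ge0 => x _; exact: IH.
Qed.

Lemma integral_rV_le (R : realType) d (f g : 'rV[R]_d -> \bar R) :
  (forall x, 0 <= f x) -> (forall x, f x <= g x) ->
  integral_rV f <= integral_rV g.
Proof.
elim: d f g => [|d IH] f g f0 fg /=; first exact: fg.
apply: ge0_le_integralT => x; first exact: integral_rV_ge0.
exact: IH.
Qed.

End NonmeasurableMonotonicity.

Lemma ord_split1 d (j : 'I_(1 + d)) : j = lshift d 0 \/ exists k, j = rshift 1 k.
Proof. by case: (split_ordP j) => k ->; [left; rewrite (ord1 k)|right; exists k]. Qed.

(** * Measure of images under maps that change one coordinate *)

Section LipschitzImages.
Variable R : realType.
Local Notation leb := (@lebesgue_measure R).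

Lemma lebesgue_interval_diam (I : set R) x y : measurable I -> is_interval I ->
  I x -> I y -> (`|x - y|%:E <= leb I)%E.
Proof.
move=> mI iI; wlog xy : x y / x <= y.
  move=> H Ix Iy; have /orP[xy|yx] := le_total x y; first exact: H.
  by rewrite distrC; exact: H.
move=> Ix Iy; rewrite distrC ger0_norm ?subr_ge0//.
have <- : leb `[x, y]%classic = (y - x)%:E.
  by rewrite lebesgue_measure_itv/= lte_fin; case: ltgtP xy => // -> _; rewrite subrr.
apply: le_measure; rewrite ?inE//.
by move=> z /=; rewrite in_itv/= => zI; exact: (iI x y).
Qed.

(** An open set [U] slightly larger than the image of [a] splits into disjoint intervals, and the
    part of the image of [b] above one of them has diameter at most [c] times its length. The two
    maps share a parameter set [T], so that slices of higher-dimensional images can be fed in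
    directly. *)
Lemma lebesgue_lipschitz T (D : set T) (a b : T -> R) c : 0 < c ->
  measurable (a @` D) -> measurable (b @` D) ->
  (forall s t, D s -> D t -> `|b s - b t| <= c * `|a s - a t|) ->
  (leb (b @` D) <= c%:E * leb (a @` D))%E.
Proof.
move=> c0 mA mB lip.
have [Aoo|] := eqVneq (leb (a @` D)) +oo%E.
  by rewrite Aoo gt0_muley ?lte_fin// leey.
rewrite -ltey => Aoo.
have Afin : leb (a @` D) \is a fin_num by rewrite ge0_fin_numE.
rewrite -(fineK Afin) -EFinM; apply/lee_addgt0Pr => e e0.
have ec0 : 0 < e / c by rewrite divr_gt0.
have [U [oU AU UA]] := lebesgue_regularity_outer mA Aoo ec0.
have mU : measurable U by exact: open_measurable.
have UE : (leb U <= (fine (leb (a @` D)) + e / c)%:E)%E.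
  rewrite EFinD fineK// -(setDUK AU) (le_trans (measureU2 _ _ _))//.
    exact: measurableD.
  by rewrite leeD2l// ltW.
pose I := open_disjoint_itv oU.
have mI q : measurable (I q) by apply: open_measurable; exact: open_disjoint_itv_open.
have sumI : leb U = (\sum_(q <oo) leb (I q))%E.
  rewrite {1}(open_disjoint_itv_bigcup oU) measure_bigcup; last 2 first.
  - by move=> q _; exact: mI.
  - exact: open_disjoint_itv_trivIset.
  by apply: eq_eseriesl => q; rewrite in_setT.
pose S q := b @` (D `&` a @^-1` I q).
(* [inf] and [sup] are meaningful on nonempty sets only, so an interval without points of the image
   of [a] gets an empty hull. *)
pose J q := if `[< S q !=set0 >] then `[inf (S q), sup (S q)]%classic else set0.
have mJ q : measurable (J q) by rewrite /J; case: ifP => _ //; exact: measurable_itv.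
have IqU q : (leb (I q) <= leb U)%E.
  apply: le_measure; rewrite ?inE//; first exact: mI.
  by rewrite (open_disjoint_itv_bigcup oU); exact: bigcup_sup.
have Ifin q : leb (I q) \is a fin_num.
  by rewrite ge0_fin_numE// (le_lt_trans (IqU q))// (le_lt_trans UE) ?ltry.
have SS q s t : S q s -> S q t -> s - t <= c * fine (leb (I q)).
  move=> [x [Dx Ix] <-] [y [Dy Iy] <-].
  rewrite (le_trans (ler_norm _))// (le_trans (lip _ _ Dx Dy))// ler_pM2l//.
  rewrite -lee_fin fineK//; apply: lebesgue_interval_diam => //.
  exact: open_disjoint_itv_is_interval.
have Sb q : S q !=set0 -> has_ubound (S q) /\ has_lbound (S q).
  move=> [s Ss]; split.
    by exists (s + c * fine (leb (I q))) => t St; rewrite -lerBlDl SS.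
  by exists (s - c * fine (leb (I q))) => t St; rewrite lerBlDr -lerBlDl SS.
have BJ : b @` D `<=` \bigcup_q J q.
  move=> _ [x Dx <-].
  have : U (a x) by apply: AU; exists x.
  rewrite (open_disjoint_itv_bigcup oU) => -[q _ Iq]; exists q => //.
  have Sbx : S q (b x) by exists x.
  have Sq0 : S q !=set0 by exists (b x).
  have [ub lb] := Sb _ Sq0.
  rewrite /J; case: ifPn => [_|/asboolPn//]; rewrite /= in_itv/=.
  by rewrite ge_inf//= ub_le_sup.
have JI q : (leb (J q) <= c%:E * leb (I q))%E.
  rewrite /J; case: ifPn => [/asboolP Sq0|_]; last first.
    by rewrite measure0 mule_ge0// lee_fin ltW.
  have [ub lb] := Sb _ Sq0.
  rewrite lebesgue_measure_itv/= lte_fin; case: ifPn => _; last first.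
    by rewrite mule_ge0// lee_fin ltW.
  rewrite -(fineK (Ifin q)) -EFinM -EFinB lee_fin lerBlDr.
  apply: ge_sup => // s Ss; rewrite addrC -lerBlDr.
  by apply: lb_le_inf => // t St; rewrite lerBlDr -lerBlDl SS.
apply: le_trans (measure_sigma_subadditive leb mJ mB BJ) _.
apply: (@le_trans _ _ (\sum_(q <oo) c%:E * leb (I q))%E).
  by apply: lee_nneseries => [q _ _|q _]; [exact: measure_ge0|exact: JI].
rewrite nneseriesZl; last by move=> q _; exact: measure_ge0.
rewrite -sumI; apply: le_trans (lee_wpmul2l _ UE) _; first by rewrite lee_fin ltW.
rewrite -EFinM -EFinD lee_fin mulrDr lerD2l.
by rewrite mulrC divfK// gt_eqF.
Qed.

Lemma leb_rVS d (B : set (borel_rV R d.+1)) : measurable B ->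
  leb_rV R d.+1 B =
  (\int[leb]_x leb_rV R d [set v | B (row_cons (x, v))])%E.
Proof.
move=> mB /=; rewrite /leb_step /pushforward /product_measure1.
apply: eq_integral => x _ /=; congr (leb_rV R d _).
by apply/seteqP; split => v; rewrite /xsection/= ?inE// => H; rewrite inE.
Qed.

Lemma row_cons_preimage_measurable d (B : set (borel_rV R d.+1)) :
  measurable B -> measurable (@row_cons R d @^-1` B).
Proof.
by move=> mB; rewrite -[X in measurable X]setTI; exact: row_cons_measurable.
Qed.

(** This order of slicing isolates the first coordinate, for maps that change only that one. *)
Lemma leb_rVS_swap d (B : set (borel_rV R d.+1)) : measurable B ->
  leb_rV R d.+1 B =
  (\int[leb_rV R d]_v leb [set x | B (row_cons (x, v))])%E.
Proof.
move=> mB; have mB' := row_cons_preimage_measurable mB.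
rewrite leb_rVS//.
have := @indic_fubini_tonelli _ _ _ _ _ leb (leb_rV R d) _ mB'.
rewrite indic_fubini_tonelli_FE// indic_fubini_tonelli_GE// => H.
transitivity (\int[leb]_x (leb_rV R d \o xsection (@row_cons R d @^-1` B)) x)%E.
  apply: eq_integral => x _ /=; congr (leb_rV R d _).
  by apply/seteqP; split => v; rewrite /xsection/= ?inE// => ?; rewrite inE.
rewrite H; apply: eq_integral => v _ /=; congr (leb _).
by apply/seteqP; split => x; rewrite /ysection/= ?inE// => ?; rewrite inE.
Qed.

Lemma slice_measurable d (B : set (borel_rV R d.+1)) x : measurable B ->
  measurable ([set v | B (row_cons (x, v))] : set (borel_rV R d)).
Proof.
move=> /row_cons_preimage_measurable/(measurable_xsection x).
by congr measurable; apply/seteqP; split => v; rewrite /xsection/= ?inE// => ?; rewrite inE.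
Qed.

Lemma slice_measurable_swap d (B : set (borel_rV R d.+1)) v : measurable B ->
  measurable ([set x | B (row_cons (x, v))] : set R).
Proof.
move=> /row_cons_preimage_measurable/(measurable_ysection v).
by congr measurable; apply/seteqP; split => x; rewrite /ysection/= ?inE// => ?; rewrite inE.
Qed.

(* Images under two maps a and b that differ in one coordinate only, the other
   coordinates being treated as parameters. *)
Lemma leb_rV_lipschitz d (i : 'I_d) T (D : set T) (a b : T -> 'rV[R]_d) c :
  0 < c ->
  measurable (a @` D : set (borel_rV R d)) ->
  measurable (b @` D : set (borel_rV R d)) ->
  (forall t j, D t -> j != i -> b t 0 j = a t 0 j) ->
  (forall s t, D s -> D t -> (forall j, j != i -> a s 0 j = a t 0 j) ->
    `|b s 0 i - b t 0 i| <= c * `|a s 0 i - a t 0 i|) ->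
  (leb_rV R d (b @` D) <= c%:E * leb_rV R d (a @` D))%E.
Proof.
elim: d i D a b => [[]//|d IH] i D a b c0 mA mB ab lip.
pose a1 t : 'rV[R]_(1 + d) := a t; pose b1 t : 'rV[R]_(1 + d) := b t.
have sE (f1 : T -> 'rV[R]_(1 + d)) x v :
    ((f1 @` D) (row_cons (x, v))) <->
    ((fun t => rsubmx (f1 t)) @` (D `&` [set t | f1 t 0 (lshift d 0) = x])) v.
  split.
    move=> [t Dt tE]; exists t.
      by split => //; rewrite /= tE /row_cons/= row_mxEl mxE eqxx.
    by rewrite tE /row_cons/= row_mxKr.
  move=> [t [Dt <-] <-]; exists t => //.
  by rewrite -[LHS]row_unconsK.
have sE' (f1 : T -> 'rV[R]_(1 + d)) x v :
    ((f1 @` D) (row_cons (x, v))) <->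
    ((fun t => f1 t 0 (lshift d 0)) @` (D `&` [set t | rsubmx (f1 t) = v])) x.
  split.
    move=> [t Dt tE]; exists t.
      by split => //; rewrite /= tE /row_cons/= row_mxKr.
    by rewrite tE /row_cons/= row_mxEl mxE eqxx.
  move=> [t [Dt <-] <-]; exists t => //.
  by rewrite -[LHS]row_unconsK.
have mfx B : measurable B -> measurable_fun setT
    (fun x => leb_rV R d [set v | B (row_cons (x, v))]).
  move=> mB'; have := measurable_fun_xsection (leb_rV R d) (row_cons_preimage_measurable mB').
  congr measurable_fun; apply/funext => x /=; congr (leb_rV R d _).
  by apply/seteqP; split => v; rewrite /xsection/= ?inE// => ?; rewrite inE.
have mfv B : measurable B -> measurable_fun setT
    (fun v => leb [set x | B (row_cons (x, v))]).
  move=> mB'; have := measurable_fun_ysection leb (row_cons_preimage_measurable mB').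
  congr measurable_fun; apply/funext => v /=; congr (leb _).
  by apply/seteqP; split => x; rewrite /ysection/= ?inE// => ?; rewrite inE.
(* If the changed coordinate is the first, the slices with all others fixed are one-dimensional;
   otherwise the first coordinate is fixed and the induction hypothesis applies to the rest. *)
have [i0|i0] := eqVneq i (lshift d (0 : 'I_1) : 'I_(1 + d)).
  rewrite !leb_rVS_swap// -ge0_integralZl_EFin//; last 2 first.
  - exact: mfv.
  - exact: ltW.
  apply: ge0_le_integralT => // v.
  pose Dv := D `&` [set t | rsubmx (a1 t) = v].
  have DvE : D `&` [set t | rsubmx (b1 t) = v] = Dv.
    apply/seteqP; split => t [Dt tv]; split => //; rewrite -tv /=; apply/rowP => j.
      by rewrite !mxE; apply/esym/ab; rewrite // i0.
    by rewrite !mxE; apply: ab; rewrite // i0.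
  have aE : [set x | (a @` D) (row_cons (x, v))] = (fun t => a1 t 0 (lshift d 0)) @` Dv.
    by apply/funext => x; apply/propext; exact: (sE' a1).
  have bE : [set x | (b @` D) (row_cons (x, v))] = (fun t => b1 t 0 (lshift d 0)) @` Dv.
    by rewrite -DvE; apply/funext => x; apply/propext; exact: (sE' b1).
  rewrite aE bE; apply: lebesgue_lipschitz => //.
  - by rewrite -aE; exact: slice_measurable_swap.
  - by rewrite -bE; exact: slice_measurable_swap.
  move=> s t [Ds sv] [Dt tv]; rewrite /a1 /b1 -i0; apply: lip => // j ji.
  have [k jk] : exists k, j = rshift 1 k.
    case: (@ord_split1 d j) => // jk.
    by move: ji; rewrite i0 jk eqxx.
  by move/rowP : sv => /(_ k); move/rowP : tv => /(_ k); rewrite !mxE jk => <- ->.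
have [i' ii] : exists k, i = rshift 1 k.
  case: (@ord_split1 d i) => // ik.
  by move: i0; rewrite ik eqxx.
rewrite !leb_rVS// -ge0_integralZl_EFin//; last 2 first.
- exact: mfx.
- exact: ltW.
apply: ge0_le_integralT => // x.
pose Dx := D `&` [set t | a1 t 0 (lshift d 0) = x].
have DxE : D `&` [set t | b1 t 0 (lshift d 0) = x] = Dx.
  by apply/seteqP; split => t [Dt tv]; split => //; rewrite -tv /=;
    [apply/esym|]; apply: ab => //; rewrite eq_sym.
have aE : [set v | (a @` D) (row_cons (x, v))] = (fun t => rsubmx (a1 t)) @` Dx.
  by apply/funext => v; apply/propext; exact: (sE a1).
have bE : [set v | (b @` D) (row_cons (x, v))] = (fun t => rsubmx (b1 t)) @` Dx.
  by rewrite -DxE; apply/funext => v; apply/propext; exact: (sE b1).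
rewrite aE bE; apply: (IH i') => //.
- by rewrite -aE; exact: slice_measurable.
- by rewrite -bE; exact: slice_measurable.
- move=> t j [Dt _] ji; rewrite !mxE; apply: ab => //.
  by rewrite ii; apply: contra_neq ji => /(congr1 val)/eqP; rewrite eqn_add2l => /eqP/val_inj.
move=> s t [Ds sx] [Dt tx] st; rewrite !mxE -ii; apply: lip => // j ji.
case: (@ord_split1 d j) => [->|[k jk]].
  by move: sx tx; rewrite /a1 /= => -> ->.
have := st k; rewrite !mxE jk; apply.
by apply: contra_neq ji => ki; rewrite jk ki ii.
Qed.

End LipschitzImages.

(** * Sigma-compact sets *)

Section SigmaCompact.

(** Continuous images of Borel sets need not be Borel. This class contains the open and the closed
    sets of [R^d], is stable under continuous images and, in Hausdorff spaces, intersections, and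
    consists of Borel sets in [R^d]; it keeps the images below measurable. *)
Definition sigma_compact (T : topologicalType) (A : set T) : Prop :=
  exists2 K : nat -> set T, (forall i, compact (K i)) & A = \bigcup_i K i.

Lemma compact_sigma_compact (T : topologicalType) (A : set T) :
  compact A -> sigma_compact A.
Proof.
by move=> cA; exists (fun=> A) => //; rewrite bigcup_const//; exists 0%N.
Qed.

Lemma sigma_compact_image (T U : topologicalType) (f : T -> U) (A : set T) :
  {within A, continuous f} -> sigma_compact A -> sigma_compact (f @` A).
Proof.
move=> cf [K cK AK]; exists (fun i => f @` K i); last by rewrite AK image_bigcup.
move=> i; apply: continuous_compact => //.
by apply: continuous_subspaceW cf; rewrite AK; exact: bigcup_sup.
Qed.

Lemma sigma_compactI (T : topologicalType) (A B : set T) : hausdorff_space T ->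
  sigma_compact A -> sigma_compact B -> sigma_compact (A `&` B).
Proof.
move=> hT [K cK AK] [L cL BL].
exists (fun i => if unpickle i is Some (a, b) then K a `&` L b else set0).
  move=> i; case: unpickle => [[a b]|]; last exact: compact0.
  by apply: compact_closedI => //; exact: compact_closed.
apply/seteqP; split => x.
  rewrite AK BL => -[[a _ Ka] [b _ Lb]].
  by exists (pickle (a, b)) => //; rewrite pickleK.
move=> [i _]; case: unpickle => [[a b] [Ka Lb]|//].
by rewrite AK BL; split; [exists a|exists b].
Qed.

Variable R : realType.

Lemma rV_hausdorff d : hausdorff_space 'rV[R]_d.
Proof. exact: norm_hausdorff. Qed.

Lemma open_sigma_compact d (A : set 'rV[R]_d) : open A -> sigma_compact A.
Proof. by move=> /open_countable_boxes[B [cB _ ->]]; exists B. Qed.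

Lemma closed_sigma_compact d (A : set 'rV[R]_d) : closed A -> sigma_compact A.
Proof.
move=> cA; have [B cB TB] := @open_sigma_compact d setT openT.
exists (fun i => A `&` B i); last by rewrite -setI_bigcupr -TB setIT.
by move=> i; rewrite setIC; exact: compact_closedI.
Qed.

Lemma sigma_compact_borel d (A : set 'rV[R]_d) :
  sigma_compact A -> measurable (A : set (borel_rV R d)).
Proof.
move=> [K cK ->]; apply: bigcupT_measurable => i; apply: closed_borel.
by apply: compact_closed => //; exact: rV_hausdorff.
Qed.

End SigmaCompact.

(** * Measure of images under linear maps *)

Section LinearImages.
Variable R : realType.

Lemma cvg_sum_ord (T : Type) (F : set_system T) (FF : Filter F) (I : finType)
    (f : I -> T -> R) (a : I -> R) :
  (forall i, f i @ F --> a i) -> (fun x => \sum_i f i x) @ F --> \sum_i a i.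
Proof.
move=> fa; elim: (index_enum I) => [|i s IH].
  rewrite big_nil (_ : (fun _ => _) = cst 0); first exact: cvg_cst.
  by apply/funext => x; rewrite big_nil.
rewrite big_cons (_ : (fun _ => _) = f i \+ (fun x => \sum_(j <- s) f j x)).
  by apply: cvgD; [exact: fa|exact: IH].
by apply/funext => x; rewrite big_cons.
Qed.

Lemma within_coord_continuous d (A : set 'rV[R]_d) d' (f : 'rV[R]_d -> 'rV[R]_d') :
  (forall i, {within A, continuous (fun x => f x 0 i)}) ->
  {within A, continuous f}.
Proof.
move=> cf x; apply/cvgrPdist_le => /= e e0.
have H i : \forall y \near (x : subspace A), `|f x 0 i - f y 0 i| <= e.
  by have /cvgrPdist_le/(_ _ e0) := cf i x.
have : \forall y \near (x : subspace A), forall i, `|f x 0 i - f y 0 i| <= e.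
  by apply: filter_forall.
apply: filterS => y yP; apply: rV_norm_le; first exact: ltW.
by move=> i; rewrite !mxE.
Qed.

(* x_0, .., x_(m-1) are replaced by the coordinates of psi x, one at a time. *)
Lemma leb_rV_seq_lipschitz d (A : set 'rV[R]_d) (psi : 'rV[R]_d -> 'rV[R]_d)
    (c : 'I_d -> R) :
  sigma_compact A -> (forall i, {within A, continuous (fun x => psi x 0 i)}) ->
  (forall i, 0 < c i) ->
  (forall (m : 'I_d) x y, A x -> A y ->
     (forall j : 'I_d, (j < m)%N -> psi x 0 j = psi y 0 j) ->
     (forall j : 'I_d, (m < j)%N -> x 0 j = y 0 j) ->
     `|psi x 0 m - psi y 0 m| <= c m * `|x 0 m - y 0 m|) ->
  (leb_rV R d (psi @` A) <= (\prod_i c i)%:E * leb_rV R d A)%E.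
Proof.
move=> sA cpsi c0 lip.
pose F m (x : 'rV[R]_d) : 'rV[R]_d := \row_i if (i < m)%N then psi x 0 i else x 0 i.
have cF m : {within A, continuous (F m)}.
  apply: within_coord_continuous => i.
  rewrite (_ : (fun x => F m x 0 i) = if (i < m)%N then (fun x => psi x 0 i) else
    (fun x => x 0 i)); last by apply/funext => x; rewrite mxE; case: ifP.
  case: ifP => _; first exact: cpsi.
  by apply: continuous_subspaceT => x; exact: coord_continuous.
have mF m : measurable (F m @` A : set (borel_rV R d)).
  by apply: sigma_compact_borel; exact: sigma_compact_image.
have H m : (m <= d)%N ->
    (leb_rV R d (F m @` A) <= (\prod_(i < d | (i < m)%N) c i)%:E * leb_rV R d A)%E.
  elim: m => [_|m IH md].
    rewrite big_pred0// mul1e (_ : F 0%N @` A = A)//.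
    rewrite -[RHS]image_id; apply: eq_imagel => x _.
    by apply/rowP => i; rewrite mxE.
  pose mo := Ordinal md.
  apply: (@le_trans _ _ ((c mo)%:E * leb_rV R d (F m @` A))%E).
    apply: (@leb_rV_lipschitz _ _ mo) => //.
      move=> x j Ax jm; rewrite !mxE ltnS leq_eqVlt.
      by move: jm; rewrite -val_eqE/= => /negbTE ->.
    move=> x y Ax Ay xy; rewrite !mxE /= ltnn ltnSn; apply: lip => // j jm.
      have := xy j; rewrite !mxE jm; apply.
      by rewrite -val_eqE/= ltn_eqF.
    have := xy j; rewrite !mxE ltnNge (ltnW jm)/=; apply.
    by rewrite -val_eqE/= gtn_eqF.
  rewrite (bigD1 mo)//= EFinM -muleA lee_pmul2l ?lte_fin//.
  rewrite (eq_bigl (fun i : 'I_d => (i < m)%N)); first exact: IH (ltnW md).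
  move=> i; rewrite ltnS -val_eqE/= ltn_neqAle andbC; exact.
have := H d (leqnn d).
have -> : \prod_(i < d | (i < d)%N) c i = \prod_i c i.
  by apply: eq_bigl => i; rewrite ltn_ord.
rewrite (_ : F d @` A = psi @` A)//; apply: eq_imagel => x _.
by apply/rowP => i; rewrite mxE ltn_ord.
Qed.

(** One inequality is enough: the reverse comparison of two charts comes from the inverse transition
    map. *)
Definition det_bounded d (T : 'M[R]_d) :=
  forall A : set 'rV[R]_d, sigma_compact A ->
  (leb_rV R d ((fun x : 'rV_d => x *m T) @` A) <= `|\det T|%:E * leb_rV R d A)%E.

Lemma mulmx_coord_continuous d d' (T : 'M[R]_(d, d')) i :
  continuous (fun x : 'rV[R]_d => (x *m T) 0 i).
Proof.
move=> x; rewrite (_ : (fun x : 'rV_d => (x *m T) 0 i) =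
  fun x : 'rV_d => \sum_j x 0 j * T j i); last by apply/funext => y; rewrite mxE.
apply: (@cvg_sum_ord 'rV[R]_d (nbhs x) _ _ (fun j (y : 'rV_d) => y 0 j * T j i)) => j.
by apply: continuousM; [exact: coord_continuous|exact: cst_continuous].
Qed.

Lemma det_boundedM d (S T : 'M[R]_d) :
  det_bounded S -> det_bounded T -> det_bounded (S *m T).
Proof.
move=> hS hT A sA; rewrite (_ : (fun x : 'rV_d => x *m (S *m T)) @` A =
    (fun x : 'rV_d => x *m T) @` ((fun x : 'rV_d => x *m S) @` A)); last first.
  by rewrite image_comp; apply: eq_imagel => x _ /=; rewrite mulmxA.
have sSA : sigma_compact ((fun x : 'rV_d => x *m S) @` A).
  apply: sigma_compact_image sA; apply: within_coord_continuous => i.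
  by apply: continuous_subspaceT; exact: mulmx_coord_continuous.
apply: le_trans (hT _ sSA) _; rewrite det_mulmx normrM mulrC EFinM -muleA.
by apply: lee_wpmul2l; [rewrite lee_fin|exact: hS].
Qed.

(** The [m]-th coordinate of the image involves only the [x_i] with [i >= m]. In the order of
    [leb_rV_seq_lipschitz] those beyond [m] are not yet replaced, so they agree and only the
    diagonal entry remains. *)
Lemma det_bounded_lower d (L : 'M[R]_d) :
  (forall i j : 'I_d, (i < j)%N -> L i j = 0) -> (forall i, L i i != 0) ->
  det_bounded L.
Proof.
move=> Ltrig Ld A sA.
rewrite det_trig; last by apply/is_trig_mxP => i j; exact: Ltrig.
rewrite normr_prod; apply: leb_rV_seq_lipschitz => //.
- by move=> i; apply: continuous_subspaceT; exact: mulmx_coord_continuous.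
- by move=> i; rewrite normr_gt0.
move=> m x y _ _ _ xy; rewrite !mxE -sumrB (bigD1 m)//= big1 ?addr0.
  by rewrite -mulrBl normrM mulrC.
move=> i im; have [mi|mi] := ltnP m i; first by rewrite xy// subrr.
by rewrite Ltrig ?mulr0 ?subrr// ltn_neqAle mi andbT.
Qed.

(** Here the [m]-th image coordinate involves the [x_i] with [i <= m], which have already been
    replaced; they are recovered from the image. *)
Lemma det_bounded_upper d (U : 'M[R]_d) :
  (forall i j : 'I_d, (j < i)%N -> U i j = 0) -> (forall i, U i i != 0) ->
  det_bounded U.
Proof.
move=> Utrig Ud A sA.
rewrite -det_tr det_trig; last first.
  by apply/is_trig_mxP => i j ij; rewrite mxE Utrig.
rewrite (eq_bigr (fun i => U i i)); last by move=> i _; rewrite mxE.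
rewrite normr_prod; apply: leb_rV_seq_lipschitz => //.
- by move=> i; apply: continuous_subspaceT; exact: mulmx_coord_continuous.
- by move=> i; rewrite normr_gt0.
move=> m x y _ _ xy xy'.
have E (k : 'I_d) : (forall j : 'I_d, (j < k)%N -> x 0 j = y 0 j) ->
    (x *m U) 0 k - (y *m U) 0 k = (x 0 k - y 0 k) * U k k.
  move=> xyk; rewrite !mxE -sumrB (bigD1 k)//= big1 ?addr0 -?mulrBl//.
  move=> i ik; have [mi|mi] := ltnP i k; first by rewrite xyk// subrr.
  by rewrite Utrig ?mulr0 ?subrr// ltn_neqAle mi andbT eq_sym.
(* Forward substitution: as the diagonal entries are nonzero, equal first image coordinates come
   from equal first coordinates. *)
have {}xy' (j : 'I_d) : (j < m)%N -> x 0 j = y 0 j.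
  elim/ltn_ind: {j}(j : nat) {-2}j (erefl (j : nat)) => k IH j jk jm.
  have /E : forall i : 'I_d, (i < j)%N -> x 0 i = y 0 i.
    by move=> i ij; apply: (IH i); rewrite -?jk// (ltn_trans ij).
  move=> /eqP; rewrite xy// subrr eq_sym mulf_eq0 (negbTE (Ud j)) orbF.
  by rewrite subr_eq0 => /eqP.
by rewrite E// normrM mulrC.
Qed.

(** A transposition is not triangular, but it is the product of three transvections, each upper or
    lower triangular, and the reflection [D], which corrects the sign. *)
Lemma det_bounded_tperm d (i j : 'I_d) : i != j -> det_bounded (tperm_mx i j : 'M[R]_d).
Proof.
move=> ij.
pose E (a b : 'I_d) (c : R) : 'M[R]_d := 1%:M + c *: delta_mx a b.
have EP (a b : 'I_d) (c : R) : a != b -> det_bounded (E a b c).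
  move=> ab; have Ed k : E a b c k k != 0.
    rewrite !mxE eqxx; have [->|_] := eqVneq k a; rewrite ?(negbTE ab) mulr0 addr0 oner_eq0//.
  have [lab|lab] := ltnP a b.
    apply: det_bounded_upper => // k l lk; rewrite !mxE.
    rewrite (_ : k == l = false) ?add0r; last by rewrite -val_eqE gtn_eqF.
    case: eqP => [ka|_]; last by rewrite mulr0.
    case: eqP => [lb|_]; last by rewrite mulr0.
    by move: lab; rewrite -ka -lb ltnNge (ltnW lk).
  apply: det_bounded_lower => // k l kl; rewrite !mxE.
  rewrite (_ : k == l = false) ?add0r; last by rewrite -val_eqE ltn_eqF.
  case: eqP => [ka|_]; last by rewrite mulr0.
  case: eqP => [lb|_]; last by rewrite mulr0.
  by move: lab; rewrite -ka -lb leqNgt kl.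
pose D : 'M[R]_d := diag_mx (\row_k if k == i then -1 else 1).
have DP : det_bounded D.
  apply: det_bounded_upper => [k l lk|k].
    by rewrite !mxE (_ : k == l = false)// -val_eqE gtn_eqF.
  by rewrite !mxE eqxx mulr1n; case: ifP => _; rewrite ?oppr_eq0 oner_eq0.
have -> : tperm_mx i j = E i j 1 *m E j i (-1) *m E i j 1 *m D.
  have ji : j != i by rewrite eq_sym.
  rewrite /E !scale1r scaleN1r.
  have -> : (1%:M + delta_mx i j) *m (1%:M - delta_mx j i) =
      1%:M + delta_mx i j - delta_mx j i - delta_mx i i :> 'M[R]_d.
    by rewrite mulmxDl mul1mx mulmxBr mulmx1 mul_delta_mx addrACA addrA (addrAC 1%:M).
  have -> : (1%:M + delta_mx i j - delta_mx j i - delta_mx i i) *m (1%:M + delta_mx i j) =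
      1%:M - delta_mx i i - delta_mx j j + delta_mx i j - delta_mx j i :> 'M[R]_d.
    rewrite mulmxDr mulmx1 !(mulmxDl, mulNmx) mul1mx !mul_delta_mx.
    rewrite mul_delta_mx_0//; apply/matrixP => k l; rewrite !mxE; ring.
  apply/matrixP => k l; rewrite /D mul_mx_diag /tperm_mx /perm_mx !mxE.
  case: tpermP => [->|->|/eqP ki /eqP kj].
  - rewrite !eqxx ?(negbTE ij) ?(negbTE ji)/=.
    have [jl|lj] := eqVneq j l; have [il|li] := eqVneq i l.
    + by move: ij; rewrite il jl eqxx.
    + by rewrite ?eqxx ?(negbTE ij) ?(negbTE ji) /=; ring.
    + by rewrite ?eqxx ?(negbTE ij) ?(negbTE ji) /=; ring.
    + by rewrite /=; ring.
  - rewrite !eqxx ?(negbTE ij) ?(negbTE ji)/=.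
    have [jl|lj] := eqVneq j l; have [il|li] := eqVneq i l.
    + by move: ij; rewrite il jl eqxx.
    + by rewrite ?eqxx ?(negbTE ij) ?(negbTE ji) /=; ring.
    + by rewrite ?eqxx ?(negbTE ij) ?(negbTE ji) /=; ring.
    + by rewrite /=; ring.
  rewrite (negbTE ki) (negbTE kj) /=.
  have [<-|_] := eqVneq k l; first by rewrite (negbTE ki); ring.
  by case: ifP => _; rewrite /=; ring.
by apply: det_boundedM => //; apply: det_boundedM; [apply: det_boundedM|];
  apply: EP; rewrite // eq_sym.
Qed.

Lemma det_bounded1 d : det_bounded (1%:M : 'M[R]_d).
Proof.
apply: det_bounded_upper => [i j ji|i]; rewrite !mxE ?eqxx ?oner_eq0//.
by rewrite (_ : i == j = false)// -val_eqE gtn_eqF.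
Qed.

Lemma det_bounded_perm d (s : 'S_d) : det_bounded (perm_mx s : 'M[R]_d).
Proof.
have [ts -> hts] := prod_tpermP s; elim: ts hts => [_|[a b] ts IH] /=.
  by rewrite big_nil perm_mx1; exact: det_bounded1.
move=> /andP[ab hts]; rewrite big_cons perm_mxM.
by apply: det_boundedM; [exact: det_bounded_tperm|exact: IH].
Qed.

(** The LUP decomposition reduces this to a permutation and two triangular factors; the determinant
    being nonzero keeps their diagonals nonzero. *)
Lemma det_bounded_unit n (T : 'M[R]_n.+1) : \det T != 0 -> det_bounded T.
Proof.
move=> dT.
have := cormen_lup_correct T; have := cormen_lup_perm T.
have := cormen_lup_lower T; have := cormen_lup_upper T.
case: cormen_lup => [[P L] U] /= hU hL /is_perm_mxP[s ->] PLU.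
have TE : T = perm_mx s^-1 *m (L *m U).
  by rewrite -[L *m U]/(L * U) -PLU -[perm_mx s * T]/(perm_mx s *m T) mulmxA
    -perm_mxM mulVg perm_mx1 mul1mx.
have Ld i : L i i != 0 by rewrite hL ?eqxx ?oner_eq0.
have Ud i : U i i != 0.
  move: dT; rewrite TE det_mulmx mulf_eq0 negb_or => /andP[_].
  rewrite det_mulmx mulf_eq0 negb_or => /andP[_].
  rewrite -det_tr det_trig; last by apply/is_trig_mxP => k l kl; rewrite mxE hU.
  by move=> /prodf_neq0/(_ i isT); rewrite mxE.
rewrite TE; apply: det_boundedM; first exact: det_bounded_perm.
apply: det_boundedM; last exact: det_bounded_upper.
apply: det_bounded_lower => // i j ij.
by rewrite hL ?(ltnW ij)// (_ : i == j = false)// -val_eqE ltn_eqF.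
Qed.

End LinearImages.

(** * Functions of class C^k on open subsets of R^(n+1) *)

Section CkFunctions.
Variables (R : realType) (n : nat).
Local Notation V := 'rV[R]_n.+1.
Local Notation e i := (@basis_vec R n i).
Implicit Types (U : set V) (f g : V -> R).

(** The recursion peels off the innermost derivative, whereas [iter_partial] adds the outermost one.
    In this form sum, product and chain rules go by induction on [k]. *)
Fixpoint Ck (k : nat) U f : Prop :=
  (forall x, U x -> {for x, continuous f}) /\
  if k is k'.+1 then
    forall i, (forall x, U x -> derivable f x (e i)) /\ Ck k' U (fun x => 'D_(e i) f x)
  else True.

Lemma iter_partial_rcons s i f :
  iter_partial (rcons s i) f = iter_partial s (fun x => 'D_(e i) f x).
Proof. by elim: s => //= j s ->. Qed.

Lemma Ck_onP k U f : Ck_on k U f <-> Ck k U f.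
Proof.
elim: k f => [|k IH] f; split => [H|[cf H]].
- by split => // x Ux; have [] := H [::] isT x Ux.
- by case=> // _ x Ux; split => //; exact: cf.
- split=> [x Ux|i]; first by have [] := H [::] isT x Ux.
  split=> [x Ux|]; first by have [_] := H [::] isT x Ux; apply.
  apply/IH => s sk x Ux; have [|cs ds] := H (rcons s i) _ x Ux.
    by rewrite size_rcons.
  rewrite iter_partial_rcons size_rcons in cs ds.
  by split => // sk'; apply: ds.
move=> s; case/lastP: s => [_ x Ux|s i].
  by split; [exact: cf|move=> _ i; have [Hd _] := H i; exact: Hd].
rewrite size_rcons ltnS => sk x Ux; rewrite iter_partial_rcons.
have [_ /IH Hi] := H i; have [cs ds] := Hi s sk x Ux.
by split=> // /[!size_rcons]/[!ltnS]; exact: ds.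
Qed.

Lemma Ck_sub k U U' f : U' `<=` U -> Ck k U f -> Ck k U' f.
Proof.
move=> UU; elim: k f => [|k IH] f [cf H]; split.
- by move=> x /UU; exact: cf.
- by [].
- by move=> x /UU; exact: cf.
by move=> i; have [H1 H2] := H i; split; [move=> x /UU; exact: H1|exact: IH].
Qed.

Lemma CkW k U f : Ck k.+1 U f -> Ck k U f.
Proof.
elim: k f => [|k IH] f [cf H]; split => // i.
by have [H1 H2] := H i; split => //; exact: IH.
Qed.

Lemma Ck_cont k U f x : Ck k U f -> U x -> {for x, continuous f}.
Proof. by case: k => [|k] [cf _]; exact: cf. Qed.

Lemma near_eq_continuous f g (x : V) : (\forall y \near x, f y = g y) ->
  {for x, continuous f} -> {for x, continuous g}.
Proof.
move=> fg cf; have fx : f x = g x := nbhs_singleton fg.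
move=> A; rewrite -fx => /cf fA.
by apply: (@filterS2 V (nbhs x) _ _ _ _ _ fg fA) => y /= ->.
Qed.

Lemma Ck_near k U f g : open U -> (forall x, U x -> f x = g x) ->
  Ck k U f -> Ck k U g.
Proof.
move=> oU fg; have ne h h' x : (forall x, U x -> h x = h' x :> R) -> U x ->
    \forall y \near x, h y = h' y.
  by move=> hh Ux; apply: filterS (open_nbhs_nbhs (conj oU Ux)) => y Uy; exact: hh.
elim: k f g fg => [|k IH] f g fg [cf H].
  by split => // x Ux; apply: near_eq_continuous (ne _ _ _ fg Ux) (cf x Ux).
split => [x Ux|i]; first exact: near_eq_continuous (ne _ _ _ fg Ux) (cf x Ux).
have [H1 H2] := H i; split=> [x Ux|].
  by apply: near_eq_derivable (ne _ _ _ fg Ux) _; exact: H1.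
by apply: IH H2 => x Ux; apply: near_eq_derive; exact: ne fg Ux.
Qed.

Lemma Ck_cst k U (c : R) : Ck k U (fun=> c).
Proof.
elim: k c => [|k IH] c; first by split=> // x _; exact: cst_continuous.
split=> [x _|i]; first exact: cst_continuous.
split => [x _|]; first exact: derivable_cst.
rewrite (_ : 'D_(e i) _ = fun=> 0); first exact: IH.
by apply/funext => x; exact: (derive_cst c).
Qed.

Lemma derive_coord (x v : V) j : is_derive x v (fun y : V => y 0 j) (v 0 j).
Proof.
have dj := @differentiable_coord R 1 n.+1 x 0 j.
apply: DeriveDef; first exact: diff_derivable.
rewrite /derive; apply: lim_near_cst => //.
near=> h; rewrite /= !mxE addrK /GRing.scale/= mulrA mulVf ?mul1r//.
by near: h; exact: nbhs_dnbhs_neq.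
Unshelve. all: by end_near. Qed.

Lemma basis_vecE (i j : 'I_n.+1) : (e i) 0 j = (i == j)%:R.
Proof. by rewrite /basis_vec mxE eqxx /= eq_sym. Qed.

Lemma Ck_coord k U j : Ck k U (fun y : V => y 0 j).
Proof.
case: k => [|k]; first by split=> // x _; exact: coord_continuous.
split=> [x _|i]; first exact: coord_continuous.
split => [x _|]; first by have [] := derive_coord x (e i) j.
rewrite (_ : (fun x => _) = fun=> (e i) 0 j); first exact: Ck_cst.
by apply/funext => x; have [_] := derive_coord x (e i) j.
Qed.

Lemma CkD k U f g : Ck k U f -> Ck k U g -> open U -> Ck k U (fun x => f x + g x).
Proof.
move=> + + oU; elim: k f g => [|k IH] f g [cf H] [cg G].
  by split => // x Ux; apply: continuousD; [exact: cf|exact: cg].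
split => [x Ux|i]; first by apply: continuousD; [exact: cf|exact: cg].
have [H1 H2] := H i; have [G1 G2] := G i; split => [x Ux|].
  by apply: derivableD; [exact: H1|exact: G1].
have := IH _ _ H2 G2; apply: Ck_near => // x Ux.
by rewrite [RHS](deriveD (H1 _ Ux) (G1 _ Ux)).
Qed.

Lemma CkM k U f g : Ck k U f -> Ck k U g -> open U -> Ck k U (fun x => f x * g x).
Proof.
move=> + + oU; elim: k f g => [|k IH] f g Hf Hg.
  case: Hf Hg => [cf H] [cg G].
  by split => // x Ux; apply: continuousM; [exact: cf|exact: cg].
have [[cf H] [cg G]] := (Hf, Hg).
split => [x Ux|i]; first by apply: continuousM; [exact: cf|exact: cg].
have [H1 H2] := H i; have [G1 G2] := G i; split => [x Ux|].
  by apply: derivableM; [exact: H1|exact: G1].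
have := CkD (IH _ _ (CkW Hf) G2) (IH _ _ (CkW Hg) H2) oU; apply: Ck_near => // x Ux.
by rewrite [RHS](deriveM (H1 _ Ux) (G1 _ Ux)).
Qed.

Lemma Ck_sum k U (I : finType) (f : I -> V -> R) : open U ->
  (forall i, Ck k U (f i)) -> Ck k U (fun x => \sum_i f i x).
Proof.
move=> oU Hf; elim: (index_enum I) => [|i s IH].
  rewrite (_ : (fun _ => _) = fun=> 0); first exact: Ck_cst.
  by apply/funext => x; rewrite big_nil.
rewrite (_ : (fun _ => _) = fun x => f i x + \sum_(j <- s) f j x).
  by apply: CkD.
by apply/funext => x; rewrite big_cons.
Qed.

Lemma Ck_prod k U (I : finType) (P : pred I) (f : I -> V -> R) : open U ->
  (forall i, P i -> Ck k U (f i)) -> Ck k U (fun x => \prod_(i | P i) f i x).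
Proof.
move=> oU Hf; elim: (index_enum I) => [|i s IH].
  rewrite (_ : (fun _ => _) = fun=> 1); first exact: Ck_cst.
  by apply/funext => x; rewrite big_nil.
have [Pi|nPi] := boolP (P i).
  rewrite (_ : (fun _ => _) = fun x => f i x * \prod_(j <- s | P j) f j x).
    by apply: CkM => //; exact: Hf.
  by apply/funext => x; rewrite big_cons Pi.
by under eq_fun do rewrite big_cons (negbTE nPi).
Qed.

Lemma is_derive_line f (w v : V) t : derivable f (w + t *: v) v ->
  is_derive t 1 (fun s : R => f (w + s *: v)) ('D_v f (w + t *: v)).
Proof.
move=> df.
have E : (fun h : R => h^-1 *: (((fun s : R => f (w + s *: v)) \o shift t) (h *: 1)
    - f (w + t *: v))) =
    (fun h : R => h^-1 *: ((f \o shift (w + t *: v)) (h *: v) - f (w + t *: v))).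
  apply/funext => h /=; congr (_ *: (f _ - _)).
  by rewrite [h *: 1]mulr1 scalerDl addrCA addrA addrC.
by apply: DeriveDef; rewrite /derivable /derive E.
Qed.

(** Restricting [f] to the line through [x] in direction [v] turns this into the one-variable chain
    rule. *)
Lemma derive_comp1 (h : R -> R) f x v :
  derivable f x v -> derivable h (f x) 1 ->
  is_derive x v (h \o f) (derive1 h (f x) * 'D_v f x).
Proof.
move=> df dh.
have H1 : is_derive (0 : R) (1 : R) (fun s : R => f (x + s *: v)) ('D_v f x).
  have df0 : derivable f (x + (0 : R) *: v) v by rewrite scale0r addr0.
  by have := is_derive_line df0; rewrite scale0r addr0.
have fx : f (x + (0 : R) *: v) = f x by rewrite scale0r addr0.
have dh' : is_derive (f (x + (0 : R) *: v)) (1 : R) h (derive1 h (f x)).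
  by rewrite fx derive1E; exact/derivableP.
have H2 := is_derive1_comp dh' H1.
have E : (fun s : R => s^-1 *: (((h \o f) \o shift x) (s *: v) - (h \o f) x)) =
    (fun s : R => s^-1 *: (((h \o (fun s : R => f (x + s *: v))) \o shift 0) (s *: 1)
      - (h \o (fun s : R => f (x + s *: v))) 0)).
  apply/funext => s /=; congr (_ *: (h _ - h _)); last by rewrite fx.
  by rewrite addr0 [s *: 1]mulr1 addrC.
case: H2 => [Hd <-]; apply: DeriveDef; rewrite /derivable /derive E//.
Qed.

Lemma is_derive_mulr (a s : R) : is_derive s (1 : R) (fun t : R => t * a) a.
Proof.
have d1 : derivable (fun t : R => t) s 1 by exact: derivable_id.
have d2 : derivable (fun=> a : R) s (1 : R) by exact: derivable_cst.
apply: DeriveDef; first exact: (derivableM d1 d2).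
rewrite [LHS](deriveM d1 d2) (derive_cst a) derive_id.
by rewrite scaler0 add0r [_ *: _]mulr1.
Qed.

(** [y] is reached from [z] by changing one coordinate at a time, with the mean value theorem on
    each segment. Both points vary: this strict form exhibits a C^1 map as a small Lipschitz
    perturbation of its linear part, which differentiability at [x] alone would not. *)
Lemma C1_strict_differentiable U f x eps : open U -> U x -> Ck 1 U f -> 0 < eps ->
  exists2 del, 0 < del & forall y z, `|y - x| < del -> `|z - x| < del ->
    `|f y - f z - \sum_i (y - z) 0 i * 'D_(e i) f x| <= eps * `|y - z|.
Proof.
move=> oU Ux [cf Hf] eps0; have [d0 d00 dU] := open_norm_ball oU Ux.
have en : 0 < eps / n.+1%:R by rewrite divr_gt0.
have Hd i : exists2 d, 0 < d & forall w, `|w - x| < d ->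
    `|'D_(e i) f w - 'D_(e i) f x| <= eps / n.+1%:R.
  have [_ [cD _]] := Hf i; have /cvgrPdist_le/(_ _ en)/nbhs_ballP[d /= dd Hdd] := cD x Ux.
  exists d => // w wx; rewrite distrC; apply: Hdd.
  by rewrite -ball_normE/= distrC.
pose d i := s2val (cid2 (Hd i)).
have Hd' i : 0 < d i /\ forall w, `|w - x| < d i ->
    `|'D_(e i) f w - 'D_(e i) f x| <= eps / n.+1%:R.
  by split; [exact: (s2valP (cid2 (Hd i)))|exact: (s2valP' (cid2 (Hd i)))].
pose del := \big[Num.min/d0]_i d i.
have deld i : del <= d i by exact: bigmin_le_cond.
have deld0 : del <= d0 by exact: bigmin_le_id.
exists del; first by apply: lt_bigmin => // i _; exact: (Hd' i).1.
move=> y z yx zx.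
pose w k : V := \row_i if (i < k)%N then y 0 i else z 0 i.
have wS (k : 'I_n.+1) : w k.+1 = w k + (y - z) 0 k *: e k.
  apply/rowP => j; rewrite !mxE ltnS leq_eqVlt eqxx /= -val_eqE/=.
  by case: (ltngtP j k) => jk /=; rewrite ?mulr0 ?addr0// mulr1 (val_inj jk) addrC subrK.
(* Sup-norm balls are products of intervals, so the mixed points [w k] and the segments between them
   stay in the ball. *)
have wdel (k : 'I_n.+1) c : 0 <= c <= 1 -> `|w k + (c * (y - z) 0 k) *: e k - x| < del.
  move=> /andP[c0 c1]; apply: rV_norm_lt; first by rewrite (le_lt_trans _ yx).
  move=> j; have yj : `|y 0 j - x 0 j| < del.
    by apply: le_lt_trans yx; rewrite (le_trans _ (rV_coord_le _ j))// !mxE.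
  have zj : `|z 0 j - x 0 j| < del.
    by apply: le_lt_trans zx; rewrite (le_trans _ (rV_coord_le _ j))// !mxE.
  rewrite !mxE eqxx /=; have [jk|jk] := eqVneq j k.
    rewrite jk ltnn mulr1 -jk.
    rewrite (_ : _ - _ = c * (y 0 j - x 0 j) + (1 - c) * (z 0 j - x 0 j)); last by ring.
    rewrite (le_lt_trans (ler_normD _ _))// !normrM (ger0_norm c0).
    rewrite (@ger0_norm _ (1 - c)) ?subr_ge0//.
    move: yj zj; set a := `|_|; set b := `|_| => yj zj.
    rewrite (_ : del = c * del + (1 - c) * del); last by ring.
    move: c0; rewrite le_eqVlt => /predU1P[<-|c0].
      by rewrite !mul0r !add0r subr0 !mul1r.
    by rewrite ltr_leD// ?ltr_pM2l// ler_wpM2l// ?subr_ge0// ltW.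
  by rewrite mulr0 addr0; case: ifP.
have tel : f y - f z = \sum_(k < n.+1) (f (w k.+1) - f (w k)).
  rewrite -(big_mkord xpredT (fun k => f (w k.+1) - f (w k))) telescope_sumr//.
  by congr (f _ - f _); apply/rowP => i; rewrite !mxE ?ltn_ord.
rewrite tel -sumrB (le_trans (ler_norm_sum _ _ _))//.
rewrite (_ : eps * _ = \sum_(k < n.+1) (eps / n.+1%:R * `|y - z|)); last first.
  by rewrite sumr_const card_ord -[RHS]mulr_natr mulrAC divfK// pnatr_eq0.
apply: ler_sum => k _.
have [/eqP yz0|yz0] := boolP ((y - z) 0 k == 0).
  by rewrite wS yz0 scale0r addr0 subrr mul0r subrr normr0 mulr_ge0// ltW.
pose g (s : R) := f (w k + s *: ((y - z) 0 k *: e k)).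
have Hg (s : R) : s \in `[0, 1] ->
    is_derive s (1 : R) g ((y - z) 0 k * 'D_(e k) f (w k + (s * (y - z) 0 k) *: e k)).
  rewrite in_itv/= => s01.
  have H1 : is_derive s (1 : R) (fun s : R => s * (y - z) 0 k) ((y - z) 0 k).
    exact: is_derive_mulr.
  have Hs : derivable f (w k + (s * (y - z) 0 k) *: e k) (e k).
    by have [Hk _] := Hf k; apply: Hk; apply: dU; apply: lt_le_trans deld0; exact: wdel.
  have H2 := is_derive_line Hs.
  have := is_derive1_comp (H2 : is_derive ((fun s : R => s * (y - z) 0 k) s) _ _ _) H1.
  rewrite mulrC; congr is_derive; apply/funext => t.
  by rewrite /g /= scalerA.
have cg : {within `[0, 1], continuous g}.
  by apply: derivable_within_continuous => s s01; have [] := Hg s s01.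
have dg (s : R) : s \in `]0, 1[ -> is_derive s (1 : R) g
    ((fun s => (y - z) 0 k * 'D_(e k) f (w k + (s * (y - z) 0 k) *: e k)) s).
  by move=> s01; apply: Hg; exact: subset_itv_oo_cc s01.
have [c c01] := MVT_segment (ler01 : (0 : R) <= 1) dg cg.
rewrite subr0 mulr1 /g scale1r scale0r addr0 -wS => ->.
rewrite -mulrBr normrM mulrC ler_pM//; last exact: rV_coord_le.
by apply: (Hd' k).2; apply: lt_le_trans (deld k); apply: wdel; rewrite in_itv/= in c01.
Qed.

Lemma sum_coord_continuous (a : 'I_n.+1 -> R) :
  continuous (fun v : V => \sum_i v 0 i * a i).
Proof.
rewrite (_ : (fun v : V => _) = fun v : V => (v *m \col_i a i) 0 0).
  exact: mulmx_coord_continuous.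
by apply/funext => v; rewrite mxE; apply: eq_bigr => i _; rewrite mxE.
Qed.

Lemma C1_differentiable U f x : open U -> U x -> Ck 1 U f ->
  differentiable f x /\ forall v, 'd f x v = \sum_i v 0 i * 'D_(e i) f x.
Proof.
move=> oU Ux Hf.
have @df : {linear V -> R}.
  exists (fun v : V => \sum_i v 0 i * 'D_(e i) f x : R).
  do 2![eexists]; do ?[constructor].
  - by apply: big1 => i _; rewrite mxE mul0r.
  - move=> u v; rewrite -big_split; apply: eq_bigr => i _ /=.
    by rewrite mxE mulrDl.
  - move=> a v; rewrite scaler_sumr; apply: eq_bigr => i _.
    by rewrite mxE -[RHS]/(a * (_ * _)) mulrA.
have cdf : continuous df.
  exact: sum_coord_continuous.
have E : f \o shift x = cst (f x) + df +o_ (0 : V) id.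
  apply/eqaddoP => eps eps0.
  have [del del0 H] := C1_strict_differentiable oU Ux Hf eps0.
  apply/nbhs_ballP; exists del => //= v; rewrite -ball_normE/= sub0r normrN => vd.
  have := H (v + x) x; rewrite addrK subrr normr0 => /(_ vd del0).
  by rewrite opprD addrA.
have dE := diff_unique cdf E.
split; last by move=> v; rewrite dE.
apply/diff_locallyP; split; first by rewrite dE.
by rewrite dE.
Qed.

Lemma C1_curve_derive (U : set V) f (c : R -> V) t (dc : V) : open U -> U (c t) ->
  Ck 1 U f -> (forall j, is_derive t 1 (fun s => c s 0 j) (dc 0 j)) ->
  is_derive t 1 (f \o c) (\sum_j dc 0 j * 'D_(e j) f (c t)).
Proof.
move=> oU Ux Hf Hc; have [df dE] := C1_differentiable oU Ux Hf.
have Dc : derivable c t 1.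
  by apply/derivable_mxP => i j; rewrite (ord1 i); case: (Hc j).
have Ec : 'D_1 c t = dc.
  by rewrite derive_mx//; apply/rowP => j; rewrite mxE; case: (Hc j).
have dc' : differentiable c t by apply/derivable1_diffP.
apply: DeriveDef.
  by apply/derivable1_diffP; exact: differentiable_comp.
rewrite deriveE; last exact: differentiable_comp.
by rewrite diff_comp//= dE -deriveE// Ec.
Qed.

Lemma C1_comp_derive (U : set V) f (Phi : V -> V) x v (dPhi : V) : open U ->
  U (Phi x) -> Ck 1 U f ->
  (forall j, is_derive x v (fun y => Phi y 0 j) (dPhi 0 j)) ->
  is_derive x v (f \o Phi) (\sum_j dPhi 0 j * 'D_(e j) f (Phi x)).
Proof.
move=> oU Ux Hf HPhi; pose c (s : R) := Phi (x + s *: v).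
have c0 : c 0 = Phi x by rewrite /c scale0r addr0.
have Hc j : is_derive (0 : R) 1 (fun s => c s 0 j) (dPhi 0 j).
  have [dj <-] := HPhi j.
  have dj0 : derivable (fun y => Phi y 0 j) (x + (0 : R) *: v) v.
    by rewrite scale0r addr0.
  by have := is_derive_line dj0; rewrite scale0r addr0.
have H := @C1_curve_derive U f c 0 dPhi oU _ Hf Hc.
rewrite c0 in H; have {H} [H <-] := H Ux.
have E : (fun s : R => s^-1 *: (((f \o Phi) \o shift x) (s *: v) - (f \o Phi) x)) =
    (fun s : R => s^-1 *: (((f \o c) \o shift 0) (s *: 1) - (f \o c) 0)).
  apply/funext => s /=; congr (_ *: (f _ - f _)); last by rewrite c0.
  by rewrite /c addr0 [s *: 1]mulr1 addrC.
by apply: DeriveDef; rewrite /derivable /derive E.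
Qed.

End CkFunctions.

(** * Change of variables, up to a constant *)

Lemma norm_continuousP (R : realType) (V W : normedModType R) (f : V -> W) (x : V) :
  {for x, continuous f} <-> forall eps, 0 < eps ->
    exists2 del, 0 < del & forall y, `|y - x| < del -> `|f y - f x| < eps.
Proof.
split=> [/cvgrPdist_lt H eps eps0|H].
  have /nbhs_ballP[del /= del0 Hdel] := H _ eps0.
  exists del => // y yx; rewrite distrC; apply: Hdel.
  by rewrite -ball_normE/= distrC.
apply/cvgrPdist_lt => eps eps0; have [del del0 Hdel] := H _ eps0.
apply/nbhs_ballP; exists del => // y; rewrite -ball_normE/= distrC => yx.
by rewrite distrC; exact: Hdel.
Qed.

Lemma rV_continuous (R : realType) (V : normedModType R) d (f : V -> 'rV[R]_d) (x : V) :
  (forall i, {for x, continuous (fun y => f y 0 i)}) -> {for x, continuous f}.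
Proof.
move=> cf; apply/norm_continuousP => eps eps0.
have H i := (norm_continuousP _ _).1 (cf i) _ eps0.
pose d1 i := s2val (cid2 (H i)).
exists (\big[Num.min/1]_i d1 i).
  by apply: lt_bigmin => // i _; exact: (s2valP (cid2 (H i))).
move=> y yx; apply: rV_norm_lt => // i; rewrite !mxE.
by apply: (s2valP' (cid2 (H i))); apply: lt_le_trans yx _; exact: bigmin_le_cond.
Qed.

Section ChangeOfVariables.
Variables (R : realType) (n : nat).
Local Notation V := 'rV[R]_n.+1.
Local Notation e i := (@basis_vec R n i).
Local Notation leb := (leb_rV R n.+1).

Lemma mulmx_norm_le d (M : 'M[R]_d) (v : 'rV[R]_d) :
  `|v *m M| <= `|v| * \sum_i \sum_j `|M i j|.
Proof.
apply: rV_norm_le => [|j]; first by rewrite mulr_ge0// !sumr_ge0// => i _; rewrite sumr_ge0.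
rewrite mxE (le_trans (ler_norm_sum _ _ _))// mulr_sumr; apply: ler_sum => i _.
rewrite normrM ler_pM//; first exact: rV_coord_le.
by rewrite (bigD1 j)//= lerDl sumr_ge0.
Qed.

(** Dividing out [T] leaves a map [psi] whose difference from the identity is Lipschitz with
    constant 1/2. Replacing coordinates one at a time then costs a factor [1 + 1/2] each. *)
Lemma leb_rV_strict_image (Phi : V -> V) (T : 'M[R]_n.+1) (A : set V) :
  \det T != 0 -> sigma_compact A ->
  (forall i, {within A, continuous (fun x => Phi x 0 i)}) ->
  (forall y z, A y -> A z -> `|Phi y - Phi z - (y - z) *m T| *
      (\sum_i \sum_j `|invmx T i j|) <= 2^-1 * `|y - z|) ->
  (leb (Phi @` A) <= (`|\det T| * (3 / 2) ^+ n.+1)%:E * leb A)%E.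
Proof.
move=> dT sA cPhi HPhi.
have uT : T \in unitmx by rewrite unitmxE unitfE.
pose psi x := Phi x *m invmx T.
have cPhi' : {within A, continuous Phi} by exact: within_coord_continuous.
have cpsi i : {within A, continuous (fun x => psi x 0 i)}.
  move=> x; exact: (@continuous_comp (subspace A) V R Phi
    (fun v : V => (v *m invmx T) 0 i) x (cPhi' x) (@mulmx_coord_continuous _ _ _ _ _ _)).
have Hpsi y z : A y -> A z -> `|psi y - psi z - (y - z)| <= 2^-1 * `|y - z|.
  move=> Ay Az; apply: le_trans (HPhi _ _ Ay Az).
  rewrite (_ : _ - _ = (Phi y - Phi z - (y - z) *m T) *m invmx T).
    exact: mulmx_norm_le.
  by rewrite !mulmxBl !mulmxK.
have H1 : (leb (psi @` A) <= (\prod_(i < n.+1) (3 / 2 : R))%:E * leb A)%E.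
  apply: leb_rV_seq_lipschitz => // m x y Ax Ay psixy xy.
  (* Earlier coordinates of [psi] agree, so there the difference of [x] and [y] is pure
     perturbation; later coordinates of [x] and [y] agree. *)
  have hx (j : 'I_n.+1) : j != m -> `|(x - y) 0 j| <= 2^-1 * `|x - y|.
    rewrite -val_eqE neq_ltn => /orP[jm|mj].
      rewrite -[leLHS]normrN; apply: le_trans (Hpsi _ _ Ax Ay).
      apply: le_trans (rV_coord_le _ j).
      rewrite (_ : (psi x - psi y - (x - y)) 0 j =
        psi x 0 j - psi y 0 j - (x - y) 0 j); last by rewrite !mxE.
      by rewrite psixy// subrr sub0r.
    by rewrite !mxE xy// subrr normr0 mulr_ge0.
  (* All other coordinates being at most half the norm, the norm is attained at [m]. *)
  have hm : `|x - y| <= `|x 0 m - y 0 m|.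
    have : `|x - y| <= Num.max `|x 0 m - y 0 m| (2^-1 * `|x - y|).
      apply: rV_norm_le => [|j]; first by rewrite le_max normr_ge0.
      have [->|jm] := eqVneq j m; first by rewrite !mxE le_max lexx.
      by rewrite le_max hx// orbT.
    rewrite le_max => /orP[//|]; rewrite -subr_le0.
    rewrite (_ : _ - _ = 2^-1 * `|x - y|); last by field.
    by rewrite pmulr_rle0// => /le_trans; apply.
  rewrite (_ : psi x 0 m - psi y 0 m =
    (psi x - psi y - (x - y)) 0 m + (x 0 m - y 0 m)); last by rewrite !mxE; ring.
  rewrite (le_trans (ler_normD _ _))// (_ : 3 / 2 * _ = 2^-1 * `|x 0 m - y 0 m| +
    `|x 0 m - y 0 m|); last by field.
  rewrite lerD2r (le_trans (rV_coord_le _ m))// (le_trans (Hpsi _ _ Ax Ay))//.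
  by rewrite ler_pM2l.
have sP : sigma_compact (psi @` A).
  by apply: sigma_compact_image sA; exact: within_coord_continuous.
have -> : Phi @` A = (fun x : V => x *m T) @` (psi @` A).
  by rewrite image_comp; apply: eq_imagel => x _; rewrite /= /psi mulmxKV.
apply: le_trans (det_bounded_unit dT sP) _.
rewrite EFinM -muleA; apply: lee_wpmul2l; first by rewrite lee_fin.
by move: H1; rewrite prodr_const card_ord.
Qed.

Lemma continuous_at_measurable d (A : set 'rV[R]_d) (w : 'rV[R]_d -> R) :
  measurable (A : set (borel_rV R d)) -> (forall x, A x -> {for x, continuous w}) ->
  measurable_fun (A : set (borel_rV R d)) w.
Proof.
move=> mA cw; apply: (measurability _ (measurable_realfun.RGenOpens.measurableE R)).
move=> _ [_ [a [b ->]] <-].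
set I := [set` _].
have oI : open I by exact: interval_open.
rewrite (_ : A `&` w @^-1` I = A `&` interior (w @^-1` I)).
  by apply: measurableI => //; apply: open_borel; exact: open_interior.
apply/seteqP; split => x [Ax Ix]; split => //; last exact: interior_subset.
by apply: (cw x Ax); apply: open_nbhs_nbhs; split.
Qed.

Lemma integral_rV_indic d (A : set 'rV[R]_d) (w : 'rV[R]_d -> R) :
  measurable (A : set (borel_rV R d)) ->
  measurable_fun (A : set (borel_rV R d)) w ->
  (forall x, A x -> 0 <= w x) ->
  (integral_rV (fun y => (\1_A y * w y)%:E) = \int[leb_rV R d]_(y in A) (w y)%:E)%E.
Proof.
move=> mA mw w0.
have E : (fun y => (\1_A y * w y)%:E) = (EFin \o w) \_ A.
  apply/funext => y; rewrite /patch indicE /=.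
  by case: (y \in A); rewrite ?mul1r ?mul0r.
rewrite E integral_mkcond integral_leb_rV//.
  by apply/(measurable_restrictT _ mA); exact/measurable_EFinP.
move=> x; rewrite /patch; case: ifPn => //; rewrite inE => Ax.
by rewrite lee_fin w0.
Qed.

(** A factor 3/2 for each coordinate, and twice a factor 2 for the variation of the two weights over
    a small set. *)
Definition cov_cst : R := 4 * (3 / 2) ^+ n.+1.

Lemma cov_cst_gt0 : 0 < cov_cst.
Proof. by rewrite mulr_gt0// exprn_gt0// divr_gt0. Qed.

Section Statement.
Variables (W : set V) (Phi : V -> V) (wj wk : V -> R).
Hypothesis oW : open W.
Hypothesis PhiC1 : forall j, Ck 1 W (fun y => Phi y 0 j).
Hypothesis Phi_inj : forall x y, W x -> W y -> Phi x = Phi y -> x = y.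
Hypothesis wk_gt0 : forall x, W x -> 0 < wk x.
Hypothesis wk_cont : forall x, W x -> {for x, continuous wk}.
Hypothesis wj_cont : forall x, W x -> {for (Phi x), continuous wj}.
Hypothesis wkE : forall x, W x ->
  wk x = `|\det (\matrix_(i, j) 'D_(e i) (fun y => Phi y 0 j) x)| * wj (Phi x).

Let J x : 'M[R]_n.+1 := \matrix_(i, j) 'D_(e i) (fun y => Phi y 0 j) x.

Let dJ x : W x -> \det (J x) != 0.
Proof.
by move=> Wx; have := wk_gt0 Wx; apply: contraTneq => d0;
  rewrite wkE// -/(J x) d0 normr0 mul0r ltxx.
Qed.

Let wj_gt0 x : W x -> 0 < wj (Phi x).
Proof.
move=> Wx; have := wk_gt0 Wx; rewrite wkE// -/(J x) pmulr_rgt0//.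
by rewrite normr_gt0 dJ.
Qed.

Let Phi_cont x : W x -> {for x, continuous Phi}.
Proof.
by move=> Wx; apply: rV_continuous => i; exact: Ck_cont (PhiC1 i) Wx.
Qed.

Let local_bound x : W x -> exists2 del, 0 < del & forall A : set V, sigma_compact A ->
  (forall y, A y -> `|y - x| < del) ->
  (\int[leb]_(y in Phi @` A) (wj y)%:E <=
   cov_cst%:E * \int[leb]_(y in A) (wk y)%:E)%E.
Proof.
move=> Wx; have [d0 d00 dW] := open_norm_ball oW Wx.
pose K := \sum_i \sum_j `|invmx (J x) i j|.
have K0 : 0 <= K by rewrite sumr_ge0// => i _; rewrite sumr_ge0.
(* Chosen so that [eta * K <= 1/2], as [leb_rV_strict_image] requires; the [+ 1] covers [K = 0]. *)
pose eta := (2 * (K + 1))^-1.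
have eta0 : 0 < eta by rewrite invr_gt0 mulr_gt0// ltr_wpDl.
pose d1 i := s2val (cid2 (C1_strict_differentiable oW Wx (PhiC1 i) eta0)).
have d10 i : 0 < d1 i by exact: (s2valP (cid2 (C1_strict_differentiable oW Wx (PhiC1 i) eta0))).
have d1P i := s2valP' (cid2 (C1_strict_differentiable oW Wx (PhiC1 i) eta0)).
have wkx2 : 0 < wk x / 2 by rewrite divr_gt0// wk_gt0.
have [d2 d20 d2P] := (norm_continuousP _ _).1 (wk_cont Wx) _ wkx2.
have wjPhi : {for x, continuous (wj \o Phi)}.
  by apply: continuous_comp; [exact: Phi_cont|exact: wj_cont].
have [d3 d30 d3P] := (norm_continuousP _ _).1 wjPhi _ (wj_gt0 Wx).
(* Within [del] of [x] the point lies in [W], [wk] is at least half and [wj \o Phi] at most twice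
   its value at [x], and every component of [Phi] is linear up to [eta]. *)
pose del := Num.min (Num.min d0 d2) (Num.min d3 (\big[Num.min/d0]_i d1 i)).
have del_d0 : del <= d0 by rewrite /del !ge_min lexx.
have del_d2 : del <= d2 by rewrite /del !ge_min lexx orbT.
have del_d3 : del <= d3 by rewrite /del !ge_min lexx !orbT.
have del_d1 i : del <= d1 i.
  by rewrite /del !ge_min; apply/orP; right; apply/orP; right; exact: bigmin_le_cond.
exists del.
  by rewrite /del !lt_min d00 d20 d30 /=; apply: lt_bigmin => // i _; exact: d10.
move=> A sA Adel.
have AW : A `<=` W by move=> y /Adel yx; apply: dW; exact: lt_le_trans yx del_d0.
have cA i : {within A, continuous (fun x => Phi x 0 i)}.
  apply: continuous_in_subspaceT => y; rewrite inE => Ay.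
  by exact: Ck_cont (PhiC1 i) (AW _ Ay).
have mA : measurable (A : set (borel_rV R n.+1)) by exact: sigma_compact_borel.
have mPA : measurable (Phi @` A : set (borel_rV R n.+1)).
  by apply: sigma_compact_borel; apply: sigma_compact_image sA;
    exact: within_coord_continuous.
have wk2 y : A y -> wk x / 2 <= wk y.
  move=> Ay; have /ltr_distlCBl := d2P y (lt_le_trans (Adel _ Ay) del_d2).
  by rewrite {1}(splitr (wk x)) addrK => /ltW.
have wj2 y : A y -> wj (Phi y) <= 2 * wj (Phi x).
  move=> Ay; have /ltr_distlDr := d3P y (lt_le_trans (Adel _ Ay) del_d3).
  by rewrite mulr_natl mulr2n => /ltW.
have wj0 y : A y -> 0 <= wj (Phi y) by move=> /AW Wy; rewrite ltW// wj_gt0.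
have S1 : (leb (Phi @` A) <= (`|\det (J x)| * (3 / 2) ^+ n.+1)%:E * leb A)%E.
  apply: leb_rV_strict_image => //; first exact: dJ.
  move=> y z Ay Az; rewrite -/K.
  have H : `|Phi y - Phi z - (y - z) *m J x| <= eta * `|y - z|.
    apply: rV_norm_le => [|j]; first by rewrite mulr_ge0// ltW.
    have := d1P j y z (lt_le_trans (Adel _ Ay) (del_d1 j))
      (lt_le_trans (Adel _ Az) (del_d1 j)).
    by rewrite !mxE; under eq_bigr do rewrite !mxE; under [in X in _ -> X]eq_bigr do rewrite !mxE.
  rewrite (le_trans (ler_wpM2r K0 H))// mulrAC ler_wpM2r//.
  rewrite /eta invfM -mulrA ler_piMr// mulrC ler_pdivrMr ?mul1r ?lerDl//.
  by rewrite ltr_wpDl.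
have mwj : measurable_fun (Phi @` A : set (borel_rV R n.+1)) wj.
  by apply: continuous_at_measurable => // _ [y Ay <-]; apply: wj_cont; exact: AW.
have mwk : measurable_fun (A : set (borel_rV R n.+1)) wk.
  by apply: continuous_at_measurable => // y Ay; apply: wk_cont; exact: AW.
apply: (@le_trans _ _ ((2 * wj (Phi x))%:E * leb (Phi @` A))%E).
  rewrite -integral_cst//; apply: ge0_le_integral => //.
  - by move=> _ [y Ay <-]; rewrite lee_fin wj0.
  - exact/measurable_EFinP.
  - by move=> _ [y Ay <-]; rewrite lee_fin wj2.
have wjx := wj_gt0 Wx.
apply: (@le_trans _ _ ((2 * wj (Phi x))%:E *
    ((`|\det (J x)| * (3 / 2) ^+ n.+1)%:E * leb A))%E).
  by apply: lee_wpmul2l => //; rewrite lee_fin mulr_ge0// ltW.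
rewrite muleA -EFinM (_ : 2 * wj (Phi x) * (`|\det (J x)| * (3 / 2) ^+ n.+1) =
    cov_cst * (wk x / 2)); last first.
  by rewrite /cov_cst wkE// -/(J x); set t := _ ^+ _; field.
rewrite EFinM -muleA; apply: lee_wpmul2l; first by rewrite lee_fin ltW// cov_cst_gt0.
rewrite -integral_cst//; apply: ge0_le_integral => //.
- by move=> y _; rewrite lee_fin ltW.
- exact/measurable_EFinP.
Qed.

(** [A] is cut along countably many small boxes made disjoint; injectivity keeps the images
    disjoint, so the local bounds add up. *)
Lemma change_of_variables_le A : A `<=` W -> sigma_compact A ->
  (\int[leb]_(y in Phi @` A) (wj y)%:E <=
   cov_cst%:E * \int[leb]_(y in A) (wk y)%:E)%E.
Proof.
move=> AW sA.
have [del Hdel] : exists del : V -> R, forall x, W x -> 0 < del x /\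
    forall A : set V, sigma_compact A -> (forall y, A y -> `|y - x| < del x) ->
    (\int[leb]_(y in Phi @` A) (wj y)%:E <=
     cov_cst%:E * \int[leb]_(y in A) (wk y)%:E)%E.
  have H x : exists d, W x -> 0 < d /\
      forall A : set V, sigma_compact A -> (forall y, A y -> `|y - x| < d) ->
      (\int[leb]_(y in Phi @` A) (wj y)%:E <=
       cov_cst%:E * \int[leb]_(y in A) (wk y)%:E)%E.
    have [Wx|nWx] := pselect (W x); last by exists 0.
    by have [d d0 dP] := local_bound Wx; exists d.
  by have [f Hf] := boolp.choice H; exists f.
have [|B [cB _ Bdel WB]] := @rV_countable_cover R n.+1 W del.
  by move=> x /Hdel[].
pose D i := A `&` seqDU B i.
have clB i : closed (B i) by apply: compact_closed => //; exact: rV_hausdorff.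
have sD i : sigma_compact (D i).
  rewrite /D /seqDU setDE; apply: (sigma_compactI (@rV_hausdorff R n.+1)) => //.
  apply: (sigma_compactI (@rV_hausdorff R n.+1)).
    exact: compact_sigma_compact.
  apply: open_sigma_compact; apply: closed_openC.
  by apply: closed_bigsetU => k _.
have AD : A = \bigcup_i D i.
  rewrite -setI_bigcupr -seqDU_bigcup_eq; apply/esym/setIidPl.
  exact: subset_trans AW WB.
have DA i : D i `<=` A by move=> x [].
have tD : trivIset setT D.
  by apply: trivIset_setIl; exact: trivIset_seqDU.
have mD i : measurable (D i : set (borel_rV R n.+1)) by exact: sigma_compact_borel.
have cPhi i : {within D i, continuous Phi}.
  apply: continuous_in_subspaceT => y; rewrite inE => Dy.
  by apply: Phi_cont; apply: AW; exact: DA Dy.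
have mPD i : measurable (Phi @` D i : set (borel_rV R n.+1)).
  by apply: sigma_compact_borel; exact: sigma_compact_image.
have tPD : trivIset setT (fun i => Phi @` D i).
  apply/trivIsetP => i j _ _ ij; apply/seteqP; split => // _ [[y Dy <-] [z Dz zy]].
  have yz : z = y.
    by apply: Phi_inj zy; apply: AW; [exact: DA Dz|exact: DA Dy].
  move/trivIsetP : tD => /(_ i j Logic.I Logic.I ij) /seteqP[H _].
  by apply: (H y); split => //; rewrite -yz.
have mwj : measurable_fun (\bigcup_i (Phi @` D i) : set (borel_rV R n.+1)) wj.
  apply: continuous_at_measurable; first exact: bigcupT_measurable.
  by move=> _ [i _ [y Dy <-]]; apply: wj_cont; apply: AW; exact: DA Dy.
have mwk : measurable_fun (\bigcup_i D i : set (borel_rV R n.+1)) wk.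
  apply: continuous_at_measurable; first exact: bigcupT_measurable.
  by move=> y [i _ Dy]; apply: wk_cont; apply: AW; exact: DA Dy.
rewrite {2}AD {1}AD image_bigcup.
rewrite ge0_integral_bigcup//; last 2 first.
- exact/measurable_EFinP.
- by move=> _ [i _ [y Dy <-]]; rewrite lee_fin ltW// wj_gt0//; apply: AW; exact: DA Dy.
rewrite ge0_integral_bigcup//; last 2 first.
- exact/measurable_EFinP.
- by move=> y [i _ Dy]; rewrite lee_fin ltW// wk_gt0//; apply: AW; exact: DA Dy.
rewrite -nneseriesZl; last first.
  move=> i _; apply: integral_ge0 => y Dy; rewrite lee_fin ltW// wk_gt0//.
  by apply: AW; exact: DA Dy.
apply: lee_nneseries => [i _ _|i _].
  apply: integral_ge0 => _ [y Dy <-]; rewrite lee_fin ltW// wj_gt0//.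
  by apply: AW; exact: DA Dy.
have [[z Dz]|/set0P/negP/negPn/eqP D0] := pselect (D i !=set0); last first.
  by rewrite D0 image_set0 !integral_set0 mule0.
have [|x Wx xP] := Bdel i.
  by exists z; case: Dz => _ [].
apply: (Hdel x Wx).2 => // y [_ [By _]]; exact: xP.
Qed.

End Statement.
End ChangeOfVariables.

(** * Charts *)

Section MatrixContinuity.
Variable R : realType.

Lemma cvg_prod_ord (T : Type) (F : set_system T) (FF : Filter F) (I : finType)
    (f : I -> T -> R) (a : I -> R) :
  (forall i, f i @ F --> a i) -> (fun x => \prod_i f i x) @ F --> \prod_i a i.
Proof.
move=> fa; elim: (index_enum I) => [|i s IH].
  rewrite big_nil (_ : (fun _ => _) = cst 1); first exact: cvg_cst.
  by apply/funext => x; rewrite big_nil.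
rewrite big_cons (_ : (fun _ => _) = f i \* (fun x => \prod_(j <- s) f j x)).
  by apply: cvgM; [exact: fa|exact: IH].
by apply/funext => x; rewrite big_cons.
Qed.

Lemma cvg_det (T : Type) (F : set_system T) (FF : Filter F) d
    (M : T -> 'M[R]_d) (M0 : 'M[R]_d) :
  (forall i j, (fun y => M y i j) @ F --> M0 i j) ->
  (fun y => \det (M y)) @ F --> \det M0.
Proof.
move=> cM; apply: (@cvg_sum_ord R T F FF {perm 'I_d}
  (fun s y => (-1) ^+ s * \prod_i M y i (s i))
  (fun s => (-1) ^+ s * \prod_i M0 i (s i))) => s.
apply: cvgM; first exact: cvg_cst.
by apply: (@cvg_prod_ord T F FF 'I_d (fun i y => M y i (s i)) (fun i => M0 i (s i))).
Qed.

Lemma cvg_invmx (T : Type) (F : set_system T) (FF : Filter F) d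
    (M : T -> 'M[R]_d) (M0 : 'M[R]_d) i j : \det M0 != 0 ->
  (forall i j, (fun y => M y i j) @ F --> M0 i j) ->
  (fun y => invmx (M y) i j) @ F --> invmx M0 i j.
Proof.
move=> d0 cM; have cdet := cvg_det FF cM.
have iE (N : 'M[R]_d) : \det N != 0 -> invmx N i j =
    (\det N)^-1 * ((-1) ^+ (j + i) * \det (row' j (col' i N))).
  by move=> dN; rewrite /invmx unitmxE unitfE dN !mxE.
have nz : \forall y \near F, \det (M y) != 0.
  exact: cvgr_neq0 cdet d0.
have E : \forall y \near F, (\det (M y))^-1 *
    ((-1) ^+ (j + i) * \det (row' j (col' i (M y)))) = invmx (M y) i j.
  by apply: filterS nz => y /iE ->.
apply: cvg_trans (near_eq_cvg E) _; rewrite iE//.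
apply: cvgM; first exact: cvgV.
apply: cvgM; first exact: cvg_cst.
apply: cvg_det => a b; rewrite !mxE.
rewrite (_ : (fun y => _) = fun y => M y (lift j a) (lift i b)); first exact: cM.
by apply/funext => y; rewrite !mxE.
Qed.

Definition posdef d (M : 'M[R]_d) := forall v : 'rV_d, v != 0 -> 0 < (v *m M *m v^T) 0 0.

(** Every matrix on the segment from the identity to [M] is positive definite, hence invertible. The
    determinant along it is a polynomial in the parameter that starts at 1 and has no zero, so it
    stays positive. *)
Lemma posdef_det_gt0 d (M : 'M[R]_d) : posdef M -> 0 < \det M.
Proof.
move=> pM; pose N : 'M[{poly R}]_d := \matrix_(i, j) ((1 - 'X) * (i == j)%:R + 'X * (M i j)%:P).
have NE (t : R) : (\det N).[t] = \det ((1 - t) *: 1%:M + t *: M).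
  rewrite -horner_evalE -det_map_mx; congr (\det _).
  apply/matrixP => i j; transitivity (N i j).[t]; first by rewrite mxE.
  by rewrite !mxE; case: (i == j); rewrite !hornerE.
have nz (t : R) : 0 <= t <= 1 -> \det ((1 - t) *: 1%:M + t *: M) != 0.
  move=> /andP[t0 t1]; set A := _ + _.
  apply/negP => /eqP dA.
  have [v v0 vA] : exists2 v : 'rV_d, v != 0 & v *m A = 0 by apply/det0P; rewrite dA.
  have : (v *m A *m v^T) 0 0 = 0 by rewrite vA mul0mx mxE.
  rewrite /A mulmxDr mulmxDl -!scalemxAr -!scalemxAl mulmx1 mxE [X in X + _]mxE [X in _ + X]mxE.
  have vv : 0 < (v *m v^T) 0 0.
    rewrite mxE lt_def psumr_eq0 ?sumr_ge0 ?andbT; last 2 first.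
    - by move=> i _; rewrite mxE -expr2 sqr_ge0.
    - by move=> i _; rewrite mxE -expr2 sqr_ge0.
    apply: contra v0 => /allP H; apply/eqP/rowP => i; rewrite mxE.
    have := H i; rewrite mem_index_enum => /(_ isT)/=.
    by rewrite mxE -expr2 sqrf_eq0 => /eqP.
  have vM := pM _ v0; move: t0; rewrite le_eqVlt => /predU1P[<-|t0].
    by rewrite subr0 mul1r mul0r addr0 => vv0; rewrite vv0 ltxx in vv.
  move=> H; have : 0 < (1 - t) * (v *m v^T) 0 0 + t * (v *m M *m v^T) 0 0.
    by rewrite ltr_wpDl ?mulr_gt0// mulr_ge0 ?subr_ge0// ltW.
  by rewrite H ltxx.
have N0 : (\det N).[0] = 1 by rewrite NE subr0 scale1r scale0r addr0 det1.
have N1 : (\det N).[1] = \det M by rewrite NE subrr scale0r add0r scale1r.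
rewrite ltNge; apply/negP => dM.
have [|t t01] := @poly_ivt R (- \det N) 0 1 ler01.
  by rewrite !hornerN N0 N1 oppr_ge0 dM lerN10.
rewrite rootN => /rootP; rewrite NE => dt.
by have := nz t; rewrite dt eqxx => /(_ t01).
Qed.

End MatrixContinuity.

(** * Locality of regularity, and one-sided derivatives *)

Section CkLocal.
Variables (R : realType) (n : nat).
Local Notation V := 'rV[R]_n.+1.
Local Notation e i := (@basis_vec R n i).

Lemma Ck_local k (U : set V) f :
  (forall x, U x -> exists U' : set V, [/\ U' x, open U' & Ck k U' f]) -> Ck k U f.
Proof.
elim: k f => [|k IH] f H.
  split => // x Ux; have [U' [U'x _ H']] := H x Ux; exact: Ck_cont H' U'x.
split=> [x Ux|i].
  by have [U' [U'x _ H']] := H x Ux; exact: Ck_cont H' U'x.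
split=> [x Ux|]; first by have [U' [U'x _ [_ H']]] := H x Ux; exact: (H' i).1.
apply: IH => x Ux; have [U' [U'x oU' [_ H']]] := H x Ux.
by exists U'; split => //; exact: (H' i).2.
Qed.

Lemma smooth_within_Ck k (W W' : set V) f : open W' -> W' `<=` W ->
  smooth_within W f -> Ck k W' f.
Proof.
move=> oW WW H; apply: Ck_local => x W'x.
have [U [F [oU Ux cF fF]]] := H x (WW _ W'x).
exists (U `&` W'); split=> //; first exact: openI.
apply: (@Ck_near _ _ _ _ F) => [|y [Uy Wy]|]; first exact: openI.
  by rewrite fF//; exact: WW.
by apply: (@Ck_sub _ _ k U) => [y []//|]; apply/Ck_onP; exact: cF.
Qed.

(** [rpartial] sees only the ray from [x] in direction [e i], so any extension that agrees with [f]
    there computes it. *)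
Lemma rpartial_derive i f (F : V -> R) x : derivable F x (e i) -> f x = F x ->
  (\forall h \near (0 : R)^'+, f (x + h *: e i) = F (x + h *: e i)) ->
  rpartial i f x = 'D_(e i) F x.
Proof.
move=> dF fx fF; rewrite /rpartial /derive.
have cF : (fun h : R => h^-1 * (F (x + h *: e i) - F x)) @ 0^' --> 'D_(e i) F x.
  have := dF; rewrite /derivable => /cvg_ex[l Hl].
  have -> : 'D_(e i) F x = l by apply/cvg_lim.
  rewrite (_ : (fun h : R => _) =
    fun h : R => h^-1 *: ((F \o shift x) (h *: e i) - F x))//.
  by apply/funext => h; rewrite /= [h *: e i + x]addrC.
have cF' : (fun h : R => h^-1 * (f (x + h *: e i) - f x)) @ 0^'+ --> 'D_(e i) F x.
  apply: cvg_trans (cvg_dnbhs_at_right cF); apply: near_eq_cvg.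
  by apply: filterS fF => h ->; rewrite fx.
exact/cvg_lim.
Qed.

Lemma rpartialE i (F : V -> R) x : derivable F x (e i) ->
  rpartial i F x = 'D_(e i) F x.
Proof. by move=> dF; apply: rpartial_derive => //; near=> h. Unshelve. all: by end_near. Qed.

End CkLocal.

(** * Transition maps and volume densities *)

Section Charts.
Variables (R : realType) (n : nat) (X : charted_space R n).
Hypothesis X_mf : smooth_manifold X.
Local Notation V := 'rV[R]_n.+1.
Local Notation e i := (@basis_vec R n i).
Implicit Types (k l : nat).

(** Coordinates of the interior points: off the face, a relatively open subset of the half-space is
    open in [R^(n+1)], where ordinary derivatives apply. *)
Definition icod k : set V := cod X k `&` @upper_half_space R n.

Lemma psi_dom k y : cod X k y -> dom X k (psi X k y).
Proof. by move=> [x dx <-]; rewrite (mf_phiK X_mf). Qed.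

Lemma psiK k y : cod X k y -> phi X k (psi X k y) = y.
Proof. by move=> [x dx <-]; rewrite (mf_phiK X_mf). Qed.

Lemma cod_phi k x : dom X k x -> cod X k (phi X k x).
Proof. by move=> dx; exists x. Qed.

Lemma cod_ge0 k y : cod X k y -> 0 <= y 0 ord_max.
Proof. by have [U _ ->] := mf_cod_open X_mf k; case. Qed.

Lemma upper_half_space_open : open (@upper_half_space R n).
Proof.
apply: (@open_comp _ _ (fun y : V => y 0 ord_max) [set t | 0 < t]).
  by move=> y _; exact: coord_continuous.
exact: open_gt.
Qed.

Lemma icod_open k : open (icod k).
Proof.
have [U oU cU] := mf_cod_open X_mf k.
rewrite (_ : icod k = U `&` @upper_half_space R n).
  by apply: openI => //; exact: upper_half_space_open.
rewrite /icod cU; apply/seteqP; split => y [].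
  by move=> [Uy _] uy; split.
by move=> Uy uy; split => //; split => //; exact: ltW.
Qed.

Lemma phi_cont k (x : X) : dom X k x -> {for x, continuous (phi X k)}.
Proof.
have : {within dom X k, continuous (phi X k)} by exact: mf_phi_cont.
rewrite continuous_open_subspace; last exact: mf_dom_open.
by move=> H dx; apply: H; rewrite inE.
Qed.

Lemma psi_cont k (y : V) : icod k y -> {for y, continuous (psi X k)}.
Proof.
have : {within icod k, continuous (psi X k)}.
  have H : {within cod X k, continuous (psi X k)} by exact: mf_psi_cont.
  by apply: continuous_subspaceW H; exact: subIsetl.
rewrite continuous_open_subspace; last exact: icod_open.
by move=> H dy; apply: H; rewrite inE.
Qed.

Definition trans_dom k l : set V := icod k `&` psi X k @^-1` dom X l.

Lemma trans_dom_open k l : open (trans_dom k l).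
Proof.
rewrite openE => y [iy dy]; apply: (@filterI V (nbhs y)).
  by apply: open_nbhs_nbhs; split => //; exact: icod_open.
by apply: (psi_cont iy); apply: open_nbhs_nbhs; split => //; exact: mf_dom_open.
Qed.

Lemma trans_Ck m k l j : Ck m (trans_dom k l) (fun y => phi X l (psi X k y) 0 j).
Proof.
apply: (@smooth_within_Ck _ _ _ (cod X k `&` psi X k @^-1` dom X l)).
- exact: trans_dom_open.
- by move=> y [[cy _] dy].
- exact: mf_transition.
Qed.

Lemma jac_derive k l y : trans_dom k l y -> jac k l (psi X k y) =
  \matrix_(i, j) 'D_(e i) (fun y => phi X l (psi X k y) 0 j) y.
Proof.
move=> ty; apply/matrixP => i j; rewrite !mxE psiK; last by case: ty => [[]].
apply: rpartialE; have [_ H] := @trans_Ck 1 k l j.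
exact: (H i).1.
Qed.

(** [mboundary] asks for one chart that sends the point to the face; this is the statement for every
    chart. [defining_boundary] derives it from a defining function, and for hyperbolic space it is
    vacuous. *)
Hypothesis bdry : forall k x, dom X k x -> mboundary x -> phi X k x 0 ord_max = 0.

Lemma icod_phi k x : dom X k x -> icod k (phi X k x) <-> minterior x.
Proof.
move=> dx; split=> [[_ px] bx|ix].
  by move: px; rewrite /upper_half_space/= (bdry dx bx) ltxx.
split; first exact: cod_phi.
rewrite /upper_half_space/= lt_def (cod_ge0 (cod_phi dx)) andbT.
by apply/eqP => p0; apply: ix; exists k.
Qed.

Lemma icod_psi k y : icod k y -> minterior (psi X k y).
Proof.
by move=> iy; case: (iy) => cy _; apply/(icod_phi (psi_dom cy)); rewrite psiK.
Qed.

Variable g : metric_field X.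
Hypothesis g_metric : riemannian_metric (@minterior R n X) g.
Hypothesis g_cont : forall k y, icod k y -> forall i j,
  {for y, continuous (fun y => g k (psi X k y) i j)}.

Definition vdens k y : R := Num.sqrt (\det (g k (psi X k y))).

Lemma g_posdef k x : minterior x -> dom X k x -> posdef (g k x).
Proof. by move=> ix dx; have [] := g_metric ix dx. Qed.

Lemma vdens_gt0 k y : icod k y -> 0 < vdens k y.
Proof.
move=> iy; rewrite sqrtr_gt0; apply: posdef_det_gt0; apply: g_posdef.
  exact: icod_psi.
by apply: psi_dom; case: iy.
Qed.

Lemma vdens_cont k y : icod k y -> {for y, continuous (vdens k)}.
Proof.
move=> iy; apply: (@continuous_comp V R R (fun y => \det (g k (psi X k y))) Num.sqrt).
  by apply: (@cvg_det R V (nbhs y)) => i j; exact: g_cont.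
exact: sqrt_continuous.
Qed.

Lemma vdens_trans k l y : trans_dom k l y ->
  vdens k y = `|\det (jac k l (psi X k y))| * vdens l (phi X l (psi X k y)).
Proof.
move=> [iy dy]; rewrite /vdens (mf_phiK X_mf)//.
have [_ _ H] := g_metric (icod_psi iy) (psi_dom iy.1).
rewrite (H l)// !det_mulmx det_tr mulrAC -expr2 sqrtrM ?sqr_ge0// sqrtr_sqr//.
Qed.

Variable h : X -> R.
Hypothesis h_gt0 : forall x, minterior x -> 0 < h x.
Hypothesis h_cont : forall x, minterior x -> {for x, continuous h}.

Definition chart_density k y : R := h (psi X k y) * vdens k y.

Lemma chart_density_gt0 k y : icod k y -> 0 < chart_density k y.
Proof. by move=> iy; rewrite mulr_gt0 ?vdens_gt0// h_gt0//; exact: icod_psi. Qed.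

Lemma chart_density_cont k y : icod k y -> {for y, continuous (chart_density k)}.
Proof.
move=> iy; apply: continuousM; last exact: vdens_cont.
by apply: continuous_comp; [exact: psi_cont|apply: h_cont; exact: icod_psi].
Qed.

Lemma trans_icod k l y : trans_dom k l y -> icod l (phi X l (psi X k y)).
Proof. by move=> [iy dy]; apply/(icod_phi dy); exact: icod_psi. Qed.

Lemma chart_integral_le k l (A : set V) : A `<=` trans_dom k l -> sigma_compact A ->
  (\int[leb_rV R n.+1]_(y in (phi X l \o psi X k) @` A) (chart_density l y)%:E <=
   (cov_cst R n)%:E * \int[leb_rV R n.+1]_(y in A) (chart_density k y)%:E)%E.
Proof.
move=> AW sA; apply: (@change_of_variables_le _ _ (trans_dom k l)) => //.
- exact: trans_dom_open.
- by move=> j; exact: trans_Ck.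
- move=> x y [ix dx] [iy dy] /= xy.
  rewrite -(psiK ix.1) -(psiK iy.1); congr phi.
  by rewrite -[LHS](mf_phiK X_mf dx) -[RHS](mf_phiK X_mf dy) xy.
- by move=> x [ix _]; exact: chart_density_gt0.
- by move=> x [ix _]; exact: chart_density_cont.
- by move=> x tx; apply: chart_density_cont; exact: trans_icod.
- move=> x tx; rewrite /chart_density (vdens_trans tx) -(jac_derive tx) /=.
  have [_ dx] := tx; rewrite (mf_phiK X_mf dx).
  exact: mulrCA.
Qed.

(** Read in chart [k], a piece is an open set minus a finite union of open sets, that is, an open
    set intersected with a closed one. *)
Lemma piece_sigma_compact k (S : set V) j : S `<=` icod k -> sigma_compact S ->
  sigma_compact (S `&` psi X k @^-1` (piece j)).
Proof.
move=> Si sS.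
have -> : S `&` psi X k @^-1` (piece j) = S `&` (trans_dom k j `\` \bigcup_(i in `I_j) trans_dom k i).
  apply/seteqP; split => y [Sy].
    move=> [dy ny]; split => //; split; first by split => //; exact: Si.
    by move=> [i ij [_ di]]; apply: ny; exists i.
  move=> [[iy dy] ny]; split => //; split => // -[i ij di].
  by apply: ny; exists i => //; split.
rewrite setDE setIA; apply: (sigma_compactI (@rV_hausdorff R n.+1)).
  apply: (sigma_compactI (@rV_hausdorff R n.+1)) => //.
  by apply: open_sigma_compact; exact: trans_dom_open.
apply: closed_sigma_compact; apply: open_closedC.
by apply: bigcup_open => i _; exact: trans_dom_open.
Qed.

Lemma piece_trivIset : trivIset setT (@piece R n X).
Proof.
apply/trivIsetP => i j _ _ ij; apply/seteqP; split => // x [[di ni] [dj nj]].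
move: ij; rewrite neq_ltn => /orP[ij|ji].
  by apply: nj; exists i.
by apply: ni; exists j.
Qed.

Lemma piece_cover (x : X) : exists j, piece j x.
Proof.
have [k dk] := mf_cover X_mf x.
have ex : exists k, `[< dom X k x >] by exists k; apply/asboolP.
exists (ex_minn ex); case: ex_minnP => m /asboolP dm mmin; split => //.
by move=> [i /= im /asboolP/mmin]; rewrite leqNgt im.
Qed.

(** [vol_integral] spreads an image of chart [k] over the pieces of the atlas, each in its own
    chart. The transition maps bring every piece back to chart [k], and the disjoint parts recombine
    there. *)
Lemma vol_integral_chart k (S : set V) : S `<=` icod k -> sigma_compact S ->
  (vol_integral g (psi X k @` S) h <=
     (cov_cst R n)%:E * \int[leb_rV R n.+1]_(y in S) (chart_density k y)%:E)%E /\
  (\int[leb_rV R n.+1]_(y in S) (chart_density k y)%:E <=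
     (cov_cst R n)%:E * vol_integral g (psi X k @` S) h)%E.
Proof.
move=> Si sS.
pose D j := S `&` psi X k @^-1` (piece j).
have sD j : sigma_compact (D j) by exact: piece_sigma_compact.
have DW j : D j `<=` trans_dom k j by move=> y [Sy [dy _]]; split => //; exact: Si.
have SD : S = \bigcup_j D j.
  apply/seteqP; split => [y Sy|y [j _ []//]].
  by have [j pj] := piece_cover (psi X k y); exists j.
have tD : trivIset setT D.
  apply/trivIsetP => i j _ _ ij; apply/seteqP; split => // y [[_ pi] [_ pj]].
  by move/trivIsetP : piece_trivIset => /(_ i j Logic.I Logic.I ij)/seteqP[H _]; exact: (H (psi X k y)).
pose E j := (phi X j \o psi X k) @` D j.
have EE j : phi X j @` (psi X k @` S `&` piece j) = E j.
  apply/seteqP; split => y.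
    by move=> [_ [[z Sz <-] pz] <-]; exists z => //; split.
  by move=> [z [Sz pz] <-]; exists (psi X k z) => //; split => //; exists z.
have sE j : sigma_compact (E j).
  apply: sigma_compact_image (sD j).
  apply: continuous_in_subspaceT => y; rewrite inE => Dy.
  have [iy dy] := DW _ _ Dy.
  by apply: continuous_comp; [exact: psi_cont|exact: phi_cont].
have Ei j : E j `<=` icod j by move=> _ [y Dy <-]; exact: trans_icod (DW _ _ Dy).
have mE j := sigma_compact_borel (sE j).
have mD j := sigma_compact_borel (sD j).
have dE j (B : set V) : measurable (B : set (borel_rV R n.+1)) -> B `<=` icod j ->
    measurable_fun (B : set (borel_rV R n.+1)) (chart_density j).
  move=> mB Bj; apply: continuous_at_measurable => // y By.
  by apply: chart_density_cont; exact: Bj.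
have volE : vol_integral g (psi X k @` S) h =
    (\sum_(0 <= j <oo) \int[leb_rV R n.+1]_(y in E j) (chart_density j y)%:E)%E.
  apply: eq_eseriesr => j _; rewrite EE integral_rV_indic//.
    by apply: dE => //; exact: Ei.
  by move=> y Ey; rewrite ltW// chart_density_gt0//; exact: Ei Ey.
have intE : (\int[leb_rV R n.+1]_(y in S) (chart_density k y)%:E =
    \sum_(0 <= j <oo) \int[leb_rV R n.+1]_(y in D j) (chart_density k y)%:E)%E.
  rewrite {1}SD ge0_integral_bigcup//.
    apply/measurable_EFinP; apply: dE; first exact: bigcupT_measurable.
    by rewrite -SD.
  by rewrite -SD => y Sy; rewrite lee_fin ltW// chart_density_gt0//; exact: Si.
have posE j : (0 <= \int[leb_rV R n.+1]_(y in E j) (chart_density j y)%:E)%E.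
  by apply: integral_ge0 => y Ey; rewrite lee_fin ltW// chart_density_gt0//; exact: Ei Ey.
have posD j : (0 <= \int[leb_rV R n.+1]_(y in D j) (chart_density k y)%:E)%E.
  apply: integral_ge0 => y Dy; rewrite lee_fin ltW// chart_density_gt0//.
  by case: (DW _ _ Dy).
rewrite volE intE -!nneseriesZl//; split; apply: lee_nneseries => // j _.
  by apply: chart_integral_le => //; exact: DW.
(* For the second bound the roles of [E j] and [D j] are exchanged by the inverse transition. *)
have ED : (phi X k \o psi X j) @` E j = D j.
  apply/seteqP; split => y.
    move=> [_ [z Dz <-] <-] /=; have [iz dz] := DW _ _ Dz.
    by rewrite (mf_phiK X_mf dz) (psiK iz.1).
  move=> Dy; have [iy dy] := DW _ _ Dy; exists (phi X j (psi X k y)).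
    by exists y.
  by rewrite /= (mf_phiK X_mf dy) (psiK iy.1).
rewrite -[X in (integral _ X _ <= _)%E]ED; apply: chart_integral_le => //.
move=> _ [y Dy <-]; have tj := DW _ _ Dy; split; first exact: trans_icod.
by rewrite /preimage/= (mf_phiK X_mf tj.2); apply: psi_dom; case: tj => [[]].
Qed.

End Charts.

(** * Chart independence of gradients, and energies *)

Section Transitions.
Variables (R : realType) (n : nat) (X : charted_space R n).
Hypothesis X_mf : smooth_manifold X.
Local Notation V := 'rV[R]_n.+1.
Local Notation e i := (@basis_vec R n i).

Lemma half_space_ray (y : V) i (t : R) : half_space y -> 0 <= t ->
  half_space (y + t *: e i).
Proof.
rewrite /half_space/= => y0 t0; rewrite !mxE eqxx /=.
by rewrite addr_ge0// mulr_ge0//; case: (_ == _).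
Qed.

Lemma open_ray (U : set V) (y : V) i : open U -> U y ->
  \forall t \near (0 : R)^'+, U (y + t *: e i).
Proof.
move=> oU Uy; have [d d0 dU] := open_norm_ball oU Uy.
near=> t; apply: dU; rewrite addrAC subrr add0r.
apply: rV_norm_lt => // j; rewrite !mxE eqxx /=.
have t0 : 0 < t by near: t; exact: nbhs_right_gt.
have td : t < d by near: t; exact: nbhs_right_lt.
by case: (_ == _); rewrite ?mulr1 ?mulr0 ?normr0// gtr0_norm.
Unshelve. all: by end_near. Qed.

Definition trans_cod k l : set V := cod X k `&` psi X k @^-1` dom X l.

Lemma cod_preimage_open k (A : set X) : open A ->
  exists2 U : set V, open U & cod X k `&` psi X k @^-1` A = U `&` @half_space R n.
Proof.
move=> oA; have [U0 oU0 cU0] := mf_cod_open X_mf k.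
have c : {within cod X k, continuous (psi X k)} by exact: mf_psi_cont.
have : open (psi X k @^-1` A : set (subspace (cod X k))).
  by move/continuousP : c; exact.
move=> /open_subspaceP[U oU UE]; exists (U `&` U0); first exact: openI.
by rewrite -setIA -cU0 UE setIC.
Qed.

(** All basis vectors point into the half-space, so the one-sided difference quotients make sense at
    boundary points as well. *)
Lemma trans_cod_ray k l (y : V) i : trans_cod k l y ->
  \forall t \near (0 : R)^'+, trans_cod k l (y + t *: e i).
Proof.
move=> ty; have [U oU UE] := cod_preimage_open k (mf_dom_open X_mf l).
have := ty; rewrite /trans_cod UE => -[Uy hy]; near=> t; split.
  by near: t; exact: open_ray.
by apply: half_space_ray => //; near: t; exact: nbhs_right_ge.
Unshelve. all: by end_near. Qed.

(** At boundary points [diff_fun] is a one-sided quotient; the extension [F] turns it into a genuine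
    derivative, which varies continuously. *)
Lemma smooth_diff_fun f k y : smooth_fun f -> cod X k y ->
  exists (U : set V) (F : V -> R), [/\ open U, U y, (forall m, Ck m U F),
    (forall z, U z -> cod X k z -> f (psi X k z) = F z) &
    forall z, U z -> cod X k z -> diff_fun k f (psi X k z) = \row_i 'D_(e i) F z].
Proof.
move=> sf cy; have [U [F [oU Uy cF fF]]] := sf k y cy.
exists U, F; split => //; first by move=> m; apply/Ck_onP; exact: cF.
move=> z Uz cz; apply/rowP => i; rewrite !mxE (psiK X_mf cz).
have [_ H] := (Ck_onP _ _ _).1 (cF 1%N).
apply: rpartial_derive; [exact: (H i).1|exact: fF|].
have tz : trans_cod k k z by split => //; exact: (psi_dom X_mf).
near=> t; apply: fF.
  by near: t; exact: open_ray.
by have [] : trans_cod k k (z + t *: e i) by near: t; exact: trans_cod_ray.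
Unshelve. all: by end_near. Qed.

(** The chain rule up to the boundary. Extensions [Q j] of the components of the transition map form
    [Phi], and [F \o Phi] is differentiated in an open set; it need agree with the function in chart
    [k] only along the rays seen by [rpartial]. *)
Lemma diff_fun_trans f k l x : smooth_fun f -> dom X k x -> dom X l x ->
  diff_fun k f x = diff_fun l f x *m (jac k l x)^T.
Proof.
move=> sf dk dl; pose y := phi X k x; pose z := phi X l x.
have xy : psi X k y = x by exact: (mf_phiK X_mf dk).
have xz : psi X l z = x by exact: (mf_phiK X_mf dl).
have ty : trans_cod k l y by split; [exact: cod_phi|rewrite /preimage/= xy].
have [U [F [oU Uz cF fF dF]]] := smooth_diff_fun sf (cod_phi dl).
have H j := @mf_transition R n X X_mf k l j y ty.
have [P HP] := boolp.choice (fun j => H j).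
have [Q HQ] := boolp.choice HP.
have HC j : Ck 1 (P j) (Q j).
  by have [_ _ cQ _] := HQ j; apply/Ck_onP; exact: cQ.
have HQy j : Q j y = z 0 j.
  by have [_ Py _ <-//] := HQ j; rewrite xy.
pose Phi (v : V) : V := \row_j Q j v.
have Phiy : Phi y = z by apply/rowP => j; rewrite mxE HQy.
have jacE : jac k l x = \matrix_(i, j) 'D_(e i) (Q j) y.
  apply/matrixP => i j; rewrite !mxE.
  have [oP Py cQ QE] := HQ j; have [_ HCj] := HC j.
  apply: rpartial_derive; [exact: (HCj i).1|exact: QE|].
  near=> t; apply: QE.
    by near: t; exact: open_ray.
  by near: t; exact: trans_cod_ray.
have dPhi i j : is_derive y (e i) (fun v => Phi v 0 j) ('D_(e i) (Q j) y).
  rewrite (_ : (fun v => _) = Q j); last by apply/funext => v; rewrite mxE.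
  have [_ HCj] := HC j; apply: DeriveDef => //; apply: (HCj i).1.
  by case: (HQ j).
rewrite -{2}xz (dF _ Uz (cod_phi dl)) jacE; apply/rowP => i; rewrite !mxE.
have H1 : is_derive y (e i) (F \o Phi)
    (\sum_j (\row_j 'D_(e i) (Q j) y) 0 j * 'D_(e j) F (Phi y)).
  apply: (@C1_comp_derive R n U) => //; first by rewrite Phiy.
  by move=> j; rewrite mxE.
have [dFP <-] : is_derive y (e i) (F \o Phi)
    (\sum_j (\row_j0 'D_(e j0) F z) 0 j * (\matrix_(i0, j0) 'D_(e i0) (Q j0) y)^T j i).
  move: H1; congr is_derive; apply: eq_bigr => j _.
  by rewrite !mxE Phiy mulrC.
have near_Phi : \forall t \near (0 : R)^'+,
    Phi (y + t *: e i) = phi X l (psi X k (y + t *: e i)).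
  have : \forall t \near (0 : R)^'+, forall j, Q j (y + t *: e i) =
      phi X l (psi X k (y + t *: e i)) 0 j.
    apply: filter_forall => j; have [oP Py cQ QE] := HQ j.
    near=> t; apply/esym/QE.
      by near: t; exact: open_ray.
    by near: t; exact: trans_cod_ray.
  by apply: filterS => t Ht; apply/rowP => j; rewrite mxE Ht.
have cPhi : \forall t \near (0 : R)^'+, U (Phi (y + t *: e i)).
  have cU : {for y, continuous Phi}.
    apply: rV_continuous => j.
    rewrite (_ : (fun v => _) = Q j); last by apply/funext => v; rewrite mxE.
    by apply: Ck_cont (HC j) _; case: (HQ j).
  have [d d0 dU] : exists2 d, 0 < d & forall v, `|v - y| < d -> U (Phi v).
    have [d1 d10 d1U] := open_norm_ball oU Uz.
    have [d d0 Hd] := (norm_continuousP _ _).1 cU _ d10.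
    by exists d => // v /Hd; rewrite Phiy => /d1U.
  have oB : open [set v : V | `|v - y| < d].
    rewrite (_ : [set v | _] = ball y d); first exact: ball_open.
    by apply/seteqP; split => v; rewrite -ball_normE/= distrC.
  have := @open_ray [set v : V | `|v - y| < d] y i oB.
  by rewrite /= subrr normr0 => /(_ d0); apply: filterS => t /dU.
apply: rpartial_derive => //.
  by rewrite /= -/y xy Phiy -fF ?xz//; exact: cod_phi.
near=> t.
have tt : trans_cod k l (y + t *: e i) by near: t; exact: trans_cod_ray.
have PE : Phi (y + t *: e i) = phi X l (psi X k (y + t *: e i)) by near: t.
rewrite /= PE -fF.
- by rewrite (mf_phiK X_mf)//; case: tt.
- by rewrite -PE; near: t.
by apply: cod_phi; case: tt.
Unshelve. all: by end_near. Qed.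

Lemma covec_trans (G H J : 'M[R]_n.+1) (v w : V) : \det G != 0 ->
  G = J *m H *m J^T -> v = w *m J^T ->
  v *m invmx G *m v^T = w *m invmx H *m w^T.
Proof.
move=> dG GE vw; have : \det G = \det J * \det H * \det J.
  by rewrite GE !det_mulmx det_tr.
move=> dE; have : \det J * \det H * \det J != 0 by rewrite -dE.
rewrite !mulf_eq0 !negb_or => /andP[/andP[dJ dH] _].
have uJ : J \in unitmx by rewrite unitmxE unitfE.
have uH : H \in unitmx by rewrite unitmxE unitfE.
have uJT : J^T \in unitmx by rewrite unitmx_tr.
have -> : invmx G = invmx J^T *m invmx H *m invmx J.
  have uG : G \in unitmx by rewrite unitmxE unitfE.
  apply: (can_inj (mulKmx uG)); rewrite mulmxV// GE.
  rewrite -!mulmxA (mulmxA J^T) mulmxV// mul1mx (mulmxA H) mulmxV// mul1mx.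
  by rewrite mulmxV.
by rewrite vw trmx_mul trmxK !mulmxA mulmxK// -!mulmxA (mulmxA (invmx J)) mulVmx// mul1mx.
Qed.

Lemma chart_at_piece (x : X) : @piece R n X (chart_at x) x.
Proof.
have [k pk] := piece_cover X_mf x.
by apply: (@xgetPex nat 0%N [set k | @piece R n X k x]); exists k.
Qed.

Lemma chart_at_dom (x : X) : dom X (chart_at x) x.
Proof. by have [] := chart_at_piece x. Qed.

Lemma vec_norm_grad (G : 'M[R]_n.+1) (w : V) : G^T = G -> \det G != 0 ->
  vec_norm G (w *m invmx G) = covec_norm G w.
Proof.
move=> sG dG; rewrite /vec_norm /covec_norm; congr (Num.sqrt (_ _ _)).
have uG : G \in unitmx by rewrite unitmxE unitfE.
by rewrite mulmxKV// trmx_mul trmx_inv sG mulmxA.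
Qed.

(** [chart_at] may jump from one point to the next; this allows a fixed chart, in which regularity
    is visible. *)
Lemma grad_norm_chart (g : metric_field X) f k x :
  riemannian_metric (@minterior R n X) g -> smooth_fun f ->
  minterior x -> dom X k x ->
  grad_norm g f x = covec_norm (g k x) (diff_fun k f x).
Proof.
move=> gm sf ix dk; rewrite /grad_norm /grad.
have dc := chart_at_dom x.
have pos l : dom X l x -> \det (g l x) != 0.
  by move=> dl; rewrite gt_eqF// posdef_det_gt0//; have [] := gm l x ix dl.
rewrite vec_norm_grad; last 2 first.
- by have [] := gm _ _ ix dc.
- exact: pos.
have [_ _ H] := gm _ _ ix dc.
have T := @covec_trans (g (chart_at x) x) (g k x) (jac (chart_at x) k x)
  (diff_fun (chart_at x) f x) (diff_fun k f x) (pos _ dc) (H _ dk).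
by rewrite /covec_norm T//; exact: diff_fun_trans.
Qed.

End Transitions.

(** * Order and additivity of volume integrals *)

Section Energies.
Variables (R : realType) (n : nat) (X : charted_space R n).
Hypothesis X_mf : smooth_manifold X.
Local Notation V := 'rV[R]_n.+1.
Local Notation icod := (@icod R n X).
Hypothesis bdry : forall k (x : X), dom X k x -> mboundary x -> phi X k x 0 ord_max = 0.
Variable g : metric_field X.
Hypothesis g_metric : riemannian_metric (@minterior R n X) g.
Hypothesis g_cont : forall (k : nat) (y : V), icod k y -> forall i j,
  {for y, continuous (fun y => g k (psi X k y) i j)}.

Lemma integral_rVD d (u v : 'rV[R]_d -> \bar R) :
  measurable_fun setT (u : borel_rV R d -> \bar R) ->
  measurable_fun setT (v : borel_rV R d -> \bar R) ->
  (forall x, 0 <= u x)%E -> (forall x, 0 <= v x)%E ->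
  (integral_rV (fun x => u x + v x) = integral_rV u + integral_rV v)%E.
Proof.
move=> mu mv u0 v0.
rewrite -!integral_leb_rV//; first exact: ge0_integralD.
  exact: emeasurable_funD.
by move=> x; rewrite adde_ge0.
Qed.

Lemma integral_rVZ d (u : 'rV[R]_d -> \bar R) (c : R) : 0 <= c ->
  measurable_fun setT (u : borel_rV R d -> \bar R) -> (forall x, 0 <= u x)%E ->
  (integral_rV (fun x => c%:E * u x) = c%:E * integral_rV u)%E.
Proof.
move=> c0 mu u0; rewrite -!integral_leb_rV//; first exact: ge0_integralZl_EFin.
  by apply: emeasurable_funM => //; exact: measurable_cst.
by move=> x; rewrite mule_ge0.
Qed.

Lemma indic_measurable d (A : set 'rV[R]_d) (u : 'rV[R]_d -> R) :
  measurable (A : set (borel_rV R d)) -> (forall x, A x -> {for x, continuous u}) ->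
  measurable_fun setT ((fun y => (\1_A y * u y)%:E) : borel_rV R d -> \bar R).
Proof.
move=> mA cu; have mu := continuous_at_measurable mA cu.
rewrite (_ : (fun y => _) = (EFin \o u) \_ A).
  by apply/(measurable_restrictT _ mA); exact/measurable_EFinP.
apply/funext => y; rewrite /patch indicE /=.
by case: (y \in A); rewrite ?mul1r ?mul0r.
Qed.

Lemma vol_integral_ge0 (A : set X) (h : X -> R) : (forall x, A x -> 0 <= h x) ->
  (0 <= vol_integral g A h)%E.
Proof.
move=> h0; apply: nneseries_ge0 => j _ _; apply: integral_rV_ge0 => y.
rewrite lee_fin indicE; have [|_] := boolP (y \in _); last by rewrite mul0r.
rewrite inE => -[x [Ax [dx _]] <-]; rewrite mul1r mulr_ge0//.
by rewrite (mf_phiK X_mf)// h0.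
Qed.

Lemma vol_integral_le (A B : set X) (h1 h2 : X -> R) : A `<=` B ->
  (forall x, A x -> 0 <= h1 x) -> (forall x, A x -> h1 x <= h2 x) ->
  (forall x, B x -> 0 <= h2 x) ->
  (vol_integral g A h1 <= vol_integral g B h2)%E.
Proof.
move=> AB h10 h12 h20; apply: lee_nneseries => [j _ _|j _].
  apply: integral_rV_ge0 => y; rewrite lee_fin indicE.
  have [|_] := boolP (y \in _); last by rewrite mul0r.
  rewrite inE => -[x [Ax [dx _]] <-]; rewrite mul1r mulr_ge0//.
  by rewrite (mf_phiK X_mf)// h10.
apply: integral_rV_le => y; rewrite lee_fin ?indicE.
  have [|_] := boolP (y \in _); last by rewrite mul0r.
  rewrite inE => -[x [Ax [dx _]] <-]; rewrite mul1r mulr_ge0//.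
  by rewrite (mf_phiK X_mf)// h10.
have [|_] := boolP (y \in _); last first.
  rewrite mul0r; have [|_] := boolP (y \in _); last by rewrite mul0r.
  rewrite inE => -[x [Ax [dx _]] <-]; rewrite mul1r mulr_ge0//.
  by rewrite (mf_phiK X_mf)// h20.
rewrite inE => -[x [Ax px] xy]; rewrite mem_set; last by exists x => //; split => //; exact: AB.
rewrite !mul1r ler_wpM2r// -xy (mf_phiK X_mf); first exact: h12.
by case: px.
Qed.

Lemma piece_image_sigma_compact k (S : set V) j : S `<=` icod k -> sigma_compact S ->
  sigma_compact (phi X j @` (psi X k @` S `&` @piece R n X j)) /\
  phi X j @` (psi X k @` S `&` @piece R n X j) `<=` icod j.
Proof.
move=> Si sS.
have sD : sigma_compact (S `&` psi X k @^-1` (piece j)) by exact: piece_sigma_compact.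
have -> : phi X j @` (psi X k @` S `&` @piece R n X j) =
    (phi X j \o psi X k) @` (S `&` psi X k @^-1` (piece j)).
  apply/seteqP; split => y.
    by move=> [_ [[z Sz <-] pz] <-]; exists z => //; split.
  by move=> [z [Sz pz] <-]; exists (psi X k z) => //; split => //; exists z.
have td y : (S `&` psi X k @^-1` (piece j)) y -> trans_dom X k j y.
  by move=> [Sy [dy _]]; split => //; exact: Si.
split; last by move=> _ [y Dy <-]; apply: trans_icod => //; exact: td.
apply: sigma_compact_image sD; apply: continuous_in_subspaceT => y; rewrite inE => /td[iy dy].
by apply: continuous_comp; [exact: psi_cont|exact: phi_cont].
Qed.

(** The part [c * u] stays an exact multiple of a volume integral, piece by piece, so no constant is
    lost on it. Only the part carried by [S] is later estimated through [vol_integral_chart]. *)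
Lemma vol_integral_split k (B S : set V) (u h : X -> R) (c : R) :
  B `<=` icod k -> sigma_compact B -> S `<=` B -> sigma_compact S -> 0 <= c ->
  (forall j y, icod j y -> {for y, continuous (u \o psi X j)}) ->
  (forall j y, icod j y -> {for y, continuous (h \o psi X j)}) ->
  (forall x, 0 <= u x) -> (forall x, 0 <= h x) ->
  (vol_integral g (psi X k @` B) (fun x => (c * u x + \1_(psi X k @` S) x * h x)%R) =
   c%:E * vol_integral g (psi X k @` B) u + vol_integral g (psi X k @` S) h)%E.
Proof.
move=> Bi sB SB sS c0 cu ch u0 h0; rewrite /vol_integral.
have Si : S `<=` icod k := subset_trans SB Bi.
pose Bj j := phi X j @` (psi X k @` B `&` @piece R n X j).
pose Sj j := phi X j @` (psi X k @` S `&` @piece R n X j).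
have [sBj iBj] : (forall j, sigma_compact (Bj j)) /\ (forall j, Bj j `<=` icod j).
  by split => j; have [] := piece_image_sigma_compact j Bi sB.
have [sSj iSj] : (forall j, sigma_compact (Sj j)) /\ (forall j, Sj j `<=` icod j).
  by split => j; have [] := piece_image_sigma_compact j Si sS.
have mu j : measurable_fun setT
    ((fun y => (\1_(Bj j) y * (u (psi X j y) * vdens g j y))%:E) : borel_rV R n.+1 -> \bar R).
  apply: indic_measurable; first exact: sigma_compact_borel.
  move=> y By; apply: continuousM; last by apply: vdens_cont => //; exact: iBj By.
  by apply: cu; exact: iBj By.
have mh j : measurable_fun setT
    ((fun y => (\1_(Sj j) y * (h (psi X j y) * vdens g j y))%:E) : borel_rV R n.+1 -> \bar R).
  apply: indic_measurable; first exact: sigma_compact_borel.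
  move=> y By; apply: continuousM; last by apply: vdens_cont => //; exact: iSj By.
  by apply: ch; exact: iSj By.
have pu j y : (0 <= (\1_(Bj j) y * (u (psi X j y) * vdens g j y))%:E)%E.
  by rewrite lee_fin mulr_ge0 ?indicE ?ler0n// mulr_ge0 ?sqrtr_ge0.
have ph j y : (0 <= (\1_(Sj j) y * (h (psi X j y) * vdens g j y))%:E)%E.
  by rewrite lee_fin mulr_ge0 ?indicE ?ler0n// mulr_ge0 ?sqrtr_ge0.
rewrite -nneseriesZl; last by move=> j _; apply: integral_rV_ge0; exact: pu.
rewrite -nneseriesD; last 2 first.
- by move=> j _ _; rewrite mule_ge0//; apply: integral_rV_ge0; exact: pu.
- by move=> j _ _; apply: integral_rV_ge0; exact: ph.
apply: eq_eseriesr => j _.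
rewrite -(integral_rVZ c0 (mu j) (pu j)).
have mcu : measurable_fun setT ((fun y => c%:E *
    (\1_(Bj j) y * (u (psi X j y) * vdens g j y))%:E)%E : borel_rV R n.+1 -> \bar R).
  by apply: emeasurable_funM; [exact: measurable_cst|exact: mu].
have pcu y : (0 <= c%:E * (\1_(Bj j) y * (u (psi X j y) * vdens g j y))%:E)%E.
  by rewrite mule_ge0.
rewrite -[RHS](integral_rVD mcu (mh j) pcu (ph j)).
congr integral_rV; apply/funext => y; rewrite -EFinM -EFinD; congr EFin.
rewrite -/(Bj j) -/(Sj j) -/(vdens g j y) !indicE.
have [|nB] := boolP (y \in Bj j); last first.
  rewrite (_ : y \in Sj j = false) ?mul0r ?mulr0 ?addr0//.
  apply/negP => /set_mem[x [[z Sz zx] px] xy]; move/negP : nB; apply.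
  by apply/mem_set; exists x => //; split => //; exists z => //; exact: SB.
rewrite inE => -[x [[z Bz zx] px] xy].
have yx : psi X j y = x by rewrite -xy (mf_phiK X_mf)//; case: px.
rewrite yx (_ : (x \in psi X k @` S) = (y \in Sj j)); first by rewrite /=; ring.
apply/idP/idP => /set_mem H; apply/mem_set.
  by exists x.
by case: H => x' [Sx' [px' _]] x'y; rewrite -yx -x'y (mf_phiK X_mf).
Qed.

End Energies.

(** * Smooth one-variable functions *)

Section Bump.
Variables (R : realType).

(** Used at 0, where the two branches of [flat] meet and [flat_le] gives the quadratic bound. *)
Lemma is_derive_quadratic (f : R -> R) (x C : R) :
  (forall t, `|f t - f x| <= C * (t - x) ^+ 2) -> is_derive x (1 : R) f 0.
Proof.
move=> fC; have C0 : 0 <= C.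
  have := fC (x + 1); rewrite addrAC subrr add0r expr1n mulr1.
  by apply: le_trans.
have c : (fun h : R => h^-1 *: ((f \o shift x) (h *: 1) - f x)) @ 0^' --> (0 : R).
  apply/cvgrPdist_lt => eps e0; near=> h.
  have h0 : h != 0 by near: h; exact: nbhs_dnbhs_neq.
  have he : `|h| < eps / (C + 1).
    near: h; apply: dnbhs0_lt; rewrite divr_gt0//; lra.
  rewrite sub0r normrN normrM /= [h *: 1]mulr1.
  have := fC (h + x); rewrite addrK => H.
  have hp : 0 < `|h| by rewrite normr_gt0.
  apply: (@le_lt_trans _ _ (C * `|h|)).
    rewrite normfV ler_pdivrMl// (le_trans H)//.
    by rewrite -[h ^+ 2]real_normK ?num_real// expr2 mulrCA.
  rewrite ltr_pdivlMr in he; last by lra.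
  by rewrite (le_lt_trans _ he)//; nra.
apply: DeriveDef; first by apply/cvg_ex; exists 0.
exact/cvg_lim.
Unshelve. all: by end_near. Qed.

(* The functions [t |-> t^-m e^(-1/t)], extended by [0], form a family closed
   under differentiation. *)
Definition flat (m : nat) (t : R) : R :=
  if 0 < t then expR (- t^-1) * t^-1 ^+ m else 0.

Lemma flat_ge0 m t : 0 <= flat m t.
Proof.
rewrite /flat; case: ifP => // t0.
by rewrite mulr_ge0 ?expR_ge0// exprn_ge0// invr_ge0 ltW.
Qed.

(** With [N = m + 2], [e^(1/t)] is the [N]-th power of [e^(1/(N t))], which is at least
    [1/(N t)]. *)
Lemma flat_le m t : flat m t <= m.+2%:R ^+ m.+2 * t ^+ 2.
Proof.
rewrite /flat; case: ifP => t0; last by rewrite mulr_ge0 ?sqr_ge0// exprn_ge0.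
have N0 : 0 < m.+2%:R :> R by rewrite ltr0n.
have tm : 0 < t ^+ m by rewrite exprn_gt0.
rewrite exprVn ler_pdivrMr// -mulrA -exprD addSn add1n -exprMn.
rewrite expRN -[leRHS]invrK lef_pV2 ?posrE ?expR_gt0 ?invr_gt0 ?exprn_gt0 ?mulr_gt0//.
rewrite -exprVn; have -> : expR t^-1 = expR ((m.+2%:R * t)^-1) ^+ m.+2.
  rewrite -expRM_natl; congr expR; by rewrite invfM mulrA mulfV ?mul1r// gt_eqF.
have i0 : 0 <= (m.+2%:R * t)^-1 by rewrite invr_ge0 mulr_ge0// ltW.
rewrite lerXn2r ?nnegrE ?expR_ge0//.
by apply: le_trans (expR_ge1Dx _); rewrite lerDr.
Qed.

Lemma is_derive_inv (t : R) : t != 0 -> is_derive t (1 : R) (fun s => s^-1) (- t^-1 ^+ 2).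
Proof.
move=> t0; have := @is_deriveV R id t 1 1 t0 (is_derive_id _ _).
by rewrite exprVn [_ *: _]mulr1.
Qed.

Lemma is_derive_invX m (t : R) : t != 0 ->
  is_derive t (1 : R) (fun s => s^-1 ^+ m) (- m%:R * t^-1 ^+ m.+1).
Proof.
move=> t0; have := is_deriveX m (is_derive_inv t0); rewrite exprfctE => D.
apply: (is_derive_eq D).
rewrite [LHS]mulrN mulNr; congr (- _); case: m {D} => [|m]; first by rewrite !mul0r.
by rewrite /= -mulrA -exprD addn2.
Qed.

(** The coefficients [1] and [- m] are written out to match the shape that [Ck_comp_family] asks
    for. *)
Lemma flat_derive m t : is_derive t (1 : R) (flat m)
  (1 * flat m.+2 t + - m%:R * flat m.+1 t).
Proof.
have [t0|t0|t0] := ltgtP t 0.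
- have -> : 1 * flat m.+2 t + - m%:R * flat m.+1 t = 0.
    by rewrite /flat ltNge (ltW t0) /= !mulr0 addr0.
  apply: (near_eq_is_derive _ (@is_derive_cst R R R 0 t 1)).
  near=> s; rewrite /flat ltNge (@ltW _ _ s 0)//.
  by near: s; exact: lt_nbhsl.
- have tn0 : t != 0 by rewrite gt_eqF.
  have d2 : is_derive t (1 : R) (fun s : R => - s^-1) (t^-1 ^+ 2).
    by apply: (is_derive_eq (is_deriveN (is_derive_inv tn0))); rewrite opprK.
  have d3 := @is_derive1_comp R expR (fun s => - s^-1) t _ _ (is_derive_expR (- t^-1)) d2.
  apply: (near_eq_is_derive _ (is_derive_eq (is_deriveM d3 (is_derive_invX m tn0)) _)).
    near=> s; rewrite /flat (_ : 0 < s)//.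
    by near: s; exact: lt_nbhsr.
  rewrite /flat t0 /GRing.scale/=.
  have -> : t^-1 ^+ m.+2 = t^-1 ^+ 2 * t^-1 ^+ m by rewrite -exprD.
  by rewrite /=; ring.
- rewrite t0 (_ : 1 * _ + _ = 0); last by rewrite /flat ltxx !mulr0 addr0.
  apply: (@is_derive_quadratic _ _ (m.+2%:R ^+ m.+2)) => s.
  rewrite /(flat m 0) ltxx !subr0 ger0_norm ?flat_ge0//.
  exact: flat_le.
Unshelve. all: by end_near. Qed.

Definition bump (t : R) : R := flat 0 (1 - t) * flat 0 (1 + t).

Definition bump' (t : R) : R :=
  flat 0 (1 - t) * flat 2 (1 + t) - flat 2 (1 - t) * flat 0 (1 + t).

Lemma bump_derive t : is_derive t (1 : R) bump (bump' t).
Proof.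
have d1 : is_derive t (1 : R) (fun s : R => 1 - s) (-1).
  have := @is_deriveB R R R (cst 1) id t 1 0 1 (is_derive_cst _ _ _) (is_derive_id _ _).
  by rewrite sub0r.
have d2 : is_derive t (1 : R) (fun s : R => 1 + s) 1.
  have := @is_deriveD R R R (cst 1) id t 1 0 1 (is_derive_cst _ _ _) (is_derive_id _ _).
  by rewrite add0r.
have d3 := @is_derive1_comp R (flat 0) (fun s => 1 - s) t _ _ (flat_derive 0 (1 - t)) d1.
have d4 := @is_derive1_comp R (flat 0) (fun s => 1 + s) t _ _ (flat_derive 0 (1 + t)) d2.
apply: (is_derive_eq (is_deriveM d3 d4)).
by rewrite /bump' /GRing.scale/=; ring.
Qed.

Lemma flat0 m t : t <= 0 -> flat m t = 0.
Proof. by move=> t0; rewrite /flat ltNge t0. Qed.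

Lemma bump_ge0 t : 0 <= bump t. Proof. by rewrite mulr_ge0 ?flat_ge0. Qed.

Lemma flat0_le1 t : flat 0 t <= 1.
Proof.
rewrite /flat; case: ifP => // t0; rewrite expr0 mulr1 -expR0 ler_expR.
by rewrite oppr_le0 invr_ge0 ltW.
Qed.

Lemma bump_le1 t : bump t <= 1.
Proof. by rewrite mulr_ile1 ?flat_ge0 ?flat0_le1. Qed.

Lemma bump_eq0 t : 1 <= `|t| -> bump t = 0 /\ bump' t = 0.
Proof.
rewrite ler_normr => /orP[t1|t1].
  by rewrite /bump /bump' !(@flat0 _ (1 - t)) ?subr_le0// !mul0r subrr.
by rewrite /bump /bump' !(@flat0 _ (1 + t)) ?mulr0 ?subrr//; lra.
Qed.

(** [flat_le] at [m = 2] gives 256 times the square of the argument, and both arguments [1 - t] and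
    [1 + t] are below 2 on the support. *)
Definition bump'_max : R := 1024.

Lemma bump'_le t : `|bump' t| <= bump'_max.
Proof.
have [t1|t1] := leP 1 `|t|.
  by rewrite (bump_eq0 t1).2 normr0 /bump'_max; lra.
move: t1; rewrite ltr_norml => /andP[t1 t2].
have H s : 0 < s < 2 -> flat 2 s <= 1024.
  move=> /andP[s0 s2]; apply: le_trans (flat_le _ _) _.
  have -> : 4%:R ^+ 4 = 256 :> R by rewrite !exprS expr0; lra.
  by nra.
have := H (1 - t); have := H (1 + t).
have := flat_ge0 2 (1 - t); have := flat_ge0 2 (1 + t).
have := flat_ge0 0 (1 - t); have := flat_ge0 0 (1 + t).
have := flat0_le1 (1 - t); have := flat0_le1 (1 + t).
rewrite /bump' /bump'_max => a1 a2 a3 a4 a5 a6 a7 a8.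
have b7 := a7 ltac:(lra); have b8 := a8 ltac:(lra).
by rewrite ler_norml; apply/andP; split; nra.
Qed.

(** For [t] at most 1/2 in absolute value, both [1 - t] and [1 + t] are at least 1/2, and each
    factor of the bump is at least [e^(-2)]. *)
Definition bump_min : R := expR (- 4).

Lemma bump_ge t : `|t| <= 2^-1 -> bump_min <= bump t.
Proof.
rewrite ler_norml => /andP[t1 t2].
have H s : 2^-1 <= s -> expR (- 2) <= flat 0 s.
  move=> s2; have s0 : 0 < s by lra.
  rewrite /flat s0 expr0 mulr1 ler_expR lerN2 invf_ple ?posrE.
  - exact: s2.
  - by [].
  by lra.
rewrite /bump_min /bump; have -> : - 4 = - 2 + - 2 :> R by lra.
by rewrite expRD; apply: ler_pM; rewrite ?expR_ge0// H//; lra.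
Qed.

Lemma bump_min_gt0 : 0 < bump_min. Proof. exact: expR_gt0. Qed.

End Bump.

(** * Composition with smooth functions of one variable *)

Section CkComposition.
Variables (R : realType) (n : nat).
Local Notation V := 'rV[R]_n.+1.
Local Notation e i := (@basis_vec R n i).

(** One induction on [k], for all [m] at once, covers every family whose derivatives are
    combinations of its own later members: the flat functions, [expR], and [ln] followed by the
    powers of the inverse. *)
Lemma Ck_comp_family (J : set R) (H : nat -> R -> R) (a b : nat -> R) (k m : nat)
    (U : set V) (f : V -> R) : open U ->
  (forall m t, J t -> is_derive t (1 : R) (H m) (a m * H m.+2 t + b m * H m.+1 t)) ->
  Ck k U f -> (forall x, U x -> J (f x)) -> Ck k U (H m \o f).
Proof.
move=> oU dH + fJ; elim: k m => [|k IH] m Hf.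
  split => // x Ux; apply: continuous_comp; first exact: Ck_cont Hf Ux.
  have [d _] := dH m _ (fJ _ Ux).
  by apply/differentiable_continuous/derivable1_diffP.
split => [x Ux|i].
  apply: continuous_comp; first exact: Ck_cont Hf Ux.
  have [d _] := dH m _ (fJ _ Ux).
  by apply/differentiable_continuous/derivable1_diffP.
have Hf' := CkW Hf; have [_ /(_ i) [df Hd]] := Hf.
have D x : U x -> is_derive x (e i) (H m \o f)
    ((a m * H m.+2 (f x) + b m * H m.+1 (f x)) * 'D_(e i) f x).
  move=> Ux; have [d <-] := dH m _ (fJ _ Ux).
  by rewrite -derive1E; apply: derive_comp1 => //; exact: df.
split => [x Ux|]; first by case: (D x Ux).
have C : Ck k U (fun x => (a m * (H m.+2 \o f) x + b m * (H m.+1 \o f) x) * 'D_(e i) f x).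
  apply: CkM => //; apply: CkD => //.
    by apply: CkM => //; [exact: Ck_cst|exact: IH].
  by apply: CkM => //; [exact: Ck_cst|exact: IH].
by apply: Ck_near C => // x Ux /=; case: (D x Ux).
Qed.

Lemma Ck_bump k (U : set V) (f : V -> R) : open U -> Ck k U f ->
  Ck k U (fun x => bump (f x)).
Proof.
move=> oU cf.
have H (h : V -> R) : Ck k U h -> Ck k U (fun x => flat 0 (h x)).
  move=> ch; apply: (@Ck_comp_family setT (@flat R) (fun=> 1) (fun m => - m%:R)) => // m t _.
  exact: flat_derive.
apply: CkM => //; apply: H.
  rewrite (_ : (fun x => _) = fun x => 1 + (-1) * f x); last first.
    by apply/funext => x; rewrite mulN1r.
  by apply: CkD => //; [exact: Ck_cst|apply: CkM => //; exact: Ck_cst].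
by apply: CkD => //; exact: Ck_cst.
Qed.

Lemma Ck_expR k (U : set V) (f : V -> R) : open U -> Ck k U f ->
  Ck k U (fun x => expR (f x)).
Proof.
move=> oU cf.
apply: (@Ck_comp_family setT (fun=> expR) (fun=> 1) (fun=> 0) k 0%N) => // m t _.
by apply: (is_derive_eq (is_derive_expR t)); rewrite mul1r mul0r addr0.
Qed.

Lemma Ck_ln k (U : set V) (f : V -> R) : open U -> Ck k U f ->
  (forall x, U x -> 0 < f x) -> Ck k U (fun x => ln (f x)).
Proof.
move=> oU cf f0.
apply: (@Ck_comp_family [set t | 0 < t]
  (fun m => if m is 0 then ln (R:=R) else fun t => t^-1 ^+ m)
  (fun=> 0) (fun m => if m is 0 then 1 else - m%:R) k 0%N) => // -[|m] t t0 /=.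
  by apply: (is_derive_eq (is_derive1_ln t0)); rewrite mul0r add0r mul1r.
have tn0 : t != 0 by rewrite gt_eqF.
by apply: (is_derive_eq (is_derive_invX m.+1 tn0)); rewrite mul0r add0r.
Qed.

End CkComposition.

(** * Integrals of products over boxes *)

Section ProductIntegral.
Variable R : realType.
Local Notation leb := (@lebesgue_measure R).

(** [K] absorbs the factor of the coordinate that is held fixed, which is what the induction
    needs. *)
Lemma integral_rV_prod d (K : R) (f : 'I_d -> R -> R) (c : 'I_d -> R) : 0 <= K ->
  (forall i t, 0 <= f i t) -> (forall i, measurable_fun setT (f i : measurableTypeR R -> R)) ->
  (forall i, (\int[leb]_t (f i t)%:E)%E = (c i)%:E) ->
  integral_rV (fun v => (K * \prod_i f i (v 0 i))%:E) = (K * \prod_i c i)%:E.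
Proof.
elim: d K f c => [|d IH] K f c K0 f0 mf fc; first by rewrite /= !big_ord0.
have E (x : R) : integral_rV (fun v : 'rV[R]_d =>
     (K * \prod_i f i ((row_mx (x%:M : 'rV[R]_1) v : 'rV[R]_(1 + d)) 0 i))%:E) =
   ((K * \prod_(i < d) c (lift ord0 i))%:E * (f ord0 x)%:E)%E.
  rewrite -EFinM [RHS](_ : _ = (K * f ord0 x * \prod_(i < d) c (lift ord0 i))%:E); last first.
    by rewrite mulrAC.
  rewrite -(IH _ (fun i => f (lift ord0 i)) (fun i => c (lift ord0 i)))//; last first.
    by rewrite mulr_ge0.
  congr integral_rV; apply/funext => v; rewrite big_ord_recl -mulrA; congr (_ * (_ * _))%:E.
    rewrite (_ : ord0 = lshift d (0 : 'I_1)); last exact/val_inj.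
    by rewrite row_mxEl mxE eqxx mulr1n.
  apply: eq_bigr => i _; congr f.
  by rewrite (_ : lift ord0 i = rshift 1 i) ?row_mxEr//; exact/val_inj.
have c0 : 0 <= K * \prod_(i < d) c (lift ord0 i).
  rewrite mulr_ge0// prodr_ge0// => i _; rewrite -lee_fin -fc.
  by apply: integral_ge0 => t _; rewrite lee_fin.
rewrite /=; under eq_integral do rewrite E.
rewrite ge0_integralZl_EFin//; last 2 first.
- by move=> t _; rewrite lee_fin.
- exact/measurable_EFinP.
by rewrite fc -EFinM big_ord_recl; congr EFin; rewrite /=; ring.
Qed.

Lemma integral_itv_cst (a b : R) : a <= b ->
  (\int[leb]_t (\1_(`[a, b]%classic) t)%:E = (b - a)%:E)%E.
Proof.
move=> ab; rewrite integral_indic// setIT.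
by rewrite [LHS](lebesgue_measure_itv `[a, b])/= lte_fin; case: ltgtP ab => // -> _; rewrite subrr.
Qed.

Lemma integral_itv_inv (a b : R) : 0 < a -> a < b ->
  (\int[leb]_t (\1_(`[a, b]%classic) t * t^-1)%:E = (ln b - ln a)%:E)%E.
Proof.
move=> a0 ab.
have pos t : t \in `[a, b] -> 0 < t by rewrite in_itv/= => /andP[at_ _]; exact: lt_le_trans at_.
have D (t : R) : 0 < t -> is_derive t (1 : R) (@ln R) t^-1 by exact: is_derive1_ln.
have Cln (t : R) : 0 < t -> {for t, continuous (@ln R)} by exact: continuous_ln.
transitivity (\int[leb]_(t in `[a, b]) (t^-1)%:E)%E.
  rewrite [RHS]integral_mkcond; apply: eq_integral => t _; rewrite patchE indicE.
  by case: (t \in _); rewrite ?mul1r ?mul0r.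
rewrite (@continuous_FTC2 R (fun t => t^-1) (@ln R) a b)//.
- apply: continuous_in_subspaceT => t; rewrite inE/= => /pos t0.
  by apply: inv_continuous; rewrite gt_eqF.
- split.
  + by move=> t tab; have [] := D t (pos t (subset_itv_oo_cc tab)).
  + apply: cvg_at_right_filter; exact: Cln.
  + apply: cvg_at_left_filter; apply: Cln; exact: lt_trans ab.
- move=> t /subset_itv_oo_cc/pos t0; have [_ <-] := D t t0.
  by rewrite derive1E.
Qed.

Variable n : nat.
Local Notation V := 'rV[R]_n.+1.

(* The box of points at height in [[a, b]] above the cube of half-width [w]
   around [y0]. *)
Definition slab (y0 : V) (w a b : R) : set V :=
  [set y | forall i, `[(if i == ord_max then a else y0 0 i - w),
                       (if i == ord_max then b else y0 0 i + w)]%classic (y 0 i)].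

Lemma slabP y0 w a b y : slab y0 w a b y <->
  a <= y 0 ord_max <= b /\ forall i, i != ord_max -> `|y 0 i - y0 0 i| <= w.
Proof.
split=> [H|[H1 H2] i].
  split; first by have := H ord_max; rewrite eqxx /= in_itv.
  by move=> i /negbTE ni; have := H i; rewrite ni /= in_itv/= -ler_distlC distrC.
case: (altP (i =P ord_max)) => [->|ni]; rewrite /= in_itv//=.
by rewrite -ler_distlC distrC H2.
Qed.

Lemma slab_compact y0 w a b : compact (slab y0 w a b).
Proof.
by apply: (@rV_compact _ _ (fun i => `[(if i == ord_max then a else y0 0 i - w),
  (if i == ord_max then b else y0 0 i + w)]%classic)) => i; exact: segment_compact.
Qed.

(** The comparison integral behind all energy estimates: an integrand of order [1 / y_n] factors
    over the coordinates, and the height contributes a logarithm. *)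
Lemma slab_integral y0 w a b : 0 <= w -> 0 < a -> a < b ->
  (\int[leb_rV R n.+1]_(y in slab y0 w a b) ((y 0 ord_max)^-1)%:E =
   ((2 * w) ^+ n * (ln b - ln a))%:E)%E.
Proof.
move=> w0 a0 ab.
have mS : measurable (slab y0 w a b : set (borel_rV R n.+1)).
  by apply: sigma_compact_borel; apply: compact_sigma_compact; exact: slab_compact.
have pos y : slab y0 w a b y -> 0 < y 0 ord_max.
  by move=> /slabP[/andP[ay _] _]; exact: lt_le_trans ay.
rewrite -integral_rV_indic//; last 2 first.
- apply: continuous_at_measurable => // y /pos y0'.
  apply: (@continuous_comp V R R (fun y => y 0 ord_max) (fun t => t^-1)).
    exact: coord_continuous.
  by apply: inv_continuous; rewrite gt_eqF.
- by move=> y /pos/ltW; rewrite invr_ge0.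
pose f (i : 'I_n.+1) (t : R) : R := if i == ord_max then \1_(`[a, b]%classic) t * t^-1
  else \1_(`[y0 0 i - w, y0 0 i + w]%classic) t.
pose c (i : 'I_n.+1) : R := if i == ord_max then ln b - ln a else 2 * w.
transitivity (integral_rV (fun y : V => (1 * \prod_i f i (y 0 i))%:E)).
  congr integral_rV; apply/funext => y; congr EFin; rewrite mul1r indicE.
  have [|/negP nS] := boolP (y \in _).
    rewrite inE => Sy; rewrite (bigD1 ord_max)//= {1}/f eqxx big1 ?mulr1.
      by congr (_ * _); have := Sy ord_max; rewrite eqxx => H; rewrite indicE mem_set.
    move=> i /negbTE ni; rewrite /f ni indicE mem_set//.
    by have := Sy i; rewrite ni.
  rewrite mul0r; have [i ni] : exists i, f i (y 0 i) = 0.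
    apply: contra_notP nS => /forallNP H; rewrite inE => i.
    have := H i; rewrite /f; case: ifP => _; rewrite indicE.
      by have [|_] := boolP (_ \in _); [rewrite inE|rewrite mul0r].
    by have [|_] := boolP (_ \in _); [rewrite inE|].
  by rewrite (bigD1 i)//= ni mul0r.
rewrite (@integral_rV_prod _ _ f c)//.
- by rewrite mul1r big_ord_recr /= {2}/c eqxx; congr (_ * _)%:E;
  rewrite (eq_bigr (fun=> 2 * w)) ?prodr_const ?card_ord// => i _; rewrite /c;
  case: eqP => // /(congr1 val)/= /eqP; rewrite ltn_eqF.
- move=> i t; rewrite /f; case: ifP => _; rewrite indicE ?ler0n//.
  have [|_] := boolP (_ \in _); last by rewrite mul0r.
  by rewrite inE/= in_itv/= => /andP[at_ _]; rewrite mul1r invr_ge0 (le_trans (ltW a0)).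
- move=> i; rewrite /f; case: (i == ord_max); last exact: measurable_indic.
  rewrite (_ : (fun t => _) = (fun t : R => t^-1) \_ `[a, b]%classic); last first.
    by apply/funext => t; rewrite patchE indicE; case: (_ \in _); rewrite ?mul1r ?mul0r.
  have mab : measurable (`[a, b]%classic : set (measurableTypeR R)).
    exact: measurable_itv.
  apply/(measurable_restrictT _ mab).
  apply: subspace_continuous_measurable_fun => //.
  apply: continuous_in_subspaceT => t; rewrite inE/= in_itv/= => /andP[at_ _].
  by apply: inv_continuous; rewrite gt_eqF// (lt_le_trans a0).
- move=> i; rewrite /f /c; case: ifP => _; first exact: integral_itv_inv.
  rewrite integral_itv_cst; first by congr EFin; ring.
  by rewrite lerBlDr -addrA lerDl addr_ge0.
Qed.

End ProductIntegral.

(** * Coordinate balls as bounded smooth domains *)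

Section CoordinateBall.
Variables (R : realType) (n : nat) (X : charted_space R n).
Hypothesis X_mf : smooth_manifold X.
Local Notation V := 'rV[R]_n.+1.
Local Notation e i := (@basis_vec R n i).
Local Notation icod := (@icod R n X).
Hypothesis bdry : forall k (x : X), dom X k x -> mboundary x -> phi X k x 0 ord_max = 0.
Variable g : metric_field X.
Hypothesis g_metric : riemannian_metric (@minterior R n X) g.
Hypothesis g_cont : forall (k : nat) (y : V), icod k y -> forall i j,
  {for y, continuous (fun y => g k (psi X k y) i j)}.

(** The norm on row vectors is the sup norm, whose balls have corners; a smooth domain needs the
    Euclidean one. *)
Definition esq (v : V) : R := \sum_i v 0 i ^+ 2.

Lemma esq_ge0 v : 0 <= esq v.
Proof. by apply: sumr_ge0 => i _; exact: sqr_ge0. Qed.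

Lemma esq_coord (v : V) i : v 0 i ^+ 2 <= esq v.
Proof. by rewrite /esq (bigD1 i)//= lerDl sumr_ge0// => j _; exact: sqr_ge0. Qed.

Lemma esq_convex (u v : V) t : 0 <= t <= 1 ->
  esq (u + t *: (v - u)) <= (1 - t) * esq u + t * esq v.
Proof.
move=> /andP[t0 t1]; rewrite /esq !mulr_sumr -big_split/=.
apply: ler_sum => i _; rewrite !mxE.
(* In each coordinate the two sides differ by [t * (1 - t)] times the square of the difference. *)
have := mulr_ge0 (mulr_ge0 t0 (_ : 0 <= 1 - t)) (sqr_ge0 (v 0 i - u 0 i)).
rewrite subr_ge0 => /(_ t1); rewrite -subr_ge0 => H.
rewrite (le_trans H)// le_eqVlt; apply/orP; left; apply/eqP; ring.
Qed.

Lemma Ck_esq k U (c : V) : open U -> Ck k U (fun y => esq (y - c)).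
Proof.
move=> oU; apply: Ck_sum => // i.
rewrite (_ : (fun y : V => _) = fun y : V => (y 0 i + - c 0 i) * (y 0 i + - c 0 i)); last first.
  by apply/funext => y; rewrite !mxE expr2.
have H : Ck k U (fun y : V => y 0 i + - c 0 i).
  by apply: CkD => //; [exact: Ck_coord|exact: Ck_cst].
exact: CkM.
Qed.

Lemma esq_cont (c y : V) : {for y, continuous (fun z : V => esq (z - c))}.
Proof. exact: (Ck_cont (@Ck_esq 0 setT c openT) Logic.I). Qed.

Lemma line_connected (P : V -> Prop) (c : V) :
  (forall y t, P y -> 0 <= t <= 1 -> P (c + t *: (y - c))) -> connected [set y | P y].
Proof.
move=> H; pose A (y : V) := (fun t : R => c + t *: (y - c)) @` `[0, 1]%classic.
have -> : [set y | P y] = \bigcup_(y in [set y | P y]) A y.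
  apply/seteqP; split => [y Py|_ [y Py [t t01 <-]]]; last first.
    by apply: H => //; move: t01; rewrite /= in_itv.
  exists y => //; exists 1; first by rewrite /= in_itv/= lexx ler01.
  by rewrite scale1r addrC subrK.
apply: bigcup_connected.
  exists c => y _; exists 0; first by rewrite /= in_itv/= lexx ler01.
  by rewrite scale0r addr0.
move=> y _; apply: connected_continuous_connected; first exact: segment_connected.
apply: continuous_subspaceT => t; apply: rV_continuous => j.
rewrite (_ : (fun t => _) = fun t : R => c 0 j + t * (y - c) 0 j); last first.
  by apply/funext => z; rewrite mxE [X in _ + X]mxE.
apply: cvgD; first exact: cvg_cst.
by apply: cvgM; [exact: cvg_id|exact: cvg_cst].
Qed.

(* A C^1 reparametrisation of [[0, 1]] by the whole line. *)
Definition glide (t : R) : R := 2^-1 * (1 - cos (pi * t)).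

Lemma glide01 t : 0 <= glide t <= 1.
Proof.
rewrite /glide; have := cos_le1 (pi * t); have := cos_geN1 (pi * t) => a b.
by apply/andP; split; lra.
Qed.

Definition glide' (t : R) : R := 2^-1 * (pi * sin (pi * t)).

Lemma glide_derive t : is_derive t (1 : R) glide (glide' t).
Proof.
have d1 : is_derive t (1 : R) (fun s : R => pi * s) pi.
  rewrite (_ : (fun s => _) = fun s : R => s * pi); last by apply/funext => s; rewrite mulrC.
  exact: is_derive_mulr.
have d2 := @is_derive1_comp R cos (fun s => pi * s) t _ _ (is_derive_cos _) d1.
have d3 := @is_deriveB R R R (cst 1) _ t 1 0 _ (is_derive_cst _ _ _) d2.
have d4 := @is_deriveZ R R R _ 2^-1 t 1 _ d3.
rewrite (_ : glide = 2^-1 \*: (cst 1 - (cos \o (fun s => pi * s))))//.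
by apply: (is_derive_eq d4); rewrite /glide' /GRing.scale/=; ring.
Qed.

Lemma glide'_cont : continuous glide'.
Proof.
move=> t; rewrite /glide'; apply: cvgM; first exact: cvg_cst.
apply: cvgM; first exact: cvg_cst.
apply: (@continuous_comp R R R (fun t => pi * t) sin); last exact: continuous_sin.
by apply: cvgM; [exact: cvg_cst|exact: cvg_id].
Qed.

Lemma glide'_le t : `|glide' t| <= pi.
Proof.
rewrite /glide' normrM normrM (ger0_norm (pi_ge0 R)) (ger0_norm (_ : 0 <= 2^-1))//.
have := sin_max (pi * t); have := normr_ge0 (sin (pi * t)); have := pi_ge0 R.
nra.
Qed.

Variables (k : nat) (c : V) (rad : R).
Hypothesis rad_gt0 : 0 < rad.
Hypothesis ball_icod : forall y, esq (y - c) <= rad ^+ 2 -> icod k y.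

Let cball := [set y : V | esq (y - c) <= rad ^+ 2].

Lemma cball_compact : compact cball.
Proof.
apply: (@subclosed_compact _ _ (box c rad)); last 2 first.
- exact: box_compact.
- move=> y /= cy; apply: rV_norm_le; first exact: ltW.
  move=> i; rewrite -(ler_sqr (normr_ge0 _)) ?nnegrE ?(ltW rad_gt0)//.
  by rewrite real_normK ?num_real// (le_trans (esq_coord _ i)).
apply: (@closed_comp _ _ (fun y : V => esq (y - c)) [set t | t <= rad ^+ 2]).
  by move=> y _; exact: esq_cont.
exact: closed_le.
Qed.

Lemma line_cball (x y : V) t : cball x -> cball y -> 0 <= t <= 1 -> cball (x + t *: (y - x)).
Proof.
move=> Bx By t01; rewrite /cball /= addrAC (_ : y - x = (y - c) - (x - c)); last first.
  by rewrite opprB addrA subrK.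
apply: le_trans (esq_convex _ _ t01) _.
move: Bx By t01; rewrite /cball/= => Bx By /andP[t0 t1]; nra.
Qed.

Section Curve.
Variables x y : V.
Hypotheses (Bx : cball x) (By : cball y).

Definition glide_line (t : R) : V := x + glide t *: (y - x).
Definition glide_curve (t : R) : X := psi X k (glide_line t).

Lemma glide_line_icod t : icod k (glide_line t).
Proof. by apply: ball_icod; apply: line_cball => //; exact: glide01. Qed.

Lemma glide_line_derive t j :
  is_derive t (1 : R) (fun s => glide_line s 0 j) ((glide' t *: (y - x)) 0 j).
Proof.
rewrite (_ : (fun s => _) = cst (x 0 j) + (y - x) 0 j \*: glide); last first.
  by apply/funext => s; rewrite /glide_line mxE [X in _ + X]mxE /= [LHS]addrC addrC mulrC.
have d1 := @is_deriveZ R R R glide ((y - x) 0 j) t 1 _ (glide_derive t).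
have d2 := @is_deriveD R R R (cst (x 0 j)) _ t 1 0 _ (is_derive_cst _ _ _) d1.
by apply: (is_derive_eq d2); rewrite add0r [RHS]mxE [RHS]mulrC.
Qed.

Lemma glide_line_cont t : {for t, continuous glide_line}.
Proof.
apply: rV_continuous => j; have [d _] := glide_line_derive t j.
by apply/differentiable_continuous/derivable1_diffP.
Qed.

Lemma glide_curve_cont : continuous glide_curve.
Proof.
move=> t; apply: continuous_comp; first exact: glide_line_cont.
by apply: psi_cont => //; exact: glide_line_icod.
Qed.

Lemma glide_curve_derive l t : dom X l (glide_curve t) ->
  is_derive t (1 : R) (phi X l \o glide_curve) (glide' t *: (y - x) *m jac k l (glide_curve t)).
Proof.
move=> dl; have td : trans_dom X k l (glide_line t).
  by split => //; exact: glide_line_icod.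
have D j : is_derive t (1 : R) (fun s => phi X l (glide_curve s) 0 j)
    ((glide' t *: (y - x) *m jac k l (glide_curve t)) 0 j).
  have D0 := C1_curve_derive (@trans_dom_open R n X X_mf k l) td (trans_Ck X_mf 1 k l j)
    (glide_line_derive t).
  apply: (is_derive_eq D0); rewrite [RHS]mxE; apply: eq_bigr => i _.
  by rewrite /glide_curve (jac_derive X_mf td); congr (_ * _); rewrite mxE.
have dv : derivable (phi X l \o glide_curve) t 1.
  by apply/derivable_mxP => i j; rewrite ord1; case: (D j).
apply: DeriveDef => //; rewrite derive_mx//; apply/rowP => j; rewrite mxE.
by case: (D j).
Qed.

Lemma glide_curve_C1 : C1_curve glide_curve.
Proof.
split; first exact: glide_curve_cont.
move=> l t dl; split; first by case: (glide_curve_derive dl).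
have near_dom : \forall s \near t, dom X l (glide_curve s).
  by apply: glide_curve_cont; apply: open_nbhs_nbhs; split => //; exact: mf_dom_open.
have E : \forall s \near t, (\row_j \sum_i (glide' s *: (y - x)) 0 i *
    'D_(e i) (fun z => phi X l (psi X k z) 0 j) (glide_line s)) =
    derive1 (phi X l \o glide_curve) s.
  apply: filterS near_dom => s ds; rewrite derive1E.
  have [_ ->] := glide_curve_derive ds; apply/rowP => j; rewrite !mxE.
  have td : trans_dom X k l (glide_line s) by split => //; exact: glide_line_icod.
  by apply: eq_bigr => i _; rewrite /glide_curve (jac_derive X_mf td); congr (_ * _); rewrite mxE.
have td : trans_dom X k l (glide_line t) by split => //; exact: glide_line_icod.
have Et := nbhs_singleton E.
apply: (@cvg_trans _ _ _ _ (near_eq_cvg E)).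
rewrite -Et; apply: (@rV_continuous R R n.+1) => j.
rewrite (_ : (fun s => _) = fun s => \sum_i ((glide' s *: (y - x)) 0 i *
  'D_(e i) (fun z => phi X l (psi X k z) 0 j) (glide_line s))); last first.
  by apply/funext => s; rewrite mxE.
apply: cvg_sum_ord => i; apply: cvgM.
  rewrite (_ : (fun s => _) = fun s => glide' s * (y - x) 0 i); last first.
    by apply/funext => s; rewrite mxE.
  rewrite [X in _ --> X]mxE; apply: cvgM; [exact: glide'_cont|exact: cvg_cst].
apply: (@continuous_comp R V R glide_line
  (fun z => 'D_(e i) (fun z => phi X l (psi X k z) 0 j) z)).
  exact: glide_line_cont.
have [_ /(_ i)[_ H]] := trans_Ck X_mf 1 k l j.
exact: H.1 _ td.
Qed.

(** The integrand of [curve_length] switches charts with the point; the transformation law of the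
    metric brings it back to chart [k]. *)
Lemma glide_curve_speed t :
  vec_norm (g (chart_at (glide_curve t)) (glide_curve t))
    (derive1 (phi X (chart_at (glide_curve t)) \o glide_curve) t) =
  vec_norm (g k (glide_curve t)) (glide' t *: (y - x)).
Proof.
have dl := chart_at_dom X_mf (glide_curve t).
rewrite derive1E; have [_ ->] := glide_curve_derive dl.
have ii := glide_line_icod t.
have [_ _ H] := g_metric (icod_psi X_mf bdry ii) (psi_dom X_mf ii.1).
by rewrite /vec_norm (H _ dl) trmx_mul !mulmxA.
Qed.

End Curve.

Lemma cball_metric_bound : exists2 M, 0 <= M & forall y, cball y ->
  \sum_i \sum_j `|g k (psi X k y) i j| <= M.
Proof.
have [||z _ Hz] := @compact_EVT_max V R
    (fun y => \sum_i \sum_j `|g k (psi X k y) i j|) cball _ cball_compact _.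
- by exists c; rewrite /cball/= subrr /esq big1 ?sqr_ge0// => i _; rewrite mxE expr0n.
- apply: continuous_in_subspaceT => z; rewrite inE => Bz.
  apply: (@cvg_sum_ord R V (nbhs z)) => i.
  apply: (@cvg_sum_ord R V (nbhs z)) => j.
  by apply: cvg_norm; apply: g_cont; exact: ball_icod.
exists (\sum_i \sum_j `|g k (psi X k z) i j|).
  by apply: sumr_ge0 => i _; apply: sumr_ge0.
by move=> y By; apply: Hz; rewrite inE.
Qed.

Lemma quad_form_le (G : 'M[R]_n.+1) (v : V) D : 0 <= D -> (forall i, `|v 0 i| <= D) ->
  (v *m G *m v^T) 0 0 <= D ^+ 2 * \sum_i \sum_j `|G i j|.
Proof.
move=> D0 vD; rewrite mxE exchange_big mulr_sumr; apply: ler_sum => j _ /=.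
rewrite mxE mulr_suml mulr_sumr; apply: ler_sum => i _; rewrite mxE.
apply: le_trans (ler_norm _) _; rewrite !normrM mulrAC expr2.
by rewrite ler_wpM2r// ler_pM.
Qed.

(** Segments between points of the ball stay in it by convexity, and the metric coefficients are
    bounded on it by compactness, so these segments have uniformly bounded length. *)
Lemma cball_rdist_bound : exists K : R, forall x y, cball x -> cball y ->
  (rdist g (psi X k x) (psi X k y) <= K%:E)%E.
Proof.
have [M M0 HM] := cball_metric_bound.
have pi0 := pi_ge0 R.
(* [glide'] is bounded by [pi], and two points of the ball differ by at most [2 * rad] in each
   coordinate. *)
pose D := pi * (2 * rad); have D0 : 0 <= D by rewrite !mulr_ge0// ltW.
exists (Num.sqrt (D ^+ 2 * M)) => x y Bx By.
apply: (@le_trans _ _ (curve_length g (glide_curve x y))).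
  apply: ereal_inf_lbound; exists (glide_curve x y) => //; split.
  - exact: glide_curve_C1.
  - by move=> t; apply: icod_psi => //; exact: glide_line_icod.
  - by rewrite /glide_curve /glide_line /glide mulr0 cos0 subrr mulr0 scale0r addr0.
  - rewrite /glide_curve /glide_line /glide mulr1 cospi opprK.
    by rewrite (_ : 2^-1 * (1 + 1) = 1) ?scale1r ?[x + _]addrC ?subrK//; lra.
rewrite /curve_length.
apply: (@le_trans _ _ (\int[@lebesgue_measure R]_(t in `[0%R, 1%R]%classic)
    (Num.sqrt (D ^+ 2 * M))%:E)%E); last first.
  rewrite integral_cst//= lebesgue_measure_itv/= lte_fin ltr01 oppr0 adde0 mule1//.
rewrite integral_mkcond [leRHS]integral_mkcond; apply: ge0_le_integralT => t.
  by rewrite patchE; case: ifP => // _; rewrite lee_fin sqrtr_ge0.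
rewrite !patchE; case: ifP => // _; rewrite lee_fin (glide_curve_speed Bx By) ler_wsqrtr//.
have Bl : cball (glide_line x y t) by apply: line_cball => //; exact: glide01.
apply: le_trans (quad_form_le _ D0 _) _.
  move=> i; rewrite !mxE normrM ler_pM ?glide'_le//.
  rewrite (_ : y 0 i - x 0 i = (y - c) 0 i - (x - c) 0 i); last by rewrite !mxE; ring.
  have H (z : V) : cball z -> `|(z - c) 0 i| <= rad.
    move=> Bz; rewrite -(ler_sqr (normr_ge0 _)) ?nnegrE ?(ltW rad_gt0)//.
    by rewrite real_normK ?num_real// (le_trans (esq_coord _ i)).
  by apply: le_trans (ler_normB _ _) _; have := H _ Bx; have := H _ By; lra.
by rewrite ler_wpM2l ?sqr_ge0//; exact: HM.
Qed.

Definition coord_ball : set X := psi X k @` [set y | esq (y - c) < rad ^+ 2].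

Lemma ball_cball y : esq (y - c) < rad ^+ 2 -> cball y.
Proof. exact: ltW. Qed.

Lemma coord_ballP (x : X) : dom X k x -> coord_ball x <-> esq (phi X k x - c) < rad ^+ 2.
Proof.
move=> dx; split=> [[y By <-]|By].
  by rewrite (psiK X_mf)//; case: (ball_icod (ball_cball By)).
by exists (phi X k x) => //; rewrite (mf_phiK X_mf).
Qed.

Lemma coord_ball_dom x : coord_ball x -> dom X k x.
Proof.
by move=> [y By <-]; apply: psi_dom => //; case: (ball_icod (ball_cball By)).
Qed.

Lemma coord_ball_open : open coord_ball.
Proof.
rewrite openE => x Bx; have dx := coord_ball_dom Bx.
have o : open [set y : V | esq (y - c) < rad ^+ 2].
  apply: (@open_comp _ _ (fun y : V => esq (y - c)) [set t | t < rad ^+ 2]).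
    by move=> y _; exact: esq_cont.
  exact: open_lt.
have H1 : \forall z \near x, dom X k z.
  by apply: open_nbhs_nbhs; split => //; exact: mf_dom_open.
have H2 : \forall z \near x, esq (phi X k z - c) < rad ^+ 2.
  have No : nbhs (phi X k x) [set y : V | esq (y - c) < rad ^+ 2].
    by apply: open_nbhs_nbhs; split => //; apply/coord_ballP.
  exact: (phi_cont X_mf dx No).
by apply: filterS2 H1 H2 => z dz Bz; apply/coord_ballP.
Qed.

(** The sphere is a regular level set of [esq (y - c)]. That the image has no other boundary points
    in the manifold comes from the closed ball, which lies in the interior of the chart. *)
Lemma coord_ball_domain : bounded_smooth_domain g coord_ball.
Proof.
have cc : cball c.
  by rewrite /cball/= subrr /esq big1 ?sqr_ge0// => i _; rewrite mxE expr0n.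
split.
- by move=> _ [y By <-]; apply: icod_psi => //; exact: ball_icod (ball_cball By).
- exists (psi X k c), c => //=.
  by rewrite subrr /esq big1 ?exprn_gt0// => i _; rewrite mxE expr0n.
- exact: coord_ball_open.
- apply: connected_continuous_connected.
    apply: (@line_connected _ c) => y t By /andP[t0 t1].
    rewrite addrC addKr; have := @esq_convex 0 (y - c) t.
    rewrite subr0 add0r t0 t1 => /(_ isT)/le_lt_trans; apply.
    rewrite [esq 0]big1 ?mulr0 ?add0r; last by move=> i _; rewrite mxE expr0n.
    by have := esq_ge0 (y - c); nra.
  apply: continuous_in_subspaceT => y; rewrite inE => By.
  by apply: psi_cont => //; exact: ball_icod (ball_cball By).
split.
  have [K HK] := cball_rdist_bound; exists K => _ _ [x Bx <-] [y By <-].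
  by apply: HK; exact: ball_cball.
move=> q iq cq nq.
(* The image of the closed ball is compact, hence closed in the Hausdorff space [X], and contains
   the closure of the domain. *)
have [z Bz zq] : (psi X k @` cball) q.
  have : closed (psi X k @` cball).
    apply: compact_closed; first exact: (mf_hausdorff X_mf).
    apply: continuous_compact; last exact: cball_compact.
    apply: continuous_in_subspaceT => y; rewrite inE => By.
    by apply: psi_cont => //; exact: ball_icod.
  apply; apply: closure_subset cq => x [y By <-]; exists y => //; exact: ball_cball.
have [zc zu] := ball_icod Bz.
exists k, setT, (fun y => esq (y - c) + - (rad ^+ 2)); split.
- by rewrite -zq; exact: psi_dom.
- by split => //; exact: openT.
- move=> m; apply/Ck_onP; apply: CkD; [exact: Ck_esq openT|exact: Ck_cst|exact: openT].
- have Ez : esq (z - c) = rad ^+ 2.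
    apply/eqP; rewrite eq_le Bz /= leNgt; apply/negP => Bz'.
    by apply: nq; exists z.
  have [i zi] : exists i, (z - c) 0 i != 0.
    apply: contrapT => /forallNP H.
    suff : 0 < esq (z - c) by rewrite /esq big1 ?ltxx// => i _; have /negP := H i; rewrite negbK => /eqP ->; rewrite expr0n.
    by rewrite Ez exprn_gt0.
  exists i; rewrite -zq (psiK X_mf)//.
  have D : is_derive z (e i) (fun y : V => esq (y - c) + - (rad ^+ 2)) (2 * (z - c) 0 i).
    rewrite (_ : (fun y => _) = (\sum_j ((fun y : V => y 0 j + - c 0 j) * (fun y : V => y 0 j + - c 0 j))) +
        cst (- rad ^+ 2)); last first.
      apply/funext => y; rewrite /= fct_sumE; congr (_ + _); apply: eq_bigr => j _.
      by rewrite !mxE expr2.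
    have d1 j : is_derive z (e i) (fun y : V => y 0 j + - c 0 j) ((i == j)%:R).
      have := @is_deriveD R V R (fun y : V => y 0 j) (cst (- c 0 j)) z (e i) _ 0
        (derive_coord _ _ _) (is_derive_cst _ _ _).
      by rewrite basis_vecE addr0.
    have d2 j := is_deriveM (d1 j) (d1 j).
    have d3 := is_derive_sum d2.
    have d4 := is_deriveD d3 (@is_derive_cst R V R (- rad ^+ 2) z (e i)).
    apply: (is_derive_eq d4); rewrite addr0 (bigD1 i)//= big1; last first.
      by move=> j /negbTE ji; rewrite eq_sym ji scaler0 addr0.
    by rewrite eqxx addr0 !mxE /GRing.scale/=; ring.
  by have [_ ->] := D; rewrite mulf_neq0.
- move=> x dx _; rewrite subr_lt0; exact: coord_ballP.
Qed.

End CoordinateBall.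

(** * Upper bounds for the eigenvalue *)

Section RealPowers.
Variable R : realType.

Lemma powR_small (p eps y : R) : 0 < p -> 0 < eps -> `|y| < eps `^ p^-1 -> `|y| `^ p < eps.
Proof.
move=> p0 e0 ye; have H : (eps `^ p^-1) `^ p = eps.
  by rewrite -powRrM mulVf ?gt_eqF// powRr1// ltW.
by rewrite -[ltRHS]H; apply: gt0_ltr_powR; rewrite ?nnegrE ?powR_ge0.
Qed.

Lemma abs_powR_continuous (p : R) : 0 < p -> continuous (fun y : R => `|y| `^ p).
Proof.
move=> p0 x; have [->|x0] := eqVneq x 0.
  apply/norm_continuousP => eps e0; exists (eps `^ p^-1); first exact: powR_gt0.
  move=> y; rewrite subr0 normr0 powR0 ?gt_eqF// subr0 (ger0_norm (powR_ge0 _ _)).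
  exact: powR_small.
apply: (@continuous_comp R R R (fun y => `|y|) (fun t => t `^ p)).
  exact: norm_continuous.
have nx : 0 < `|x| by rewrite normr_gt0.
have [d _] := is_derive1_powR p nx.
exact/differentiable_continuous/derivable1_diffP.
Qed.

Lemma sqrt_powR_le (u v b p : R) : 0 <= p -> 0 <= v -> 0 <= b -> u <= v ^+ 2 * b ->
  Num.sqrt u `^ p <= Num.sqrt b `^ p * v `^ p.
Proof.
move=> p0 v0 b0 uvb; rewrite mulrC -powRM ?sqrtr_ge0//.
apply: ge0_ler_powR; rewrite ?nnegrE ?mulr_ge0 ?sqrtr_ge0//.
apply: le_trans (ler_wsqrtr uvb) _.
by rewrite sqrtrM ?sqr_ge0// sqrtr_sqr ger0_norm.
Qed.

Lemma powR_expRMln (s p t : R) : 0 < t -> expR (s * ln t) `^ p = expR (p * s * ln t).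
Proof. by move=> t0; rewrite -expRM mulrC mulrA. Qed.

Lemma expR_natln m (t : R) : 0 < t -> expR (m%:R * ln t) = t ^+ m.
Proof. by move=> t0; rewrite expRM_natl lnK// posrE. Qed.

End RealPowers.

(** * The pointwise gradient estimate, as matrix algebra *)

Section GradientAlgebra.
Variables (R : realType) (n : nat).
Local Notation V := 'rV[R]_n.+1.

(** Only the last diagonal entry meets [P] twice; every other product of components contains a
    factor at most [q]. *)
Lemma quad_form_split_le (K Gi : 'M[R]_n.+1) (w : V) (e M P q : R) :
  0 <= e <= 1 -> 0 <= Gi ord_max ord_max ->
  (forall i j, `|K i j - Gi i j| <= e) -> (forall i j, `|Gi i j| <= M) ->
  0 <= q -> q <= P -> `|w 0 ord_max| <= P ->
  (forall i, i != ord_max -> `|w 0 i| <= q) ->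
  (w *m K *m w^T) 0 0 <= (Gi ord_max ord_max + e) * P ^+ 2 +
    ((n.+1 * n.+1)%:R * (M + 1)) * (q * P).
Proof.
move=> /andP[e0 e1] A0 HK HM q0 qP wP wq.
have P0 : 0 <= P by exact: le_trans qP.
have M0 : 0 <= M by apply: le_trans (HM ord_max ord_max).
have wle i : `|w 0 i| <= P.
  by have [->//|ni] := eqVneq i ord_max; exact: le_trans (wq i ni) qP.
have KM i j : `|K i j| <= M + 1.
  rewrite -(subrK (Gi i j) (K i j)); apply: le_trans (ler_normD _ _) _.
  by have := HK i j; have := HM i j; lra.
have term (i j : 'I_n.+1) : w 0 i * K i j * w 0 j <=
    (if (i == ord_max) && (j == ord_max) then (Gi ord_max ord_max + e) * P ^+ 2 else 0)
    + (M + 1) * (q * P).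
  have qP0 : 0 <= (M + 1) * (q * P) by rewrite !mulr_ge0//; lra.
  case: ifPn => [/andP[/eqP -> /eqP ->]|nij].
    apply: (@le_trans _ _ ((Gi ord_max ord_max + e) * P ^+ 2)); last by rewrite lerDl.
    have -> : w 0 ord_max * K ord_max ord_max * w 0 ord_max =
        K ord_max ord_max * `|w 0 ord_max| ^+ 2.
      by rewrite real_normK ?num_real//; ring.
    have : K ord_max ord_max <= Gi ord_max ord_max + e.
      by have := ler_norm (K ord_max ord_max - Gi ord_max ord_max); have := HK ord_max ord_max; lra.
    have : `|w 0 ord_max| ^+ 2 <= P ^+ 2 by rewrite lerXn2r ?nnegrE.
    have := sqr_ge0 `|w 0 ord_max|; nra.
  rewrite add0r; apply: le_trans (ler_norm _) _; rewrite !normrM.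
  have -> : `|w 0 i| * `|K i j| * `|w 0 j| = `|K i j| * (`|w 0 i| * `|w 0 j|) by ring.
  apply: ler_pM => //.
  have [ie|ni] := eqVneq i ord_max.
    rewrite mulrC; apply: ler_pM => //; apply: wq.
    by move: nij; rewrite ie eqxx.
  by apply: ler_pM => //; exact: wq.
rewrite mxE; under eq_bigr do rewrite mxE mulr_suml.
apply: (@le_trans _ _ (\sum_(j < n.+1) \sum_(i < n.+1)
    ((if (i == ord_max) && (j == ord_max) then (Gi ord_max ord_max + e) * P ^+ 2 else 0)
    + (M + 1) * (q * P)))).
  by apply: ler_sum => j _; apply: ler_sum => i _; rewrite [w^T j 0]mxE; exact: term.
under eq_bigr do rewrite big_split/=; rewrite big_split/= lerD//.
  rewrite (bigD1 ord_max)//= (bigD1 ord_max)//= !eqxx/= !big1 ?addr0//.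
    by move=> j /negbTE nj; apply: big1 => i _; rewrite nj andbF.
  by move=> i /negbTE ->.
rewrite !sumr_const card_ord -mulrnA -[leLHS]mulr_natl mulrA//.
Qed.

(* Where [q] is at most a small multiple of [F] the gradient of the test
   function is essentially radial; elsewhere it is controlled by [q] alone. *)
Lemma gradient_power_le (A M s p eta : R) : 1 < p -> 0 < A -> 0 <= M -> 0 <= s -> 0 < eta ->
  exists tau C, [/\ 0 < tau <= 1, 0 <= C &
  forall (K Gi : 'M[R]_n.+1) (w : V) (F q : R),
    Gi ord_max ord_max = A -> (forall i j, `|K i j - Gi i j| <= tau) ->
    (forall i j, `|Gi i j| <= M) -> 0 <= F -> 0 <= q ->
    `|w 0 ord_max| <= s * F + q -> (forall i, i != ord_max -> `|w 0 i| <= q) ->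
    Num.sqrt ((w *m K *m w^T) 0 0) `^ p <=
      ((Num.sqrt A * s) `^ p + eta) * F `^ p + C * q `^ p].
Proof.
move=> p1 A0 M0 s0 eta0; set N := (n.+1 * n.+1)%:R * (M + 1).
have N0 : 0 <= N by rewrite mulr_ge0//; lra.
(* [c t * F ^+ 2] is the bound of [quad_form_split_le] for [e = t] and [q = t * F]. Since
   [c 0 = A * s ^+ 2], continuity at 0 yields [tau]. *)
pose c (t : R) := (A + t) * (s + t) ^+ 2 + N * (t * (s + t)).
have cc : {for 0, continuous (fun t : R => `|Num.sqrt (c t)| `^ p)}.
  apply: (@continuous_comp R R R (fun t => Num.sqrt (c t)) (fun y => `|y| `^ p)); last first.
    by apply: abs_powR_continuous; lra.
  apply: (@continuous_comp R R R c Num.sqrt); last exact: sqrt_continuous.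
  rewrite /c; apply: cvgD; apply: cvgM.
  - by apply: cvgD; [exact: cvg_cst|exact: cvg_id].
  - rewrite expr2; under eq_fun do rewrite expr2.
    by apply: cvgM; apply: cvgD; [exact: cvg_cst|exact: cvg_id|exact: cvg_cst|exact: cvg_id].
  - exact: cvg_cst.
  - by apply: cvgM; [exact: cvg_id|apply: cvgD; [exact: cvg_cst|exact: cvg_id]].
have [t0 t00 Ht0] := (norm_continuousP _ _).1 cc _ eta0.
pose tau := Num.min 1 (t0 / 2).
have tau0 : 0 < tau by rewrite lt_min ltr01 divr_gt0.
have tau1 : tau <= 1 by rewrite ge_min lexx.
have taut : tau < t0.
  by apply: (@le_lt_trans _ _ (t0 / 2)); [rewrite ge_min lexx orbT|lra].
have ctau : Num.sqrt (c tau) `^ p <= (Num.sqrt A * s) `^ p + eta.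
  have := Ht0 tau; rewrite subr0 gtr0_norm// => /(_ taut).
  have -> : c 0 = A * s ^+ 2 by rewrite /c; ring.
  rewrite !(ger0_norm (sqrtr_ge0 _)) sqrtrM ?(ltW A0)// sqrtr_sqr (ger0_norm s0).
  by rewrite ltr_norml => /andP[_]; lra.
(* When [q > tau * F], the radial bound [s * F + q] is at most [P * q] and the whole form at most
   [D * q ^+ 2]. *)
pose P := s / tau + 1.
have P1 : 1 <= P by rewrite lerDr divr_ge0// ltW.
pose D := (A + 1) * P ^+ 2 + N * P.
have D0 : 0 <= D by rewrite addr_ge0// mulr_ge0 ?sqr_ge0//; lra.
exists tau, (Num.sqrt D `^ p); split; [by rewrite tau0|exact: powR_ge0|].
move=> K Gi w F q GA HK HM F0 q0 wn wi.
have sF0 : 0 <= s * F by rewrite mulr_ge0.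
have := @quad_form_split_le K Gi w tau M (s * F + q) q.
rewrite GA (ltW tau0) tau1 => /(_ isT (ltW A0) HK HM q0) H.
have {}H := H ltac:(by rewrite lerDr) wn wi; rewrite -/N in H.
have [qF|Fq] := leP q (tau * F).
  apply: (@le_trans _ _ (((Num.sqrt A * s) `^ p + eta) * F `^ p)); last first.
    by rewrite lerDl mulr_ge0 ?powR_ge0.
  apply: (@le_trans _ _ (Num.sqrt (c tau) `^ p * F `^ p)); last first.
    by rewrite ler_wpM2r ?powR_ge0.
  apply: sqrt_powR_le => //; [lra| |].
    by rewrite /c addr_ge0// !mulr_ge0 ?sqr_ge0//; lra.
  apply: le_trans H _; rewrite /c.
  have H1 : (s * F + q) <= (s + tau) * F by lra.
  have H2 : (s * F + q) ^+ 2 <= ((s + tau) * F) ^+ 2.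
    by rewrite lerXn2r ?nnegrE//; [lra|rewrite mulr_ge0//; lra].
  have H3 : q * (s * F + q) <= (tau * F) * ((s + tau) * F).
    by apply: ler_pM => //; lra.
  have -> : F ^+ 2 * ((A + tau) * (s + tau) ^+ 2 + N * (tau * (s + tau))) =
    (A + tau) * ((s + tau) * F) ^+ 2 + N * ((tau * F) * ((s + tau) * F)) by ring.
  by apply: lerD; apply: ler_wpM2l => //; lra.
apply: (@le_trans _ _ (Num.sqrt D `^ p * q `^ p)); last first.
  by rewrite lerDr mulr_ge0 ?powR_ge0// addr_ge0 ?powR_ge0// ltW.
apply: sqrt_powR_le => //; first lra.
apply: le_trans H _; rewrite /D.
have H1 : s * F + q <= P * q.
  rewrite /P mulrDl mul1r lerD2r -mulrA ler_wpM2l// ler_pdivlMl//; exact: ltW.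
have H2 : (s * F + q) ^+ 2 <= (P * q) ^+ 2.
  by rewrite lerXn2r ?nnegrE//; [lra|rewrite mulr_ge0//; lra].
have -> : q ^+ 2 * ((A + 1) * P ^+ 2 + N * P) = (A + 1) * (P * q) ^+ 2 + N * (q * (P * q)) by ring.
apply: lerD; first by apply: ler_pM; rewrite ?sqr_ge0//; lra.
by apply: ler_wpM2l => //; apply: ler_wpM2l.
Qed.

End GradientAlgebra.

(** * A single test function bounds the eigenvalue *)

Section TestEnergy.
Variables (R : realType) (n : nat) (X : charted_space R n) (g : metric_field X).
Hypothesis X_mf : smooth_manifold X.
Local Open Scope ereal_scope.

Lemma ediv_le (x y : \bar R) (c : R) : (0 <= c)%R -> 0 <= x -> 0 < y -> x <= c%:E * y ->
  x / y <= c%:E.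
Proof.
move=> c0 x0; case: y => [y| |]//; last by rewrite invey mule0 lee_fin.
rewrite lte_fin => y0; rewrite -EFinM; case: x x0 => [x| |]// x0.
rewrite !lee_fin => xc; rewrite inver gt_eqF// -EFinM lee_fin.
by rewrite ler_pdivrMr.
Qed.

Lemma integral_rV0 d : integral_rV (fun _ : 'rV[R]_d => 0) = 0.
Proof. by elim: d => //= d IH; rewrite IH integral0. Qed.

Lemma vol_integral0 (A : set X) : vol_integral g A (fun=> 0%R) = 0.
Proof.
rewrite /vol_integral eseries0// => j _ _.
rewrite (_ : (fun y => _) = fun=> 0) ?integral_rV0//.
by apply/funext => y; rewrite mul0r mulr0.
Qed.

Lemma grad_norm0 (x : X) : grad_norm g (fun=> 0%R) x = 0%R.
Proof.
rewrite /grad_norm /grad.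
have -> : diff_fun (chart_at x) (fun=> 0%R) x = 0%R.
  apply/rowP => i; rewrite !mxE (_ : _ \o _ = cst 0%R)// rpartialE.
    by rewrite derive_cst.
  exact: derivable_cst.
by rewrite mul0mx /vec_norm !mul0mx mxE sqrtr0.
Qed.

(** A test function, as a constant Cauchy sequence, is an element of the completion, and positive Lp
    energy makes it nonzero there. *)
Lemma lambda1p_le_test (p C : R) (Om : set X) (f : X -> R) :
  (1 < p)%R -> (0 <= C)%R -> bounded_smooth_domain g Om -> test_function Om f ->
  0 < Lp_energy g p Om f -> grad_energy g p Om f <= C%:E * Lp_energy g p Om f ->
  lambda1p g p <= C%:E.
Proof.
move=> p1 C0 dOm tf L0 gL.
have p0 : (p != 0)%R by rewrite gt_eqF//; lra.
have g0 : 0 <= grad_energy g p Om f by apply: vol_integral_ge0 => // x _; exact: powR_ge0.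
apply: (@le_trans _ _ (lambda1p_dom g p Om)); first by apply: ereal_inf_lbound; exists Om.
apply: (@le_trans _ _ (rayleigh g p Om (fun=> f))).
  apply: ereal_inf_lbound; exists (fun=> f) => //; split.
    split => // eps e0; exists 0%N => i j _ _.
    rewrite (_ : (fun x => _) = fun=> 0%R); last by apply/funext => x; rewrite subrr.
    rewrite /sobolev_norm /Lp_energy /grad_energy.
    rewrite (_ : (fun x : X => _) = fun=> 0%R); last first.
      by apply/funext => x; rewrite normr0 powR0.
    rewrite [X in _ + vol_integral _ _ X](_ : _ = fun=> 0%R); last first.
      by apply/funext => x; rewrite grad_norm0 powR0.
    rewrite vol_integral0 adde0 poweR0r ?lte_fin// invr_eq0//.
  rewrite /W1p0_zero => c0.
  have S : sobolev_norm g p Om f = 0.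
    by apply: (cvg_unique _ _ c0) => //; exact: cvg_cst.
  have S0 := poweR_eq0_eq0 (adde_ge0 (ltW L0) g0) S.
  by have := lt_le_trans L0 (leeDl _ g0); rewrite S0 ltxx.
have lc (a : \bar R) : limn (fun=> a) = a.
  by apply: cvg_lim; [exact: ereal_hausdorff|exact: cvg_cst].
have -> : rayleigh g p Om (fun=> f) = grad_energy g p Om f / Lp_energy g p Om f.
  exact: (f_equal2 (fun a b => a / b) (lc _) (lc _)).
exact (ediv_le C0 g0 L0 gL).
Qed.

End TestEnergy.

(** * The logarithmic cut-off in coordinates *)

Section TestFunction.
Variables (R : realType) (n : nat) (s L w : R) (y0 : 'rV[R]_n.+1).
Hypotheses (s_ge0 : 0 <= s) (L_gt0 : 0 < L) (w_gt0 : 0 < w).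
Local Notation V := 'rV[R]_n.+1.
Local Notation e i := (@basis_vec R n i).

(* On the support of the last factor, [- 3 * L <= ln t <= - 2 * L]. *)
Definition test_factor (i : 'I_n.+1) (t : R) : R :=
  if i == ord_max then expR (s * ln t) * bump (2 / L * ln t + 5)
  else bump ((t - y0 0 i) / w).

Definition test_factor' (i : 'I_n.+1) (t : R) : R :=
  if i == ord_max then
    t^-1 * (s * (expR (s * ln t) * bump (2 / L * ln t + 5)) +
            2 / L * (expR (s * ln t) * bump' (2 / L * ln t + 5)))
  else w^-1 * bump' ((t - y0 0 i) / w).

Definition test_fun (y : V) : R := \prod_i test_factor i (y 0 i).

Lemma test_factor_derive i (t : R) : (i == ord_max -> 0 < t) ->
  is_derive t (1 : R) (test_factor i) (test_factor' i t).
Proof.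
rewrite /test_factor /test_factor'; case: (i == ord_max) => [/(_ isT) t0|_].
  have dl := is_derive1_ln t0.
  have d1 := @is_deriveZ R R R _ s t 1 _ dl.
  have d2 := @is_derive1_comp R expR (s \*: @ln R) t _ _ (is_derive_expR _) d1.
  have d3 := @is_deriveZ R R R _ (2 / L) t 1 _ dl.
  have d4 := @is_deriveD R R R _ (cst 5) t 1 _ 0 d3 (is_derive_cst _ _ _).
  have d5 := @is_derive1_comp R (@bump R) _ t _ _ (bump_derive _) d4.
  have d6 := is_deriveM d2 d5.
  by apply: (is_derive_eq d6); rewrite /GRing.scale/=; ring.
have d1 := @is_deriveB R R R id (cst (y0 0 i)) t 1 1 0 (is_derive_id _ _) (is_derive_cst _ _ _).
have d2 := @is_deriveZ R R R _ w^-1 t 1 _ d1.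
have d3 := @is_derive1_comp R (@bump R) _ t _ _ (bump_derive _) d2.
rewrite (_ : (fun t => _) = @bump R \o w^-1 \*: (id - cst (y0 0 i))); last first.
  by apply/funext => z; rewrite /= mulrC.
apply: (is_derive_eq d3); rewrite /GRing.scale/= subr0 mulr1 mulrC; congr (_ * bump' _).
by rewrite mulrC.
Qed.

Lemma test_fun_derive (y : V) i : 0 < y 0 ord_max ->
  is_derive y (e i) test_fun (test_factor' i (y 0 i) * \prod_(j | j != i) test_factor j (y 0 j)).
Proof.
move=> yn; pose rest (z : V) : R := \prod_(j | j != i) test_factor j (z 0 j).
have dr : is_derive y (e i) rest 0.
  have E : (fun h : R => h^-1 *: ((rest \o shift y) (h *: e i) - rest y)) = cst 0.
    apply/funext => h; rewrite (_ : (rest \o shift y) (h *: e i) = rest y).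
      by rewrite subrr scaler0.
    apply: eq_bigr => j ji; congr test_factor.
    by rewrite mxE [X in X + _]mxE basis_vecE eq_sym (negbTE ji) mulr0 add0r.
  apply: DeriveDef; first by rewrite /derivable E; exact: is_cvg_cst.
  by rewrite /derive E; exact: lim_cst.
have inn : i == ord_max -> 0 < y 0 i by move=> /eqP ->.
have dt := test_factor_derive inn.
have dc : is_derive y (e i) (test_factor i \o (fun z : V => z 0 i)) (test_factor' i (y 0 i)).
  have [dt1 dt2] := dt; have [dc1 dc2] := derive_coord y (e i) i.
  apply: (is_derive_eq (derive_comp1 dc1 dt1)).
  by rewrite derive1E dt2 dc2 basis_vecE eqxx mulr1.
rewrite (_ : test_fun = (test_factor i \o (fun z : V => z 0 i)) * rest); last first.
  by apply/funext => z; rewrite /test_fun (bigD1 i).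
apply: (is_derive_eq (is_deriveM dc dr)).
by rewrite scaler0 add0r /GRing.scale/= mulrC.
Qed.

Lemma test_fun_Ck m (U : set V) (T : V -> V) : open U ->
  (forall j, Ck m U (fun y => T y 0 j)) -> (forall y, U y -> 0 < T y 0 ord_max) ->
  Ck m U (fun y => test_fun (T y)).
Proof.
move=> oU cT T0; apply: (@Ck_prod _ _ m U _ xpredT) => // j _.
rewrite /test_factor; case: (altP (j =P ord_max)) => [->|_].
  have cl : Ck m U (fun y => ln (T y 0 ord_max)) by apply: Ck_ln.
  apply: CkM => //.
    by apply: Ck_expR => //; apply: CkM => //; exact: Ck_cst.
  apply: Ck_bump => //; apply: CkD => //; last exact: Ck_cst.
  by apply: CkM => //; exact: Ck_cst.
apply: Ck_bump => //; apply: CkM => //; last exact: Ck_cst.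
by apply: CkD => //; exact: Ck_cst.
Qed.

Lemma test_factor_ge0 i t : 0 <= test_factor i t.
Proof.
rewrite /test_factor; case: ifP => _; last exact: bump_ge0.
by apply: mulr_ge0; [exact: expR_ge0|exact: bump_ge0].
Qed.

Lemma test_fun_ge0 y : 0 <= test_fun y.
Proof. by apply: prodr_ge0 => i _; exact: test_factor_ge0. Qed.

Local Notation S := (slab y0 w (expR (- 3 * L)) (expR (- 2 * L))).

(** The constants [2 / L] and 5 are those of the affine map that sends [[-3L, -2L]] onto [[-1, 1]],
    where the bump lives. *)
Lemma ln_bounds (t : R) : 0 < t -> ~~ (expR (- 3 * L) <= t <= expR (- 2 * L)) ->
  1 <= `|2 / L * ln t + 5|.
Proof.
move=> t0 nt; have tE : expR (ln t) = t by rewrite lnK// posrE.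
move: nt; rewrite -tE !ler_expR tE => nt.
set z := ln t in nt *; have zE : z = L * (z / L) by rewrite mulrCA mulfV ?mulr1// gt_eqF.
set u := z / L in zE; rewrite (_ : 2 / L * z = 2 * u); last by rewrite /u; ring.
rewrite ler_normr; move: nt; rewrite negb_and -!ltNge zE [L * u]mulrC !ltr_pM2r//.
by move=> /orP[] H; apply/orP; [right|left]; lra.
Qed.

Lemma test_factor_out i (t : R) : (i == ord_max -> 0 < t) ->
  ~~ ((if i == ord_max then expR (- 3 * L) else y0 0 i - w) <= t <=
      (if i == ord_max then expR (- 2 * L) else y0 0 i + w)) ->
  test_factor i t = 0 /\ test_factor' i t = 0.
Proof.
rewrite /test_factor /test_factor'; case: (i == ord_max) => [/(_ isT) t0|_] nt.
  have [b1 b2] := bump_eq0 (ln_bounds t0 nt).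
  by rewrite b1 b2 !mulr0 addr0 mulr0.
have H : 1 <= `|(t - y0 0 i) / w|.
  rewrite normrM normfV (gtr0_norm w_gt0) ler_pdivlMr// mul1r.
  by move: nt; rewrite -ler_distlC distrC -ltNge => /ltW.
by have [b1 b2] := bump_eq0 H; rewrite b1 b2 mulr0.
Qed.

Lemma not_slab (y : V) : ~ S y -> exists i, ~~
  ((if i == ord_max then expR (- 3 * L) else y0 0 i - w) <= y 0 i <=
      (if i == ord_max then expR (- 2 * L) else y0 0 i + w)).
Proof.
move=> nS; apply: contra_notP nS => /forallNP H i; have /negP := H i.
by rewrite negbK => H'; rewrite /= in_itv.
Qed.

Lemma test_fun_out (y : V) i : 0 < y 0 ord_max -> ~ S y ->
  test_fun y = 0 /\ test_factor' i (y 0 i) * \prod_(j | j != i) test_factor j (y 0 j) = 0.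
Proof.
move=> yn /not_slab[j nj].
have jn : j == ord_max -> 0 < y 0 j by move=> /eqP ->.
have [T T'] := test_factor_out jn nj.
split; first by rewrite /test_fun (bigD1 j)//= T mul0r.
have [<-|ji] := eqVneq j i; first by rewrite T' mul0r.
by rewrite (bigD1 j)//= T mul0r mulr0.
Qed.

Lemma test_prod_le (y : V) i : \prod_(j | j != i) test_factor j (y 0 j) <=
  (if i == ord_max then 1 else expR (s * ln (y 0 ord_max))).
Proof.
apply: (@le_trans _ _ (\prod_(j | j != i)
    (if j == ord_max then expR (s * ln (y 0 ord_max)) else 1))).
  apply: ler_prod => j _; rewrite test_factor_ge0 /= /test_factor.
  case: (altP (j =P ord_max)) => [->|_]; last exact: bump_le1.
  by rewrite ler_piMr ?expR_ge0 ?bump_le1.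
case: (altP (i =P ord_max)) => [->|ni].
  by rewrite big1// => j /negbTE ->.
have ni' : ord_max != i by rewrite eq_sym.
by rewrite (bigD1 ord_max)//= eqxx big1 ?mulr1// => j /andP[_ /negbTE ->].
Qed.

(** What differentiating a cut-off costs: [1 / L] times the size [y_n ^ s] of the function without
    its cut-offs. *)
Definition test_error (B : R) (y : V) : R := \1_S y * (B / L * expR (s * ln (y 0 ord_max))).

(** [y_n] times the radial derivative reproduces the power [y_n ^ s] with the factor [s]; the rest
    falls on the logarithmic bump, whose argument has derivative [2 / L] with respect to
    [ln y_n]. *)
Lemma test_fun_radial B (y : V) : 0 < y 0 ord_max -> 2 * bump'_max R <= B ->
  `|y 0 ord_max * 'D_(e ord_max) test_fun y| <= s * test_fun y + test_error B y.
Proof.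
move=> yn HB; have [_ ->] := test_fun_derive ord_max yn; rewrite /test_error indicE.
have [|/negP nS] := boolP (y \in S); last first.
  have [-> ->] := @test_fun_out y ord_max yn (fun H => nS (mem_set H)).
  by rewrite !mulr0 mul0r normr0 addr0.
rewrite inE => Sy; rewrite mul1r.
set P := \prod_(j | j != ord_max) _.
have -> : test_fun y = test_factor ord_max (y 0 ord_max) * P.
  by rewrite /test_fun (bigD1 ord_max).
have P0 : 0 <= P by apply: prodr_ge0 => j _; exact: test_factor_ge0.
have P1 : P <= 1 by have := @test_prod_le y ord_max; rewrite eqxx.
rewrite /test_factor /test_factor' eqxx.
set E := expR _; set b := bump _; set b' := bump' _.
have -> : y 0 ord_max * ((y 0 ord_max)^-1 * (s * (E * b) + 2 / L * (E * b')) * P) =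
   s * (E * b * P) + 2 / L * E * b' * P.
  by rewrite -(mulrA (y 0 ord_max)^-1) mulVKf ?gt_eqF//; ring.
apply: le_trans (ler_normD _ _) _; apply: lerD.
  have Eb : 0 <= E * b by apply: mulr_ge0; [exact: expR_ge0|exact: bump_ge0].
  by rewrite ger0_norm// mulr_ge0// mulr_ge0.
have E0 : 0 <= 2 / L * E by rewrite mulr_ge0 ?expR_ge0// divr_ge0// ltW.
rewrite normrM normrM (ger0_norm E0) (ger0_norm P0).
apply: (@le_trans _ _ (2 / L * E * bump'_max R * 1)).
  apply: ler_pM => //; first by rewrite mulr_ge0.
  by rewrite ler_wpM2l// bump'_le.
have -> : 2 / L * E * bump'_max R * 1 = 2 * bump'_max R * (L^-1 * E) by ring.
by rewrite -[leRHS]mulrA ler_wpM2r// mulr_ge0 ?expR_ge0// invr_ge0 ltW.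
Qed.

(** The horizontal cut-off costs [y_n / w], which is at most [expR (- 2 * L) / w] on the slab. *)
Lemma test_fun_tangential B (y : V) i : 0 < y 0 ord_max -> i != ord_max ->
  expR (- 2 * L) / w * bump'_max R <= B / L ->
  `|y 0 ord_max * 'D_(e i) test_fun y| <= test_error B y.
Proof.
move=> yn ni HB; have [_ ->] := test_fun_derive i yn; rewrite /test_error indicE.
have [|/negP nS] := boolP (y \in S); last first.
  have [_ ->] := @test_fun_out y i yn (fun H => nS (mem_set H)).
  by rewrite !mulr0 mul0r normr0.
rewrite inE => /slabP[/andP[_ yb] _]; rewrite mul1r.
set P := \prod_(j | j != i) _.
have P0 : 0 <= P by apply: prodr_ge0 => j _; exact: test_factor_ge0.
have P1 : P <= expR (s * ln (y 0 ord_max)).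
  by have := @test_prod_le y i; rewrite (negbTE ni).
rewrite /test_factor' (negbTE ni) mulrA normrM (ger0_norm P0).
apply: ler_pM => //; apply: le_trans _ HB.
rewrite mulrA normrM ler_pM// ?bump'_le//.
by rewrite normrM (gtr0_norm yn) gtr0_norm ?invr_gt0// ler_wpM2r// invr_ge0 ltW.
Qed.

(** The exponents 11/4 and 9/4 are the preimages of -1/2 and 1/2 under the affine map in the
    logarithmic bump, so on this inner slab every bump is at least [bump_min]. *)
Lemma test_fun_lower (y : V) :
  slab y0 (w / 2) (expR (- (11 / 4) * L)) (expR (- (9 / 4) * L)) y ->
  bump_min R ^+ n.+1 * expR (s * ln (y 0 ord_max)) <= test_fun y.
Proof.
move=> /slabP[/andP[ay yb] Hy].
have yn : 0 < y 0 ord_max by apply: lt_le_trans ay; exact: expR_gt0.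
apply: (@le_trans _ _ (\prod_(j < n.+1) (bump_min R *
   (if j == ord_max then expR (s * ln (y 0 ord_max)) else 1)))).
  rewrite big_split/= prodr_const card_ord ler_wpM2l//; first exact/exprn_ge0/ltW/bump_min_gt0.
  by rewrite (bigD1 ord_max)//= eqxx big1 ?mulr1// => j /negbTE ->.
apply: ler_prod => j _; apply/andP; split.
  by apply: mulr_ge0; [exact/ltW/bump_min_gt0|case: ifP => // _; exact: expR_ge0].
rewrite /test_factor; case: (altP (j =P ord_max)) => [->|nj]; last first.
  rewrite mulr1; apply: bump_ge; rewrite normrM normfV (gtr0_norm w_gt0).
  by rewrite ler_pdivrMr// mulrC; exact: Hy.
rewrite mulrC ler_wpM2l ?expR_ge0//; apply: bump_ge.
have tE : expR (ln (y 0 ord_max)) = y 0 ord_max by rewrite lnK// posrE.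
move: ay yb; rewrite -tE !ler_expR tE.
set z := ln _; have zE : z = L * (z / L) by rewrite mulrCA mulfV ?mulr1// gt_eqF.
set u := z / L in zE; rewrite (_ : 2 / L * z = 2 * u); last by rewrite /u; ring.
rewrite zE [L * u]mulrC !ler_pM2r// => H1 H2.
by rewrite ler_norml; apply/andP; split; lra.
Qed.

End TestFunction.

(** * Metric and volume near a boundary point *)

Section ChartUpperBound.
Variables (R : realType) (n : nat) (X : charted_space R n).
Hypothesis X_mf : smooth_manifold X.
Local Notation V := 'rV[R]_n.+1.
Local Notation e i := (@basis_vec R n i).
Local Notation icod := (@icod R n X).
Hypothesis bdry : forall k (x : X), dom X k x -> mboundary x -> phi X k x 0 ord_max = 0.
Variable g : metric_field X.
Hypothesis g_metric : riemannian_metric (@minterior R n X) g.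
Hypothesis g_cont : forall (k : nat) (y : V), icod k y -> forall i j,
  {for y, continuous (fun y => g k (psi X k y) i j)}.
Variables (k : nat) (y0 : V) (G : 'M[R]_n.+1).
Hypothesis y0_max : y0 0 ord_max = 0.
Hypothesis G_posdef : posdef G.
Hypothesis G_lim : forall i j, (fun y : V => y 0 ord_max ^+ 2 * g k (psi X k y) i j) @
  within [set y : V | 0 < y 0 ord_max] (nbhs y0) --> G i j.
(** [rr] replaces the height [y_n] by a continuous function on the whole space, comparable to it in
    this chart. An error term written with [rr] makes sense in every chart, as [vol_integral_chart]
    requires. *)
Variables (rr : X -> R) (b1 b2 : R).
Hypotheses (b1_gt0 : 0 < b1) (b2_gt0 : 0 < b2).
Hypothesis rr_ge0 : forall x, 0 <= rr x.
Hypothesis rr_gt0 : forall x, minterior x -> 0 < rr x.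
Hypothesis rr_cont : forall x, minterior x -> {for x, continuous rr}.

Definition scaled_metric (y : V) : 'M[R]_n.+1 := y 0 ord_max ^+ 2 *: g k (psi X k y).

Lemma G_det_gt0 : 0 < \det G. Proof. exact: posdef_det_gt0. Qed.

(** This entry of the inverse is the value of the form [G] at the nonzero vector
    [e ord_max *m invmx G]. *)
Lemma G_inv_gt0 : 0 < invmx G ord_max ord_max.
Proof.
have uG : G \in unitmx by rewrite unitmxE unitfE gt_eqF ?G_det_gt0.
pose v : V := e ord_max *m invmx G.
have v0 : v != 0.
  apply: contraTneq (oner_neq0 R) => v0.
  have : (v *m G) 0 ord_max = 1 by rewrite mulmxKV// basis_vecE eqxx.
  by rewrite v0 mul0mx mxE => <-; rewrite eqxx.
have := G_posdef v0; rewrite {1}/v mulmxKV// /v trmx_mul.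
by rewrite /basis_vec -rowE trmx_delta -colE !mxE.
Qed.

Lemma nbhs_norm_ball (P : V -> Prop) : (\forall y \near y0, P y) ->
  exists2 d, 0 < d & forall y, `|y - y0| < d -> P y.
Proof.
move=> NP; have [d d0 dU] := @open_norm_ball R _ [set y | P y]° y0 (@open_interior _ _) NP.
by exists d => // y /dU /interior_subset.
Qed.

Lemma metric_near_limit tau : 0 < tau -> exists2 del, 0 < del &
  forall y : V, `|y - y0| < del -> 0 < y 0 ord_max ->
    (forall i j, `|invmx (scaled_metric y) i j - invmx G i j| <= tau) /\
    \det G / 2 <= \det (scaled_metric y) <= 2 * \det G.
Proof.
move=> tau0; have dG := G_det_gt0.
have lim i j : (fun y => scaled_metric y i j) @
    within [set y : V | 0 < y 0 ord_max] (nbhs y0) --> G i j.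
  by rewrite /scaled_metric; under eq_fun do rewrite mxE; exact: G_lim.
have FF : Filter (within [set y : V | 0 < y 0 ord_max] (nbhs y0)) by exact: within_filter.
have N1 : within [set y : V | 0 < y 0 ord_max] (nbhs y0)
    [set y : V | forall i j, `|invmx (scaled_metric y) i j - invmx G i j| <= tau].
  apply: (@filter_forall V 'I_n.+1 (fun i => [set y : V | forall j,
    `|invmx (scaled_metric y) i j - invmx G i j| <= tau]) _ FF) => i.
  apply: (@filter_forall V 'I_n.+1 (fun j => [set y : V |
    `|invmx (scaled_metric y) i j - invmx G i j| <= tau]) _ FF) => j.
  have dG0 : \det G != 0 by rewrite gt_eqF.
  have /cvgrPdist_le/(_ _ tau0) := @cvg_invmx R V _ FF _ _ _ i j dG0 lim.
  by apply: (@filterS V _ FF) => y; rewrite distrC.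
have N2 : within [set y : V | 0 < y 0 ord_max] (nbhs y0)
    [set y : V | `|\det G - \det (scaled_metric y)| <= \det G / 2].
  have d2 : 0 < \det G / 2 by rewrite divr_gt0.
  by have /cvgrPdist_le/(_ _ d2) := @cvg_det R V _ FF _ _ _ lim.
have [d1 d10 H1] := nbhs_norm_ball N1; have [d2 d20 H2] := nbhs_norm_ball N2.
exists (Num.min d1 d2); first by rewrite lt_min d10.
move=> y; rewrite lt_min => /andP[yd1 yd2] yn; split; first exact: H1.
have := H2 _ yd2 yn; rewrite /= ler_distlC => /andP[h1 h2].
by apply/andP; split; lra.
Qed.

Section NearBoundary.
Variables (del tau : R).
Hypothesis near_icod : forall y : V, `|y - y0| < del -> 0 < y 0 ord_max -> icod k y.
Hypothesis near_rr : forall y : V, `|y - y0| < del -> 0 < y 0 ord_max ->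
  b1 * y 0 ord_max <= rr (psi X k y) <= b2 * y 0 ord_max.
Hypothesis near_metric : forall y : V, `|y - y0| < del -> 0 < y 0 ord_max ->
    (forall i j, `|invmx (scaled_metric y) i j - invmx G i j| <= tau) /\
    \det G / 2 <= \det (scaled_metric y) <= 2 * \det G.

Lemma vdens_scaled (y : V) : 0 < y 0 ord_max ->
  vdens g k y = y 0 ord_max ^- n.+1 * Num.sqrt (\det (scaled_metric y)).
Proof.
move=> yn; rewrite /scaled_metric detZ -exprM mulnC exprM sqrtrM ?sqr_ge0//.
by rewrite sqrtr_sqr gtr0_norm ?exprn_gt0// mulKf// gt_eqF// exprn_gt0.
Qed.

(** The volume density is of order [y_n ^ (- n - 1)]; the factor [rr ^+ n] brings it to order
    [1 / y_n]. *)
Lemma density_bounds (kap : R) (y : V) : 0 < kap -> `|y - y0| < del -> 0 < y 0 ord_max ->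
  kap * b1 ^+ n * Num.sqrt (\det G / 2) * (y 0 ord_max)^-1 <=
  chart_density g (fun x => kap * rr x ^+ n) k y <=
  kap * b2 ^+ n * Num.sqrt (2 * \det G) * (y 0 ord_max)^-1.
Proof.
move=> kap0 yd yn; rewrite /chart_density vdens_scaled//.
have /andP[r1 r2] := near_rr yd yn; have [_ /andP[d1 d2]] := near_metric yd yn.
set t := y 0 ord_max in yn r1 r2 *; set rho := rr _ in r1 r2 *.
have s1 := ler_wsqrtr d1; have s2 := ler_wsqrtr d2.
have t1 : 0 <= b1 * t by rewrite mulr_ge0// ltW.
have rho0 : 0 <= rho := le_trans t1 r1.
have e1 : (b1 * t) ^+ n <= rho ^+ n by rewrite lerXn2r.
have e2 : rho ^+ n <= (b2 * t) ^+ n by rewrite lerXn2r// nnegrE (le_trans rho0).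
have tn : 0 < t ^- n.+1 by rewrite invr_gt0 exprn_gt0.
have tE (b c : R) : kap * b ^+ n * c * t^-1 = kap * ((b * t) ^+ n * (t ^- n.+1 * c)).
  rewrite exprMn exprS invfM; have : t ^+ n != 0 by rewrite expf_neq0// gt_eqF.
  have : t != 0 by rewrite gt_eqF.
  by set T := t ^+ n => t0 T0; field; rewrite t0 T0.
rewrite !tE -!(mulrA kap) !ler_pM2l//; apply/andP; split.
  apply: ler_pM => //; first by rewrite exprn_ge0.
    by rewrite mulr_ge0 ?sqrtr_ge0// ltW.
  by rewrite ler_pM2l.
apply: ler_pM => //; first by rewrite exprn_ge0.
  by rewrite mulr_ge0 ?sqrtr_ge0// ltW.
by rewrite ler_pM2l.
Qed.

Lemma slab_volume (w a b kap : R) : 0 <= w -> 0 < a -> a < b -> 0 < kap ->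
  (forall y, slab y0 w a b y -> `|y - y0| < del) ->
  (vol_integral g (psi X k @` slab y0 w a b) (fun x => (kap * rr x ^+ n)%R) <=
    (cov_cst R n * (kap * b2 ^+ n * Num.sqrt (2 * \det G) * ((2 * w) ^+ n * (ln b - ln a))))%:E)%E /\
  ((kap * b1 ^+ n * Num.sqrt (\det G / 2) * ((2 * w) ^+ n * (ln b - ln a)))%:E <=
    (cov_cst R n)%:E * vol_integral g (psi X k @` slab y0 w a b) (fun x => (kap * rr x ^+ n)%R))%E.
Proof.
move=> w0 a0 ab kap0 Sd.
have pos y : slab y0 w a b y -> 0 < y 0 ord_max.
  by move=> /slabP[/andP[ay _] _]; exact: lt_le_trans ay.
have sS : sigma_compact (slab y0 w a b) by apply: compact_sigma_compact; exact: slab_compact.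
have mS := sigma_compact_borel sS.
have Si : slab y0 w a b `<=` icod k by move=> y Sy; apply: near_icod; [exact: Sd|exact: pos].
have h0 x : minterior x -> 0 < kap * rr x ^+ n.
  by move=> ix; rewrite mulr_gt0// exprn_gt0// rr_gt0.
have hc x : minterior x -> {for x, continuous (fun x => kap * rr x ^+ n)}.
  move=> ix; apply: cvgM; first exact: cvg_cst.
  by apply: (@continuous_comp _ _ _ rr (fun t => t ^+ n)); [exact: rr_cont|exact: exprn_continuous].
have [U1 U2] := vol_integral_chart X_mf bdry g_metric g_cont h0 hc Si sS.
have mi : measurable_fun (slab y0 w a b : set (borel_rV R n.+1)) (fun y : V => (y 0 ord_max)^-1).
  apply: continuous_at_measurable => // y /pos y0'.
  apply: (@continuous_comp V R R (fun y => y 0 ord_max) (fun t => t^-1)).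
    exact: coord_continuous.
  by apply: inv_continuous; rewrite gt_eqF.
have intE (c : R) : 0 <= c ->
   (\int[leb_rV R n.+1]_(y in slab y0 w a b) (c * (y 0 ord_max)^-1)%:E =
    (c * ((2 * w) ^+ n * (ln b - ln a)))%:E)%E.
  move=> c0; under eq_integral do rewrite EFinM.
  rewrite ge0_integralZl_EFin//; first by rewrite slab_integral.
  - by move=> y Sy; rewrite lee_fin invr_ge0 ltW// pos.
  - exact/measurable_EFinP.
have mono (u v : V -> R) : (forall y, slab y0 w a b y -> 0 <= u y <= v y) ->
   (\int[leb_rV R n.+1]_(y in slab y0 w a b) (u y)%:E <=
    \int[leb_rV R n.+1]_(y in slab y0 w a b) (v y)%:E)%E.
  move=> uv; rewrite integral_mkcond [leRHS]integral_mkcond.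
  apply: ge0_le_integralT => y; rewrite ?patchE; case: ifP => //;
    by rewrite inE => /uv/andP[]; rewrite ?lee_fin.
have c0 (c : R) : 0 < c -> 0 <= kap * c ^+ n.
  by move=> c_gt0; rewrite mulr_ge0 ?exprn_ge0// ltW.
split.
  apply: le_trans U1 _; rewrite [leRHS]EFinM lee_wpmul2l//.
    by rewrite lee_fin ltW// cov_cst_gt0.
  rewrite -(intE _ (mulr_ge0 (c0 _ b2_gt0) (sqrtr_ge0 _))); apply: mono => y Sy.
  have /andP[_ ->] := density_bounds kap0 (Sd _ Sy) (pos _ Sy); rewrite andbT.
  by apply: ltW; apply: chart_density_gt0 => //; exact: Si.
apply: le_trans _ U2.
rewrite -(intE _ (mulr_ge0 (c0 _ b1_gt0) (sqrtr_ge0 _))); apply: mono => y Sy.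
have /andP[-> _] := density_bounds kap0 (Sd _ Sy) (pos _ Sy); rewrite andbT.
by rewrite !mulr_ge0 ?sqrtr_ge0 ?c0// ?exprn_ge0 ?invr_ge0 ?ltW// pos.
Qed.

End NearBoundary.

End ChartUpperBound.

(** * The test domain, a Euclidean ball close to the face *)

Section TestDomain.
Variables (R : realType) (n : nat) (X : charted_space R n).
Hypothesis X_mf : smooth_manifold X.
Local Notation V := 'rV[R]_n.+1.
Local Notation e i := (@basis_vec R n i).
Local Notation icod := (@icod R n X).
Hypothesis bdry : forall k (x : X), dom X k x -> mboundary x -> phi X k x 0 ord_max = 0.
Variable g : metric_field X.
Hypothesis g_metric : riemannian_metric (@minterior R n X) g.
Variables (k : nat) (y0 : V) (del rho L s : R).
Hypothesis y0_max : y0 0 ord_max = 0.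
Hypothesis near_icod : forall y : V, `|y - y0| < del -> 0 < y 0 ord_max -> icod k y.
Hypotheses (s_ge0 : 0 <= s) (rho_gt0 : 0 < rho) (rho_del : 2 * rho < del) (L_ge1 : 1 <= L).
Hypothesis L_rho : expR (- 2 * L) <= rho.

Definition slab_bot : R := expR (- 3 * L).
Definition slab_top : R := expR (- 2 * L).
(** At height [slab_bot], a ball of radius about [rho] close to the face has horizontal extent of
    order the square root of [slab_bot * rho]. The divisor makes [n.+1] squared widths add up to
    [slab_bot * rho / 2]. *)
Definition slab_width : R := Num.sqrt (slab_bot * rho / (2 * n.+1%:R)).
Definition ball_center : V := y0 + rho *: e ord_max.
(** With its centre at height [rho], the closed ball stays at height at least [slab_bot / 4], away
    from the boundary, and the slab still fits inside. *)
Definition ball_radius : R := rho - slab_bot / 4.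
(** The summand 2 serves the logarithmic cut-off in [test_fun_radial], the square root serves the
    horizontal one through [slab_error]. *)
Definition error_cst : R := bump'_max R * (2 + Num.sqrt (8 * n.+1%:R / rho)).
Local Notation S := (slab y0 slab_width slab_bot slab_top).
Local Notation F := (test_fun s L slab_width y0).

Let L_gt0 : 0 < L. Proof. exact: lt_le_trans L_ge1. Qed.
Let bot_gt0 : 0 < slab_bot. Proof. exact: expR_gt0. Qed.
Let bot_lt_rho : slab_bot < rho.
Proof. by apply: lt_le_trans L_rho; rewrite ltr_expR; have := L_gt0; lra. Qed.

Lemma slab_width_gt0 : 0 < slab_width.
Proof. by rewrite sqrtr_gt0 divr_gt0 ?mulr_gt0// ltr0n. Qed.

Lemma ball_radius_gt0 : 0 < ball_radius.
Proof. by rewrite /ball_radius; have := bot_lt_rho; have := bot_gt0; lra. Qed.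

Lemma ball_center_coord (y : V) i : (y - ball_center) 0 i =
  (y - y0) 0 i - (if i == ord_max then rho else 0).
Proof.
rewrite /ball_center opprD addrA mxE; congr (_ + _).
by rewrite !mxE eqxx /= eq_sym; case: eqP => _; rewrite ?mulr1 ?mulr0.
Qed.

Lemma ball_near (y : V) : esq (y - ball_center) <= ball_radius ^+ 2 ->
  `|y - y0| < del /\ 0 < y 0 ord_max.
Proof.
move=> By; have rad0 := ball_radius_gt0.
have H i : `|(y - ball_center) 0 i| <= ball_radius.
  rewrite -(ler_sqr (normr_ge0 _)) ?nnegrE ?(ltW rad0)//.
  by rewrite real_normK ?num_real// (le_trans (esq_coord _ i)).
split.
  apply: le_lt_trans rho_del; apply: rV_norm_le; first by have := rho_gt0; lra.
  move=> i; have := H i; rewrite ball_center_coord.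
  have -> : (y - y0) 0 i = ((y - y0) 0 i - (if i == ord_max then rho else 0)) +
      (if i == ord_max then rho else 0) by rewrite subrK.
  rewrite addrK => Hi; apply: le_trans (ler_normD _ _) _.
  have : `|if i == ord_max then rho else 0| <= rho.
    by case: ifP => _; rewrite ?normr0 ?ger0_norm// ltW.
  by move: Hi; rewrite /ball_radius; have := bot_gt0; lra.
have := H ord_max; rewrite ball_center_coord eqxx !mxE y0_max subr0 ler_norml => /andP[+ _].
by rewrite /ball_radius; have := bot_gt0; lra.
Qed.

Lemma ball_icod (y : V) : esq (y - ball_center) <= ball_radius ^+ 2 -> icod k y.
Proof. by move=> /ball_near[]; exact: near_icod. Qed.

Lemma slab_ball (y : V) : S y -> esq (y - ball_center) < ball_radius ^+ 2.
Proof.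
move=> /slabP[/andP[ay yb] Hy].
have w0 := slab_width_gt0; have b0 := bot_gt0; have br := bot_lt_rho.
apply: (@le_lt_trans _ _ ((rho - slab_bot) ^+ 2 + \sum_(i < n.+1) slab_width ^+ 2)).
  rewrite /esq (bigD1 ord_max)//= lerD//.
    rewrite ball_center_coord eqxx !mxE y0_max subr0.
    have : y 0 ord_max <= rho by apply: le_trans yb L_rho.
    by rewrite -sqrrN opprB => yr; rewrite lerXn2r ?nnegrE; lra.
  rewrite [leRHS](bigD1 ord_max)//= [X in _ <= X](_ : _ = slab_width ^+ 2 + \sum_(i < n.+1 | i != ord_max) slab_width ^+ 2)//.
  apply: (@le_trans _ _ (\sum_(i < n.+1 | i != ord_max) slab_width ^+ 2)); last first.
    by rewrite lerDr sqr_ge0.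
  apply: ler_sum => i ni; rewrite ball_center_coord (negbTE ni) subr0.
  rewrite -[leLHS]real_normK ?num_real// lerXn2r ?nnegrE ?(ltW w0)//.
  by have := Hy i ni; rewrite !mxE.
rewrite sumr_const card_ord sqr_sqrtr; last first.
  by rewrite divr_ge0 ?mulr_ge0 ?ltW// mulr_gt0.
have -> : slab_bot * rho / (2 * n.+1%:R) *+ n.+1 = slab_bot * rho / 2.
  by rewrite -mulr_natr; field.
by rewrite /ball_radius; nra.
Qed.

(** [slab_top ^+ 2 / slab_bot] is [expR (- L)], and [L ^+ 2 * expR (- L) <= 4]. The horizontal
    cut-off is steep, but it is weighted by the height, and the exponents -3 and -2 let the height
    win. *)
Lemma slab_error : slab_top / slab_width * bump'_max R <= error_cst / L.
Proof.
have w0 := slab_width_gt0; have b0 := bot_gt0.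
have B0 : 0 < bump'_max R by rewrite /bump'_max; lra.
rewrite /error_cst [leRHS]mulrAC mulrC -[leRHS]mulrA ler_pM2l// ler_pdivlMl//.
apply: (@le_trans _ _ (Num.sqrt (8 * n.+1%:R / rho))); last by rewrite lerDr.
have E0 : 0 <= L * (slab_top / slab_width).
  by rewrite mulr_ge0 ?divr_ge0 ?expR_ge0 ?ltW// (lt_le_trans _ L_ge1).
rewrite -(ger0_norm E0) -sqrtr_sqr ler_wsqrtr//.
rewrite !exprMn exprVn sqr_sqrtr; last by rewrite divr_ge0 ?mulr_ge0 ?ltW// mulr_gt0.
have tb : slab_top ^+ 2 = slab_bot * expR (- L).
  by rewrite /slab_top /slab_bot expr2 -!expRD; congr expR; ring.
rewrite tb invfM invrK.
have -> : L ^+ 2 * (slab_bot * expR (- L) * ((slab_bot * rho)^-1 * (2 * n.+1%:R))) =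
  (L ^+ 2 * expR (- L)) * (2 * n.+1%:R / rho).
  by field; rewrite !gt_eqF.
have -> : 8 * n.+1%:R / rho = 4 * (2 * n.+1%:R / rho) by field; rewrite gt_eqF.
rewrite ler_wpM2r//; first by rewrite divr_ge0 ?mulr_ge0 ?ltW// mulr_gt0.
have -> : expR (- L) = (expR (L / 2) ^+ 2)^-1.
  by rewrite -expRM_natl -expRN; congr expR; field.
have h : L / 2 <= expR (L / 2) by apply: le_trans (expR_ge1Dx _); rewrite lerDr.
rewrite ler_pdivrMr ?exprn_gt0 ?expR_gt0//.
have -> : L ^+ 2 = 4 * (L / 2) ^+ 2 by field.
by rewrite ler_wpM2l// lerXn2r ?nnegrE ?expR_ge0//; have := L_gt0; lra.
Qed.

Definition test_domain : set X := coord_ball (X := X) k ball_center ball_radius.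

(** [phi X k] carries no information outside its domain, hence the indicator of the ball. It creates
    no jump, since within the ball the function vanishes off the slab. *)
Definition chart_test_fun (x : X) : R := \1_test_domain x * F (phi X k x).

Local Notation B := [set y : V | esq (y - ball_center) < ball_radius ^+ 2].

Lemma B_icod (y : V) : B y -> icod k y.
Proof. by move=> /ltW; exact: ball_icod. Qed.

Lemma B_near (y : V) : B y -> `|y - y0| < del /\ 0 < y 0 ord_max.
Proof. by move=> /ltW; exact: ball_near. Qed.

Lemma B_open : open B.
Proof.
apply: (@open_comp _ _ (fun y : V => esq (y - ball_center)) [set t | t < ball_radius ^+ 2]).
  by move=> y _; exact: esq_cont.
exact: open_lt.
Qed.

Lemma chart_test_fun_psi (y : V) : B y -> chart_test_fun (psi X k y) = F y.
Proof.
move=> By; rewrite /chart_test_fun (psiK X_mf); last by have [] := B_icod By.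
by rewrite indicE mem_set ?mul1r//; exists y.
Qed.

Lemma chart_test_fun_out (x : X) : ~ (psi X k @` S) x -> chart_test_fun x = 0.
Proof.
move=> nx; rewrite /chart_test_fun indicE.
have [|_] := boolP (x \in test_domain); last by rewrite mul0r.
rewrite inE mul1r => -[y By yx].
have [_ yn] := B_near By.
rewrite -yx (psiK X_mf); last by have [] := B_icod By.
have nS : ~ S y by move=> Sy; apply: nx; exists y.
by have [] := test_fun_out s L_gt0 slab_width_gt0 ord_max yn nS.
Qed.

Lemma slab_image_compact : compact (psi X k @` S).
Proof.
apply: continuous_compact; last exact: slab_compact.
apply: continuous_in_subspaceT => y; rewrite inE => Sy.
by apply: psi_cont => //; apply: B_icod; exact: slab_ball.
Qed.

Lemma test_domain_open : open test_domain.
Proof. exact: (coord_ball_open X_mf ball_icod). Qed.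

(** Two open sets cover the space: the ball, where a smooth function is composed with a transition
    map, and the complement of the image of the slab, where the function is zero. *)
Lemma chart_test_fun_smooth : smooth_fun chart_test_fun.
Proof.
move=> l z cz; have [Bz|nBz] := pselect (test_domain (psi X l z)).
  have iz (y : V) : cod X l y -> test_domain (psi X l y) -> icod l y.
    move=> cy [v Bv vy]; rewrite -(psiK X_mf cy).
    apply/(icod_phi X_mf bdry (psi_dom X_mf cy)); rewrite -vy.
    by apply: (icod_psi X_mf bdry); exact: B_icod.
  pose U : set V := icod l `&` psi X l @^-1` test_domain.
  have oU : open U.
    rewrite openE => y [iy By]; apply: (@filterI V (nbhs y)).
      by apply: open_nbhs_nbhs; split => //; exact: icod_open.
    by apply: (psi_cont X_mf iy); apply: open_nbhs_nbhs; split => //; exact: test_domain_open.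
  have Ut (y : V) : U y -> trans_dom X l k y.
    by move=> [iy By]; split => //; exact: (coord_ball_dom X_mf ball_icod By).
  have Up (y : V) : U y -> 0 < phi X k (psi X l y) 0 ord_max.
    move=> [iy [v Bv <-]]; rewrite (psiK X_mf); last by have [] := B_icod Bv.
    by have [] := B_near Bv.
  exists U, (fun y => F (phi X k (psi X l y))); split => //.
  - by split => //; exact: iz.
  - move=> m; apply/Ck_onP; apply: test_fun_Ck => // j.
    by apply: (@Ck_sub _ _ m (trans_dom X l k)) => //; exact: trans_Ck.
  - by move=> y [_ By] _ /=; rewrite /chart_test_fun indicE mem_set// mul1r.
have oK : open (~` (psi X k @` S)).
  apply: closed_openC; apply: compact_closed; first exact: (mf_hausdorff X_mf).
  exact: slab_image_compact.
have [U oU UE] := cod_preimage_open X_mf l oK.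
have Kz : ~ (psi X k @` S) (psi X l z).
  by move=> [y Sy yz]; apply: nBz; exists y => //; exact: slab_ball.
have [Uz _] : (U `&` @half_space R n) z by rewrite -UE; split.
exists U, (fun=> 0); split => //.
- by move=> m; apply/Ck_onP; exact: Ck_cst.
- move=> y Uy cy; apply: chart_test_fun_out.
  have : (U `&` @half_space R n) y by split => //; exact: cod_ge0 cy.
  by rewrite -UE => -[].
Qed.

Lemma chart_test_function : test_function test_domain chart_test_fun.
Proof.
split; first exact: chart_test_fun_smooth.
exists (psi X k @` S); split; [exact: slab_image_compact| |exact: chart_test_fun_out].
by move=> _ [y Sy <-]; exists y => //; exact: slab_ball.
Qed.

(** The factor [y_n ^ 2] of the scaled metric is transferred to the covector, so that the
    derivatives that matter are [y_n] times the partial derivatives. *)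
Lemma grad_norm_test (y : V) : B y ->
  grad_norm g chart_test_fun (psi X k y) =
  Num.sqrt (((y 0 ord_max *: \row_i 'D_(e i) F y) *m invmx (scaled_metric g k y) *m
    (y 0 ord_max *: \row_i 'D_(e i) F y)^T) 0 0).
Proof.
move=> By; have iy := B_icod By; have [_ yn] := B_near By.
rewrite (grad_norm_chart X_mf g_metric chart_test_fun_smooth (icod_psi X_mf bdry iy) (psi_dom X_mf iy.1)).
have -> : diff_fun k chart_test_fun (psi X k y) = \row_i 'D_(e i) F y.
  apply/rowP => i; rewrite !mxE (psiK X_mf iy.1).
  apply: rpartial_derive.
  - by have [] := test_fun_derive s L slab_width y0 i yn.
  - exact: chart_test_fun_psi.
  - near=> t; apply: chart_test_fun_psi; near: t.
    by apply: (@open_ray _ _ B) => //; exact: B_open.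
rewrite /covec_norm /scaled_metric; congr (Num.sqrt _).
set D := \row_i _; have t0 : y 0 ord_max != 0 by rewrite gt_eqF.
have dg : \det (g k (psi X k y)) != 0.
  rewrite gt_eqF// posdef_det_gt0//.
  exact: (g_posdef g_metric (icod_psi X_mf bdry iy) (psi_dom X_mf iy.1)).
rewrite invmxZ; last by rewrite unitmxE unitfE detZ mulf_neq0// !expf_neq0.
have -> : (y 0 ord_max *: D)^T = y 0 ord_max *: D^T by apply/matrixP => a b; rewrite !mxE.
rewrite -?scalemxAr -?scalemxAl -?scalemxAr -?scalemxAl !scalerA [RHS]mxE.
set Q := (_ *m _) 0 0.
by field.
Unshelve. all: by end_near. Qed.

End TestDomain.

(** * The bound at a boundary point, as the cut-off scale grows *)

Section BoundaryPointBound.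
Variables (R : realType) (n : nat) (X : charted_space R n).
Hypothesis X_mf : smooth_manifold X.
Local Notation V := 'rV[R]_n.+1.
Local Notation e i := (@basis_vec R n i).
Local Notation icod := (@icod R n X).
Hypothesis bdry : forall k (x : X), dom X k x -> mboundary x -> phi X k x 0 ord_max = 0.
Variable g : metric_field X.
Hypothesis g_metric : riemannian_metric (@minterior R n X) g.
Hypothesis g_cont : forall (k : nat) (y : V), icod k y -> forall i j,
  {for y, continuous (fun y => g k (psi X k y) i j)}.
Variables (k : nat) (y0 : V) (G : 'M[R]_n.+1).
Hypothesis y0_max : y0 0 ord_max = 0.
Hypothesis G_posdef : posdef G.
Hypothesis G_lim : forall i j, (fun y : V => y 0 ord_max ^+ 2 * g k (psi X k y) i j) @
  within [set y : V | 0 < y 0 ord_max] (nbhs y0) --> G i j.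
Variables (rr : X -> R) (b1 b2 : R).
Hypotheses (b1_gt0 : 0 < b1) (b2_gt0 : 0 < b2).
Hypothesis rr_ge0 : forall x, 0 <= rr x.
Hypothesis rr_gt0 : forall x, minterior x -> 0 < rr x.
Hypothesis rr_cont : forall x, minterior x -> {for x, continuous rr}.
Variable p : R.
Hypothesis p_gt1 : 1 < p.
Let s : R := n%:R / p.

Let p_gt0 : 0 < p. Proof. exact: lt_trans p_gt1. Qed.
Let s_ge0 : 0 <= s. Proof. by rewrite divr_ge0 ?ler0n// ltW. Qed.
Let rr_icod j y : icod j y -> {for y, continuous (fun y => rr (psi X j y))}.
Proof.
move=> iy; apply: (@continuous_comp _ _ _ (psi X j) rr); first exact: (psi_cont X_mf).
by apply: rr_cont; exact: (icod_psi X_mf bdry).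
Qed.

Lemma expR_slope_powR (t : R) : 0 < t -> expR (s * ln t) `^ p = t ^+ n.
Proof.
by move=> t0; rewrite powR_expRMln// /s mulrCA mulfV ?gt_eqF// mulr1 expR_natln.
Qed.

Section TestParameters.
Variables (del tau C A eta rho L : R).
Hypothesis near_icod : forall y : V, `|y - y0| < del -> 0 < y 0 ord_max -> icod k y.
Hypothesis near_rr : forall y : V, `|y - y0| < del -> 0 < y 0 ord_max ->
  b1 * y 0 ord_max <= rr (psi X k y) <= b2 * y 0 ord_max.
Hypothesis near_metric : forall y : V, `|y - y0| < del -> 0 < y 0 ord_max ->
    (forall i j, `|invmx (scaled_metric g k y) i j - invmx G i j| <= tau) /\
    \det G / 2 <= \det (scaled_metric g k y) <= 2 * \det G.
Hypotheses (C_ge0 : 0 <= C) (eta_gt0 : 0 < eta).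
Hypothesis grad_le : forall (K : 'M[R]_n.+1) (w : V) (F q : R),
    (forall i j, `|K i j - invmx G i j| <= tau) -> 0 <= F -> 0 <= q ->
    `|w 0 ord_max| <= s * F + q -> (forall i, i != ord_max -> `|w 0 i| <= q) ->
    Num.sqrt ((w *m K *m w^T) 0 0) `^ p <= A * F `^ p + C * q `^ p.
Hypotheses (rho_gt0 : 0 < rho) (rho_del : 2 * rho < del) (L_ge1 : 1 <= L).
Hypothesis L_rho : expR (- 2 * L) <= rho.

Let w := slab_width n rho L.
Let w_gt0 : 0 < w. Proof. exact: slab_width_gt0. Qed.
Let L_gt0 : 0 < L. Proof. exact: lt_le_trans L_ge1. Qed.
Let E := error_cst n rho.
Let E_gt0 : 0 < E.
Proof.
rewrite /E /error_cst; apply: mulr_gt0; first by rewrite /bump'_max; lra.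
by rewrite ltr_pwDl// sqrtr_ge0.
Qed.
Local Notation S := (slab y0 w (slab_bot L) (slab_top L)).
Local Notation F := (test_fun s L w y0).
Local Notation Om := (@test_domain R n X k y0 rho L).
Local Notation f := (@chart_test_fun R n X k y0 rho L s).
(** As [L >= 1] and [p > 1], [(E / L) ^ p] is at most [E ^ p / L]; the explicit [1 / L] will cancel
    the logarithmic length of the slab. Dividing by [b1 ^+ n] passes from powers of [y_n] to powers
    of [rr], and [C + 1] keeps the constant positive. *)
Let kap := (C + 1) * E `^ p / b1 ^+ n / L.
Let kap' := (bump_min R ^+ n.+1) `^ p / b2 ^+ n.

Let kap_gt0 : 0 < kap.
Proof.
have C1 : 0 < C + 1 by rewrite ltr_wpDl.
by rewrite divr_gt0// divr_gt0 ?exprn_gt0// mulr_gt0// powR_gt0.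
Qed.

Let kap'_gt0 : 0 < kap'.
Proof. by rewrite divr_gt0 ?exprn_gt0// powR_gt0// exprn_gt0// bump_min_gt0. Qed.

Lemma test_error_powR (y : V) : 0 < y 0 ord_max -> `|y - y0| < del ->
  C * test_error s L w y0 E y `^ p <= \1_(psi X k @` S) (psi X k y) * (kap * rr (psi X k y) ^+ n).
Proof.
move=> yn yd; rewrite /test_error indicE.
have [|_] := boolP (y \in S); last first.
  rewrite mul0r powR0 ?gt_eqF// mulr0 indicE mulr_ge0 ?ler0n//.
  by rewrite mulr_ge0 ?exprn_ge0// ltW.
rewrite inE => Sy; rewrite mul1r indicE mem_set ?mul1r; last by exists y.
have EL : 0 <= E / L by rewrite divr_ge0 ?ltW.
rewrite powRM ?expR_ge0// expR_slope_powR//.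
have /andP[r1 _] := near_rr yd yn.
have H1 : (E / L) `^ p <= E `^ p / L.
  have E0 := ltW E_gt0; have Li : 0 < L^-1 by rewrite invr_gt0.
  rewrite powRM ?(ltW Li)// ler_wpM2l ?powR_ge0//.
  by apply: ge1r_powR; [rewrite Li invf_le1|exact: ltW].
have H2 : y 0 ord_max ^+ n <= rr (psi X k y) ^+ n / b1 ^+ n.
  rewrite ler_pdivlMr ?exprn_gt0// mulrC -exprMn lerXn2r ?nnegrE ?rr_ge0//.
  by rewrite mulr_ge0 ?ltW.
apply: (@le_trans _ _ ((C + 1) * ((E `^ p / L) * (rr (psi X k y) ^+ n / b1 ^+ n)))).
  apply: ler_pM => //; first by rewrite mulr_ge0 ?powR_ge0 ?exprn_ge0 ?ltW.
    by rewrite lerDl.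
  by apply: ler_pM => //; [exact: powR_ge0|rewrite exprn_ge0// ltW].
rewrite /kap le_eqVlt; apply/orP; left; apply/eqP; ring.
Qed.

Lemma grad_norm_test_le x : Om x ->
  grad_norm g f x `^ p <= A * `|f x| `^ p + \1_(psi X k @` S) x * (kap * rr x ^+ n).
Proof.
move=> [y By <-]; have [yd yn] := B_near y0_max rho_gt0 rho_del L_ge1 L_rho By.
rewrite (grad_norm_test X_mf bdry g_metric s y0_max near_icod rho_gt0 rho_del L_ge1 L_rho By).
rewrite (chart_test_fun_psi X_mf s y0_max near_icod rho_gt0 rho_del L_ge1 L_rho By).
have F0 : 0 <= F y by exact: test_fun_ge0.
rewrite -/w (ger0_norm F0).
apply: (@le_trans _ _ (A * F y `^ p + C * test_error s L w y0 E y `^ p)); last first.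
  by rewrite lerD2l test_error_powR.
have [Hm _] := near_metric yd yn.
apply: grad_le => //.
- by rewrite /test_error indicE mulr_ge0 ?ler0n// mulr_ge0 ?expR_ge0// divr_ge0 ?ltW.
- rewrite [X in `|X|]mxE [X in _ * X]mxE; apply: test_fun_radial => //.
  have B0 : 0 <= bump'_max R by rewrite /bump'_max; lra.
  by rewrite /E /error_cst mulrC ler_wpM2l// lerDl sqrtr_ge0.
- move=> i ni; rewrite [X in `|X|]mxE [X in _ * X]mxE.
  by apply: test_fun_tangential => //; exact: slab_error.
Qed.

Lemma slab_S_near (y : V) : S y -> `|y - y0| < del.
Proof.
move=> Sy; have By := slab_ball y0_max rho_gt0 L_ge1 L_rho Sy.
by have [] := B_near y0_max rho_gt0 rho_del L_ge1 L_rho By.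
Qed.

Local Notation S' := (slab y0 (w / 2) (expR (- (11 / 4) * L)) (expR (- (9 / 4) * L))).

Lemma slab_inner (y : V) : S' y -> S y.
Proof.
move=> /slabP[/andP[ay yb] Hy]; apply/slabP; split.
  apply/andP; split.
    by apply: le_trans ay; rewrite ler_expR; have := L_gt0; lra.
  by apply: (le_trans yb); rewrite ler_expR; have := L_gt0; lra.
by move=> i ni; apply: le_trans (Hy i ni) _; have := w_gt0; lra.
Qed.

Definition lower_cst : R := kap' * b1 ^+ n * Num.sqrt (\det G / 2) / 2.

(** On the inner slab the integrand is at least of order [1 / y_n], and the logarithmic length there
    is [L / 2]; this is where the growth in [L] comes from. *)
Lemma Lp_energy_ge :
  ((lower_cst * (w ^+ n * L))%:E <= (cov_cst R n)%:E * Lp_energy g p Om f)%E.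
Proof.
have a'b' : expR (- (11 / 4) * L) < expR (- (9 / 4) * L).
  by rewrite ltr_expR; have := L_gt0; lra.
have w2 : 0 <= w / 2 by rewrite divr_ge0// ltW.
have [_] := slab_volume X_mf bdry g_metric g_cont b1_gt0 b2_gt0 rr_gt0 rr_cont
  near_icod near_rr near_metric w2 (expR_gt0 _) a'b' kap'_gt0
  (fun y Sy => slab_S_near (slab_inner Sy)).
rewrite !expRK (_ : 2 * (w / 2) = w); last by field.
rewrite (_ : - (9 / 4) * L - - (11 / 4) * L = L / 2); last by field.
rewrite (_ : _ * (_ ^+ n * (L / 2)) = lower_cst * (w ^+ n * L)); last first.
  by rewrite /lower_cst; field.
move=> H; apply: (le_trans H); apply: lee_wpmul2l.
  by rewrite lee_fin ltW// cov_cst_gt0.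
apply: vol_integral_le => //.
- move=> _ [y Sy <-]; exists y => //.
  by apply: (slab_ball y0_max rho_gt0 L_ge1 L_rho); exact: slab_inner.
- by move=> x _; rewrite mulr_ge0 ?exprn_ge0// ltW.
move=> _ [y Sy <-].
have By := slab_ball y0_max rho_gt0 L_ge1 L_rho (slab_inner Sy).
have [yd yn] := B_near y0_max rho_gt0 rho_del L_ge1 L_rho By.
rewrite (chart_test_fun_psi X_mf s y0_max near_icod rho_gt0 rho_del L_ge1 L_rho By) -/w.
have F0 : 0 <= F y by exact: test_fun_ge0.
rewrite (ger0_norm F0).
have m0 : 0 <= bump_min R ^+ n.+1 by rewrite exprn_ge0// ltW// bump_min_gt0.
apply: (@le_trans _ _ ((bump_min R ^+ n.+1 * expR (s * ln (y 0 ord_max))) `^ p)); last first.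
  apply: ge0_ler_powR; rewrite ?nnegrE ?mulr_ge0 ?expR_ge0 ?(ltW p_gt0)//.
  exact: test_fun_lower.
rewrite powRM ?expR_ge0// expR_slope_powR// /kap' -mulrA ler_wpM2l ?powR_ge0//.
have /andP[_ r2] := near_rr yd yn.
rewrite ler_pdivrMl ?exprn_gt0// -exprMn lerXn2r ?nnegrE ?rr_ge0//.
by rewrite mulr_ge0 ?ltW.
Qed.

Definition upper_cst : R := cov_cst R n * ((C + 1) * E `^ p / b1 ^+ n *
  b2 ^+ n * Num.sqrt (2 * \det G) * 2 ^+ n).

(** The error is carried by the slab and is the only part compared with a chart integral. The
    [1 / L] in [kap] meets the logarithmic length [L], which leaves a multiple of [w ^+ n]. *)
Lemma grad_energy_le : 0 <= A ->
  (grad_energy g p Om f <= A%:E * Lp_energy g p Om f + (upper_cst * w ^+ n)%:E)%E.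
Proof.
move=> A0; have OmB : Om = psi X k @` [set y : V | esq (y - ball_center y0 rho) < ball_radius rho L ^+ 2].
  by [].
have h0 x : 0 <= kap * rr x ^+ n by rewrite mulr_ge0 ?exprn_ge0// ltW.
have i0 x : 0 <= \1_(psi X k @` S) x * (kap * rr x ^+ n) by rewrite indicE mulr_ge0 ?ler0n.
apply: (@le_trans _ _ (vol_integral g Om
    (fun x => (A * `|f x| `^ p + \1_(psi X k @` S) x * (kap * rr x ^+ n))%R))).
  apply: vol_integral_le => //.
  - by move=> x _; exact: powR_ge0.
  - exact: grad_norm_test_le.
  - by move=> x _; rewrite addr_ge0// mulr_ge0 ?powR_ge0.
have Bi : [set y : V | esq (y - ball_center y0 rho) < ball_radius rho L ^+ 2] `<=` icod k.
  exact: (B_icod y0_max near_icod rho_gt0 rho_del L_ge1 L_rho).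
have sB : sigma_compact [set y : V | esq (y - ball_center y0 rho) < ball_radius rho L ^+ 2].
  by apply: open_sigma_compact; exact: B_open.
have SB : S `<=` [set y : V | esq (y - ball_center y0 rho) < ball_radius rho L ^+ 2].
  exact: (slab_ball y0_max rho_gt0 L_ge1 L_rho).
have sS : sigma_compact S by apply: compact_sigma_compact; exact: slab_compact.
have cu j y : icod j y -> {for y, continuous ((fun x => `|f x| `^ p) \o psi X j)}.
  move=> iy; apply: (@continuous_comp _ _ _ (f \o psi X j) (fun t => `|t| `^ p)).
    have sf := chart_test_fun_smooth X_mf bdry s y0_max near_icod rho_gt0 rho_del L_ge1 L_rho.
    have C0 := @smooth_within_Ck R n 0 _ _ _ (@icod_open R n X X_mf j) (@subIsetl _ _ _) (sf j).
    exact: Ck_cont C0 iy.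
  by apply: abs_powR_continuous; exact: p_gt0.
have ch j y : icod j y -> {for y, continuous ((fun x => kap * rr x ^+ n) \o psi X j)}.
  move=> iy; apply: (@cvgM R V (nbhs y) _ (fun=> kap) (fun y => rr (psi X j y) ^+ n)).
    exact: cvg_cst.
  apply: (@continuous_comp _ _ _ (fun y => rr (psi X j y)) (fun t => t ^+ n)).
    exact: rr_icod.
  exact: exprn_continuous.
have u0 x : 0 <= `|f x| `^ p by exact: powR_ge0.
rewrite OmB (vol_integral_split X_mf bdry g_cont Bi sB SB sS A0 cu ch u0 h0).
rewrite -OmB; apply: leeD2l.
have ab : slab_bot L < slab_top L by rewrite ltr_expR; have := L_gt0; lra.
have [H _] := slab_volume X_mf bdry g_metric g_cont b1_gt0 b2_gt0 rr_gt0 rr_cont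
  near_icod near_rr near_metric (ltW w_gt0) (expR_gt0 _) ab kap_gt0 slab_S_near.
apply: (le_trans H); rewrite lee_fin !expRK.
rewrite (_ : - 2 * L - - 3 * L = L); last by ring.
rewrite le_eqVlt; apply/orP; left; apply/eqP.
rewrite /upper_cst /kap exprMn; field.
by rewrite !gt_eqF ?exprn_gt0.
Qed.

Lemma lower_cst_gt0 : 0 < lower_cst.
Proof.
rewrite /lower_cst; apply: divr_gt0 => //; apply: mulr_gt0.
  by rewrite mulr_gt0 ?exprn_gt0.
by rewrite sqrtr_gt0 divr_gt0// posdef_det_gt0.
Qed.

(** The error and the lower bound for the Lp energy share the factor [w ^+ n]; it drops out although
    [w] depends on [L], and the relative error is of order [1 / L]. *)
Lemma lambda1p_le_parameters : 0 <= A ->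
  upper_cst * cov_cst R n <= eta * lower_cst * L -> (lambda1p g p <= (A + eta)%:E)%E.
Proof.
move=> A0 HL; have cov0 := cov_cst_gt0 R n; have l0 := lower_cst_gt0.
have wL : 0 < w ^+ n * L by rewrite mulr_gt0// exprn_gt0.
have Lge : ((lower_cst * (w ^+ n * L) / cov_cst R n)%:E <= Lp_energy g p Om f)%E.
  by rewrite mulrC EFinM lee_pdivrMl// Lp_energy_ge.
have Lp0 : (0 < Lp_energy g p Om f)%E.
  by apply: lt_le_trans Lge; rewrite lte_fin divr_gt0// mulr_gt0.
have AE0 : 0 <= A + eta by rewrite addr_ge0// ltW.
have dOm : bounded_smooth_domain g Om.
  apply: (coord_ball_domain X_mf bdry g_metric g_cont).
    exact: (ball_radius_gt0 L_ge1 L_rho).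
  by move=> y; exact: (ball_icod y0_max near_icod rho_gt0 rho_del L_ge1 L_rho).
have tf := chart_test_function X_mf bdry s y0_max near_icod rho_gt0 rho_del L_ge1 L_rho.
apply (lambda1p_le_test X_mf p_gt1 AE0 dOm tf Lp0).
apply: (le_trans (grad_energy_le A0)).
rewrite EFinD ge0_muleDl ?lee_fin ?(ltW eta_gt0)//; apply: leeD2l.
apply: (@le_trans _ _ (eta%:E * (lower_cst * (w ^+ n * L) / cov_cst R n)%:E)%E); last first.
  by apply: lee_wpmul2l => //; rewrite lee_fin ltW.
rewrite -EFinM lee_fin [leRHS]mulrA ler_pdivlMr// mulrAC.
have -> : eta * (lower_cst * (w ^+ n * L)) = eta * lower_cst * L * w ^+ n by ring.
by rewrite ler_wpM2r// exprn_ge0// ltW.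
Qed.

End TestParameters.

Hypothesis half_icod : exists2 del, 0 < del &
  forall y : V, `|y - y0| < del -> 0 < y 0 ord_max -> icod k y /\
    b1 * y 0 ord_max <= rr (psi X k y) <= b2 * y 0 ord_max.

Lemma chart_upper_bound :
  (lambda1p g p <= (covec_norm G (e ord_max) `^ p * (n%:R / p) `^ p)%:E)%E.
Proof.
have A0 := G_inv_gt0 G_posdef.
have -> : covec_norm G (e ord_max) = Num.sqrt (invmx G ord_max ord_max).
  by rewrite /covec_norm /basis_vec -rowE trmx_delta -colE !mxE.
rewrite -powRM ?sqrtr_ge0//; apply/lee_addgt0Pr => eta' eta'0.
(* One half is spent on the gradient estimate, the other on the cut-off error. *)
pose eta := eta' / 2; have eta0 : 0 < eta by rewrite divr_gt0.
pose M := \sum_i \sum_j `|invmx G i j|.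
have HM i j : `|invmx G i j| <= M.
  rewrite /M (bigD1 i)//= (bigD1 j)//= -addrA lerDl addr_ge0//.
    by apply: sumr_ge0.
  by apply: sumr_ge0 => i' _; apply: sumr_ge0.
have M0 : 0 <= M by apply: le_trans (HM ord_max ord_max).
have [tau [C [/andP[tau0 _] C0 HC]]] := gradient_power_le n p_gt1 A0 M0 s_ge0 eta0.
have [d1 d10 H1] := metric_near_limit G_posdef G_lim tau0.
have [d0 d00 H0] := half_icod.
pose del := Num.min d0 d1; have del0 : 0 < del by rewrite lt_min d00.
pose rho := del / 4; have rho0 : 0 < rho by rewrite divr_gt0.
have rd : 2 * rho < del by rewrite /rho; lra.
(* Neither constant involves [L], so [L] can be chosen last: 1 gives [L >= 1], [rho^-1] keeps the
   slab below height [rho], and [U] controls the error. *)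
pose U := upper_cst C rho * cov_cst R n / (eta * lower_cst).
pose L := 1 + rho^-1 + `|U|.
have ri : 0 < rho^-1 by rewrite invr_gt0.
have L1 : 1 <= L by rewrite /L; have := normr_ge0 U; lra.
have Lr : expR (- 2 * L) <= rho.
  rewrite -[leRHS]invrK mulNr expRN lef_pV2 ?posrE ?expR_gt0//.
  apply: le_trans (expR_ge1Dx _); rewrite /L; have := normr_ge0 U; lra.
rewrite -EFinD.
have -> : (Num.sqrt (invmx G ord_max ord_max) * (n%:R / p)) `^ p + eta' =
    ((Num.sqrt (invmx G ord_max ord_max) * s) `^ p + eta) + eta.
  by rewrite /eta; field.
have ll0 := lower_cst_gt0.
apply: (@lambda1p_le_parameters del tau C _ eta rho L) => //.
- by move=> y; rewrite lt_min => /andP[yd _] yn; have [] := H0 y yd yn.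
- by move=> y; rewrite lt_min => /andP[yd _] yn; have [] := H0 y yd yn.
- by move=> y; rewrite lt_min => /andP[_ yd]; exact: H1.
- by move=> K v F q HK; apply: HC.
- by rewrite addr_ge0 ?powR_ge0// ltW.
- have el : 0 < eta * lower_cst by rewrite mulr_gt0.
  rewrite [leRHS]mulrC -ler_pdivrMr//.
  by rewrite /L -/U; have := ler_norm U; lra.
Qed.

End BoundaryPointBound.

(** * Hyperbolic space *)

Section HyperbolicManifold.
Variables (R : realType) (n : nat).
Local Notation V := 'rV[R]_n.+1.
Local Notation e i := (@basis_vec R n i).
Local Notation H := (hyperbolic_space R n).
Local Notation half := (@upper_half_space R n).

Lemma hyp_phiP k (x : H) : half (phi H k x).
Proof. exact: set_valP. Qed.

Lemma hyp_psiK k (y : V) : half y -> phi H k (psi H k y) = y.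
Proof. by move=> hy; rewrite /= set_valE insubdK//; exact: mem_set. Qed.

Lemma hyp_phiK k (x : H) : psi H k (phi H k x) = x.
Proof. by rewrite /= set_valE valKd. Qed.

Lemma hyp_codE k : cod H k = half.
Proof.
apply/seteqP; split => [_ [x _ <-]|y hy]; first exact: (hyp_phiP k).
by exists (psi H k y) => //; exact: hyp_psiK.
Qed.

Lemma hyp_phi_cont k : continuous (phi H k).
Proof. exact: initial_continuous. Qed.

Lemma hyp_interior (x : H) : minterior x.
Proof. by move=> [k _ x0]; have := hyp_phiP k x; rewrite /upper_half_space/= x0 ltxx. Qed.

Lemma hyperbolic_manifold : smooth_manifold H.
Proof.
split.
- move=> x y cxy; rewrite -(hyp_phiK 0 x) -(hyp_phiK 0 y); congr psi.
  apply: rV_hausdorff => A B nA nB.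
  have [z [Az Bz]] := cxy _ _ (hyp_phi_cont nA) (hyp_phi_cont nB).
  by exists (phi H 0 z).
- by move=> x; exists 0%N.
- by move=> k; exact: openT.
- move=> k; exists half; first exact: upper_half_space_open.
  rewrite hyp_codE; apply/seteqP; split => [y hy|y []//]; split => //.
  exact: ltW.
- by move=> k x _; exact: hyp_phiK.
- by move=> k; apply: continuous_subspaceT; exact: hyp_phi_cont.
- move=> k; rewrite hyp_codE; apply/subspace_sigL_continuousP.
  rewrite (_ : sigL _ _ = id); first by move=> x A.
  by apply/funext => x; exact: (hyp_phiK k x).
- move=> k l j y [+ _]; rewrite hyp_codE => hy.
  exists half, (fun y : V => y 0 j); split => //.
  + exact: upper_half_space_open.
  + by move=> m; apply/Ck_onP; exact: Ck_coord.
  + by move=> z hz _; have := hyp_psiK k hz => /= ->.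
Qed.

Lemma hyp_icodE k : icod H k = half.
Proof. by rewrite /icod hyp_codE setIid. Qed.

Lemma hyp_bdry k (x : H) : dom H k x -> mboundary x -> phi H k x 0 ord_max = 0.
Proof. by move=> _ /hyp_interior. Qed.

Variable kap : R.
Hypothesis kap_gt0 : 0 < kap.
Local Notation g := (@hyperbolic_metric R n kap).

Definition conformal_factor (y : V) : R := (kap * y 0 ord_max ^+ 2)^-1.

Lemma conformal_factor_gt0 y : half y -> 0 < conformal_factor y.
Proof. by move=> hy; rewrite invr_gt0 mulr_gt0// exprn_gt0. Qed.

Lemma hyp_metric_psi k l y : half y -> g k (psi H l y) = (conformal_factor y)%:M.
Proof. by move=> hy; rewrite /hyperbolic_metric (hyp_psiK k hy). Qed.

Lemma scalar_posdef (a : R) : 0 < a -> posdef (a%:M : 'M[R]_n.+1).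
Proof.
move=> a0 v v0; rewrite mul_mx_scalar -scalemxAl mxE mulr_gt0//.
rewrite mxE lt_def psumr_eq0 ?sumr_ge0 ?andbT; last 2 first.
- by move=> i _; rewrite mxE -expr2 sqr_ge0.
- by move=> i _; rewrite mxE -expr2 sqr_ge0.
apply: contra v0 => /allP N; apply/eqP/rowP => i; rewrite mxE.
have := N i; rewrite mem_index_enum => /(_ isT)/=.
by rewrite mxE -expr2 sqrf_eq0 => /eqP.
Qed.

Lemma hyp_jac k l (x : H) : jac k l x = 1%:M.
Proof.
have td : trans_dom H k l (phi H k x).
  by split => //; rewrite hyp_icodE; exact: hyp_phiP.
rewrite -[x in LHS](hyp_phiK k) (jac_derive hyperbolic_manifold td).
apply/matrixP => i j; rewrite !mxE.
have [_ D] := derive_coord (phi H k x) (e i) j.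
rewrite -basis_vecE -D; apply: near_eq_derive.
have : \forall y \near phi H k x, half y.
  by apply: open_nbhs_nbhs; split; [exact: upper_half_space_open|exact: hyp_phiP].
by apply: (@filterS V (nbhs _)) => y hy; have := hyp_psiK k hy => /= ->.
Qed.

Lemma hyp_riemannian : riemannian_metric (@minterior R n H) g.
Proof.
move=> k x _ _; split; first by rewrite /hyperbolic_metric tr_scalar_mx.
  by apply: scalar_posdef; exact: (conformal_factor_gt0 (hyp_phiP k x)).
by move=> l _; rewrite hyp_jac trmx1 mulmx1 mul1mx.
Qed.

Lemma conformal_factor_cont y : half y -> {for y, continuous conformal_factor}.
Proof.
move=> hy; apply: (@continuous_comp _ _ _ (fun y : V => kap * y 0 ord_max ^+ 2) (fun t => t^-1)).
  apply: (@cvgM R V (nbhs y)); first exact: cvg_cst.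
  apply: (@continuous_comp _ _ _ (fun y : V => y 0 ord_max) (fun t : R => t ^+ 2)).
    exact: coord_continuous.
  exact: exprn_continuous.
by apply: inv_continuous; rewrite gt_eqF// mulr_gt0// exprn_gt0.
Qed.

Lemma near_half (y : V) : half y -> \forall z \near y, half z.
Proof.
by move=> hy; apply: open_nbhs_nbhs; split => //; exact: upper_half_space_open.
Qed.

Lemma hyp_metric_cont k (y : V) : icod H k y -> forall i j,
  {for y, continuous (fun y => g k (psi H k y) i j)}.
Proof.
rewrite hyp_icodE => hy i j.
apply: (@near_eq_continuous _ _ (fun y => conformal_factor y *+ (i == j))).
  have := near_half hy; apply: (@filterS V (nbhs y)) => z hz.
  by rewrite hyp_metric_psi// mxE.
case: (i == j); last exact: cst_continuous.
exact: conformal_factor_cont.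
Qed.

(** The same estimate at the origin of the face. That point is outside hyperbolic space, but the
    estimate only looks at the points above it and at the limit of [y_n ^ 2 g], here the constant
    matrix [kap^-1]. *)
Lemma hyperbolic_upper_bound (p : R) : 1 < p ->
  (lambda1p g p <= (Num.sqrt kap `^ p * (n%:R / p) `^ p)%:E)%E.
Proof.
move=> p1; have kV : 0 < kap^-1 by rewrite invr_gt0.
have := @chart_upper_bound R n H hyperbolic_manifold hyp_bdry g hyp_riemannian
  hyp_metric_cont 0%N 0 (kap^-1)%:M (mxE _ _ _ _) (scalar_posdef kV) _
  (fun x => phi H 0 x 0 ord_max) 1 1 ltr01 ltr01 _ _ _ p p1 _.
have -> : covec_norm (kap^-1)%:M (e ord_max) = Num.sqrt kap.
  rewrite /covec_norm invmx_scalar invrK mul_mx_scalar -scalemxAl mxE.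
  by rewrite /basis_vec trmx_delta mul_delta_mx mxE !eqxx mulr1.
apply.
- move=> i j; have FF : Filter (within half (nbhs (0 : V))) by exact: within_filter.
  have E : within half (nbhs (0 : V)) [set y : V |
      (kap^-1)%:M i j = y 0 ord_max ^+ 2 * g 0%N (psi H 0 y) i j].
    have N0 : Filter (nbhs (0 : V)) by exact: nbhs_filter.
    apply: (@filterS V _ N0 setT); last exact: filterT.
    move=> y _ hy /=; rewrite hyp_metric_psi// !mxE.
    case: (i == j); rewrite ?mulr0// !mulr1n /conformal_factor invfM mulrCA.
    by rewrite mulfV ?mulr1// expf_neq0// gt_eqF.
  exact: cvg_trans (near_eq_cvg E) (cvg_cst _).
- by move=> x; apply: ltW; exact: (hyp_phiP 0 x).
- by move=> x _; exact: (hyp_phiP 0 x).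
- move=> x _; apply: (@continuous_comp _ _ _ (phi H 0) (fun y : V => y 0 ord_max)).
    exact: hyp_phi_cont.
  exact: coord_continuous.
- exists 1 => // y _ yn; rewrite hyp_icodE !mul1r; split => //.
  by have := hyp_psiK 0 yn => /= ->; rewrite lexx.
Qed.

End HyperbolicManifold.

(** * Hardy's inequality *)

Section Hardy.
Variable R : realType.
Local Notation leb := (@lebesgue_measure R).

Lemma is_derive_small (f : R -> R) (x : R) :
  (forall eps, 0 < eps -> exists2 d, 0 < d &
    forall t, `|t - x| < d -> `|f t - f x| <= eps * `|t - x|) ->
  is_derive x (1 : R) f 0.
Proof.
move=> H; have c : (fun h : R => h^-1 *: ((f \o shift x) (h *: 1) - f x)) @ 0^' --> (0 : R).
  apply/cvgrPdist_le => eps e0; have [d d0 Hd] := H eps e0; near=> h.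
  have h0 : h != 0 by near: h; exact: nbhs_dnbhs_neq.
  have hd : `|h| < d by near: h; apply: dnbhs0_lt.
  rewrite sub0r normrN normrM /= [h *: 1]mulr1.
  rewrite normfV ler_pdivrMl ?normr_gt0// mulrC.
  by have := Hd (h + x); rewrite addrK; apply.
apply: DeriveDef; first by apply/cvg_ex; exists 0.
exact/cvg_lim.
Unshelve. all: by end_near. Qed.

(* [p |x|^(p-1) sgn x], in a form whose continuity at 0 is apparent. *)
Definition abs_powR' (p x : R) : R :=
  p * (`|(x + `|x|) / 2| `^ (p - 1) - `|(x - `|x|) / 2| `^ (p - 1)).

Lemma abs_powR'_pos p x : 0 < x -> 1 < p -> abs_powR' p x = p * x `^ (p - 1).
Proof.
move=> x0 p1; rewrite /abs_powR' (gtr0_norm x0) subrr mul0r normr0 powR0; last first.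
  by rewrite subr_eq0 gt_eqF.
by rewrite subr0 (_ : (x + x) / 2 = x) ?gtr0_norm//; field.
Qed.

Lemma abs_powR'_neg p x : x < 0 -> 1 < p -> abs_powR' p x = - (p * (- x) `^ (p - 1)).
Proof.
move=> x0 p1; rewrite /abs_powR' (ltr0_norm x0) subrr mul0r normr0 powR0; last first.
  by rewrite subr_eq0 gt_eqF.
by rewrite opprK sub0r (_ : (x + x) / 2 = x) ?ltr0_norm ?mulrN//; field.
Qed.

Lemma abs_powR'0 p : 1 < p -> abs_powR' p 0 = 0.
Proof.
by move=> p1; rewrite /abs_powR' normr0 addr0 subr0 subrr mulr0.
Qed.

Lemma abs_powR_derive p (x : R) : 1 < p ->
  is_derive x (1 : R) (fun y => `|y| `^ p) (abs_powR' p x).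
Proof.
move=> p1; have [x0|x0|->] := ltgtP x 0.
- rewrite abs_powR'_neg//.
  have d1 : is_derive x (1 : R) (fun y : R => - y) (- 1) by exact: is_deriveNid.
  have nx : 0 < - x by rewrite oppr_gt0.
  have d2 := @is_derive1_comp R (fun t => t `^ p) (fun y => - y) x _ _ (is_derive1_powR p nx) d1.
  apply: (near_eq_is_derive _ (is_derive_eq d2 _)); last by rewrite mulrN1.
  near=> y; rewrite /= ltr0_norm//.
  by near: y; exact: lt_nbhsl.
- rewrite abs_powR'_pos//.
  apply: (near_eq_is_derive _ (is_derive1_powR p x0)).
  near=> y; rewrite gtr0_norm//.
  by near: y; exact: lt_nbhsr.
(* At 0 one factor of the absolute value is split off, and the remaining power [p - 1 > 0] is
   small. *)
- rewrite abs_powR'0//; apply: is_derive_small => eps e0.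
  have q0 : 0 < p - 1 by rewrite subr_gt0.
  exists (eps `^ (p - 1)^-1); first exact: powR_gt0.
  move=> t; rewrite subr0 => td; rewrite normr0 powR0 ?gt_eqF//; last by lra.
  rewrite subr0 (ger0_norm (powR_ge0 _ _)) -(mulr_powRB1 (normr_ge0 t)); last by lra.
  by rewrite mulrC ler_wpM2r// ltW// powR_small.
Unshelve. all: by end_near. Qed.

Lemma abs_powR'_cont p : 1 < p -> continuous (abs_powR' p).
Proof.
move=> p1 x; have q0 : 0 < p - 1 by rewrite subr_gt0.
apply: (@cvgM R R (nbhs x)); first exact: cvg_cst.
apply: (@cvgB R R R (nbhs x)).
  apply: (@continuous_comp R R R (fun x => (x + `|x|) / 2) (fun y => `|y| `^ (p - 1))).
    apply: cvgM; last exact: cvg_cst.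
    by apply: cvgD; [exact: cvg_id|exact: norm_continuous].
  exact: abs_powR_continuous.
apply: (@continuous_comp R R R (fun x => (x - `|x|) / 2) (fun y => `|y| `^ (p - 1))).
  apply: cvgM; last exact: cvg_cst.
  by apply: cvgB; [exact: cvg_id|exact: norm_continuous].
exact: abs_powR_continuous.
Qed.

Lemma abs_powR'_norm p x : 1 < p -> `|abs_powR' p x| = p * `|x| `^ (p - 1).
Proof.
move=> p1; have q0 : 0 < p - 1 by rewrite subr_gt0.
have [x0|x0|->] := ltgtP x 0.
- by rewrite abs_powR'_neg// normrN (ltr0_norm x0) ger0_norm// mulr_ge0 ?powR_ge0//; lra.
- by rewrite abs_powR'_pos// (gtr0_norm x0) ger0_norm// mulr_ge0 ?powR_ge0//; lra.
- by rewrite abs_powR'0// normr0 powR0 ?mulr0// gt_eqF.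
Qed.

(** Young's inequality for the exponents [p / (p - 1)] and [p]; equivalently, the convex function
    [b ^ p] lies above its tangent at [a]. *)
Lemma powR_tangent (p a b : R) : 1 < p -> 0 <= a -> 0 <= b ->
  p * a `^ (p - 1) * b <= (p - 1) * a `^ p + b `^ p.
Proof.
move=> p1 a0 b0; have p0 : 0 < p by lra.
have q0 : 0 < p - 1 by lra.
have := @conjugate_powR R (a `^ (p - 1)) b (p / (p - 1)) p (powR_ge0 _ _) b0 (divr_gt0 p0 q0) p0.
have -> : (p / (p - 1))^-1 + p^-1 = 1 by field; rewrite !gt_eqF.
move=> /(_ erefl); rewrite -powRrM (_ : (p - 1) * (p / (p - 1)) = p); last first.
  by field; rewrite gt_eqF.
rewrite -(ler_pM2l p0) => H; rewrite -mulrA (le_trans H)// le_eqVlt; apply/orP; left.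
by apply/eqP; field; rewrite !gt_eqF.
Qed.

Section Interval.
Variables (n : nat) (p alpha beta : R) (f f' : R -> R).
Hypotheses (p_gt1 : 1 < p) (alpha_gt0 : 0 < alpha) (alpha_beta : alpha < beta).
Hypothesis f_derive : forall t : R, 0 < t -> is_derive t (1 : R) f (f' t).
Hypothesis f'_cont : forall t : R, 0 < t -> {for t, continuous f'}.
Hypotheses (f_alpha : f alpha = 0) (f_beta : f beta = 0).
Let s : R := n%:R / p.

(** [w] vanishes at both ends of the interval, so a multiple of its derivative can be added to the
    integrand at no cost; that makes Hardy's inequality pointwise. *)
Let w (t : R) : R := `|f t| `^ p * t^-1 ^+ n.
Let w' (t : R) : R := `|f t| `^ p * (- n%:R * t^-1 ^+ n.+1) +
  t^-1 ^+ n * (abs_powR' p (f t) * f' t).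

Let w_derive (t : R) : 0 < t -> is_derive t (1 : R) w (w' t).
Proof.
move=> t0; have tn : t != 0 by rewrite gt_eqF.
have d1 := @is_derive1_comp R (fun y => `|y| `^ p) f t _ _ (abs_powR_derive _ p_gt1) (f_derive t0).
exact: (is_derive_eq (is_deriveM d1 (is_derive_invX n tn))).
Qed.

(** This is [powR_tangent] for the values [s] times the size of [f] and [t] times the size of [f'].
    The part of [w'] with [f'] is at most the cross term, and [n = p * s] makes the p-th powers of
    [f] cancel. *)
Let hardy_pointwise (t : R) : 0 < t ->
  s `^ p * (`|f t| `^ p * t^-1 ^+ n.+1) + s `^ (p - 1) * w' t <=
  `|t * f' t| `^ p * t^-1 ^+ n.+1.
Proof.
move=> t0; have p0 : 0 < p by exact: lt_trans p_gt1.
have s0 : 0 <= s by rewrite divr_ge0 ?ler0n// ltW.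
have tn : t != 0 by rewrite gt_eqF.
pose T := t^-1 ^+ n.+1; have T0 : 0 <= T by rewrite exprn_ge0// invr_ge0 ltW.
have -> : w' t = T * (t * (abs_powR' p (f t) * f' t) - n%:R * `|f t| `^ p).
  by rewrite /w' /T exprS; field.
rewrite -/T mulrA mulrCA -[X in X + _]mulrC -mulrDr [leRHS]mulrC ler_wpM2l//.
have H := @powR_tangent p (s * `|f t|) (t * `|f' t|) p_gt1 (mulr_ge0 s0 (normr_ge0 _))
  (mulr_ge0 (ltW t0) (normr_ge0 _)).
rewrite (powRM (p - 1) s0 (normr_ge0 (f t))) (powRM p s0 (normr_ge0 (f t)))
  (powRM p (ltW t0) (normr_ge0 (f' t))) in H.
have sp : s * s `^ (p - 1) = s `^ p by rewrite mulr_powRB1.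
have nE : n%:R = p * s by rewrite /s mulrCA mulfV ?mulr1// gt_eqF.
have G : t * (abs_powR' p (f t) * f' t) <= p * `|f t| `^ (p - 1) * (t * `|f' t|).
  apply: le_trans (ler_norm _) _; rewrite (normrM t) (normrM (abs_powR' p (f t))).
  by rewrite abs_powR'_norm// (gtr0_norm t0) mulrCA.
have S0 : 0 <= s `^ (p - 1) by exact: powR_ge0.
have {}G := ler_wpM2l S0 G.
rewrite normrM (gtr0_norm t0) (powRM p (ltW t0) (normr_ge0 (f' t))).
rewrite mulrBr nE [s `^ (p - 1) * (p * s * _)](_ : _ = p * (s `^ p * `|f t| `^ p)); last first.
  by rewrite -sp; ring.
move: H G; set a := s `^ p * _; set b := _ `^ p * `|f' t| `^ p.
have -> : p * (s `^ (p - 1) * `|f t| `^ (p - 1)) * (t * `|f' t|) =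
  s `^ (p - 1) * (p * `|f t| `^ (p - 1) * (t * `|f' t|)) by ring.
set c := s `^ (p - 1) * (p * _ * _); set d := s `^ (p - 1) * (t * _).
lra.
Qed.

Local Notation I := (`[alpha, beta]%classic : set R).

Let I_gt0 t : I t -> 0 < t.
Proof. by rewrite /= in_itv/= => /andP[at_ _]; exact: lt_le_trans at_. Qed.

Let f_cont t : 0 < t -> {for t, continuous f}.
Proof.
by move=> t0; have [d _] := f_derive t0; apply/differentiable_continuous/derivable1_diffP.
Qed.

Let fp_cont t : 0 < t -> {for t, continuous (fun t => `|f t| `^ p)}.
Proof.
move=> t0; apply: (@continuous_comp R R R f (fun y => `|y| `^ p)); first exact: f_cont.
by apply: abs_powR_continuous; exact: lt_trans p_gt1.
Qed.

Let inv_cont m (t : R) : 0 < t -> {for t, continuous (fun t : R => t^-1 ^+ m)}.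
Proof.
move=> t0; apply: (@continuous_comp R R R (fun t => t^-1) (fun t => t ^+ m)).
  by apply: inv_continuous; rewrite gt_eqF.
exact: exprn_continuous.
Qed.

Let w'_cont (t : R) : 0 < t -> {for t, continuous w'}.
Proof.
move=> t0; apply: (@cvgD R R R (nbhs t)).
  apply: cvgM; first exact: fp_cont.
  by apply: cvgM; [exact: cvg_cst|exact: inv_cont].
apply: cvgM; first exact: inv_cont.
apply: cvgM; last exact: f'_cont.
apply: (@continuous_comp R R R f (abs_powR' p)); first exact: f_cont.
exact: abs_powR'_cont.
Qed.

Let mI (u : R -> R) : (forall t, 0 < t -> {for t, continuous u}) ->
  measurable_fun (I : set (measurableTypeR R)) u.
Proof.
move=> cu; apply: subspace_continuous_measurable_fun => //.
by apply: continuous_in_subspaceT => t; rewrite inE => /I_gt0; exact: cu.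
Qed.

Lemma hardy_interval :
  (\int[leb]_(t in I) (s `^ p * (`|f t| `^ p * t^-1 ^+ n.+1))%:E <=
   \int[leb]_(t in I) (`|t * f' t| `^ p * t^-1 ^+ n.+1)%:E)%E.
Proof.
have ab := ltW alpha_beta.
pose D t := s `^ (p - 1) * w' t.
have D_cont (t : R) : 0 < t -> {for t, continuous D}.
  by move=> t0; apply: (@cvgM R R (nbhs t)); [exact: cvg_cst|exact: w'_cont].
have [|t0 _ HM] := @EVT_min R D alpha beta ab.
  by apply: continuous_in_subspaceT => t; rewrite inE => /I_gt0; exact: D_cont.
(* [D] may change sign, whereas nonnegative functions can be integrated termwise without further
   conditions; both sides are shifted by a constant that makes [D + M] nonnegative. *)
pose M := `|D t0|.
have DM t : I t -> 0 <= D t + M.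
  move=> It; have := ler_norm (- D t0); rewrite normrN -/M => h.
  by have := HM t It; lra.
have A_cont (t : R) : 0 < t -> {for t, continuous (fun t => s `^ p * (`|f t| `^ p * t^-1 ^+ n.+1))}.
  move=> tp; apply: (@cvgM R R (nbhs t)); first exact: cvg_cst.
  by apply: cvgM; [exact: fp_cont|exact: inv_cont].
have B_cont (t : R) : 0 < t -> {for t, continuous (fun t : R => `|t * f' t| `^ p * t^-1 ^+ n.+1)}.
  move=> tp; apply: (@cvgM R R (nbhs t)); last exact: inv_cont.
  apply: (@continuous_comp R R R (fun t => t * f' t) (fun y => `|y| `^ p)).
    by apply: cvgM; [exact: cvg_id|exact: f'_cont].
  by apply: abs_powR_continuous; exact: lt_trans p_gt1.
have p0 : 0 < p by exact: lt_trans p_gt1.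
have DM_cont (t : R) : 0 < t -> {for t, continuous (fun t => D t + M)}.
  by move=> tp; apply: (@cvgD R R R (nbhs t)); [exact: D_cont|exact: cvg_cst].
(* The exact derivative contributes nothing, because [f] vanishes at both ends; only the shift
   remains. *)
have DMI : (\int[leb]_(t in I) (D t + M)%:E = (M * (beta - alpha))%:E)%E.
  have dW (t : R) : 0 < t -> is_derive t (1 : R) (fun t => s `^ (p - 1) * w t + M * t) (D t + M).
    move=> tp; have d1 := @is_deriveZ R R R w (s `^ (p - 1)) t 1 _ (w_derive tp).
    have d2 := @is_deriveZ R R R id M t 1 _ (is_derive_id _ _).
    by apply: (is_derive_eq (is_deriveD d1 d2)); rewrite /GRing.scale/= mulr1.
  have cW (t : R) : 0 < t -> {for t, continuous (fun t => s `^ (p - 1) * w t + M * t)}.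
    by move=> tp; have [d _] := dW t tp; apply/differentiable_continuous/derivable1_diffP.
  rewrite (@continuous_FTC2 R (fun t => D t + M) (fun t => s `^ (p - 1) * w t + M * t) alpha beta)//.
  - rewrite /w f_alpha f_beta !normr0 powR0 ?gt_eqF// !mul0r !mulr0 !add0r -EFinB.
    by rewrite mulrBr.
  - by apply: continuous_in_subspaceT => t; rewrite inE => /I_gt0; exact: DM_cont.
  - split.
    + by move=> t /subset_itv_oo_cc/I_gt0 tp; case: (dW t tp).
    + by apply: cvg_at_right_filter; exact: cW.
    + by apply: cvg_at_left_filter; apply: cW; exact: lt_trans alpha_beta.
  - by move=> t /subset_itv_oo_cc/I_gt0 tp; rewrite derive1E; case: (dW t tp).
have mI' (u : R -> R) : (forall t, 0 < t -> {for t, continuous u}) ->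
    measurable_fun (I : set (measurableTypeR R)) (EFin \o u).
  by move=> cu; apply/measurable_EFinP; exact: mI.
have A0 t : I t -> 0 <= s `^ p * (`|f t| `^ p * t^-1 ^+ n.+1).
  by move=> /I_gt0 tp; rewrite mulr_ge0 ?powR_ge0// mulr_ge0 ?powR_ge0// exprn_ge0// invr_ge0 ltW.
have B0 t : I t -> 0 <= `|t * f' t| `^ p * t^-1 ^+ n.+1.
  by move=> /I_gt0 tp; rewrite mulr_ge0 ?powR_ge0// exprn_ge0// invr_ge0 ltW.
have M0 : 0 <= M by exact: normr_ge0.
have mII : measurable (I : set (measurableTypeR R)) by exact: measurable_itv.
have fin : (M * (beta - alpha))%:E \is a fin_num by [].
rewrite -(leeD2rE _ _ fin) -{1}DMI.
have -> : ((M * (beta - alpha))%:E = \int[leb]_(t in I) (fun=> M%:E) t)%E.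
  by rewrite integral_cst//= lebesgue_measure_itv/= lte_fin alpha_beta -EFinB -EFinM.
have addI (u v : R -> R) : (forall t, I t -> 0 <= u t) -> (forall t, I t -> 0 <= v t) ->
    (forall t, 0 < t -> {for t, continuous u}) -> (forall t, 0 < t -> {for t, continuous v}) ->
    (\int[leb]_(t in I) (u t)%:E + \int[leb]_(t in I) (v t)%:E =
     \int[leb]_(t in I) ((u t)%:E + (v t)%:E))%E.
  move=> u0 v0 cu cv; rewrite ge0_integralD//; [exact: (mI' _ cu)|exact: (mI' _ cv)].
rewrite (addI _ _ A0 DM A_cont DM_cont) (addI _ (fun=> M) B0 (fun _ _ => M0) B_cont); last first.
  by move=> t _; exact: cst_continuous.
rewrite integral_mkcond [leRHS]integral_mkcond; apply: ge0_le_integralT => t.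
  rewrite patchE; case: ifP => //; rewrite inE => It.
  by rewrite -EFinD lee_fin addr_ge0 ?A0 ?DM.
rewrite !patchE; case: ifP => //; rewrite inE => It.
rewrite -!EFinD lee_fin addrA lerD2r; apply: hardy_pointwise; exact: I_gt0.
Qed.

End Interval.

End Hardy.

(** * Integration along vertical lines *)

Section LastCoordinate.
Variable R : realType.

Definition set_last n (v : 'rV[R]_n.+1) (t : R) : 'rV[R]_n.+1 :=
  \row_i (if i == ord_max then t else v 0 i).

Lemma set_lastE n (v : 'rV[R]_n.+1) t :
  set_last v t = set_last v 0 + t *: basis_vec R ord_max.
Proof.
apply/rowP => i; rewrite !mxE eqxx /=.
by case: eqP => _; rewrite ?mulr1 ?add0r// mulr0 addr0.
Qed.

Lemma set_last_max n (v : 'rV[R]_n.+1) t : set_last v t 0 ord_max = t.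
Proof. by rewrite mxE eqxx. Qed.

(* The innermost variable of [integral_rV] is the last coordinate. *)
Lemma integral_rV_last_le n (f g : 'rV[R]_n.+1 -> \bar R) : (forall x, 0 <= f x)%E ->
  (forall v, \int[@lebesgue_measure R]_t f (set_last v t) <=
             \int[@lebesgue_measure R]_t g (set_last v t))%E ->
  (integral_rV f <= integral_rV g)%E.
Proof.
elim: n f g => [|n IH] f g f0 fg.
  have E (h : 'rV[R]_1 -> \bar R) : integral_rV h =
      (\int[@lebesgue_measure R]_t h (set_last 0 t))%E.
    apply: eq_integral => x _; congr h; apply/rowP => i.
    have i2 : i = ord_max by rewrite (ord1 i); exact/val_inj.
    transitivity x.
      by rewrite mxE; case: splitP => [j _|[]//]; rewrite mxE !ord1 eqxx mulr1n.
    by rewrite i2 set_last_max.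
  by rewrite !E.
apply: ge0_le_integralT => x; first exact: (@integral_rV_ge0 R n.+1
    (fun v => f (row_mx (x%:M : 'rV[R]_1) v : 'rV[R]_(1 + n.+1))) (fun v => f0 _)).
apply: (IH (fun v => f (row_mx (x%:M : 'rV[R]_1) v : 'rV[R]_(1 + n.+1)))
  (fun v => g (row_mx (x%:M : 'rV[R]_1) v : 'rV[R]_(1 + n.+1)))) => [v//|v].
have E t : row_mx (x%:M : 'rV_1) (set_last v t) = set_last (row_mx (x%:M : 'rV_1) v : 'rV_(1 + n.+1)) t.
  apply/rowP => i; rewrite [RHS]mxE.
  have [->|[j ->]] := ord_split1 i.
    rewrite row_mxEl; case: eqP => // _.
    exact: (esym (@row_mxEl R 1 1 n.+1 x%:M v 0 0)).
  rewrite row_mxEr mxE; case: eqP => [/(congr1 (@nat_of_ord _))/= jn|nj]; case: eqP => // H.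
    by case: H; apply/val_inj; rewrite /= jn.
    by case: nj; apply/val_inj; move: H => /(congr1 (@nat_of_ord _)) [].
  exact: (esym (@row_mxEr R 1 1 n.+1 x%:M v 0 j)).
by under eq_integral do rewrite E; under [leRHS]eq_integral do rewrite E.
Qed.

End LastCoordinate.

(** * Energies on hyperbolic space and Hardy's inequality for test functions *)

Section HyperbolicEnergies.
Variables (R : realType) (n : nat).
Local Notation V := 'rV[R]_n.+1.
Local Notation e i := (@basis_vec R n i).
Local Notation H := (hyperbolic_space R n).
Local Notation half := (@upper_half_space R n).
Local Notation chart := (psi H 0).
Variables (kap p : R).
Hypotheses (kap_gt0 : 0 < kap) (p_gt1 : 1 < p).
Local Notation g := (@hyperbolic_metric R n kap).

Definition regular (f : H -> R) : Prop := Ck 1 half (f \o chart).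

Lemma smooth_regular f : smooth_fun f -> regular f.
Proof.
move=> sf; apply: smooth_within_Ck (sf 0%N); last by rewrite hyp_codE.
exact: upper_half_space_open.
Qed.

Lemma regularB f h : regular f -> regular h -> regular (fun x => f x - h x).
Proof.
move=> rf rh; have oh := @upper_half_space_open R n.
have c1 := CkM (@Ck_cst R n 1 half (-1)) rh oh.
by apply: Ck_near oh _ (CkD rf c1 oh) => y _ /=; rewrite mulN1r.
Qed.

Definition hyp_gradient (f : H -> R) (y : V) : R :=
  Num.sqrt (kap * y 0 ord_max ^+ 2 * esq (\row_i 'D_(e i) (f \o chart) y)).

Lemma hyp_grad_norm f y : regular f -> half y -> grad_norm g f (chart y) = hyp_gradient f y.
Proof.
move=> rf hy; rewrite /grad_norm /grad; set k := chart_at _.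
have D : diff_fun k f (chart y) = \row_i 'D_(e i) (f \o chart) y.
  apply/rowP => i; rewrite !mxE; have := hyp_psiK k hy => /= ->.
  by have [_ /(_ i)[d _]] := rf; apply: rpartialE; exact: d.
have cf := conformal_factor_gt0 kap_gt0 hy.
rewrite D (hyp_metric_psi _ _ _ hy) vec_norm_grad; last 2 first.
- by rewrite tr_scalar_mx.
- by rewrite det_scalar expf_neq0// gt_eqF.
rewrite /covec_norm invmx_scalar mul_mx_scalar -scalemxAl mxE /hyp_gradient; congr (Num.sqrt _).
by rewrite invrK; congr (_ * _); rewrite mxE; apply: eq_bigr => i _; rewrite !mxE expr2.
Qed.

Definition hyp_density (y : V) : R := ((Num.sqrt kap)^-1 * (y 0 ord_max)^-1) ^+ n.+1.

Lemma hyp_vdens y : half y -> vdens g 0 y = hyp_density y.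
Proof.
move=> hy; rewrite /vdens (hyp_metric_psi _ _ _ hy) det_scalar.
have sk : 0 < Num.sqrt kap by rewrite sqrtr_gt0.
have -> : conformal_factor kap y = ((Num.sqrt kap)^-1 * (y 0 ord_max)^-1) ^+ 2.
  by rewrite /conformal_factor -[in LHS](sqr_sqrtr (ltW kap_gt0)) -exprMn -exprVn invfM.
rewrite -exprM mulnC exprM sqrtr_sqr ger0_norm// exprn_ge0// mulr_ge0// invr_ge0 ltW//.
Qed.

Lemma hyp_density_ge0 y : half y -> 0 <= hyp_density y.
Proof.
by move=> hy; rewrite exprn_ge0// mulr_ge0// invr_ge0 ?sqrtr_ge0// ltW.
Qed.

Lemma hyp_density_cont y : half y -> {for y, continuous hyp_density}.
Proof.
move=> hy; apply: (@continuous_comp _ _ _ (fun y : V => (Num.sqrt kap)^-1 * (y 0 ord_max)^-1)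
  (fun t => t ^+ n.+1)); last exact: exprn_continuous.
apply: (@cvgM R V (nbhs y)); first exact: cvg_cst.
apply: (@continuous_comp _ _ _ (fun y : V => y 0 ord_max) (fun t => t^-1)).
  exact: coord_continuous.
by apply: inv_continuous; rewrite gt_eqF.
Qed.

(** All charts coincide, so the first piece is the whole space and a volume integral is a single
    integral. *)
Lemma hyp_piece k : @piece R n H k = if k is 0 then setT else set0.
Proof.
case: k => [|k]; apply/seteqP; split => // x.
  by move=> _; split => // -[].
by move=> [_ []]; exists 0%N.
Qed.

Definition hyp_domain (Om : set H) : set V := half `&` chart @^-1` Om.

Lemma hyp_vol_integral Om (h : H -> R) : (forall x, 0 <= h x) ->
  vol_integral g Om h =
  integral_rV (fun y : V => (\1_(hyp_domain Om) y * (h (chart y) * hyp_density y))%:E).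
Proof.
move=> h0; rewrite /vol_integral.
have t0 k : (0 <= integral_rV (fun y : V => (\1_(phi H k @` (Om `&` @piece R n H k)) y *
    (h (psi H k y) * Num.sqrt (\det (g k (psi H k y)))))%:E))%E.
  by apply: integral_rV_ge0 => y; rewrite lee_fin indicE mulr_ge0 ?ler0n// mulr_ge0 ?sqrtr_ge0.
rewrite nneseries_recl//.
rewrite (_ : (\sum_(1 <= k <oo) _)%E = 0%E) ?adde0; last first.
  apply: eseries0 => -[//|k] _ _; rewrite hyp_piece setI0 image_set0.
  rewrite (_ : (fun y => _) = fun=> 0%E) ?integral_rV0//.
  by apply/funext => y; rewrite indicE in_set0 mul0r.
congr integral_rV; apply/funext => y; congr EFin; rewrite hyp_piece setIT.
have -> : phi H 0 @` Om = hyp_domain Om.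
  apply/seteqP; split => z.
    move=> [x Ox <-]; split; [exact: (hyp_phiP 0)|].
    by change (Om (psi H 0 (phi H 0 x))); rewrite hyp_phiK.
  by move=> [hz Oz]; exists (chart z) => //; exact: hyp_psiK.
rewrite !indicE; have [|_] := boolP (_ \in _); last by rewrite !mul0r.
by rewrite inE => -[hy _]; rewrite -hyp_vdens.
Qed.

Lemma hyp_domain_open Om : open Om -> open (hyp_domain Om).
Proof.
move=> oO; rewrite openE => y [hy Oy]; apply: (@filterI V (nbhs y)).
  exact: near_half.
have iy : icod H 0 y by rewrite hyp_icodE.
by apply: (psi_cont (hyperbolic_manifold R n) iy); apply: open_nbhs_nbhs; split.
Qed.

Lemma regular_partial_cont f i y : regular f -> half y ->
  {for y, continuous (fun y => 'D_(e i) (f \o chart) y)}.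
Proof. by move=> [_ /(_ i)[_ c]] hy; exact: c.1. Qed.

Lemma hyp_gradient_cont f y : regular f -> half y -> {for y, continuous (hyp_gradient f)}.
Proof.
move=> rf hy; apply: (@continuous_comp _ _ _ (fun y : V => kap * y 0 ord_max ^+ 2 *
    esq (\row_i 'D_(e i) (f \o chart) y)) Num.sqrt); last exact: sqrt_continuous.
apply: (@cvgM R V (nbhs y)).
  apply: (@cvgM R V (nbhs y)); first exact: cvg_cst.
  apply: (@continuous_comp _ _ _ (fun y : V => y 0 ord_max) (fun t => t ^+ 2)).
    exact: coord_continuous.
  exact: exprn_continuous.
apply: (@cvg_sum_ord R V (nbhs y)) => i; rewrite mxE.
rewrite (_ : (fun x => _) = fun x => 'D_(e i) (f \o chart) x ^+ 2); last first.
  by apply/funext => z; rewrite mxE.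
apply: (@continuous_comp V R R (fun y => 'D_(e i) (f \o chart) y) (fun t => t ^+ 2)).
  exact: regular_partial_cont.
exact: exprn_continuous.
Qed.

Section HardyTest.
Variables (Om : set H) (f : H -> R).
Hypothesis oOm : open Om.
Hypothesis tf : test_function Om f.
Let F : V -> R := f \o chart.

Let rf : regular f. Proof. by case: tf => /smooth_regular. Qed.

Lemma test_support : exists2 S : set V, compact S /\ S `<=` hyp_domain Om &
  forall y, half y -> ~ S y -> F y = 0 /\ forall i, 'D_(e i) F y = 0.
Proof.
have [_ [K [cK KO Kf]]] := tf; exists (phi H 0 @` K).
  split; first by apply: continuous_compact => //; apply: continuous_subspaceT; exact: hyp_phi_cont.
  move=> _ [x Kx <-]; split; [exact: (hyp_phiP 0)|].
  by change (Om (psi H 0 (phi H 0 x))); rewrite hyp_phiK; exact: KO.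
have cS : closed (phi H 0 @` K).
  apply: compact_closed; first exact: rV_hausdorff.
  by apply: continuous_compact => //; apply: continuous_subspaceT; exact: hyp_phi_cont.
have F0 y : half y -> ~ (phi H 0 @` K) y -> F y = 0.
  by move=> hy nS; apply: Kf => Ky; apply: nS; exists (chart y) => //; exact: hyp_psiK.
move=> y hy nS; split; first exact: F0.
move=> i; rewrite -(@derive_cst R V R (0 : R) y (e i)); apply: near_eq_derive.
have N1 := near_half hy.
have N2 : \forall z \near y, ~ (phi H 0 @` K) z.
  by apply: open_nbhs_nbhs; split => //; exact: closed_openC.
by apply: (@filterS2 V (nbhs y) _ _ _ _ _ N1 N2) => z; exact: F0.
Qed.

(** The bounds on the height are strict, so that a test function vanishes at both ends of every
    vertical segment, as [hardy_interval] requires. The empty support gets arbitrary values. *)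
Lemma support_bounds (S : set V) : compact S -> S `<=` half ->
  exists a b w, [/\ 0 < a, a < b, 0 <= w & forall y, S y -> slab 0 w a b y /\ a < y 0 ord_max < b].
Proof.
move=> cS Sh; have [[z Sz]|S0] := pselect (S !=set0); last first.
  exists 1, 2, 0; split => //; first by rewrite ltr1n.
  by move=> y Sy; exfalso; apply: S0; exists y.
have cc : {within S, continuous (fun y : V => y 0 ord_max)}.
  by apply: continuous_subspaceT => y; exact: coord_continuous.
have S0 : S !=set0 by exists z.
have [l] := EVT_min_rV S0 cS cc; rewrite inE => Sl Hl.
have [u] := EVT_max_rV S0 cS cc; rewrite inE => Su Hu.
have cn : {within S, continuous (fun y : V => `|y|)}.
  by apply: continuous_subspaceT => y; exact: norm_continuous.
have [m] := EVT_max_rV S0 cS cn; rewrite inE => Sm Hm.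
have l0 : 0 < l 0 ord_max := Sh _ Sl.
have H1 y : S y -> l 0 ord_max <= y 0 ord_max by move=> Sy; apply: Hl; rewrite inE.
have H2 y : S y -> y 0 ord_max <= u 0 ord_max by move=> Sy; apply: Hu; rewrite inE.
have H3 y : S y -> `|y| <= `|m| by move=> Sy; apply: Hm; rewrite inE.
have lu := H1 u Su.
exists (l 0 ord_max / 2), (u 0 ord_max + 1), `|m|; split => //; first by lra.
  by lra.
move=> y Sy; have h1 := H1 y Sy; have h2 := H2 y Sy; split; last by apply/andP; split; lra.
apply/slabP; split; first by apply/andP; split; lra.
by move=> i _; rewrite mxE subr0 (le_trans (rV_coord_le _ _))// H3.
Qed.

(** On each vertical line Hardy's inequality applies to the restriction of [f], and the vertical
    derivative alone bounds the gradient norm from below. *)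
Lemma hardy_test :
  ((((Num.sqrt kap) `^ p * (n%:R / p) `^ p)%:E) * Lp_energy g p Om f <=
   grad_energy g p Om f)%E.
Proof.
have p0 : 0 < p by exact: lt_trans p_gt1.
have sk : 0 < Num.sqrt kap by rewrite sqrtr_gt0.
have [S [cS SO] S0] := test_support.
have [a [b [w [a0 ab w0 Sab]]]] := support_bounds cS (fun y Sy => (SO y Sy).1).
rewrite /Lp_energy /grad_energy !hyp_vol_integral; last 2 first.
- by move=> x; exact: powR_ge0.
- by move=> x; exact: powR_ge0.
have c0 : 0 <= Num.sqrt kap `^ p * (n%:R / p) `^ p by rewrite mulr_ge0 ?powR_ge0.
have mL : measurable_fun setT ((fun y => (\1_(hyp_domain Om) y *
    (`|f (chart y)| `^ p * hyp_density y))%:E) : borel_rV R n.+1 -> \bar R).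
  apply: indic_measurable; first by apply: open_borel; exact: hyp_domain_open.
  move=> y [hy _]; apply: (@cvgM R V (nbhs y)); last exact: hyp_density_cont.
  apply: (@continuous_comp _ _ _ (f \o chart) (fun t => `|t| `^ p)).
    exact: Ck_cont rf hy.
  exact: abs_powR_continuous.
rewrite -integral_rVZ//; last first.
  move=> y; rewrite lee_fin indicE; have [|_] := boolP (_ \in _); last by rewrite mul0r.
  by rewrite inE => -[hy _]; rewrite mul1r mulr_ge0 ?powR_ge0// hyp_density_ge0.
apply: integral_rV_last_le => [y|v].
  rewrite -EFinM lee_fin mulr_ge0// indicE.
  have [|_] := boolP (_ \in _); last by rewrite mul0r.
  by rewrite inE => -[hy _]; rewrite mul1r mulr_ge0 ?powR_ge0// hyp_density_ge0.
(* [k0] collects the powers of [kap] from the gradient and from the density; its p-th root [lam] is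
   absorbed into the function, so that [hardy_interval] applies as it stands. *)
pose k0 := Num.sqrt kap `^ p * (Num.sqrt kap)^-1 ^+ n.+1.
have k00 : 0 < k0 by rewrite mulr_gt0 ?powR_gt0// exprn_gt0// invr_gt0.
pose lam := k0 `^ p^-1.
have lam0 : 0 <= lam by exact: powR_ge0.
have lamp : lam `^ p = k0 by rewrite /lam -powRrM mulVf ?gt_eqF// powRr1// ltW.
have hv t : 0 < t -> half (set_last v t).
  by move=> t0; rewrite /upper_half_space/= set_last_max.
have line_cont : continuous (set_last v).
  move=> t; apply: rV_continuous => i.
  rewrite (_ : (fun y => _) = fun y => if i == ord_max then y else v 0 i); last first.
    by apply/funext => y; rewrite mxE.
  by case: (i == ord_max); [exact: cvg_id|exact: cvg_cst].
have P1 (t : R) : 0 < t -> is_derive t (1 : R) (lam \*: (F \o set_last v))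
    (lam * 'D_(e ord_max) F (set_last v t)).
  move=> t0; have [_ /(_ ord_max)[d _]] := rf.
  apply: is_deriveZ.
  have := @is_derive_line R n F (set_last v 0) (e ord_max) t.
  rewrite -set_lastE => /(_ (d _ (hv t t0))).
  by congr is_derive; apply/funext => z; rewrite /= -set_lastE.
have P2 (t : R) : 0 < t -> {for t, continuous (fun t => lam * 'D_(e ord_max) F (set_last v t))}.
  move=> t0; apply: (@cvgM R R (nbhs t)); first exact: cvg_cst.
  apply: (@continuous_comp R V R (set_last v) (fun y => 'D_(e ord_max) F y)).
    exact: line_cont.
  by apply: regular_partial_cont => //; exact: hv.
have Pa : (lam \*: (F \o set_last v)) a = 0.
  have nS : ~ S (set_last v a) by move=> /Sab[_]; rewrite set_last_max ltxx.
  by rewrite /= (S0 _ (hv a a0) nS).1 scaler0.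
have Pb : (lam \*: (F \o set_last v)) b = 0.
  have nS : ~ S (set_last v b) by move=> /Sab[_]; rewrite set_last_max ltxx andbF.
  by rewrite /= (S0 _ (hv b (lt_trans a0 ab)) nS).1 scaler0.
have Hd := hardy_interval n p_gt1 a0 ab P1 P2 Pa Pb.
have lamM z : `|lam * z| `^ p = k0 * `|z| `^ p.
  by rewrite normrM (ger0_norm lam0) powRM// lamp.
have I_gt0 t : t \in (`[a, b]%classic : set R) -> 0 < t.
  by rewrite inE /= in_itv/= => /andP[at_ _]; exact: lt_le_trans at_.
have T0 t : 0 < t -> 0 <= t^-1 ^+ n.+1 by move=> t0; rewrite exprn_ge0// invr_ge0 ltW.
apply: le_trans (le_trans _ Hd) _.
  rewrite [leRHS]integral_mkcond; apply: ge0_le_integralT => t.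
    rewrite -EFinM lee_fin mulr_ge0// indicE.
    have [|_] := boolP (_ \in _); last by rewrite mul0r.
    by rewrite inE => -[hy _]; rewrite mul1r mulr_ge0 ?powR_ge0// hyp_density_ge0.
  have R0 : (0 <= ((fun t => ((n%:R / p) `^ p * (`|(lam \*: (F \o set_last v)) t| `^ p *
      t^-1 ^+ n.+1))%:E) \_ `[a, b]%classic) t)%E.
    rewrite patchE; case: ifPn => // /I_gt0 t0.
    by rewrite lee_fin mulr_ge0 ?powR_ge0// mulr_ge0 ?powR_ge0 ?T0.
  have [Oy|/negbTE nOy] := boolP (set_last v t \in hyp_domain Om); last first.
    by rewrite indicE nOy mul0r mule0.
  move: (Oy); rewrite inE => -[hy _].
  have [F0|F0] := eqVneq (F (set_last v t)) 0.
    by rewrite [f _]F0 normr0 powR0 ?gt_eqF// mul0r mulr0 mule0.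
  have St : S (set_last v t).
    by apply: contrapT => nS; move: F0; rewrite (S0 _ hy nS).1 eqxx.
  have [_] := Sab _ St; rewrite set_last_max => /andP[at_ tb].
  rewrite patchE mem_set ?indicE ?Oy ?mul1r; last by rewrite /= in_itv/= !ltW.
  rewrite -EFinM lee_fin /= lamM /hyp_density set_last_max exprMn /k0 le_eqVlt.
  by apply/orP; left; apply/eqP; rewrite /F /=; ring.
rewrite integral_mkcond; apply: ge0_le_integralT => t.
  rewrite patchE; case: ifPn => // /I_gt0 t0.
  by rewrite lee_fin mulr_ge0 ?powR_ge0 ?T0.
have R0 : 0 <= \1_(hyp_domain Om) (set_last v t) *
    (grad_norm g f (chart (set_last v t)) `^ p * hyp_density (set_last v t)).
  rewrite indicE; have [|_] := boolP (_ \in _); last by rewrite mul0r.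
  by rewrite inE => -[hy _]; rewrite mul1r mulr_ge0 ?powR_ge0// hyp_density_ge0.
rewrite patchE; case: ifPn => [/I_gt0 t0|_]; last by rewrite lee_fin.
have hy := hv t t0; rewrite lee_fin.
have [Oy|nOy] := boolP (set_last v t \in hyp_domain Om); last first.
  have nS : ~ S (set_last v t) by move=> /SO Oy; rewrite mem_set in nOy.
  by rewrite (S0 _ hy nS).2 !mulr0 normr0 powR0 ?gt_eqF// mul0r.
rewrite indicE Oy mul1r hyp_grad_norm// mulrCA lamM.
set D := 'D_(e ord_max) F (set_last v t).
have gD : Num.sqrt kap * `|t * D| <= hyp_gradient f (set_last v t).
  rewrite /hyp_gradient set_last_max -[leLHS]ger0_norm ?mulr_ge0 ?sqrtr_ge0//.
  rewrite -sqrtr_sqr; apply: ler_wsqrtr.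
  rewrite exprMn real_normK ?num_real// sqr_sqrtr ?(ltW kap_gt0)// exprMn mulrA.
  rewrite ler_wpM2l//; first by rewrite mulr_ge0 ?sqr_ge0// ltW.
  by have := esq_coord (\row_i 'D_(e i) (f \o chart) (set_last v t)) ord_max; rewrite mxE.
have gp : Num.sqrt kap `^ p * `|t * D| `^ p <= hyp_gradient f (set_last v t) `^ p.
  rewrite -powRM ?sqrtr_ge0//; apply: ge0_ler_powR => //; first exact: ltW.
    by rewrite nnegrE mulr_ge0 ?sqrtr_ge0.
  by rewrite nnegrE sqrtr_ge0.
rewrite /hyp_density set_last_max exprMn /k0.
have -> : Num.sqrt kap `^ p * (Num.sqrt kap)^-1 ^+ n.+1 * `|t * D| `^ p * t^-1 ^+ n.+1 =
  (Num.sqrt kap `^ p * `|t * D| `^ p) * ((Num.sqrt kap)^-1 ^+ n.+1 * t^-1 ^+ n.+1) by ring.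
by rewrite ler_wpM2r// mulr_ge0 ?T0// exprn_ge0// invr_ge0 sqrtr_ge0.
Qed.

End HardyTest.
End HyperbolicEnergies.

(** * Convergence of energies along Cauchy sequences *)

Section EnergyLimits.
Variables (R : realType) (n : nat).
Local Notation V := 'rV[R]_n.+1.
Local Notation e i := (@basis_vec R n i).
Local Notation H := (hyperbolic_space R n).
Local Notation half := (@upper_half_space R n).
Local Notation chart := (psi H 0).
Variables (kap p : R).
Hypothesis p_gt1 : 1 < p.

Let p_gt0 : 0 < p. Proof. exact: lt_trans p_gt1. Qed.

Lemma quasi_powR (x a b th : R) : 0 <= x -> 0 <= a -> 0 <= b -> 0 < th ->
  x ^+ 2 <= (1 + th) * a ^+ 2 + (1 + th^-1) * b ^+ 2 ->
  x `^ p <= (1 + th) `^ p * a `^ p + (1 + th^-1) `^ p * b `^ p.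
Proof.
move=> x0 a0 b0 th0 H; have thi : 0 < th^-1 by rewrite invr_gt0.
have thK : th * th^-1 = 1 by rewrite mulfV// gt_eqF.
have mono (c : R) : 0 <= c -> x ^+ 2 <= c ^+ 2 -> x `^ p <= c `^ p.
  move=> c0; rewrite ler_sqr ?nnegrE// => xc.
  by apply: ge0_ler_powR; rewrite ?nnegrE// ltW.
have [ba|ab] := leP b (th * a).
  apply: (@le_trans _ _ ((1 + th) `^ p * a `^ p)); last by rewrite lerDl mulr_ge0 ?powR_ge0.
  rewrite -powRM//; last lra.
  apply: mono; first by rewrite mulr_ge0//; lra.
  apply: (le_trans H).
  have b2 : b ^+ 2 <= (th * a) ^+ 2 by rewrite lerXn2r ?nnegrE// mulr_ge0// ltW.
  have h : (1 + th^-1) * b ^+ 2 <= (1 + th^-1) * (th * a) ^+ 2 by rewrite ler_wpM2l//; lra.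
  apply: le_trans (_ : _ <= (1 + th) * a ^+ 2 + (1 + th^-1) * (th * a) ^+ 2) _.
    by rewrite lerD2l.
  rewrite le_eqVlt; apply/orP; left; apply/eqP.
  have -> : (1 + th) * a ^+ 2 + (1 + th^-1) * (th * a) ^+ 2 =
    (1 + th) * a ^+ 2 + (th + th * th^-1) * th * a ^+ 2 by ring.
  by rewrite thK; ring.
apply: (@le_trans _ _ ((1 + th^-1) `^ p * b `^ p)); last by rewrite lerDr mulr_ge0 ?powR_ge0.
rewrite -powRM//; last lra.
apply: mono; first by rewrite mulr_ge0//; lra.
apply: (le_trans H).
have ab' : a <= th^-1 * b by rewrite ler_pdivlMl// ltW.
have a2 : a ^+ 2 <= (th^-1 * b) ^+ 2 by rewrite lerXn2r ?nnegrE// mulr_ge0// ltW.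
have h : (1 + th) * a ^+ 2 <= (1 + th) * (th^-1 * b) ^+ 2 by rewrite ler_wpM2l//; lra.
apply: le_trans (_ : _ <= (1 + th) * (th^-1 * b) ^+ 2 + (1 + th^-1) * b ^+ 2) _.
  by rewrite lerD2r.
rewrite le_eqVlt; apply/orP; left; apply/eqP.
have -> : (1 + th) * (th^-1 * b) ^+ 2 + (1 + th^-1) * b ^+ 2 =
  (th^-1 + th * th^-1) * th^-1 * b ^+ 2 + (1 + th^-1) * b ^+ 2 by ring.
by rewrite thK; ring.
Qed.

(** The case [th = 1] bounds the tail by [K]; then [th] with [(1 + th) ^ p] close to 1 relative to
    [K] makes the sequence Cauchy. *)
Lemma quasi_cauchy_cvg (a : nat -> R) : (forall i, 0 <= a i) ->
  (forall th eps, 0 < th -> 0 < eps -> exists N, forall i j, (N <= i)%N -> (N <= j)%N ->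
    a i <= (1 + th) `^ p * a j + eps) ->
  exists2 l : R, 0 <= l & a @ \oo --> l.
Proof.
move=> a0 H; have [N0 HN0] := H 1 1 ltr01 ltr01.
pose K := (1 + 1) `^ p * a N0 + 1.
have K0 : 0 < K by rewrite ltr_wpDl// mulr_ge0 ?powR_ge0.
have aK i : (N0 <= i)%N -> a i <= K by move=> ?; exact: HN0.
have c1 : {for 0, continuous (fun t : R => `|1 + t| `^ p)}.
  apply: (@continuous_comp R R R (fun t => 1 + t) (fun y => `|y| `^ p)).
    by apply: cvgD; [exact: cvg_cst|exact: cvg_id].
  exact: abs_powR_continuous.
have ca : cvg (a @ \oo).
  apply/cauchy_cvgP/cauchy_ballP => eps e0.
  have e4 : 0 < eps / 4 / K by rewrite !divr_gt0.
  have [t0 t00 Ht] := (norm_continuousP _ _).1 c1 _ e4.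
  pose th := t0 / 2; have th0 : 0 < th by rewrite divr_gt0.
  have thK : (1 + th) `^ p * K <= K + eps / 4.
    have := Ht th; rewrite subr0 gtr0_norm// => /(_ ltac:(by rewrite /th; lra)).
    have th1 : 0 <= 1 + th by rewrite addr_ge0// ltW.
    rewrite addr0 normr1 powR1 (ger0_norm th1).
    rewrite ltr_norml => /andP[_]; rewrite ltr_pdivlMr// mulrBl mul1r; lra.
  have e4' : 0 < eps / 4 by rewrite divr_gt0.
  have [N1 HN1] := H th (eps / 4) th0 e4'.
  pose N := maxn N0 N1.
  have key i j : (N <= i)%N -> (N <= j)%N -> a i - a j <= eps / 2.
    rewrite !geq_max => /andP[i0 i1] /andP[j0 j1].
    have h1 := HN1 i j i1 j1; have h2 := aK j j0.
    have P1 : 1 <= (1 + th) `^ p.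
      have th1 : 0 <= 1 + th by rewrite addr_ge0// ltW.
      have p1 : 1 `^ p = 1 :> R by rewrite powR1.
      by rewrite -[leLHS]p1; apply: ge0_ler_powR; rewrite ?nnegrE ?(ltW p_gt0)// lerDl ltW.
    have : ((1 + th) `^ p - 1) * a j <= ((1 + th) `^ p - 1) * K by rewrite ler_wpM2l// subr_ge0.
    lra.
  pose A := a @` [set i | (N <= i)%N].
  exists (A, A) => /=; first by split; exists N => // i Ni; exists i.
  move=> [_ _] [/= [i Ni <-] [j Nj <-]]; rewrite /ball/= ltr_norml; apply/andP; split.
    by have := key j i Nj Ni; lra.
  by have := key i j Ni Nj; lra.
exists (lim (a @ \oo)); last exact: ca.
by apply: limr_ge => //; near=> i; exact: a0.
Unshelve. all: by end_near. Qed.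

Section Functional.
(** [N] stands for the absolute value or for the gradient norm, so that one argument serves both
    energies. *)
Variables (N : (H -> R) -> V -> R) (Om : set H).
Hypothesis oOm : open Om.
Hypothesis N_ge0 : forall f (y : V), 0 <= N f y.
Hypothesis N_cont : forall f (y : V), regular f -> half y -> {for y, continuous (N f)}.
Hypothesis N_quasi : forall f h (y : V) th, regular f -> regular h -> half y -> 0 < th ->
  N f y ^+ 2 <= (1 + th) * N h y ^+ 2 + (1 + th^-1) * N (fun x => f x - h x) y ^+ 2.
Hypothesis N_zero : forall f (y : V), f (chart y) = 0 ->
  (forall i, 'D_(e i) (f \o chart) y = 0) -> N f y = 0.
Local Notation D := (hyp_domain Om).
Local Notation dens := (hyp_density kap).

Definition functional_energy (f : H -> R) : \bar R :=
  integral_rV (fun y : V => (\1_D y * (N f y `^ p * dens y))%:E).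

Lemma energy_integrand_ge0 f (y : V) : (0 <= (\1_D y * (N f y `^ p * dens y))%:E)%E.
Proof.
rewrite lee_fin indicE; have [|_] := boolP (_ \in _); last by rewrite mul0r.
by rewrite inE => -[hy _]; rewrite mul1r mulr_ge0 ?powR_ge0// hyp_density_ge0.
Qed.

Lemma energy_measurable f : regular f ->
  measurable_fun setT ((fun y => (\1_D y * (N f y `^ p * dens y))%:E) : borel_rV R n.+1 -> \bar R).
Proof.
move=> rf; apply: indic_measurable; first by apply: open_borel; exact: hyp_domain_open.
move=> y [hy _]; apply: (@cvgM R V (nbhs y)); last exact: hyp_density_cont.
rewrite (_ : (fun y => _) = fun y => `|N f y| `^ p); last first.
  by apply/funext => z; rewrite ger0_norm.
rewrite -[X in X `^ p](ger0_norm (N_ge0 f y)).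
apply: (@continuous_comp _ _ _ (N f) (fun t => `|t| `^ p)); first exact: N_cont.
exact: abs_powR_continuous.
Qed.

Lemma functional_energy_ge0 f : (0 <= functional_energy f)%E.
Proof. by apply: integral_rV_ge0 => y; exact: energy_integrand_ge0. Qed.

Lemma functional_energy_quasi f h th : regular f -> regular h -> 0 < th ->
  (functional_energy f <= ((1 + th) `^ p)%:E * functional_energy h +
    ((1 + th^-1) `^ p)%:E * functional_energy (fun x => f x - h x)%R)%E.
Proof.
move=> rf rh th0; have rfh := regularB rf rh.
have p1 : 0 <= (1 + th) `^ p by exact: powR_ge0.
have p2 : 0 <= (1 + th^-1) `^ p by exact: powR_ge0.
have m1 := energy_measurable rh; have m2 := energy_measurable rfh.
rewrite /functional_energy -(integral_rVZ p1 m1 (energy_integrand_ge0 h)).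
rewrite -(integral_rVZ p2 m2 (energy_integrand_ge0 _)).
rewrite -integral_rVD//; last 4 first.
- by apply: emeasurable_funM => //; exact: measurable_cst.
- by apply: emeasurable_funM => //; exact: measurable_cst.
- by move=> y; rewrite mule_ge0 ?lee_fin//; exact: energy_integrand_ge0.
- by move=> y; rewrite mule_ge0 ?lee_fin//; exact: energy_integrand_ge0.
apply: integral_rV_le => [y|y]; first exact: energy_integrand_ge0.
rewrite -!EFinM -EFinD lee_fin !indicE.
have [|_] := boolP (_ \in _); last by rewrite !mul0r !mulr0 addr0.
rewrite inE => -[hy _]; rewrite !mul1r !mulrA -mulrDl ler_wpM2r//.
  exact: hyp_density_ge0.
apply: quasi_powR => //; exact: N_quasi.
Qed.

Lemma functional_energy_fin f : test_function Om f -> (functional_energy f < +oo)%E.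
Proof.
move=> tf; have rf : regular f by case: tf => /smooth_regular.
have [S [cS SO] S0] := test_support tf.
have [a [b [w [a0 ab w0 Sab]]]] := support_bounds cS (fun y Sy => (SO y Sy).1).
(* The factor [y_n] is inserted so that the integrand is at most [M / y_n] on a slab, where the
   integral is known. *)
pose W (y : V) := N f y `^ p * dens y * y 0 ord_max.
have [M M0 HM] : exists2 M, 0 <= M & forall y, S y -> W y <= M.
  have [Sne|Se] := pselect (S !=set0); last first.
    by exists 0 => // y Sy; exfalso; apply: Se; exists y.
  have cW : {within S, continuous W}.
    apply: continuous_in_subspaceT => y; rewrite inE => Sy; have [hy _] := SO y Sy.
    apply: (@cvgM R V (nbhs y)); last exact: coord_continuous.
    apply: (@cvgM R V (nbhs y)); last exact: hyp_density_cont.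
    rewrite (_ : (fun y => _) = fun y => `|N f y| `^ p); last first.
      by apply/funext => z; rewrite ger0_norm.
    rewrite -[X in X `^ p](ger0_norm (N_ge0 f y)).
    apply: (@continuous_comp _ _ _ (N f) (fun t => `|t| `^ p)); first exact: N_cont.
    exact: abs_powR_continuous.
  have [m] := EVT_max_rV Sne cS cW; rewrite inE => Sm Hm.
  exists (W m); last by move=> y Sy; apply: Hm; rewrite inE.
  have [hm _] := SO m Sm.
  by rewrite mulr_ge0 ?(ltW hm)// mulr_ge0 ?powR_ge0// hyp_density_ge0.
have pos (y : V) : slab 0 w a b y -> 0 < y 0 ord_max.
  by move=> /slabP[/andP[ay _] _]; exact: lt_le_trans ay.
have mS : measurable (slab 0 w a b : set (borel_rV R n.+1)).
  by apply: sigma_compact_borel; apply: compact_sigma_compact; exact: slab_compact.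
have ci (y : V) : slab 0 w a b y -> {for y, continuous (fun y : V => (y 0 ord_max)^-1)}.
  move=> /pos y0; apply: (@continuous_comp V R R (fun y => y 0 ord_max) (fun t => t^-1)).
    exact: coord_continuous.
  by apply: inv_continuous; rewrite gt_eqF.
have mi := indic_measurable mS ci.
have i0 (y : V) : (0 <= (\1_(slab 0 w a b) y * (y 0 ord_max)^-1)%:E)%E.
  rewrite lee_fin indicE; have [|_] := boolP (_ \in _); last by rewrite mul0r.
  by rewrite inE => /pos/ltW; rewrite mul1r invr_ge0.
apply: (@le_lt_trans _ _ (integral_rV (fun y : V =>
    M%:E * (\1_(slab 0 w a b) y * (y 0 ord_max)^-1)%:E)%E)).
  apply: integral_rV_le => [y|y]; first exact: energy_integrand_ge0.
  have [Sy|nSy] := pselect (S y); last first.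
    apply: (@le_trans _ _ 0%E); last by rewrite mule_ge0.
    rewrite lee_fin indicE; have [|_] := boolP (_ \in _); last by rewrite mul0r.
    rewrite inE => -[hy _]; have [F0 D0] := S0 y hy nSy.
    by rewrite (N_zero F0 D0) powR0 ?gt_eqF// mul0r mulr0.
  have [sy _] := Sab y Sy; rewrite -EFinM lee_fin !indicE (mem_set sy) (mem_set (SO y Sy)) !mul1r.
  by rewrite ler_pdivlMr ?pos//; exact: HM.
rewrite integral_rVZ// integral_rV_indic//; last 2 first.
- exact: continuous_at_measurable.
- by move=> y /pos/ltW; rewrite invr_ge0.
by rewrite slab_integral// -EFinM ltry.
Qed.

Lemma functional_energy_cvg (u : nat -> H -> R) : (forall i, test_function Om (u i)) ->
  (forall eps, 0 < eps -> exists m, forall i j, (m <= i)%N -> (m <= j)%N ->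
    (functional_energy (fun x => u i x - u j x)%R < eps%:E)%E) ->
  exists (a : nat -> R) (l : R), [/\ forall i, functional_energy (u i) = (a i)%:E,
    0 <= l & a @ \oo --> l].
Proof.
move=> tu cu; pose a i := fine (functional_energy (u i)).
have aE i : functional_energy (u i) = (a i)%:E.
  by rewrite fineK// ge0_fin_numE ?functional_energy_ge0// functional_energy_fin.
have a0 i : 0 <= a i by rewrite fine_ge0// functional_energy_ge0.
have ru i : regular (u i) by case: (tu i) => /smooth_regular.
have [|l l0 al] := @quasi_cauchy_cvg a a0; last by exists a, l.
move=> th eps th0 e0; pose c := (1 + th^-1) `^ p.
have c0 : 0 < c by rewrite powR_gt0// ltr_wpDr// invr_ge0 ltW.
have [m Hm] := cu (eps / c) (divr_gt0 e0 c0); exists m => i j mi mj.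
have := functional_energy_quasi (ru i) (ru j) th0; rewrite !aE => H.
rewrite -lee_fin EFinD EFinM; apply: (le_trans H); apply: leeD2l.
apply: (@le_trans _ _ (c%:E * (eps / c)%:E)%E).
  by apply: lee_wpmul2l; [rewrite lee_fin ltW|exact: (ltW (Hm i j mi mj))].
by rewrite -EFinM lee_fin mulrCA mulfV ?mulr1// gt_eqF.
Qed.

End Functional.

End EnergyLimits.

(** * The eigenvalue of hyperbolic space *)

Section HyperbolicLowerBound.
Variables (R : realType) (n : nat).
Local Notation V := 'rV[R]_n.+1.
Local Notation e i := (@basis_vec R n i).
Local Notation H := (hyperbolic_space R n).
Local Notation half := (@upper_half_space R n).
Local Notation chart := (psi H 0).
Variables (kap p : R).
Hypotheses (kap_gt0 : 0 < kap) (p_gt1 : 1 < p).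
Local Notation g := (@hyperbolic_metric R n kap).

Let p_gt0 : 0 < p. Proof. exact: lt_trans p_gt1. Qed.

Definition abs_value (f : H -> R) (y : V) : R := `|f (chart y)|.

(** Completing the square: the two sides differ by [th^-1 * (th * b - (a - b)) ^+ 2]. *)
Lemma sqr_quasi (a b th : R) : 0 < th ->
  a ^+ 2 <= (1 + th) * b ^+ 2 + (1 + th^-1) * (a - b) ^+ 2.
Proof.
move=> th0; have thi : 0 < th^-1 by rewrite invr_gt0.
have thK : th * th^-1 = 1 by rewrite mulfV// gt_eqF.
(* A polynomial identity in which [th^-1] is an independent variable; the last summand carries the
   relation [th * th^-1 = 1]. *)
have -> : (1 + th) * b ^+ 2 + (1 + th^-1) * (a - b) ^+ 2 =
    a ^+ 2 + th^-1 * (th * b - (a - b)) ^+ 2 +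
    (1 - th * th^-1) * (th * b ^+ 2 - 2 * (b * (a - b))) by ring.
by rewrite thK subrr mul0r addr0 lerDl mulr_ge0 ?sqr_ge0// ltW.
Qed.

Lemma abs_value_quasi f h (y : V) th : regular f -> regular h -> half y -> 0 < th ->
  abs_value f y ^+ 2 <= (1 + th) * abs_value h y ^+ 2 +
    (1 + th^-1) * abs_value (fun x => f x - h x) y ^+ 2.
Proof.
by move=> _ _ _ th0; rewrite /abs_value !real_normK ?num_real//; exact: sqr_quasi.
Qed.

Lemma hyp_gradient_quasi f h (y : V) th : regular f -> regular h -> half y -> 0 < th ->
  hyp_gradient kap f y ^+ 2 <= (1 + th) * hyp_gradient kap h y ^+ 2 +
    (1 + th^-1) * hyp_gradient kap (fun x => f x - h x) y ^+ 2.
Proof.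
move=> rf rh hy th0; have k0 : 0 <= kap * y 0 ord_max ^+ 2 by rewrite mulr_ge0 ?sqr_ge0 ?ltW.
rewrite /hyp_gradient !(sqr_sqrtr (mulr_ge0 k0 (esq_ge0 _))).
rewrite (mulrCA (1 + th)) (mulrCA (1 + th^-1)) -mulrDr ler_wpM2l//.
rewrite /esq !mulr_sumr -big_split/=; apply: ler_sum => i _; rewrite !mxE.
have [_ /(_ i)[df _]] := rf; have [_ /(_ i)[dh _]] := rh.
have -> : 'D_(e i) ((fun x => f x - h x) \o chart) y =
    'D_(e i) (f \o chart) y - 'D_(e i) (h \o chart) y.
  exact: (deriveB (df y hy) (dh y hy)).
exact: sqr_quasi.
Qed.

Lemma hyp_gradient_zero f (y : V) : f (chart y) = 0 ->
  (forall i, 'D_(e i) (f \o chart) y = 0) -> hyp_gradient kap f y = 0.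
Proof.
move=> _ D0; rewrite /hyp_gradient /esq big1 ?mulr0 ?sqrtr0// => i _.
by rewrite mxE D0 expr0n.
Qed.

Lemma abs_value_cont f (y : V) : regular f -> half y -> {for y, continuous (abs_value f)}.
Proof.
move=> rf hy; apply: (@continuous_comp _ _ _ (f \o chart) (fun t => `|t|)).
  exact: Ck_cont rf hy.
exact: norm_continuous.
Qed.

Lemma Lp_energyE (Om : set H) f :
  Lp_energy g p Om f = functional_energy kap p abs_value Om f.
Proof. by rewrite /Lp_energy hyp_vol_integral// => x; exact: powR_ge0. Qed.

Lemma grad_energyE (Om : set H) f : regular f ->
  grad_energy g p Om f = functional_energy kap p (hyp_gradient kap) Om f.
Proof.
move=> rf; rewrite /grad_energy /functional_energy (hyp_vol_integral kap_gt0); last first.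
  by move=> x; exact: powR_ge0.
congr integral_rV; apply/funext => y; congr EFin; rewrite indicE.
have [|_] := boolP (_ \in _); last by rewrite !mul0r.
by rewrite inE => -[hy _]; rewrite (hyp_grad_norm kap_gt0 rf hy).
Qed.

Lemma poweR_lt (x : \bar R) (eps : R) : (0 <= x)%E -> 0 < eps ->
  (x `^ p^-1 < (eps `^ p^-1)%:E)%E -> (x < eps%:E)%E.
Proof.
move=> x0 e0; have pi : 0 < p^-1 by rewrite invr_gt0.
case: x x0 => [r r0|_|//]; last by rewrite poweRyr// gt_eqF.
rewrite poweR_EFin !lte_fin; apply: contraTT; rewrite -!leNgt => er.
by apply: ge0_ler_powR; rewrite ?nnegrE ?(ltW pi)// ltW.
Qed.

Section Sequence.
Variables (Om : set H) (u : nat -> H -> R).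
Hypothesis oOm : open Om.
Hypothesis W1p0_u : W1p0 g p Om u.

Let tu i : test_function Om (u i). Proof. exact: W1p0_u.1. Qed.
Let ru i : regular (u i). Proof. by case: (tu i) => /smooth_regular. Qed.

Let Lp0 f : (0 <= Lp_energy g p Om f)%E.
Proof.
by apply: vol_integral_ge0 => [|x _]; [exact: hyperbolic_manifold|exact: powR_ge0].
Qed.

Let gr0 f : (0 <= grad_energy g p Om f)%E.
Proof.
by apply: vol_integral_ge0 => [|x _]; [exact: hyperbolic_manifold|exact: powR_ge0].
Qed.

Let small eps : 0 < eps -> exists m, forall i j, (m <= i)%N -> (m <= j)%N ->
  (Lp_energy g p Om (fun x => u i x - u j x)%R +
   grad_energy g p Om (fun x => u i x - u j x)%R < eps%:E)%E.
Proof.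
move=> e0; have [m Hm] := W1p0_u.2 _ (powR_gt0 p^-1 e0); exists m => i j mi mj.
exact (poweR_lt (adde_ge0 (Lp0 _) (gr0 _)) e0 (Hm i j mi mj)).
Qed.

Lemma rayleigh_ge : ~ W1p0_zero g p Om u ->
  ((Num.sqrt kap `^ p * (n%:R / p) `^ p)%:E <= rayleigh g p Om u)%E.
Proof.
move=> nz; set c := _ * _; have c0 : 0 <= c by rewrite mulr_ge0 ?powR_ge0.
have az f (y : V) : f (chart y) = 0 -> (forall i, 'D_(e i) (f \o chart) y = 0) ->
    abs_value f y = 0.
  by move=> F0 _; rewrite /abs_value F0 normr0.
have sa eps : 0 < eps -> exists m, forall i j, (m <= i)%N -> (m <= j)%N ->
    (functional_energy kap p abs_value Om (fun x => u i x - u j x)%R < eps%:E)%E.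
  move=> e0; have [m Hm] := small e0; exists m => i j mi mj; rewrite -Lp_energyE.
  exact (le_lt_trans (leeDl _ (gr0 _)) (Hm i j mi mj)).
have sb eps : 0 < eps -> exists m, forall i j, (m <= i)%N -> (m <= j)%N ->
    (functional_energy kap p (hyp_gradient kap) Om (fun x => u i x - u j x)%R < eps%:E)%E.
  move=> e0; have [m Hm] := small e0; exists m => i j mi mj.
  rewrite -(grad_energyE _ (regularB (ru i) (ru j))).
  exact (le_lt_trans (leeDr _ (Lp0 _)) (Hm i j mi mj)).
have [a [la [aE la0 al]]] := @functional_energy_cvg R n kap p p_gt1 abs_value Om oOm
  (fun _ _ => normr_ge0 _) abs_value_cont abs_value_quasi az u tu sa.
have [b [lb [bE lb0 bl]]] := @functional_energy_cvg R n kap p p_gt1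
  (hyp_gradient kap) Om oOm
  (fun _ _ => sqrtr_ge0 _) (fun f y => @hyp_gradient_cont R n kap f y) hyp_gradient_quasi hyp_gradient_zero u tu sb.
have aE' i : Lp_energy g p Om (u i) = (a i)%:E by rewrite Lp_energyE aE.
have bE' i : grad_energy g p Om (u i) = (b i)%:E by rewrite grad_energyE ?bE.
have cab : c * la <= lb.
  apply: (@ler_cvg_to nat \oo _ R (fun i => c * a i) b) => //.
    by apply: cvgM; [exact: cvg_cst|exact: al].
  near=> i; have := hardy_test kap_gt0 p_gt1 oOm (tu i).
  by rewrite aE' bE' -EFinM lee_fin.
have lim_ae : limn (fun i => Lp_energy g p Om (u i)) = la%:E.
  rewrite (_ : (fun i => _) = EFin \o a); last by apply/funext => i; rewrite aE'.
  apply: cvg_lim; first exact: ereal_hausdorff.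
  by apply: cvg_EFin al; near=> i.
have lim_be : limn (fun i => grad_energy g p Om (u i)) = lb%:E.
  rewrite (_ : (fun i => _) = EFin \o b); last by apply/funext => i; rewrite bE'.
  apply: cvg_lim; first exact: ereal_hausdorff.
  by apply: cvg_EFin bl; near=> i.
have -> : rayleigh g p Om u = (lb%:E * la%:E^-1)%E by rewrite -lim_be -lim_ae.
(* If the Lp energies tend to 0, the inverse of their limit is [+oo]. The gradient energies then
   have a positive limit, since otherwise the sequence would represent zero, and the quotient is
   [+oo]. *)
rewrite inver; case: eqVneq => [la_0|la_n0]; last first.
  by rewrite -EFinM lee_fin ler_pdivlMr// lt_def la_n0.
have lb1 : 0 < lb.
  rewrite lt_def lb0 andbT; apply/eqP => lb_0; apply: nz.
  rewrite /W1p0_zero /sobolev_norm.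
  rewrite (_ : (fun i => _) = EFin \o (fun i => `|a i + b i| `^ p^-1)); last first.
    apply/funext => i; rewrite aE' bE' -EFinD poweR_EFin/=.
    have a0 : 0 <= a i by rewrite -lee_fin -aE'; exact (Lp0 _).
    have b0 : 0 <= b i by rewrite -lee_fin -bE'; exact (gr0 _).
    by rewrite (ger0_norm (addr_ge0 a0 b0)).
  have ab0 : (fun i => a i + b i) @ \oo --> (0 : R).
    by rewrite -[X in _ --> X](addr0 0) -{1}la_0 -lb_0; exact: cvgD.
  have pi : 0 < p^-1 by rewrite invr_gt0.
  have := cvg_comp _ _ ab0 (@abs_powR_continuous R _ pi 0).
  by rewrite normr0 powR0 ?gt_eqF// => H0; apply: cvg_EFin H0; near=> i.
by rewrite gt0_muley ?lte_fin// leey.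
Unshelve. all: by end_near. Qed.

End Sequence.

Lemma hyperbolic_lower_bound :
  ((Num.sqrt kap `^ p * (n%:R / p) `^ p)%:E <= lambda1p g p)%E.
Proof.
apply/ereal_infP => _ [Om dOm <-]; apply/ereal_infP => _ [u [Wu nz] <-].
by apply: rayleigh_ge => //; case: dOm.
Qed.

Lemma hyperbolic_lambda1p :
  (lambda1p g p = (Num.sqrt kap `^ p * (n%:R / p) `^ p)%:E)%E.
Proof.
by apply/eqP; rewrite eq_le hyperbolic_lower_bound hyperbolic_upper_bound.
Qed.

End HyperbolicLowerBound.

(** * Defining functions *)

Section DefiningFunction.
Variables (R : realType) (n : nat) (X : charted_space R n).
Hypothesis X_mf : smooth_manifold X.
Local Notation V := 'rV[R]_n.+1.
Local Notation e i := (@basis_vec R n i).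

Lemma ratio_dist_le (u a t eps : R) : 0 < t -> `|u - a * t| <= eps * t -> `|a - u / t| <= eps.
Proof.
move=> t0; rewrite -ler_pdivrMr// distrC => h.
by rewrite -[X in X - _](mulfK (lt0r_neq0 t0)) -mulrBl normf_div (gtr0_norm t0) distrC -distrC.
Qed.

Lemma chart_continuous (F : V -> R) (f : X -> R) k (x : X) (U : set V) :
  dom X k x -> open U -> U (phi X k x) -> {for phi X k x, continuous F} ->
  (forall z, U z -> cod X k z -> f (psi X k z) = F z) -> {for x, continuous f}.
Proof.
move=> dx oU Ux cF fF; have cp := phi_cont X_mf dx.
have N : \forall z \near x, F (phi X k z) = f z.
  have Nd : nbhs x (dom X k) by apply: open_nbhs_nbhs; split => //; exact: mf_dom_open.
  have NU : nbhs x (phi X k @^-1` U) by apply: cp; exact: open_nbhs_nbhs.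
  apply: (@filterS2 X (nbhs x) _ _ _ _ _ Nd NU) => z dz Uz.
  by rewrite -fF ?(mf_phiK X_mf)//; exact: cod_phi.
have cc : {for x, continuous (F \o phi X k)} by exact: continuous_comp cp cF.
move=> A; rewrite -(nbhs_singleton N) => /cc FA.
by apply: (@filterS2 X (nbhs x) _ _ _ _ _ N FA) => z /= <-.
Qed.

Variable r : X -> R.
Hypothesis r_def : defining_function r.

Let r_smooth : smooth_fun r. Proof. by case: r_def. Qed.

Lemma defining_ge0 x : 0 <= r x. Proof. by case: r_def. Qed.

Lemma defining_gt0 x : minterior x -> 0 < r x.
Proof.
move=> ix; rewrite lt_def defining_ge0 andbT; apply/eqP => rx; apply: ix.
by case: r_def => _ _ /(_ x) [/(_ rx)].
Qed.

(* Were a boundary point interior in another chart, r would have an interior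
   minimum there, contradicting [dr <> 0]. *)
Lemma defining_boundary k (x : X) : dom X k x -> mboundary x -> phi X k x 0 ord_max = 0.
Proof.
move=> dx bx; have [//|yn] := eqVneq (phi X k x 0 ord_max) 0.
have [_ _ rE /(_ k x bx dx)/negP[]] := r_def; apply/eqP.
pose y := phi X k x; have cy : cod X k y by exact: cod_phi.
have iy : icod X k y by split => //; rewrite /upper_half_space/= lt_def yn (cod_ge0 X_mf cy).
have psiy : psi X k y = x by exact: (mf_phiK X_mf dx).
have [_ CF] : Ck 1 (icod X k) (r \o psi X k).
  by apply: (@smooth_within_Ck R n 1 (cod X k)); [exact: icod_open|move=> z []|exact: r_smooth].
have [del d0 Hd] := open_norm_ball (icod_open X_mf (k := k)) iy.
apply/rowP => i; rewrite !mxE rpartialE; last exact: (CF i).1.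
have ray (t : R) : t \in `]- del, del[ -> icod X k (y + t *: e i).
  rewrite in_itv/= -ltr_norml => td; apply: Hd; rewrite addrAC subrr add0r.
  apply: rV_norm_lt => // j; rewrite !mxE eqxx /=.
  by case: (_ == _); rewrite ?mulr1 ?mulr0 ?normr0.
have D t : t \in `]- del, del[ -> is_derive t (1 : R)
    (fun s : R => (r \o psi X k) (y + s *: e i)) ('D_(e i) (r \o psi X k) (y + t *: e i)).
  by move=> td; apply: is_derive_line; exact: (CF i).1 (ray _ td).
have z0 : (0 : R) \in `]- del, del[ by rewrite in_itv/= oppr_lt0 d0.
have [|||_ <-] := @derive1_at_min R (fun s : R => (r \o psi X k) (y + s *: e i)) (- del) del 0 _ _ z0.
- by rewrite ge0_cp// ltW.
- by move=> t td; have [] := D t td.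
- move=> t _; rewrite scale0r addr0 /= psiy.
  by have [_ ->//] := rE x; exact: defining_ge0.
by have [_ ->] := D 0 z0; rewrite scale0r addr0.
Qed.

Definition normal_derivative k (x : X) : R := diff_fun k r x 0 ord_max.

(** Tangential derivatives vanish because [r] is zero on the face. The estimate is strict
    differentiability between [y] and its foot on the face, uniform in the foot; the sign of the
    slope comes from [r >= 0] and [dr <> 0]. *)
Lemma defining_first_order k (x : X) : dom X k x -> mboundary x ->
  [/\ diff_fun k r x = normal_derivative k x *: e ord_max, 0 < normal_derivative k x &
  forall eps, 0 < eps -> exists2 del, 0 < del & forall y : V, `|y - phi X k x| < del ->
    0 < y 0 ord_max -> cod X k y /\
    `|r (psi X k y) - normal_derivative k x * y 0 ord_max| <= eps * y 0 ord_max].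
Proof.
move=> dx bx; pose y0 := phi X k x.
have y0n : y0 0 ord_max = 0 by exact: defining_boundary.
have cy0 : cod X k y0 by exact: cod_phi.
have psiy0 : psi X k y0 = x by exact: (mf_phiK X_mf dx).
have [U [F [oU Uy CF rF dF]]] := smooth_diff_fun X_mf r_smooth cy0.
have [_ _ rE /(_ k x bx dx) dr] := r_def.
have r0 z : cod X k z -> z 0 ord_max = 0 -> r (psi X k z) = 0.
  move=> cz zn; apply/rE; exists k; first exact: psi_dom.
  by rewrite (psiK X_mf cz).
have dn : normal_derivative k x = 'D_(e ord_max) F y0.
  by rewrite /normal_derivative -psiy0 dF// mxE.
have dE : diff_fun k r x = normal_derivative k x *: e ord_max.
  apply/rowP => i; rewrite [RHS]mxE basis_vecE eq_sym; have [->|ni] := eqVneq i ord_max.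
    by rewrite mulr1.
  rewrite mulr0 mxE (@rpartial_derive R n i _ (fun=> 0)).
  - exact: derive_cst.
  - exact: derivable_cst.
  - by rewrite /= psiy0; apply/rE.
  have ty : trans_cod X k k y0 by split => //; exact: psi_dom.
  have N := trans_cod_ray X_mf i ty; apply: filterS N => t [ct _].
  by apply: r0 => //; rewrite !mxE eqxx /= -/y0 y0n add0r eq_sym (negbTE ni) mulr0.
have [U0 oU0 cU0] := mf_cod_open X_mf k.
have U0y : U0 y0 by move: cy0; rewrite cU0 => -[].
have est eps : 0 < eps -> exists2 del, 0 < del & forall y : V, `|y - y0| < del ->
    0 < y 0 ord_max -> cod X k y /\
    `|r (psi X k y) - normal_derivative k x * y 0 ord_max| <= eps * y 0 ord_max.
  move=> eps0; have [d1 d10 H1] := C1_strict_differentiable oU Uy (CF 1%N) eps0.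
  have [d2 d20 H2] := open_norm_ball oU Uy; have [d3 d30 H3] := open_norm_ball oU0 U0y.
  pose del := Num.min d1 (Num.min d2 d3).
  have d0 : 0 < del by rewrite !lt_min d10 d20 d30.
  (* [z] is the foot of the perpendicular from [y] to the face, where [r] vanishes. *)
  exists del => // y yd yn; pose z := y - y 0 ord_max *: e ord_max.
  have zn : z 0 ord_max = 0 by rewrite !mxE !eqxx mulr1 subrr.
  have zd : `|z - y0| < del.
    apply: rV_norm_lt => // j; have [->|nj] := eqVneq j ord_max.
      by rewrite mxE zn [X in 0 + X]mxE y0n oppr0 addr0 normr0.
    rewrite !mxE eqxx (negbTE nj) mulr0 subr0.
    by apply: le_lt_trans yd; have := rV_coord_le (y - y0) j; rewrite !mxE.
  move: (yd) (zd); rewrite !lt_min => /and3P[y1 y2 y3] /and3P[z1 z2 z3].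
  have cy : cod X k y by rewrite cU0; split; [exact: H3|exact: ltW].
  have cz : cod X k z by rewrite cU0; split; [exact: H3|rewrite /half_space/= zn].
  split => //; have := H1 y z y1 z1.
  have -> : y - z = y 0 ord_max *: e ord_max by rewrite opprB addrC subrK.
  rewrite -(rF y (H2 y y2) cy) -(rF z (H2 z z2) cz) (r0 z cz zn) subr0.
  rewrite (bigD1 ord_max)//= big1 => [|i ni]; last by rewrite !mxE eqxx (negbTE ni) mulr0 mul0r.
  rewrite addr0 dn !mxE !eqxx mulr1 mulrC => /le_trans; apply.
  rewrite ler_pM2l//; apply: rV_norm_le => [|j]; first exact: ltW.
  rewrite !mxE eqxx /=; case: (_ == _); rewrite ?mulr1 ?mulr0 ?normr0 ?(ltW yn)//.
  by rewrite gtr0_norm.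
split => //; rewrite lt_def; apply/andP; split.
  by apply: contraNneq dr => d0; rewrite dE d0 scale0r.
(* A negative slope would make [r] negative at a point slightly above the face. *)
rewrite leNgt; apply/negP => neg; have eps0 : 0 < - normal_derivative k x / 2.
  by rewrite divr_gt0// oppr_gt0.
have [del d0 H] := est _ eps0; pose t := del / 2.
have t0 : 0 < t by rewrite divr_gt0.
have td : `|y0 + t *: e ord_max - y0| < del.
  rewrite addrAC subrr add0r; apply: rV_norm_lt => // j; rewrite !mxE eqxx /=.
  have tdel : t < del by rewrite /t; lra.
  by case: (_ == _); rewrite ?mulr1 ?mulr0 ?normr0// gtr0_norm.
have yn : (y0 + t *: e ord_max) 0 ord_max = t by rewrite !mxE !eqxx mulr1 -/y0 y0n add0r.
have := H _ td; rewrite yn => /(_ t0)[_]; rewrite ler_norml => /andP[_].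
have := defining_ge0 (psi X k (y0 + t *: e ord_max)).
have : normal_derivative k x * t < 0 by rewrite pmulr_llt0.
lra.
Qed.

Lemma defining_continuous (x : X) : {for x, continuous r}.
Proof.
have [k dx] := mf_cover X_mf x.
have [U [F [oU Ux CF rF _]]] := smooth_diff_fun X_mf r_smooth (cod_phi dx).
by apply: (chart_continuous dx oU Ux _ rF); exact: Ck_cont (CF 0%N) Ux.
Qed.

Lemma diff_fun_continuous k i (x : X) : dom X k x ->
  {for x, continuous (fun z => diff_fun k r z 0 i)}.
Proof.
move=> dx; have [U [F [oU Ux CF _ dF]]] := smooth_diff_fun X_mf r_smooth (cod_phi dx).
have [_ H] := CF 1%N.
apply: (chart_continuous (F := fun z => 'D_(e i) F z) dx oU Ux).
  exact: (H i).2.1 _ Ux.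
by move=> z Uz cz; rewrite dF// mxE.
Qed.

(** Boundary points are limits of interior points. Without this the filter in [compactified] would
    be trivial and its [lim] would not be determined. *)
Lemma minterior_proper (x : X) : ProperFilter (within (@minterior R n X) (nbhs x)).
Proof.
apply: Build_ProperFilter_ex => A; rewrite /within/= nbhsE => -[B [oB Bx] BA].
have [[k dx _]|ix] := pselect (mboundary x); last first.
  by exists x; exact: BA.
have [U oU cU] := cod_preimage_open X_mf k oB.
have [Uy hy] : (U `&` @half_space R n) (phi X k x).
  by rewrite -cU; split; [exact: cod_phi|rewrite /preimage/= (mf_phiK X_mf dx)].
have [d d0 Hd] := open_norm_ball oU Uy.
pose y := phi X k x + (d / 2) *: e ord_max.
have d2 : 0 < d / 2 by rewrite divr_gt0.
have yn : 0 < y 0 ord_max by rewrite !mxE !eqxx mulr1 ltr_wpDl.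
have Uy' : U y.
  apply: Hd; rewrite addrAC subrr add0r; apply: rV_norm_lt => // j; rewrite !mxE eqxx /=.
  have dd : d / 2 < d by lra.
  by case: (_ == _); rewrite ?mulr1 ?mulr0 ?normr0// gtr0_norm.
have [cy By] : (cod X k `&` psi X k @^-1` B) y by rewrite cU; split => //; exact: ltW.
exists (psi X k y); apply: (BA _ By).
exact: (icod_psi X_mf defining_boundary).
Qed.

Lemma defining_ratio k (x : X) : dom X k x -> mboundary x ->
  (fun z => r z / phi X k z 0 ord_max) @ within (@minterior R n X) (nbhs x) -->
  normal_derivative k x.
Proof.
move=> dx bx; have [_ _ H] := defining_first_order dx bx.
apply/cvgrPdist_le => eps eps0; have [del d0 Hd] := H eps eps0.
have cp := phi_cont X_mf dx.
have Nd : nbhs x (dom X k) by apply: open_nbhs_nbhs; split => //; exact: mf_dom_open.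
have NB : nbhs x (phi X k @^-1` [set y | `|y - phi X k x| < del]).
  apply: cp; rewrite (_ : [set y | _] = ball (phi X k x) del); first exact: nbhsx_ballx.
  by apply/seteqP; split => v; rewrite -ball_normE/= distrC.
rewrite /within/=; apply: (@filterS2 X (nbhs x) _ _ _ _ _ Nd NB) => z dz zd iz.
have [cz yn] : icod X k (phi X k z) by apply/(icod_phi X_mf defining_boundary dz).
have [_] := Hd _ zd yn; rewrite (mf_phiK X_mf dz) => h.
exact: ratio_dist_le h.
Qed.

End DefiningFunction.

(** * The conformal compactification at the boundary *)

Section Compactification.
Variables (R : realType) (n : nat) (X : charted_space R n).
Hypothesis X_mf : smooth_manifold X.
Local Notation V := 'rV[R]_n.+1.
Local Notation e i := (@basis_vec R n i).

Lemma covec_normZ (M : 'M[R]_n.+1) (c : R) (v : V) : \det M != 0 -> 0 < c ->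
  covec_norm (c ^+ 2 *: M) v = covec_norm M (c^-1 *: v).
Proof.
move=> dM c0; rewrite /covec_norm invmxZ; last first.
  by rewrite unitmxE unitfE detZ mulf_neq0// expf_neq0// expf_neq0// gt_eqF.
congr (Num.sqrt (_ _ _)); rewrite -scalemxAr -!scalemxAl linearZ /= -scalemxAr scalerA.
by rewrite -expr2 exprVn.
Qed.

Lemma covec_norm_gt0 (M : 'M[R]_n.+1) (a : R) : posdef M -> 0 < a ->
  0 < covec_norm M (a *: e ord_max).
Proof.
move=> pM a0; rewrite /covec_norm sqrtr_gt0 linearZ/= -scalemxAr -!scalemxAl scalerA.
rewrite /basis_vec -rowE trmx_delta -colE !mxE mulr_gt0 ?mulr_gt0//.
exact: G_inv_gt0.
Qed.

Variables (g gbar : metric_field X) (r0 : X -> R) (alpha : R).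
Hypothesis r0_def : defining_function r0.
Hypothesis gbar_metric : riemannian_metric [set: X] gbar.
Hypothesis gbar_holder : forall k i j, holder_within 3 alpha (cod X k)
  (fun y => gbar k (psi X k y) i j).
Hypothesis gbarE : forall k x, minterior x -> dom X k x -> gbar k x = r0 x ^+ 2 *: g k x.

Let bdry := defining_boundary X_mf r0_def.

Lemma gbar_posdef k (x : X) : dom X k x -> posdef (gbar k x).
Proof. by move=> dx v v0; have [_ /(_ _ v0)] := gbar_metric (I : [set: X] x) dx. Qed.

Lemma gbar_det k (x : X) : dom X k x -> \det (gbar k x) != 0.
Proof. by move=> dx; rewrite gt_eqF// posdef_det_gt0//; exact: gbar_posdef. Qed.

Lemma gbar_continuous k i j (x : X) : dom X k x -> {for x, continuous (fun z => gbar k z i j)}.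
Proof.
move=> dx; have [U [F [oU Ux CF _ gF]]] := gbar_holder i j (cod_phi dx).
apply: (chart_continuous X_mf dx oU Ux); last exact: gF.
by have [] := CF [::] isT _ Ux.
Qed.

Lemma g_gbar k (x : X) : minterior x -> dom X k x -> g k x = (r0 x)^-1 ^+ 2 *: gbar k x.
Proof.
move=> ix dx; rewrite gbarE// scalerA -exprMn mulVf ?expr1n ?scale1r// gt_eqF//.
exact: (defining_gt0 r0_def).
Qed.

(** On the interior [g] is [gbar] divided by the square of a positive continuous function. *)
Lemma g_continuous k (y : V) : icod X k y -> forall i j,
  {for y, continuous (fun y => g k (psi X k y) i j)}.
Proof.
move=> iy i j; have cp := psi_cont X_mf iy.
have dy : dom X k (psi X k y) by apply: psi_dom => //; case: iy.
have iX : minterior (psi X k y) by exact: (icod_psi X_mf bdry).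
pose h z := (r0 z)^-1 ^+ 2 * gbar k z i j.
have ch : {for y, continuous (h \o psi X k)}.
  apply: continuous_comp cp _; apply: (@cvgM R X (nbhs (psi X k y))); last exact: gbar_continuous.
  have rV : (fun z => (r0 z)^-1) @ nbhs (psi X k y) --> (r0 (psi X k y))^-1.
    apply: cvgV; first by rewrite gt_eqF// (defining_gt0 r0_def).
    exact: defining_continuous.
  by rewrite /= (_ : (fun z => _) = (fun z => (r0 z)^-1 * (r0 z)^-1))//; exact: cvgM.
apply: near_eq_continuous ch.
have N : nbhs y (icod X k) by apply: open_nbhs_nbhs; split => //; exact: icod_open.
apply: (@filterS V (nbhs y) _ _ _ _ N) => z iz.
rewrite (@g_gbar k) ?mxE//; first exact: (icod_psi X_mf bdry).
by apply: psi_dom; case: iz.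
Qed.

(** On the interior [r ^+ 2 g] is [(r / r0) ^+ 2] times [gbar]. Numerator and denominator vanish on
    the face; dividing both by the height gives the ratio of the normal derivatives as limit. *)
Lemma compactified_boundary r k (x : X) : defining_function r -> dom X k x -> mboundary x ->
  compactified r g k x =
    (normal_derivative r k x / normal_derivative r0 k x) ^+ 2 *: gbar k x.
Proof.
move=> r_def dx bx; apply/matrixP => i j; rewrite !mxE.
have PF := minterior_proper X_mf r0_def x.
apply: cvg_lim; first exact: norm_hausdorff.
have [_ a0 _] := defining_first_order X_mf r0_def dx bx.
have c1 := defining_ratio X_mf r_def dx bx.
have c0 := defining_ratio X_mf r0_def dx bx.
have cg : gbar k z i j @[z --> within (@minterior R n X) (nbhs x)] --> gbar k x i j.
  apply: cvg_within_filter; exact: gbar_continuous.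
have cq : (fun z => r z / phi X k z 0 ord_max / (r0 z / phi X k z 0 ord_max))
    @ within (@minterior R n X) (nbhs x) -->
    normal_derivative r k x / normal_derivative r0 k x.
  by apply: cvgM => //; apply: cvgV => //; rewrite gt_eqF.
apply: cvg_trans (cvgM (cvgM cq cq) cg); apply: near_eq_cvg.
have Nd : nbhs x (dom X k) by apply: open_nbhs_nbhs; split => //; exact: mf_dom_open.
rewrite /within/=; apply: filterS Nd => z dz iz /=.
have [_ yn] : icod X k (phi X k z) by apply/(icod_phi X_mf bdry dz).
have rz : r0 z != 0 by rewrite gt_eqF// (defining_gt0 r0_def).
have yn0 : phi X k z 0 ord_max != 0 by rewrite gt_eqF.
rewrite (gbarE iz dz) mxE; field.
by rewrite rz yn0.
Qed.

(** Passing from [r0] to [r] multiplies the differential by the ratio of normal derivatives and the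
    metric by its square, and the two effects cancel in the norm. *)
Lemma diff_norm_boundary r (x : X) : defining_function r -> mboundary x ->
  diff_norm (compactified r g) r x = diff_norm gbar r0 x.
Proof.
move=> r_def bx; rewrite /diff_norm; have dx := chart_at_dom X_mf x.
have [-> a0 _] := defining_first_order X_mf r0_def dx bx.
have [-> a _] := defining_first_order X_mf r_def dx bx.
rewrite (compactified_boundary r_def dx bx) covec_normZ ?gbar_det ?divr_gt0//.
by rewrite scalerA invfM invrK mulrAC mulVf ?mul1r// gt_eqF.
Qed.

Lemma diff_norm_chart k (x : X) : dom X k x ->
  diff_norm gbar r0 x = covec_norm (gbar k x) (diff_fun k r0 x).
Proof.
move=> dk; have dc := chart_at_dom X_mf x.
have [_ _ /(_ _ dk) H] := gbar_metric (I : [set: X] x) dc.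
have [sr _ _ _] := r0_def.
rewrite /diff_norm /covec_norm; congr Num.sqrt.
by rewrite (covec_trans (gbar_det dc) H (diff_fun_trans X_mf sr dc dk)).
Qed.

(** [diff_norm] is computed in [chart_at], which may jump; near [x] it equals the expression in one
    fixed chart, where every ingredient is continuous. *)
Lemma diff_norm_continuous (x : X) : {for x, continuous (diff_norm gbar r0)}.
Proof.
have [k dx] := mf_cover X_mf x.
pose q z := \sum_j (\sum_i diff_fun k r0 z 0 i * invmx (gbar k z) i j) * diff_fun k r0 z 0 j.
have qE z : covec_norm (gbar k z) (diff_fun k r0 z) = Num.sqrt (q z).
  rewrite /covec_norm mxE; congr Num.sqrt; apply: eq_bigr => j _; rewrite !mxE.
  by congr (_ * _); apply: eq_bigr => i _; rewrite mxE.
have cq : q @ nbhs x --> q x.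
  apply: (@cvg_sum_ord R X (nbhs x) _ 'I_n.+1 (fun j z =>
    (\sum_i diff_fun k r0 z 0 i * invmx (gbar k z) i j) * diff_fun k r0 z 0 j)
    (fun j => (\sum_i diff_fun k r0 x 0 i * invmx (gbar k x) i j) * diff_fun k r0 x 0 j)) => j.
  apply: cvgM; last exact: diff_fun_continuous.
  apply: (@cvg_sum_ord R X (nbhs x) _ 'I_n.+1 (fun i z =>
    diff_fun k r0 z 0 i * invmx (gbar k z) i j)
    (fun i => diff_fun k r0 x 0 i * invmx (gbar k x) i j)) => i.
  apply: cvgM; first exact: diff_fun_continuous.
  apply: cvg_invmx; first exact: gbar_det.
  by move=> a b; exact: gbar_continuous.
have cs : {for x, continuous (Num.sqrt \o q)}.
  by apply: continuous_comp; [exact: cq|exact: sqrt_continuous].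
have Nd : nbhs x (dom X k) by apply: open_nbhs_nbhs; split => //; exact: mf_dom_open.
move=> A; rewrite (diff_norm_chart dx) qE => /cs qA.
by apply: (@filterS2 X (nbhs x) _ _ _ _ _ Nd qA) => z dz /=; rewrite (diff_norm_chart dz) qE.
Qed.

Lemma mboundary_closed : closed (@mboundary R n X).
Proof.
rewrite (_ : mboundary (X:=X) = r0 @^-1` [set 0]).
  by apply: closed_comp => [x _|]; [exact: defining_continuous|exact: closed_eq].
by apply/seteqP; split => x /=; have [_ _ rE _] := r0_def; rewrite rE.
Qed.

(** [y_n ^ 2 g] is [(y_n / r0) ^ 2 gbar], and [r0 / y_n] tends to the normal derivative. *)
Lemma scaled_metric_limit k (x : X) : dom X k x -> mboundary x -> forall i j,
  (fun y : V => y 0 ord_max ^+ 2 * g k (psi X k y) i j) @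
    within [set y : V | 0 < y 0 ord_max] (nbhs (phi X k x)) -->
  ((normal_derivative r0 k x)^-1 ^+ 2 *: gbar k x) i j.
Proof.
move=> dx bx i j; have [_ a0 H] := defining_first_order X_mf r0_def dx bx.
set a := normal_derivative r0 k x in a0 H *; rewrite mxE.
pose F := within [set y : V | 0 < y 0 ord_max] (nbhs (phi X k x)).
have FF : Filter F by exact: within_filter.
have icodF : F (icod X k).
  have [del d0 Hd] := H 1 ltr01; rewrite /F /within/=.
  apply: filterS (nbhsx_ballx (phi X k x) del d0) => y; rewrite -ball_normE/= distrC => yd yn.
  by have [] := Hd y yd yn.
have cq : (fun y : V => r0 (psi X k y) / y 0 ord_max) @ F --> a.
  apply/cvgrPdist_le => eps eps0; have [del d0 Hd] := H eps eps0; rewrite /F /within/=.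
  apply: filterS (nbhsx_ballx (phi X k x) del d0) => y; rewrite -ball_normE/= distrC => yd yn.
  have [_] := Hd y yd yn => h.
  exact: ratio_dist_le h.
have cg : (fun y : V => gbar k (psi X k y) i j) @ F --> gbar k x i j.
  have [U [G [oU Ux CG _ gG]]] := gbar_holder i j (cod_phi dx).
  have <- : G (phi X k x) = gbar k x i j by rewrite -gG ?(mf_phiK X_mf dx)//; exact: cod_phi.
  have cG : G @ F --> G (phi X k x).
    by apply: cvg_within_filter; have [] := CG [::] isT _ Ux.
  apply: cvg_trans cG; apply: near_eq_cvg.
  have NU : F U.
    have := open_nbhs_nbhs (conj oU Ux); rewrite /F /within/=.
    by apply: (@filterS V (nbhs (phi X k x))) => y Uy _.
  by apply: (@filterS2 V F FF _ _ _ _ icodF NU) => y [cy _] Uy; rewrite gG.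
have ci := @cvgV R V F FF _ _ (lt0r_neq0 a0) cq.
apply: cvg_trans (cvgM (cvgM ci ci) cg); apply: near_eq_cvg.
apply: filterS icodF => y [cy yn] /=.
have iy : minterior (psi X k y) by exact: (icod_psi X_mf bdry).
have ry : r0 (psi X k y) != 0 by rewrite gt_eqF// (defining_gt0 r0_def).
have yn0 : y 0 ord_max != 0 by rewrite gt_eqF.
rewrite (gbarE iy (psi_dom X_mf cy)) mxE; field.
by rewrite ry yn0.
Qed.

Hypothesis g_metric : riemannian_metric (@minterior R n X) g.

Lemma conformally_compact_upper_bound p (x : X) : 1 < p -> mboundary x ->
  (lambda1p g p <= (diff_norm gbar r0 x `^ p * (n%:R / p) `^ p)%:E)%E.
Proof.
move=> p1 bx; have dx := chart_at_dom X_mf x; set k := chart_at x in dx *.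
have [dr a0 H] := defining_first_order X_mf r0_def dx bx.
set a := normal_derivative r0 k x in dr a0 H.
(* The limit of [y_n ^ 2 g] is [gbar] divided by [a ^ 2]; this division multiplies the norm of
   [dy_n] by [a], which gives the norm of [dr0 = a dy_n]. *)
have -> : diff_norm gbar r0 x = covec_norm (a^-1 ^+ 2 *: gbar k x) (e ord_max).
  by rewrite covec_normZ ?gbar_det ?invr_gt0// invrK /diff_norm -/k dr.
(* The first-order estimate with error [a / 2] puts [r0] between [a / 2] and [a + a / 2] times the
   height. *)
have a2 : 0 < a / 2 by rewrite divr_gt0.
apply: (@chart_upper_bound R n X X_mf bdry g g_metric g_continuous k (phi X k x) _
  (bdry dx bx) _ (scaled_metric_limit dx bx) r0 (a / 2) (a + a / 2) a2 _ _ _ _ p p1 _).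
- move=> v v0; rewrite -scalemxAr -scalemxAl mxE mulr_gt0 ?exprn_gt0 ?invr_gt0//.
  exact: gbar_posdef.
- by rewrite addr_gt0.
- exact: (defining_ge0 r0_def).
- by move=> z; exact: (defining_gt0 r0_def).
- by move=> z _; exact: defining_continuous.
have [del d0 Hd] := H _ a2; exists del => // y yd yn; have [cy h] := Hd y yd yn.
split; first by split.
by move: h; rewrite ler_norml => /andP[h1 h2]; apply/andP; split; lra.
Qed.

End Compactification.

(** * The comparison at a minimiser of the boundary norm *)

Unset Implicit Arguments.

Theorem theorem1p4 (R : realType) (n : nat) (X : charted_space R n)
    (g : metric_field X) (r : X -> R) (p : R)
    (X_manifold : smooth_manifold X)
    (X_compact : compact [set: X])
    (X_boundary : exists x : X, mboundary x)
    (g_metric : riemannian_metric (@minterior R n X) g)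
    (g_complete : complete_metric g)
    (g_cc : conformally_compact g)
    (r_defining : defining_function r)
    (p_gt1 : 1 < p) :
  let dr := diff_norm (compactified r g) r in
  exists q0 : X,
    [/\ mboundary q0,
        (forall q : X, mboundary q -> dr q0 <= dr q),
        (lambda1p g p <= (dr q0 `^ p * (n%:R / p) `^ p)%:E)%E &
        (dr q0 `^ p * (n%:R / p) `^ p)%:E =
          lambda1p (@hyperbolic_metric R n (dr q0 ^+ 2)) p].
Proof.
move=> dr; have [r0 [alpha [gbar [r0_def _ gbar_metric gbar_holder gbarE]]]] := g_cc.
have drE q : mboundary q -> dr q = diff_norm gbar r0 q.
  exact: (diff_norm_boundary X_manifold r0_def gbar_metric gbar_holder gbarE r_defining).
have bdry_compact : compact (@mboundary R n X).
  exact: (subclosed_compact (mboundary_closed X_manifold r0_def) X_compact).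
have [|q0] := @compact_EVT_min X R (diff_norm gbar r0) _ X_boundary bdry_compact.
  apply: continuous_subspaceT => x.
  exact: (diff_norm_continuous X_manifold r0_def gbar_metric gbar_holder).
rewrite inE => bq0 q0_min; exists q0; split => //.
- by move=> q bq; rewrite !drE//; apply: q0_min; rewrite inE.
- rewrite drE//.
  exact (conformally_compact_upper_bound X_manifold r0_def gbar_metric gbar_holder gbarE
    g_metric p_gt1 bq0).
(* On the boundary [dr0] is a positive multiple of [dy_n]; positivity makes [dr q0 ^+ 2] an
   admissible curvature parameter for [hyperbolic_lambda1p]. *)
have dr_gt0 : 0 < dr q0.
  rewrite drE// /diff_norm; have dq := chart_at_dom X_manifold q0.
  have [-> a0 _] := defining_first_order X_manifold r0_def dq bq0.
  by apply: covec_norm_gt0 => //; exact: (gbar_posdef gbar_metric).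
rewrite (hyperbolic_lambda1p n (exprn_gt0 2 dr_gt0) p_gt1).
by rewrite sqrtr_sqr (gtr0_norm dr_gt0).
Qed.
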